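(* Let $G$ be a split semisimple simply connected group over $\mathbb{R}$ with a splitting $(T_0,B_0,\{X_\alpha\}_{\alpha\in\Delta})$, and let $A'\subset A$ be strongly orthogonal subsets of $R=R(T_0,G)$ consisting of positive roots. Let $(H,s,\eta)$ be an endoscopic triple for $G$ and assume that $T_{A'}$ and $T_A$ originate from $H$, i.e. there exist maximal tori $T_1,T_2\subset H$ and admissible isomorphisms $T_1\to T_{A'}$ and $T_2\to T_A$. Write $s_{T_{A'}}\in\hat T_{A'}$ and $s_{T_A}\in\hat T_A$ for the images of $s$ under the duals of these isomorphisms. Assume that there exists a canonical isomorphism $j:T_{A'}^{S_{A\setminus A'}}\to T_A$ such that $\hat j(s_{T_A})=s_{T_{A'}}$, where $\hat j:\hat T_A\to\hat T_{A'}$ is the dual of $j$ (this can always be arranged). Then the characters $s_{T_{A'}}$ and $s_{T_A}$ on $H^1(\Gamma,T_{A'})$ and $H^1(\Gamma,T_A)$, respectively, factor through the quotients corresponding, via the Tate–Nakayama isomorphism, to $$\frac{X_*(T_{A'})_{-1}}{IX_*(T_{A'})+i_{A',A}^{-1}(IX_*(T_A))}\quad\text{and}\quad\frac{X_*(T_A)_{-1}}{i_{A',A}(IX_*(T_{A'}))+IX_*(T_A)},$$ and the pull-back of the character $s_{T_A}$ via the embedding $\bar i_{A',A}$ of the first quotient into the second equals $s_{T_{A'}}$.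
   Context: Setting. $G$ is a split semisimple simply connected group over $\mathbb{R}$; $(T_0,B_0,\{X_\alpha\}_{\alpha\in\Delta})$ is a splitting: $T_0$ a split maximal torus, $B_0\supset T_0$ a Borel subgroup over $\mathbb{R}$, $0\ne X_\alpha\in\mathrm{Lie}(G)_\alpha(\mathbb{R})$ for each simple root $\alpha$. $R=R(T_0,G)$; $\alpha>0$ means $\alpha\in R(T_0,B_0)$; $\Delta$ is the set of simple roots; $\Omega=N(T_0)/T_0$; $\Gamma=\mathrm{Gal}(\mathbb{C}/\mathbb{R})=\{1,\sigma\}$. $\mathrm{Int}(g)h=ghg^{-1}$. For a nonzero $X\in\mathrm{Lie}(G)_\gamma$, $\gamma\in R$, let $X_{-}\in\mathrm{Lie}(G)_{-\gamma}$ be the unique element such that $(d\gamma^\vee(1),X,X_-)$ is an $\mathfrak{sl}_2$-triple (for $X=X_\alpha$ write $X_-=X_{-\alpha}$). For $\alpha\in\Delta$, $n_\alpha=\exp(X_\alpha)\exp(-X_{-\alpha})\exp(X_\alpha)$; for $\mu\in\Omega$ with reduced expression $\mu=s_{\alpha_1}\cdots s_{\alpha_q}$, $n(\mu)=n_{\alpha_1}\cdots n_{\alpha_q}$. For $\mu\in\Omega,\alpha\in\Delta$, $X_{\mu|\alpha}=\mathrm{Int}(n(\mu))X_\alpha$. For $\alpha>0$ and $\mu\in\Omega$ with $\mu^{-1}\alpha\in\Delta$, put $g_{\mu,\alpha}=\exp\left(\frac{i\pi}{4}(X+X_-)\right)$ with $X=X_{\mu|\mu^{-1}\alpha}$. Roots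 $\alpha,\beta$ are strongly orthogonal if $\alpha+\beta\notin R$ and $\alpha-\beta\notin R$; a strongly orthogonal subset (SOS) is a subset of $R$ consisting of pairwise strongly orthogonal roots. For an SOS $A$, $S_A=\prod_{\alpha\in A}s_\alpha$. For an SOS $A$ of positive roots, all elements $g=\prod_{\alpha\in A}g_{\mu_\alpha,\alpha}$ (with $\mu_\alpha\in\Omega$, $\mu_\alpha^{-1}\alpha\in\Delta$; the factors commute) give the same torus $T_A:=\mathrm{Int}(g)T_0$, defined over $\mathbb{R}$; the maps $\mathrm{Int}(g)|_{T_0}$ are isomorphisms of real tori $T_0^{S_A}\to T_A$, where $T_0^{S_A}$ is $T_0$ with $\sigma$ acting by $S_A\circ\sigma$. For $A'\subset A$, the canonical isomorphisms $T_{A'}^{S_{A\setminus A'}}\to T_A$ are the maps $\mathrm{Int}(g)|_{T_{A'}}$ with $g=\prod_{\alpha\in A\setminus A'}g_{\mu_\alpha,\alpha}$, $\mu_\alpha\in\Omega$, $\mu_\alpha^{-1}\alpha\in\Delta$, where $T_{A'}^{S_{A\setminus A'}}$ is $T_{A'}$ with Galois action twisted by $S_{A\setminus A'}$ (transported to $T_{A'}$ via any of the isomorphisms $T_0^{S_{A'}}\to T_{A'}$). Cohomology. For a maximal torus $T$ over $\mathbb{R}$, with $\sigma_T$ the action of $\sigma$ on $X_*(T)$, put $X_*(T)_{-1}=\{\lambda\in X_*(T):\sigma_T(\lambda)=-\lambda\}$ and $IX_*(T)=\{\lambda-\sigma_T(\lambda):\lambda\in X_*(T)\}$. The Tate–Nakayama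 isomorphism $X_*(T)_{-1}/IX_*(T)=\hat H^{-1}(\Gamma,X_*(T))\to H^1(\Gamma,T)$ is cup product with the canonical class in $H^2(\Gamma,\mathbb{C}^\times)$. Let $\hat T=\mathrm{Hom}(X_*(T),\mathbb{C}^\times)=X^*(T)\otimes\mathbb{C}^\times$ be the complex dual torus; via Tate–Nakayama, a $\Gamma$-invariant element of $\hat T$ defines a character of $H^1(\Gamma,T)$. All canonical isomorphisms $T_{A'}^{S_{A\setminus A'}}\to T_A$ induce on cocharacters the same embedding $i_{A',A}:X_*(T_{A'})_{-1}\hookrightarrow X_*(T_A)_{-1}$, and $\bar i_{A',A}$ is the injection it induces between the two quotients displayed in the claim. Endoscopy. An endoscopic triple $(H,s,\eta)$ consists of a quasi-split connected reductive group $H$ over $\mathbb{R}$, an embedding $\eta:\hat H\to\hat G$ of complex dual groups and an element $s\in Z(\hat H)$ with $\eta(\hat H)=\mathrm{Cent}(\eta(s),\hat G)^\circ$, such that the $\hat G$-conjugacy class of $\eta$ is $\Gamma$-invariant and $s\in Z(\hat H)^\Gamma$ (since $G$ is simply connected, $Z(\hat G)=1$). For maximal tori $T_H\subset H$ and $T\subset G$ over $\mathbb{R}$, an isomorphism $T_H\to T$ defined over $\mathbb{R}$ is admissible if it is dual to an isomorphism $\hat T\cong\hat T_H$ obtained by choosing Borel subgroups containing $T$ and $T_H$ to identify $\hat T$ and $\hat T_H$ with maximal tori of $\hat G$ and $\hat H$ that correspond under ($\hat G$-conjugates of) $\eta$. Since $s$ is central in $\hat H$, it gives an element of $\hat T_H$,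 hence via the dual of the admissible isomorphism an element $s_T\in\hat T$. *)

(* Defs.v *)
From HB Require Import structures.
From mathcomp Require Import all_boot all_order all_algebra.
From mathcomp Require Import finmap.
From mathcomp Require Import all_classical all_reals all_analysis.
From mathcomp Require Import complex ring_quotient.

Set Implicit Arguments.
Unset Strict Implicit.
Unset Printing Implicit Defensive.

Import Order.TTheory GRing.Theory Num.Theory.
Import numFieldNormedType.Exports.

Local Open Scope classical_set_scope.
Local Open Scope ring_scope.
Local Open Scope quotient_scope.

(* A linear algebraic group over C = R[i] is a Zariski closed subgroup of
   GL_n(C), identified with its set of complex points.  It is defined over the
   field R of real numbers when it is stable under complex conjugation (Galois
   descent), and Gal(C/R) acts on its points by conjugation of the entries. *)

Definition conjm (R : realType) m n (g : 'M[R[i]]_(m, n)) : 'M[R[i]]_(m, n) :=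
  map_mx (@conjc R) g.

Definition conj_stable (R : realType) n (S : set 'M[R[i]]_n) :=
  forall g, S g -> S (conjm g).

(* The coordinate ring of GL_n, as an algebra of functions: it is generated by
   the matrix entries and the inverse of the determinant. *)
Inductive regular (R : realType) n : ('M[R[i]]_n -> R[i]) -> Prop :=
| RegCst c : regular (fun=> c)
| RegCoord i j : regular (fun g => g i j)
| RegInvDet : regular (fun g => (\det g)^-1)
| RegAdd f h : regular f -> regular h -> regular (fun g => f g + h g)
| RegMul f h : regular f -> regular h -> regular (fun g => f g * h g).

Definition zclosed (R : realType) n (S : set 'M[R[i]]_n) :=
  exists2 F : set ('M[R[i]]_n -> R[i]), F `<=` @regular R n &
    S = [set g | g \in unitmx /\ forall f, F f -> f g = 0].

Definition is_subgroup (R : realType) n (S : set 'M[R[i]]_n) :=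
  [/\ S `<=` [set g | g \in unitmx], S 1%:M,
      forall g h, S g -> S h -> S (g *m h) &
      forall g, S g -> S (invmx g)].

Record agroup (R : realType) n := AGroup {
  gset :> set 'M[R[i]]_n;
  gset_closed : zclosed gset;
  gset_group : is_subgroup gset }.

Record pts (R : realType) n (G : agroup R n) := Pt {
  pval :> 'M[R[i]]_n;
  pvalP : gset G pval }.

Section Points.
Context {R : realType}.
Local Notation C := R[i].
Context {n : nat} (G : agroup R n).

Lemma pval_inj : injective (@pval R n G).
Proof. by move=> [x Gx] [y Gy] /= exy; subst y; rewrite (Prop_irrelevance Gx Gy). Qed.

Lemma pt_unit (x : pts G) : pval x \in unitmx.
Proof. by case: x => x Gx /=; have [+ _ _ _] := gset_group G; apply. Qed.

Definition pt1 : pts G := Pt (let: And4 _ h _ _ := gset_group G in h).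

Definition ptM (x y : pts G) : pts G :=
  Pt (let: And4 _ _ h _ := gset_group G in h _ _ (pvalP x) (pvalP y)).

Definition ptV (x : pts G) : pts G :=
  Pt (let: And4 _ _ _ h := gset_group G in h _ (pvalP x)).

Definition regular_on (f : pts G -> C) :=
  exists2 F, regular F & forall x, f x = F (pval x).

End Points.

HB.instance Definition _ (R : realType) n (G : agroup R n) := gen_eqMixin (pts G).
HB.instance Definition _ (R : realType) n (G : agroup R n) := gen_choiceMixin (pts G).

Record ahom (R : realType) m n (G : agroup R m) (H : agroup R n) := AHom {
  ahfun :> pts G -> pts H;
  ahomM : forall x y, ahfun (ptM x y) = ptM (ahfun x) (ahfun y);
  ahom_regular : forall i j, regular_on (fun x => ahfun x i j) }.

HB.instance Definition _ (R : realType) m n (G : agroup R m) (H : agroup R n) :=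
  gen_eqMixin (ahom G H).
HB.instance Definition _ (R : realType) m n (G : agroup R m) (H : agroup R n) :=
  gen_choiceMixin (ahom G H).

Section RegularTheory.
Context {R : realType}.
Local Notation C := R[i].

Lemma ahom_eq m n (G : agroup R m) (H : agroup R n) (f h : ahom G H) :
  (forall x, f x = h x) -> f = h.
Proof.
case: f h => [f fM fr] [h hM hr] /= efh.
have ? : f = h by apply/funext.
subst h; rewrite (Prop_irrelevance fM hM); congr AHom; exact: Prop_irrelevance.
Qed.

Lemma regular_ext n (f h : 'M[C]_n -> C) : f =1 h -> regular f -> regular h.
Proof. by move=> /funext ->. Qed.

Lemma regular_sum n (I : Type) (r : seq I) (P : pred I) (F : I -> 'M[C]_n -> C) :
  (forall i, regular (F i)) -> regular (fun g => \sum_(i <- r | P i) F i g).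
Proof.
move=> rF; elim: r => [|i r IH].
  refine (@regular_ext _ (fun=> 0) _ (fun g => _) (RegCst _ 0)).
  by rewrite big_nil.
case Pi : (P i).
  by apply: (regular_ext _ (RegAdd (rF i) IH)) => g /=; rewrite big_cons Pi.
by apply: (regular_ext _ IH) => g /=; rewrite big_cons Pi.
Qed.

Lemma regular_prod n (I : Type) (r : seq I) (P : pred I) (F : I -> 'M[C]_n -> C) :
  (forall i, regular (F i)) -> regular (fun g => \prod_(i <- r | P i) F i g).
Proof.
move=> rF; elim: r => [|i r IH].
  refine (@regular_ext _ (fun=> 1) _ (fun g => _) (RegCst _ 1)).
  by rewrite big_nil.
case Pi : (P i).
  by apply: (regular_ext _ (RegMul (rF i) IH)) => g /=; rewrite big_cons Pi.
by apply: (regular_ext _ IH) => g /=; rewrite big_cons Pi.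
Qed.

Lemma regular_det n k (E : 'M[C]_n -> 'M[C]_k) :
  (forall i j, regular (fun g => E g i j)) -> regular (fun g => \det (E g)).
Proof.
move=> rE; rewrite /determinant; apply: regular_sum => s.
by apply: RegMul; [apply: RegCst | apply: regular_prod].
Qed.

Lemma regular_inv n i j :
  exists2 F : 'M[C]_n -> C, regular F & forall g, g \in unitmx -> invmx g i j = F g.
Proof.
exists (fun g => (\det g)^-1 * cofactor g j i); last first.
  by move=> g ug; rewrite /invmx ug !mxE.
apply: RegMul; first exact: RegInvDet.
apply: RegMul; first exact: RegCst.
apply: regular_det => a b.
refine (@regular_ext _ _ _ (fun g => _) (RegCoord _ (lift j a) (lift i b))).
by rewrite !mxE.
Qed.

Section On.
Context {m : nat} (G : agroup R m).

Lemma regular_on_ext (f h : pts G -> C) : f =1 h -> regular_on f -> regular_on h.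
Proof. by move=> /funext ->. Qed.

Lemma regular_on_cst c : regular_on (fun _ : pts G => c).
Proof. by exists (fun=> c) => //; apply: RegCst. Qed.

Lemma regular_on_add (f h : pts G -> C) :
  regular_on f -> regular_on h -> regular_on (fun x => f x + h x).
Proof.
move=> [F rF eF] [H rH eH]; exists (fun g => F g + H g); first exact: RegAdd.
by move=> x; rewrite eF eH.
Qed.

Lemma regular_on_mul (f h : pts G -> C) :
  regular_on f -> regular_on h -> regular_on (fun x => f x * h x).
Proof.
move=> [F rF eF] [H rH eH]; exists (fun g => F g * H g); first exact: RegMul.
by move=> x; rewrite eF eH.
Qed.

Lemma regular_on_mulmx k (f h : pts G -> 'M[C]_k) :
    (forall i j, regular_on (fun x => f x i j)) ->
    (forall i j, regular_on (fun x => h x i j)) ->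
  forall i j, regular_on (fun x => (f x *m h x) i j).
Proof.
move=> rf rh i j.
pose F l := sval (cid2 (rf i l)); pose H l := sval (cid2 (rh l j)).
exists (fun g => \sum_l F l g * H l g).
  by apply: regular_sum => l; apply: RegMul; rewrite /F /H; case: cid2.
move=> x; rewrite mxE; apply: eq_bigr => l _.
by rewrite /F /H; case: cid2 => /= f' _ <-; case: cid2 => /= h' _ <-.
Qed.

End On.

Lemma ahom1 m n (G : agroup R m) (H : agroup R n) (f : ahom G H) : f (pt1 G) = pt1 H.
Proof.
apply: pval_inj => /=.
have e : pval (f (pt1 G)) *m pval (f (pt1 G)) = pval (f (pt1 G)).
  rewrite -[LHS]/(pval (ptM (f (pt1 G)) (f (pt1 G)))) -ahomM.
  by congr (pval (f _)); apply: pval_inj; rewrite /= mul1mx.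
by have /(congr1 (mulmx (invmx (f (pt1 G))))) := e; rewrite mulKmx ?mulVmx ?pt_unit.
Qed.

Lemma ahomV m n (G : agroup R m) (H : agroup R n) (f : ahom G H) x :
  f (ptV x) = ptV (f x).
Proof.
apply: pval_inj => /=.
have e : pval (f x) *m pval (f (ptV x)) = 1%:M.
  rewrite -[LHS]/(pval (ptM (f x) (f (ptV x)))) -ahomM.
  rewrite -[RHS]/(pval (pt1 H)) -(ahom1 f); congr (pval (f _)).
  by apply: pval_inj; rewrite /= mulmxV ?pt_unit.
by rewrite -[RHS]mulmx1 -e mulKmx ?pt_unit.
Qed.

Lemma regular_on_invmx m (G : agroup R m) i j :
  regular_on (fun x : pts G => invmx x i j).
Proof. by have [F rF eF] := @regular_inv m i j; exists F => // x; rewrite eF ?pt_unit. Qed.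

Lemma regular_comp_gen m (G : agroup R m) n (E D : pts G -> 'M[C]_n) :
    (forall i j, regular_on (fun x => E x i j)) ->
    (forall i j, regular_on (fun x => D x i j)) ->
    (forall x, E x *m D x = 1%:M) ->
  forall F, regular F -> regular_on (fun x => F (E x)).
Proof.
move=> rE rD ED F; elim => [c|i j||f h _ If _ Ih|f h _ If _ Ih].
- exact: regular_on_cst.
- exact: rE.
- apply: (@regular_on_ext _ _ (fun x => \det (D x))) => [x|].
    have := congr1 determinant (ED x); rewrite det_mulmx det1 => e.
    have d0 : \det (E x) != 0.
      by apply/eqP => d0; move/eqP: e; rewrite d0 mul0r eq_sym oner_eq0.
    by rewrite -[LHS](mulKf d0) e mulr1.
  pose F' i j := sval (cid2 (rD i j)).
  exists (fun g => \det (\matrix_(i, j) F' i j g)).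
    apply: regular_det => i j; apply: (@regular_ext _ (F' i j)) => [g|].
      by rewrite mxE.
    by rewrite /F'; case: cid2.
  move=> x; congr (\det _); apply/matrixP => i j; rewrite mxE /F'.
  by case: cid2 => /= f _ <-.
- exact: regular_on_add.
- exact: regular_on_mul.
Qed.

End RegularTheory.


Section Composition.
Context {R : realType} {l m n : nat}.
Context {G : agroup R l} {H : agroup R m} {K : agroup R n}.
Variables (f : ahom H K) (h : ahom G H).

Fact acomp_hom x y : f (h (ptM x y)) = ptM (f (h x)) (f (h y)).
Proof. by rewrite !ahomM. Qed.

Fact acomp_regular i j : regular_on (fun x => f (h x) i j).
Proof.
have [F rF eF] := ahom_regular f i j.
apply: (@regular_on_ext _ _ _ (fun x => F (h x))) => [x|]; first by rewrite eF.
apply: (regular_comp_gen (D := fun x => pval (h (ptV x)))) rF => [a b|a b|x].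
- exact: ahom_regular.
- have [F' rF' eF'] := ahom_regular h a b.
  apply: (@regular_on_ext _ _ _ (fun x => F' (invmx (pval x)))) => [x|].
    by rewrite eF'.
  apply: (regular_comp_gen (D := @pval _ _ G)) rF' => [i' j'|i' j'|x].
  + exact: regular_on_invmx.
  + by exists (fun g => g i' j') => //; apply: RegCoord.
  + by rewrite mulVmx ?pt_unit.
- by rewrite ahomV /= mulmxV ?pt_unit.
Qed.

Definition acomp : ahom G K := AHom acomp_hom acomp_regular.

End Composition.

Section Diagonal.
Context {R : realType}.
Local Notation C := R[i].

Definition diag_set r : set 'M[C]_r := [set g | g \in unitmx /\ is_diag_mx g].

Fact diag_closed r : zclosed (@diag_set r).
Proof.
exists [set f | exists i j, i != j /\ f = fun g : 'M[C]_r => g i j].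
  by move=> f [i [j [_ ->]]]; exact: RegCoord.
apply/seteqP; split=> g [ug dg]; split=> //.
  move=> f [i [j [ij ->]]].
  exact: (elimT is_diag_mxP dg).
apply/is_diag_mxP => i j ij; apply: (dg (fun g => g i j)).
by exists i, j; split.
Qed.

Fact diag_subgroup r : is_subgroup (@diag_set r).
Proof.
split.
- by move=> g [].
- by split; [exact: unitmx1 | exact: scalar_mx_is_diag].
- move=> g h [ug /diag_mxP [d eg]] [uh /diag_mxP [e eh]]; split.
    by rewrite unitmx_mul ug uh.
  by rewrite eg eh mulmx_diag diag_mx_is_diag.
- move=> g [ug /diag_mxP [d eg]]; subst g; split; first by rewrite unitmx_inv.
  have d0 i : d 0 i != 0.
    apply: contraTneq ug => di; rewrite unitmxE det_diag.
    by rewrite (bigD1 i) //= di mul0r unitr0.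
  suff -> : invmx (diag_mx d) = diag_mx (\row_i (d 0 i)^-1).
    exact: diag_mx_is_diag.
  rewrite -[RHS](mulKmx ug) mulmx_diag.
  suff -> : diag_mx (\row_j (d 0 j * (\row_i (d 0 i)^-1) 0 j)) = 1%:M :> 'M[C]_r.
    by rewrite mulmx1.
  rewrite -diag_const_mx; congr diag_mx; apply/rowP => j.
  by rewrite !mxE divff.
Qed.


Definition diag_group r : agroup R r := AGroup (@diag_closed r) (@diag_subgroup r).

Fact diag_conj_stable r : conj_stable (@diag_set r).
Proof.
move=> g [ug /is_diag_mxP dg]; split; first by rewrite map_unitmx.
by apply/is_diag_mxP => i j ij; rewrite mxE dg // conjc0.
Qed.

Fact diag_groupC r (x y : pts (diag_group r)) : ptM x y = ptM y x.
Proof.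
apply: pval_inj => /=; case: x y => [x [_ /diag_mxP [d ex]]] [y [_ /diag_mxP [e ey]]] /=.
rewrite ex ey !mulmx_diag; congr diag_mx; apply/rowP => i.
by rewrite !mxE mulrC.
Qed.

Fact ahom_id_regular m (G : agroup R m) i j : regular_on (fun x : pts G => x i j).
Proof. by exists (fun g => g i j) => //; apply: RegCoord. Qed.

Definition aid m (G : agroup R m) : ahom G G :=
  @AHom R m m G G (fun x => x) (fun _ _ => erefl) (@ahom_id_regular m G).

Definition is_aiso m n (G : agroup R m) (H : agroup R n) (f : ahom G H) :=
  exists h : ahom H G, cancel f h /\ cancel h f.

End Diagonal.

Record torus (R : realType) n := Torus {
  tgrp :> agroup R n;
  torusP : exists r, exists f : ahom (@diag_group R r) tgrp, is_aiso f }.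

Record rtorus (R : realType) n := RTorus {
  rtor :> torus R n;
  rtorP : conj_stable (gset rtor) }.

Arguments rtorP {R n} r _ _.

Section TorusPoints.
Context {R : realType} {n : nat} (T : torus R n).

Fact ptMA : @associative (pts T) (@ptM R n T).
Proof. by move=> x y z; apply: pval_inj; rewrite /= mulmxA. Qed.

Fact ptMC : @commutative (pts T) (pts T) (@ptM R n T).
Proof.
have [r [f [h [fK hK]]]] := torusP T => x y.
by rewrite -(hK x) -(hK y) -!(ahomM f) diag_groupC.
Qed.

Fact pt1M : left_id (pt1 T) (@ptM R n T).
Proof. by move=> x; apply: pval_inj; rewrite /= mul1mx. Qed.

Fact ptVM : left_inverse (pt1 T) (@ptV R n T) (@ptM R n T).
Proof. by move=> x; apply: pval_inj; rewrite /= mulVmx ?pt_unit. Qed.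

End TorusPoints.

(* The group of points of a torus, and hence the groups of characters and of
   cocharacters, are written additively. *)
HB.instance Definition _ (R : realType) n (T : torus R n) :=
  GRing.isZmodule.Build (pts T) (ptMA (T:=T)) (ptMC (T:=T)) (pt1M (T:=T)) (ptVM (T:=T)).

Section TorusHom.
Context {R : realType} {m n : nat} (G : agroup R m) (T : torus R n).

Fact ahom0_hom (x y : pts G) : pt1 T = ptM (pt1 T) (pt1 T).
Proof. by rewrite pt1M. Qed.

Fact ahom0_regular i j : regular_on (fun x : pts G => pval (pt1 T) i j).
Proof. exact: regular_on_cst. Qed.

Definition ahom0 : ahom G T := AHom ahom0_hom ahom0_regular.

Fact ahomD_hom (f h : ahom G T) x y :
  ptM (f (ptM x y)) (h (ptM x y)) = ptM (ptM (f x) (h x)) (ptM (f y) (h y)).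
Proof. by rewrite !ahomM; exact: (@addrACA (pts T)). Qed.

Fact ahomD_regular (f h : ahom G T) i j : regular_on (fun x => ptM (f x) (h x) i j).
Proof. by apply: regular_on_mulmx => i' j'; apply: ahom_regular. Qed.

Definition ahomD (f h : ahom G T) : ahom G T := AHom (ahomD_hom f h) (ahomD_regular f h).

Fact ahomN_hom (f : ahom G T) x y : ptV (f (ptM x y)) = ptM (ptV (f x)) (ptV (f y)).
Proof. by rewrite ahomM; exact: (@opprD (pts T)). Qed.

Fact ahomN_regular (f : ahom G T) i j : regular_on (fun x => ptV (f x) i j).
Proof.
have [F rF eF] := @regular_inv R n i j.
apply: (@regular_on_ext _ _ _ (fun x => F (pval (f x)))) => [x|].
  by rewrite /= eF ?pt_unit.
apply: (regular_comp_gen (D := fun x => pval (ptV (f x)))) rF => [a b|a b|x].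
- exact: ahom_regular.
- apply: (@regular_on_ext _ _ _ (fun x => f (ptV x) a b)) => [x|]; first by rewrite ahomV.
  have [F' rF' eF'] := ahom_regular f a b.
  apply: (@regular_on_ext _ _ _ (fun x => F' (invmx (pval x)))) => [x|].
    by rewrite eF'.
  apply: (regular_comp_gen (D := @pval _ _ G)) rF' => [i' j'|i' j'|x].
  + exact: regular_on_invmx.
  + exact: ahom_id_regular.
  + by rewrite mulVmx ?pt_unit.
- by rewrite /= mulmxV ?pt_unit.
Qed.

Definition ahomN (f : ahom G T) : ahom G T := AHom (ahomN_hom f) (ahomN_regular f).

Fact ahomDA : associative ahomD.
Proof. by move=> f h k; apply: ahom_eq => x; exact: ptMA. Qed.

Fact ahomDC : commutative ahomD.
Proof. by move=> f h; apply: ahom_eq => x; exact: ptMC. Qed.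

Fact ahom0D : left_id ahom0 ahomD.
Proof. by move=> f; apply: ahom_eq => x; exact: pt1M. Qed.

Fact ahomND : left_inverse ahom0 ahomN ahomD.
Proof. by move=> f; apply: ahom_eq => x; exact: ptVM. Qed.

End TorusHom.

HB.instance Definition _ (R : realType) m n (G : agroup R m) (T : torus R n) :=
  GRing.isZmodule.Build (ahom G T)
    (@ahomDA R m n G T) (@ahomDC R m n G T) (@ahom0D R m n G T) (@ahomND R m n G T).

Section GaloisAction.
Context {R : realType}.
Local Notation C := R[i].

Lemma conjmK m n : involutive (@conjm R m n).
Proof. by move=> g; apply/matrixP => i j; rewrite !mxE conjcK. Qed.

Lemma conjmM m n p (g : 'M[C]_(m, n)) (h : 'M[C]_(n, p)) :
  conjm (g *m h) = conjm g *m conjm h.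
Proof. exact: map_mxM. Qed.

Lemma regular_conj n (F : 'M[C]_n -> C) :
  regular F -> regular (fun g => conjc (F (conjm g))).
Proof.
elim => [c|i j||f h _ If _ Ih|f h _ If _ Ih].
- exact: RegCst.
- refine (@regular_ext _ _ _ _ (fun g => _) (RegCoord _ i j)).
  by rewrite mxE conjcK.
- refine (@regular_ext _ _ _ _ (fun g => _) (RegInvDet _ _)).
  by rewrite /= /conjm det_map_mx conjc_inv conjcK.
- refine (@regular_ext _ _ _ _ (fun g => _) (RegAdd If Ih)).
  by rewrite rmorphD.
- refine (@regular_ext _ _ _ _ (fun g => _) (RegMul If Ih)).
  by rewrite rmorphM.
Qed.

Definition conj_pt n (G : agroup R n) (rG : conj_stable (gset G)) (x : pts G) : pts G :=
  Pt (rG _ (pvalP x)).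

Section ConjHom.
Context {m n : nat} (G : agroup R m) (H : agroup R n).
Variables (rG : conj_stable (gset G)) (rH : conj_stable (gset H)) (f : ahom G H).

Fact conj_hom_hom x y :
  conj_pt rH (f (conj_pt rG (ptM x y))) =
  ptM (conj_pt rH (f (conj_pt rG x))) (conj_pt rH (f (conj_pt rG y))).
Proof.
have -> : conj_pt rG (ptM x y) = ptM (conj_pt rG x) (conj_pt rG y).
  by apply: pval_inj; exact: conjmM.
by apply: pval_inj; rewrite ahomM; exact: conjmM.
Qed.

Fact conj_hom_regular i j :
  regular_on (fun x => conj_pt rH (f (conj_pt rG x)) i j).
Proof.
have [F rF eF] := ahom_regular f i j.
exists (fun g => conjc (F (conjm g))); first exact: regular_conj.
by move=> x; rewrite mxE eF.
Qed.

Definition conj_hom : ahom G H := AHom conj_hom_hom conj_hom_regular.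

End ConjHom.
End GaloisAction.


Section GroupTheory.
Context {R : realType}.
Local Notation C := R[i].
Context {n : nat}.
Implicit Types (S : set 'M[C]_n) (G N B : agroup R n) (T : torus R n).

Definition intm (g x : 'M[C]_n) : 'M[C]_n := g *m x *m invmx g.

Definition zconnected S :=
  forall Z1 Z2, zclosed Z1 -> zclosed Z2 -> S `<=` Z1 `|` Z2 ->
    S `&` Z1 `&` Z2 = set0 -> S `<=` Z1 \/ S `<=` Z2.

Definition identity_component S : set 'M[C]_n :=
  [set g | exists Y, [/\ Y `<=` S, zconnected Y, Y 1%:M & Y g]].

Definition centralizer S (s : 'M[C]_n) : set 'M[C]_n :=
  [set g | S g /\ g *m s = s *m g].

Definition normalizer S S' : set 'M[C]_n :=
  [set g | S g /\ intm g @` S' = S'].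

Definition center S : set 'M[C]_n :=
  [set g | S g /\ forall h, S h -> g *m h = h *m g].

Definition derived_subgroup S : set 'M[C]_n :=
  [set g | forall K, is_subgroup K ->
    (forall a b, S a -> S b -> K (a *m b *m invmx a *m invmx b)) -> K g].

Definition solvable_set S := exists k, iter k derived_subgroup S `<=` [set 1%:M].

Definition unipotent_set S :=
  forall g, S g -> exists k, (g - 1%:M) ^+ k = 0.

Definition normal_in N G :=
  gset N `<=` gset G /\ forall g x, gset G g -> gset N x -> gset N (intm g x).

Definition connected_reductive G :=
  zconnected (gset G) /\
  forall N, normal_in N G -> zconnected (gset N) -> unipotent_set (gset N) ->
    gset N = [set 1%:M].

Definition semisimple G :=
  zconnected (gset G) /\
  forall N, normal_in N G -> zconnected (gset N) -> solvable_set (gset N) ->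
    gset N = [set 1%:M].

Definition maximal_torus G T :=
  gset T `<=` gset G /\
  forall T', gset T' `<=` gset G -> gset T `<=` gset T' -> gset T' = gset T.

Definition borel G B :=
  [/\ gset B `<=` gset G, zconnected (gset B), solvable_set (gset B) &
    forall B', gset B' `<=` gset G -> zconnected (gset B') ->
      solvable_set (gset B') -> gset B `<=` gset B' -> gset B' = gset B].

Definition borel_pair G B T :=
  [/\ borel G B, maximal_torus G T & gset T `<=` gset B].

End GroupTheory.


Definition Gm (R : realType) : rtorus R 1 :=
  @RTorus R 1 (@Torus R 1 (@diag_group R 1)
    (ex_intro _ 1%N (ex_intro _ (aid _)
      (ex_intro _ (aid _) (conj (fun=> erefl) (fun=> erefl))))))
    (@diag_conj_stable R 1).

Notation "X_*( T )" := (ahom (tgrp (rtor (Gm _))) (tgrp T))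
  (at level 0, format "X_*( T )") : type_scope.
Notation "X^*( T )" := (ahom (tgrp T) (tgrp (rtor (Gm _))))
  (at level 0, format "X^*( T )") : type_scope.

Section Characters.
Context {R : realType}.
Local Notation C := R[i].

Fact gm_subproof (z : C) : z != 0 -> gset (Gm R) (z%:M).
Proof. by move=> z0; split; [rewrite unitmxE det_scalar1 unitfE | exact: mx11_is_diag]. Qed.

(* The point z of the multiplicative group (the identity for z = 0). *)
Definition gm (z : C) : pts (Gm R) :=
  if pselect (z != 0) is left z0 then Pt (gm_subproof z0) else pt1 (Gm R).

Context {n : nat}.
Implicit Type T : torus R n.

Definition chv T (chi : X^*(T)) (t : pts T) : C := chi t ord0 ord0.

Definition pairing T (chi : X^*(T)) (lambda : X_*(T)) : int :=
  xget 0 [set m : int | forall z, z != 0 -> chv chi (lambda (gm z)) = z ^ m].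

(* Int(g) on cocharacters, for g carrying T to T'. *)
Definition conj_cochar (g : 'M[C]_n) T T' (lambda : X_*(T)) : X_*(T') :=
  xget 0 [set lambda' : X_*(T') | forall z, pval (lambda' z) = intm g (lambda z)].

(* chi |-> chi o Int(g)^-1, for g normalizing T. *)
Definition conj_char (g : 'M[C]_n) T (chi : X^*(T)) : X^*(T) :=
  xget 0 [set chi' : X^*(T) |
    forall x y : pts T, pval y = intm g x -> chi' y = chi x].

End Characters.


Section LieAlgebra.
Context {R : realType}.
Local Notation C := R[i].

(* Derivations at the identity of the coordinate ring of G. *)
Definition point_derivation n (G : agroup R n) (D : (pts G -> C) -> C) :=
  (forall c f h, regular_on f -> regular_on h ->
    D (fun x => c * f x + h x) = c * D f + D h) /\
  (forall f h, regular_on f -> regular_on h ->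
    D (fun x => f x * h x) = f (pt1 G) * D h + D f * h (pt1 G)).

Definition lie n (G : agroup R n) : set 'M[C]_n :=
  [set X | exists2 D, @point_derivation n G D &
    forall i j, D (fun x => x i j) = X i j].

(* Y = d(phi)(X) *)
Definition is_differential m n (G : agroup R m) (H : agroup R n) (phi : ahom G H)
    (X : 'M[C]_m) (Y : 'M[C]_n) :=
  exists D, [/\ @point_derivation m G D,
    forall i j, D (fun x => x i j) = X i j &
    forall i j, D (fun x => phi x i j) = Y i j].

Context {n : nat}.
Implicit Types (G B : agroup R n) (T : torus R n).

Definition root_space G T (chi : X^*(T)) : set 'M[C]_n :=
  [set X | lie G X /\ forall t : pts T, intm t X = chv chi t *: X].

(* is_root G defines R(T, G), and is_root B the positive roots R(T, B). *)
Definition is_root G T : set X^*(T) :=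
  [set chi | chi <> 0 /\ exists2 X, root_space G chi X & X <> 0].

Definition simple_root B T : set X^*(T) :=
  [set alpha | is_root B alpha /\
    forall beta gamma, is_root B beta -> is_root B gamma -> alpha <> beta + gamma].

Definition sl2_triple (H X Y : 'M[C]_n) :=
  [/\ H *m X - X *m H = X *+ 2, H *m Y - Y *m H = - (Y *+ 2) &
      X *m Y - Y *m X = H].

(* The coroot of alpha is the cocharacter alpha^vee with
   <alpha, alpha^vee> = 2 and d(alpha^vee)(1) in [g_alpha, g_-alpha]. *)
Definition coroot G T (alpha : X^*(T)) : X_*(T) :=
  xget 0 [set av : X_*(T) | pairing alpha av = 2 /\
    exists X Y, [/\ root_space G alpha X, root_space G (- alpha) Y &
      is_differential av 1%:M (X *m Y - Y *m X)]].

Definition refl_cochar G T (alpha : X^*(T)) (lambda : X_*(T)) : X_*(T) :=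
  lambda - coroot G alpha *~ pairing alpha lambda.

Definition refl_char G T (alpha chi : X^*(T)) : X^*(T) :=
  chi - alpha *~ pairing chi (coroot G alpha).

(* X_-, for X in the root space of gamma *)
Definition opposite G T (gamma : X^*(T)) (X : 'M[C]_n) : 'M[C]_n :=
  xget 0 [set Y | root_space G (- gamma) Y /\
    exists2 H, is_differential (coroot G gamma) 1%:M H & sl2_triple H X Y].

End LieAlgebra.

Arguments is_root {R n} G {T} _.
Arguments simple_root {R n} B {T} _.
Arguments coroot {R n} G {T} alpha.
Arguments refl_cochar {R n} G {T} alpha lambda.
Arguments refl_char {R n} G {T} alpha chi.
Arguments opposite {R n} G {T} gamma X.

Section MatrixExponential.
Context {R : realType} {n : nat}.
Local Notation C := R[i].

Definition mexp_partial (X : 'M[C]_n) N : 'M[C]_n :=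
  \sum_(k < N) (k`!%:R : C)^-1 *: X ^+ k.

Definition mexp (X : 'M[C]_n) : 'M[C]_n :=
  \matrix_(i, j)
    (lim ((fun N => complex.Re (mexp_partial X N i j)) @ \oo)
     +i* lim ((fun N => complex.Im (mexp_partial X N i j)) @ \oo))%C.

End MatrixExponential.

(* Subgroup of V generated by S; for subgroups S1 and S2 the sum S1 + S2 is the
   subgroup generated by their union. *)
Definition generated (V : zmodType) (S : set V) : {pred V} :=
  [pred v | `[< forall K : set V, K 0 -> (forall x y, K x -> K y -> K (x - y)) ->
                S `<=` K -> K v >]].

Fact generated_closed (V : zmodType) (S : set V) : zmod_closed (generated S).
Proof.
split=> [|x y]; rewrite !inE; first by move=> K K0.
move=> hx hy K K0 KB SK.
exact: KB (hx K K0 KB SK) (hy K K0 KB SK).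
Qed.

HB.instance Definition _ (V : zmodType) (S : set V) :=
  GRing.isZmodClosed.Build V (generated S) (generated_closed S).

Notation quotient_by S := (Quotient.quot (generated S)).

Definition simply_connected (R : realType) n (G : agroup R n) :=
  forall T : torus R n, maximal_torus G T ->
  forall lambda : X_*(T), lambda \in generated [set coroot G alpha | alpha in @is_root R n G T].

Definition split_torus (R : realType) n (T : rtorus R n) :=
  forall (chi : X^*(T)) (t : pts T),
    chv chi (conj_pt (rtorP T) t) = conjc (chv chi t).


Record splitting (R : realType) n (G : agroup R n) := Splitting {
  spT : rtorus R n;
  spB : agroup R n;
  spX : X^*(spT) -> 'M[R[i]]_n;
  sp_pair : borel_pair G spB spT;
  sp_split : split_torus spT;
  sp_real : conj_stable (gset spB);
  spX_root : forall alpha, simple_root spB alpha ->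
    [/\ root_space G alpha (spX alpha), conjm (spX alpha) = spX alpha &
        spX alpha <> 0] }.

Arguments spX {R n G} s _.

Section CayleyTransforms.
Context {R : realType} {n : nat} {G : agroup R n} (S : splitting G).
Local Notation C := R[i].
Local Notation T0 := (spT S).
Local Notation Delta := (@simple_root R n (spB S) T0).
Implicit Types (w : seq X^*(T0)) (alpha beta : X^*(T0)) (A : {fset X^*(T0)}).

Definition n_simple alpha : 'M[C]_n :=
  let X := spX S alpha in
  mexp X *m mexp (- opposite G alpha X) *m mexp X.

(* An element mu of the Weyl group is given by a reduced expression: the word
   [:: alpha_1; ...; alpha_q] stands for s_alpha_1 ... s_alpha_q. *)
Definition word_char w (chi : X^*(T0)) := foldr (refl_char G) chi w.

Definition reduced_word w :=
  (forall alpha, alpha \in w -> Delta alpha) /\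
  forall w', (forall alpha, alpha \in w' -> Delta alpha) ->
    word_char w' =1 word_char w -> (size w <= size w')%N.

Definition n_word w : 'M[C]_n := foldr (fun alpha g => n_simple alpha *m g) 1%:M w.

(* g_{mu, mu(beta)} for a simple root beta *)
Definition cayley w beta : 'M[C]_n :=
  let X := intm (n_word w) (spX S beta) in
  mexp ((pi / 4)*i%C *: (X + opposite G (word_char w beta) X)).

Definition is_cayley alpha (g : 'M[C]_n) :=
  exists w beta, [/\ reduced_word w, Delta beta, word_char w beta = alpha &
    g = cayley w beta].

(* Products of elements g_{mu_alpha, alpha}, one for each alpha in A *)
Definition cayley_product A (g : 'M[C]_n) :=
  exists gf : X^*(T0) -> 'M[C]_n,
    (forall alpha, alpha \in A -> is_cayley alpha (gf alpha)) /\
    g = \big[mulmx/1%:M]_(alpha <- A) gf alpha.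

Definition SOS A :=
  (forall alpha, alpha \in A -> is_root G alpha) /\
  (forall alpha beta, alpha \in A -> beta \in A -> alpha != beta ->
    ~ is_root G (alpha + beta) /\ ~ is_root G (alpha - beta)).

Definition S_ A (lambda : X_*(T0)) : X_*(T0) := foldr (refl_cochar G) lambda A.

End CayleyTransforms.

Section RealTori.
Context {R : realType} {n : nat}.
Implicit Types T : rtorus R n.
Local Notation C := R[i].

(* The action of Gal(C/R) on T(C) and X_*(T); the group is represented by
   (bool, addb), with true for complex conjugation. *)
Definition galp T (r : bool) (x : pts T) : pts T :=
  if r then conj_pt (rtorP T) x else x.

Definition galc T (r : bool) (lambda : X_*(T)) : X_*(T) :=
  if r then conj_hom (rtorP (Gm R)) (rtorP T) lambda else lambda.

(* c : T -> T' is defined over R when the Galois action on T is replaced by its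
   twist by the automorphism w of X_*(T). *)
Definition twisted_real T T' (w : X_*(T) -> X_*(T)) (c : ahom T T') :=
  forall lambda, galc true (acomp c lambda) = acomp c (w (galc true lambda)).

(* The automorphism c o w o c^-1 of X_*(T'), for an isomorphism c *)
Definition transport T T' (c : ahom T T') (w : X_*(T) -> X_*(T))
    (lambda' : X_*(T')) : X_*(T') :=
  acomp c (w (xget 0 [set lambda | acomp c lambda = lambda'])).

End RealTori.

Definition defined_over_R (R : realType) m n (T : rtorus R m) (T' : rtorus R n)
    (c : ahom T T') :=
  forall x, c (galp true x) = galp true (c x).

Section CanonicalIsomorphisms.
Context {R : realType} {n : nat} {G : agroup R n} (S : splitting G).
Local Notation C := R[i].
Local Notation T0 := (spT S).
Implicit Types (A : {fset X^*(T0)}) (T : rtorus R n).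

(* The isomorphisms Int(g) : T_0^{S_A} -> T_A of real tori *)
Definition canonical_from_T0 A T (c : ahom T0 T) :=
  [/\ exists2 g, cayley_product A g & forall x, pval (c x) = intm g x,
      is_aiso c & twisted_real (S_ A) c].

(* T is the torus T_A *)
Definition is_T_ A T := exists c : ahom T0 T, canonical_from_T0 A c.

(* j : T^{S_{A \ A'}} -> T' is a canonical isomorphism, for T = T_A', T' = T_A *)
Definition canonical_iso A' A T T' (j : ahom T T') :=
  [/\ exists2 g, cayley_product (A `\` A')%fset g & forall x, pval (j x) = intm g x,
      is_aiso j &
      exists2 c : ahom T0 T, canonical_from_T0 A' c &
        twisted_real (transport c (S_ (A `\` A')%fset)) j].

End CanonicalIsomorphisms.


Section Cohomology.
Context {R : realType} {n : nat} (T : rtorus R n).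
Local Notation C := R[i].

Lemma galpD r : {morph @galp R n T r : x y / x + y}.
Proof. by case: r => //= x y; apply: pval_inj; exact: conjmM. Qed.

Lemma galp_zmod r : zmod_morphism (@galp R n T r).
Proof.
move=> x y; have g0 : galp r (0 : pts T) = 0.
  by apply: (addIr (galp r 0)); rewrite -galpD !add0r.
apply: (addIr (galp r y)); rewrite -galpD !addrNK //.
Qed.

HB.instance Definition _ r :=
  GRing.isZmodMorphism.Build (pts T) (pts T) (@galp R n T r) (galp_zmod r).

Lemma galcD r : {morph @galc R n T r : x y / x + y}.
Proof. by case: r => //= x y; apply: ahom_eq => z; apply: pval_inj; exact: conjmM. Qed.

Lemma galc_zmod r : zmod_morphism (@galc R n T r).
Proof.
move=> x y; have g0 : galc r (0 : X_*(T)) = 0.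
  by apply: (addIr (galc r 0)); rewrite -galcD !add0r.
apply: (addIr (galc r y)); rewrite -galcD !addrNK //.
Qed.

HB.instance Definition _ r :=
  GRing.isZmodMorphism.Build X_*(T) X_*(T) (@galc R n T r) (galc_zmod r).

(* X_*(T)_{-1} *)
Definition minus_one : {pred X_*(T)} := [pred lambda | galc true lambda == - lambda].

Fact minus_one_closed : zmod_closed minus_one.
Proof.
split=> [|x y /eqP ex /eqP ey]; apply/eqP; first by rewrite raddf0 oppr0.
by rewrite raddfB /= -/(galc true x) -/(galc true y) ex ey opprD.
Qed.

HB.instance Definition _ := GRing.isZmodClosed.Build X_*(T) minus_one minus_one_closed.

Record Xm1 := MkXm1 { xm1val : X_*(T); xm1P : xm1val \in minus_one }.
HB.instance Definition _ := [isSub for xm1val].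
HB.instance Definition _ := [Choice of Xm1 by <:].
HB.instance Definition _ := [SubChoice_isSubZmodule of Xm1 by <:].

(* IX_*(T), as a subset of X_*(T)_{-1} *)
Definition IX : set Xm1 :=
  [set lambda | exists mu : X_*(T), val lambda = mu - galc true mu].

Definition cocycle : {pred {ffun bool -> pts T}} :=
  [pred a : {ffun bool -> pts T} |
    `[< forall r r', a (r (+) r') = a r + galp r (a r') >]].

Fact cocycle_closed : zmod_closed cocycle.
Proof.
split=> [|a b]; rewrite !inE.
  by move=> r r'; rewrite !ffunE raddf0 addr0.
move=> ha hb r r'.
by rewrite !ffunE ha hb raddfB addrACA -opprD.
Qed.

HB.instance Definition _ :=
  GRing.isZmodClosed.Build {ffun bool -> pts T} cocycle cocycle_closed.

Record Z1 := MkZ1 { z1val : {ffun bool -> pts T}; z1P : z1val \in cocycle }.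
HB.instance Definition _ := [isSub for z1val].
HB.instance Definition _ := [Choice of Z1 by <:].
HB.instance Definition _ := [SubChoice_isSubZmodule of Z1 by <:].

Definition B1 : set Z1 :=
  [set a | exists b : pts T, val a = [ffun r => galp r b - b]].

Definition H1 : zmodType := quotient_by B1.

Definition Tate : zmodType := quotient_by IX.

(* Represents the nontrivial class in H^2(Gal(C/R), C^x). *)
Definition fundamental_cocycle (r r' : bool) : pts (Gm R) :=
  gm (if r && r' then -1 else 1).

(* Cup product Hhat^{-1} x H^2 -> H^1 at the level of cochains:
   (lambda u c)(r) = sum over r' of (r r' lambda)(c(r, r')). *)
Definition cup (lambda : X_*(T)) : {ffun bool -> pts T} :=
  [ffun r => \sum_(r' : bool) (galc (r (+) r') lambda) (fundamental_cocycle r r')].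

Fact cup_cocycle (lambda : Xm1) : cup (val lambda) \in cocycle.
Proof.
case: lambda => l /= /eqP sl.
have gm1 : gm (1 : C) = pt1 (Gm R).
  rewrite /gm; case: pselect => // h; apply: pval_inj => /=.
  by [].
have ct : cup l true = l (gm (-1)).
  rewrite ffunE big_bool /fundamental_cocycle /= gm1.
  rewrite -[conj_pt _ (l _)]/(galc true l (pt1 (Gm R))) (ahom1 (galc true l)).
  exact: (@addr0 (pts T)).
have cf : cup l false = 0.
  rewrite ffunE big_bool /fundamental_cocycle /= gm1.
  rewrite -[conj_pt _ (l _)]/(galc true l (pt1 (Gm R))) (ahom1 (galc true l)) (ahom1 l).
  exact: (@addr0 (pts T)).
have cm : conj_pt (rtorP (Gm R)) (gm (-1)) = gm (-1).
  apply: pval_inj; rewrite /gm; case: pselect => /= h; apply/matrixP => i j.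
    by rewrite !mxE !ord1 eqxx !mulr1n rmorphN rmorph1.
  by rewrite !mxE !ord1 eqxx !mulr1n rmorph1.
have se : galp true (l (gm (-1))) = - l (gm (-1)).
  by rewrite -[RHS]/((- l) (gm (-1))) -sl /= cm.
have g0 : galp true (0 : pts T) = 0 by rewrite raddf0.
rewrite inE => -[] [] /=; rewrite ?ct ?cf ?addr0 ?add0r //; last first.
  by rewrite -[conj_pt _ _]/(galp true (0 : pts T)) g0 addr0.
by rewrite -[conj_pt _ _]/(galp true (l (gm (-1)))) se subrr.
Qed.

Definition cupZ1 (lambda : Xm1) : Z1 := MkZ1 (cup_cocycle lambda).

Definition tate_nakayama (x : Tate) : H1 := \pi_H1 (cupZ1 (repr x)).

End Cohomology.

Record cxchar (R : realType) (V : zmodType) := CxChar {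
  cxfun :> V -> R[i];
  cxfunD : forall x y, cxfun (x + y) = cxfun x * cxfun y;
  cxfun_neq0 : forall x, cxfun x != 0 }.

Notation dual_torus T := (cxchar _ X_*(T)).

Definition tn_character (R : realType) n (T : rtorus R n) (s : dual_torus T)
    (chi : cxchar R (H1 T)) :=
  forall lambda : Xm1 T, chi (tate_nakayama (\pi_(Tate T) lambda)) = s (val lambda).

Section Embedding.
Context {R : realType} {n : nat} {G : agroup R n} (S : splitting G).
Variables (A' A : {fset X^*(spT S)}) (TA' TA : rtorus R n).

(* i_{A',A}: all canonical isomorphisms induce the same map. *)
Definition i_emb (lambda : Xm1 TA') : Xm1 TA :=
  xget 0 [set mu : Xm1 TA | exists2 j : ahom TA' TA,
    canonical_iso A' A j & val mu = acomp j (val lambda)].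

Definition Q_sub : zmodType := quotient_by (@IX R n TA' `|` i_emb @^-1` @IX R n TA).

Definition Q_big : zmodType := quotient_by ((i_emb @` @IX R n TA') `|` @IX R n TA).

Definition i_bar (q : Q_sub) : Q_big := \pi_Q_big (i_emb (repr q)).

End Embedding.


(* A complex dual group of H, for H quasi-split over R.  It is specified by a
   Borel pair (B, T) of H over R, a Borel pair of the dual group, and an
   isomorphism delta from X_*(T) to the character group of the maximal torus of
   the dual group which exchanges is_root and coroots, and positive is_root and
   coroots, and matches the Weyl groups.  The complex conjugation acts on the
   dual group by an automorphism preserving a pinning and corresponding under
   delta to the Galois action on X_*(T). *)
Record dual_group (R : realType) n (H : agroup R n) := DualGroup {
  dgB : agroup R n;
  dgT : rtorus R n;
  dg_pair : borel_pair H dgB dgT;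
  dg_real : conj_stable (gset dgB);
  dg_dim : nat;
  dg_hat : agroup R dg_dim;
  dg_reductive : connected_reductive dg_hat;
  dgBhat : agroup R dg_dim;
  dgThat : torus R dg_dim;
  dg_pairhat : borel_pair dg_hat dgBhat dgThat;
  dg_delta : {additive X_*(dgT) -> X^*(dgThat)};
  dg_delta_bij : bijective dg_delta;
  dg_root : forall alpha : X^*(dgT), is_root H alpha ->
    is_root dg_hat (dg_delta (coroot H alpha));
  dg_root_surj : forall beta : X^*(dgThat), is_root dg_hat beta ->
    exists2 alpha : X^*(dgT), is_root H alpha & beta = dg_delta (coroot H alpha);
  dg_coroot : forall alpha : X^*(dgT), is_root H alpha -> forall lambda,
    pairing alpha lambda =
    pairing (dg_delta lambda) (coroot dg_hat (dg_delta (coroot H alpha)));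
  dg_positive : forall alpha : X^*(dgT), is_root H alpha ->
    (is_root dgB alpha <-> is_root dgBhat (dg_delta (coroot H alpha)));
  dg_weyl : forall h, normalizer (gset H) (gset dgT) h ->
    exists2 x, normalizer (gset dg_hat) (gset dgThat) x &
      forall lambda, dg_delta (conj_cochar h dgT lambda) = conj_char x (dg_delta lambda);
  dg_weyl_surj : forall x, normalizer (gset dg_hat) (gset dgThat) x ->
    exists2 h, normalizer (gset H) (gset dgT) h &
      forall lambda, dg_delta (conj_cochar h dgT lambda) = conj_char x (dg_delta lambda);
  dg_sigma : ahom dg_hat dg_hat;
  dg_sigmaK : involutive dg_sigma;
  dg_sigmaT : ahom dgThat dgThat;
  dg_sigmaTE : forall (t : pts dgThat) (x : pts dg_hat),
    pval t = pval x -> pval (dg_sigmaT t) = pval (dg_sigma x);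
  dg_sigmaB : forall x : pts dg_hat,
    gset dgBhat x -> gset dgBhat (dg_sigma x);
  dg_pin : X^*(dgThat) -> 'M[R[i]]_dg_dim;
  dg_pin_root : forall beta, simple_root dgBhat beta ->
    root_space dg_hat beta (dg_pin beta) /\ dg_pin beta <> 0;
  dg_pin_sigma : forall beta, simple_root dgBhat beta ->
    is_differential dg_sigma (dg_pin beta) (dg_pin (acomp beta dg_sigmaT));
  dg_galois : forall lambda,
    dg_delta (galc true lambda) = acomp (dg_delta lambda) dg_sigmaT }.

Arguments dgB {R n H} d.
Arguments dgT {R n H} d.
Arguments dg_hat {R n H} d.
Arguments dgThat {R n H} d.
Arguments dg_delta {R n H} d.
Arguments dg_sigma {R n H} d.

Section DualTori.
Context {R : realType} {n : nat} {H : agroup R n} (dH : dual_group H).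
Local Notation C := R[i].

(* Int(h) carries the reference Borel pair to (B, T), for a Borel subgroup B
   containing T. *)
Definition borel_frame (T : rtorus R n) (h : 'M[C]_n) :=
  gset H h /\ exists B, [/\ borel H B, gset T `<=` gset B,
    intm h @` gset (dgB dH) = gset B & intm h @` gset (dgT dH) = gset T].

(* The point t of the maximal torus of the dual group, as an element of the dual
   torus Hom(X_*(T), C^x), by means of the Borel subgroup given by h. *)
Definition dual_eval (T : rtorus R n) (h : 'M[C]_n) (t : pts (dgThat dH))
    (lambda : X_*(T)) : C :=
  chv (dg_delta dH (conj_cochar (invmx h) (dgT dH) lambda)) t.

End DualTori.

Record endoscopic_triple (R : realType) n (G : agroup R n) (dG : dual_group G) :=
  EndoscopicTriple {
  en_dim : nat;
  en_H : agroup R en_dim;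
  en_real : conj_stable (gset en_H);
  en_reductive : connected_reductive en_H;
  en_quasisplit : exists2 B, borel en_H B & conj_stable (gset B);
  en_dual : dual_group en_H;
  en_s : pts (dg_hat en_dual);
  en_eta : ahom (dg_hat en_dual) (dg_hat dG);
  en_eta_inj : injective en_eta;
  en_central : center (gset (dg_hat en_dual)) en_s;
  en_centralizer : [set pval (en_eta h) | h in setT] =
    identity_component (centralizer (gset (dg_hat dG)) (en_eta en_s));
  en_eta_galois : exists x : pts (dg_hat dG), forall h,
    pval (dg_sigma dG (en_eta (dg_sigma en_dual h))) = intm x (en_eta h);
  en_s_galois : dg_sigma en_dual en_s = en_s }.

Section Admissible.
Context {R : realType} {n : nat} {G : agroup R n} {dG : dual_group G}.
Variable E : endoscopic_triple dG.
Local Notation dH := (en_dual E).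

(* phi : T_H -> T is dual to an isomorphism of dual tori given by Borel subgroups
   (encoded in h and g) and the conjugate Int(x) o eta of eta. *)
Definition admissible (TH : rtorus R (en_dim E)) (T : rtorus R n) (phi : ahom TH T) :=
  [/\ is_aiso phi, defined_over_R phi &
    exists h g (x : pts (dg_hat dG)),
      [/\ borel_frame dH TH h, borel_frame dG T g,
        [set intm x (en_eta E y) | y in [set y | gset (dgThat dH) (pval y)]]
          = gset (dgThat dG) &
        forall (t : pts (dgThat dH)) (y : pts (dg_hat dH)) (t' : pts (dgThat dG)),
          pval y = pval t -> pval t' = intm x (en_eta E y) ->
          forall lambda : X_*(TH),
            dual_eval (dH := dG) g t' (acomp phi lambda) = dual_eval h t lambda]].

(* sT is the image of s in the dual torus of T under the dual of phi. *)
Definition image_of_s (TH : rtorus R (en_dim E)) (T : rtorus R n) (phi : ahom TH T)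
    (sT : dual_torus T) :=
  exists h (t : pts (dgThat dH)), [/\ borel_frame dH TH h, pval t = pval (en_s E) &
    forall lambda : X_*(TH), sT (acomp phi lambda) = dual_eval h t lambda].

End Admissible.

(* Main.v *)
(** A cocharacter of [T_A'] killed by [1 + sigma] comes from a cocharacter [nu] of
    [T_0] with [S_A' nu = - nu].  Strongly orthogonal roots are orthogonal, so a
    root [beta] of [A \ A'] satisfies [<beta, nu> = <beta, S_A' nu> = - <beta, nu>],
    that is [<beta, nu> = 0].  The Cayley elements of [A \ A'] are exponentials of
    sums of vectors of weights [beta] and [- beta]; hence they commute with the
    Cayley elements of [A'] and with the image of [nu].  Consequently every canonical
    isomorphism [T_A' -> T_A] carries [lambda] in [X_*(T_A')_{-1}] to the same
    cocharacter, as a map to [GL_n]; this is [i_{A',A}].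

    As [s] is Galois invariant, [s_T] is trivial on [IX_*(T)]; since it is
    compatible with [j], both characters factor as stated.  They are characters of
    [H^1] because Tate-Nakayama is bijective, by the exponential sequence
    [0 -> X_*(T) -> X_*(T) (x) C -> T(C) -> 0].

    Orthogonality of strongly orthogonal roots rests on the sl2-triples of roots.
    For a semisimple matrix group, the radical of the trace form on the span of the
    Lie algebras of one-parameter subgroups contains no root vector, since the
    brackets with the radical form an ideal of nilpotent matrices, whose exponentials
    lie in a solvable connected normal subgroup.  The Jacobson-Morozov argument then
    gives the triple, and the coroot is the cocharacter [z |-> w(z) w(1)^-1] with
    [w(z) = exp(z x) exp(- y / z) exp(z x)]. *)

From HB Require Import structures.
From mathcomp Require Import falgebra.
Require Import Defs.
From mathcomp Require Import all_boot all_order all_algebra.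
From mathcomp Require Import finmap.
From mathcomp Require Import all_classical all_reals all_analysis.
From mathcomp Require Import complex ring_quotient.
From mathcomp Require Import spectral ring zify.

Set Implicit Arguments.
Unset Strict Implicit.
Unset Printing Implicit Defensive.

Import Order.TTheory GRing.Theory Num.Theory.

Local Open Scope ring_scope.

(** * Trace forms and spaces of nilpotent matrices *)

(** [coroot], [opposite], [pairing], [conj_cochar] and [i_emb] are choices that fall back on 0, so
    nothing can be said of them before existence is proved, and for the coroot also uniqueness. This
    forces a development of root theory from the closed subgroup alone. Unipotent elements enter
    through truncated exponentials, semisimple ones through Laurent polynomials with idempotent
    coefficients, and statements on groups become statements on polynomials with infinitely many
    zeros. Outside the exponential sequence, analysis serves only to handle [mexp].

    Strong orthogonality says nothing about a bracket of weight 0, since 0 is not a root.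
    Distinctness of the roots excludes alpha - beta = 0, but excluding alpha + beta = 0 takes their
    positivity: a Borel subgroup with root vectors for alpha and - alpha would contain the unipotent
    subgroups of an sl2-triple, and these generate a group that is not solvable. For this, the
    vector of weight - alpha in the Borel subgroup must be proportional to that of the triple, so
    root spaces have to be lines. *)

Lemma poly_interpolation (F : fieldType) (f : F -> F) N (l : seq F) :
  exists q : {poly F}, forall a, a \in l -> ('X - a%:P) ^+ N %| q - (f a)%:P.
Proof.
elim: l => [|a l [q qP]]; first by exists 0.
have [al|al] := boolP (a \in l).
  by exists q => b; rewrite inE => /predU1P [->|]; apply: qP.
pose p := \prod_(b <- l) ('X - b%:P) ^+ N.
have : coprimep (('X - a%:P) ^+ N) p.
  apply: coprimep_expl; rewrite /p big_seq.
  elim/big_rec: _ => [|b r bl co]; first by rewrite coprimep1.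
  rewrite coprimepMr co andbT coprimep_expr // coprimep_XsubC root_XsubC.
  by apply: contraNneq al => <-.
case/Bezout_eq1_coprimepP => -[u v] /= uv.
(* Chinese remainder step: [v * p] is 1 modulo the power of ['X - a] and 0 modulo the powers already
   treated. *)
exists (q + v * p * ((f a)%:P - q)) => b; rewrite inE => /predU1P [->|bl].
  have -> : q + v * p * ((f a)%:P - q) - (f a)%:P
      = (q - (f a)%:P) * u * ('X - a%:P) ^+ N.
    by rewrite -[v * p](addKr (u * ('X - a%:P) ^+ N)) uv; ring.
  exact: dvdp_mulIr.
rewrite addrAC dvdp_add ?qP // dvdp_mulr // dvdp_mull //.
by rewrite /p (big_rem b) //= dvdp_mulIl.
Qed.

HB.lock Definition bracket (C : numClosedFieldType) n (x y : 'M[C]_n) : 'M[C]_n :=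
  x *m y - y *m x.

Section Matrices.
Context {C : numClosedFieldType}.

Lemma bracketE n (x y : 'M[C]_n) : bracket x y = x *m y - y *m x.
Proof. by rewrite bracket.unlock. Qed.

Lemma bracket_is_linear n (x : 'M[C]_n) : linear (bracket x).
Proof.
move=> a y z; rewrite !bracketE mulmxDr mulmxDl -scalemxAr -scalemxAl.
by rewrite opprD addrACA -scalerBr.
Qed.

HB.instance Definition _ n (x : 'M[C]_n) :=
  GRing.isLinear.Build C 'M[C]_n 'M[C]_n _ (bracket x) (bracket_is_linear x).

Lemma bracket_eq0 n (x y : 'M[C]_n) : (bracket x y == 0) = (x *m y == y *m x).
Proof. by rewrite bracketE subr_eq0. Qed.

Lemma bracketC n (x y : 'M[C]_n) : bracket x y = - bracket y x.
Proof. by rewrite !bracketE opprB. Qed.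

Lemma bracketDl n (x y z : 'M[C]_n) : bracket (x + y) z = bracket x z + bracket y z.
Proof. by rewrite bracketC (raddfD (bracket z)) opprD -!bracketC. Qed.

Lemma bracketZl n a (x z : 'M[C]_n) : bracket (a *: x) z = a *: bracket x z.
Proof. by rewrite bracketC (linearZZ (bracket z)) -scalerN -bracketC. Qed.

Lemma bracketNl n (x z : 'M[C]_n) : bracket (- x) z = - bracket x z.
Proof. by rewrite -scaleN1r bracketZl scaleN1r. Qed.

Lemma bracketDr n (x y z : 'M[C]_n) : bracket x (y + z) = bracket x y + bracket x z.
Proof. exact: (raddfD (bracket x)). Qed.

Lemma bracketBr n (x y z : 'M[C]_n) : bracket x (y - z) = bracket x y - bracket x z.
Proof. exact: (raddfB (bracket x)). Qed.

Lemma bracketNr n (x y : 'M[C]_n) : bracket x (- y) = - bracket x y.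
Proof. exact: (raddfN (bracket x)). Qed.

Lemma bracketZr n a (x y : 'M[C]_n) : bracket x (a *: y) = a *: bracket x y.
Proof. exact: (linearZZ (bracket x)). Qed.

Lemma bracketMnr n (x y : 'M[C]_n) k : bracket x (y *+ k) = bracket x y *+ k.
Proof. exact: (raddfMn (bracket x)). Qed.

Lemma bracket0r n (x : 'M[C]_n) : bracket x 0 = 0.
Proof. exact: (raddf0 (bracket x)). Qed.

Lemma bracket0l n (x : 'M[C]_n) : bracket 0 x = 0.
Proof. by rewrite bracketC bracket0r oppr0. Qed.

Lemma bracketxx n (x : 'M[C]_n) : bracket x x = 0.
Proof. by rewrite bracketE subrr. Qed.

Lemma jacobi n (x y z : 'M[C]_n) :
  bracket x (bracket y z) = bracket (bracket x y) z + bracket y (bracket x z).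
Proof.
have E (V : zmodType) (a b c d e f : V) :
    a - b - (c - d) = (a - e - (f - d)) + (e - c - (b - f)).
  rewrite !opprB !addrA [RHS](ACl ((1*8*3*6)*(5*2)*(7*4))) /=.
  by rewrite !subrr !addr0.
rewrite !bracketE !mulmxBr !mulmxBl !mulmxA; exact: E.
Qed.

Section Spectral.
Context {n : nat}.
Implicit Types (A x y : 'M[C]_n.+1) (v : 'rV[C]_n.+1) (r : seq C).

(** The space is the sum of the generalized eigenspaces of A: Bezout identities split off one
    eigenvalue at a time. Multiplicities are at most [size r], so the exponent N suffices for all of
    them. *)
Lemma gen_eigen_ind A r N (P : 'rV[C]_n.+1 -> Prop) :
    (forall u v, P u -> P v -> P (u + v)) -> P 0 ->
    char_poly A = \prod_(a <- r) ('X - a%:P) -> (size r <= N)%N ->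
    (forall v a, a \in r -> v *m (A - a%:M) ^+ N = 0 -> P v) ->
  forall v, P v.
Proof.
move=> PD P0 Ar rN Pe.
pose p (l : seq C) : {poly C} := \prod_(a <- l) ('X - a%:P) ^+ N.
have pE a l : p (a :: l) = ('X - a%:P) ^+ N * p l by rewrite /p big_cons.
pose h : {poly C} -> 'M[C]_n.+1 := horner_mx A.
have hX a k : h (('X - a%:P) ^+ k) = (A - a%:M) ^+ k.
  by rewrite /h rmorphXn rmorphB /= horner_mx_X horner_mx_C.
have hM p1 p2 : h (p1 * p2) = h p1 *m h p2 by exact: rmorphM.
have hD p1 p2 : h (p1 + p2) = h p1 + h p2 by exact: rmorphD.
have h1 : h 1 = 1%:M by exact: rmorph1.
have hC a : h a%:P = a%:M by exact: horner_mx_C.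
have main l v : uniq l -> {subset l <= r} -> v *m h (p l) = 0 -> P v.
  elim: l v => [|a l IH] v /=.
    by rewrite /p big_nil h1 mulmx1 => _ _ ->.
  move=> /andP [al ul] lr; rewrite pE => vp.
  have : coprimep (('X - a%:P) ^+ N) (p l).
    apply: coprimep_expl; rewrite /p big_seq.
    elim/big_rec: _ => [|b s bl co]; first by rewrite coprimep1.
    rewrite coprimepMr co andbT coprimep_expr // coprimep_XsubC root_XsubC.
    by apply: contraNneq al => <-.
  case/Bezout_eq1_coprimepP => -[u w] /= uw.
  have -> : v = v *m h (u * ('X - a%:P) ^+ N) + v *m h (w * p l).
    by rewrite -mulmxDr -hD uw h1 mulmx1.
  apply: PD.
    apply: IH => // [b bl|]; first by apply: lr; rewrite inE bl orbT.
    by rewrite -mulmxA -hM -mulrA mulrC hM mulmxA vp mul0mx.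
  apply: (Pe _ a); first by apply: lr; rewrite inE eqxx.
  by rewrite -mulmxA -hX -hM -mulrA [p l * _]mulrC [w * _]mulrC hM mulmxA vp mul0mx.
move=> v; apply: (main (undup r)) => [|b|]; rewrite ?undup_uniq ?mem_undup //.
have hA : h (char_poly A) = 0 by exact: Cayley_Hamilton.
suff /dvdpP [q ->] : char_poly A %| p (undup r).
  by rewrite hM hA !mulmx0.
rewrite Ar -big_undup_iterop_count /p.
elim: (undup r) => [|a l IH]; first by rewrite !big_nil.
rewrite !big_cons dvdp_mul //=.
rewrite [iterop _ _ _ _](_ : _ = ('X - a%:P) ^+ count_mem a r) //.
by rewrite dvdp_exp2l // (leq_trans (count_size _ _)).
Qed.

(** Congruence of q to f(a) modulo a power of X - a makes q(A) a scalar on generalized eigenvectors,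
    and not only on eigenvectors. *)
Lemma gen_eigen_interpolate A r N (f : C -> C) :
    char_poly A = \prod_(a <- r) ('X - a%:P) ->
  exists q, [/\ forall a, a \in r -> q.[a] = f a &
    forall v a k, (k <= N)%N -> v *m (A - a%:M) ^+ k = 0 ->
      v *m horner_mx A q = f a *: v].
Proof.
move=> Ar; have [q qP] := poly_interpolation f N.+1 r.
pose h : {poly C} -> 'M[C]_n.+1 := horner_mx A.
have hX a k : h (('X - a%:P) ^+ k) = (A - a%:M) ^+ k.
  by rewrite /h rmorphXn rmorphB /= horner_mx_X horner_mx_C.
have hM p1 p2 : h (p1 * p2) = h p1 *m h p2 by exact: rmorphM.
have hD p1 p2 : h (p1 + p2) = h p1 + h p2 by exact: rmorphD.
have h1 : h 1 = 1%:M by exact: rmorph1.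
have hC a : h a%:P = a%:M by exact: horner_mx_C.
have hA : h (char_poly A) = 0 by exact: Cayley_Hamilton.
exists q; split=> [a /qP|v a k kN va].
  rewrite exprS => /dvdpP [u /(congr1 (fun p => p.[a]))].
  rewrite hornerD hornerN hornerC !hornerM hornerXsubC subrr mul0r mulr0.
  by move/eqP; rewrite subr_eq0 => /eqP.
have [ar|ar] := boolP (a \in r).
  have /dvdpP [u qu] := qP _ ar.
  have -> : q = u * ('X - a%:P) ^+ (N.+1 - k) * ('X - a%:P) ^+ k + (f a)%:P.
    by rewrite -mulrA -exprD subnK ?(leqW kN) // -qu subrK.
  rewrite -/(h _) hD hC mulmxDr [u * _ * _]mulrC hM mulmxA hX va mul0mx add0r.
  by rewrite mul_mx_scalar.
(* Here a is not an eigenvalue: the power of X - a is coprime to the characteristic polynomial, and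
   both kill v. *)
suff -> : v = 0 by rewrite mul0mx scaler0.
have : coprimep (('X - a%:P) ^+ k) (char_poly A).
  rewrite coprimep_expl // Ar big_seq.
  elim/big_rec: _ => [|b s br co]; first by rewrite coprimep1.
  rewrite coprimepMr co andbT coprimep_XsubC root_XsubC.
  by apply: contraNneq ar => <-.
case/Bezout_eq1_coprimepP => -[u w] /= uw.
rewrite -[v]mulmx1 -h1 -uw hD mulmxDr [u * _]mulrC !hM.
by rewrite hA mulmx0 mulmx0 addr0 hX mulmxA va mul0mx.
Qed.

Lemma trig_mx_mul A B : is_trig_mx A -> is_trig_mx B ->
  is_trig_mx (A *m B) /\ forall i, (A *m B) i i = A i i * B i i.
Proof.
move=> /is_trig_mxP tA /is_trig_mxP tB; split.
  apply/is_trig_mxP => i j ij; rewrite mxE big1 // => k _.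
  have [ik|ki] := ltnP i k; first by rewrite tA ?mul0r.
  by rewrite tB ?mulr0 // (leq_ltn_trans ki).
move=> i; rewrite mxE (bigD1 i) //= big1 ?addr0 // => k; rewrite neq_ltn.
by case/orP=> h; [rewrite tB ?mulr0 | rewrite tA ?mul0r].
Qed.

Lemma trig_horner_mx A (p : {poly C}) : is_trig_mx A ->
  is_trig_mx (horner_mx A p) /\ forall i, horner_mx A p i i = p.[A i i].
Proof.
move=> tA; elim/poly_ind: p => [|p c [tp dp]].
  by rewrite rmorph0; split=> [|i]; [exact: mx0_is_trig | rewrite mxE horner0].
have [tq dq] := trig_mx_mul tp tA.
have -> : horner_mx A (p * 'X + c%:P) = horner_mx A p *m A + c%:M.
  by rewrite rmorphD rmorphM /= horner_mx_X horner_mx_C.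
split=> [|i].
  apply/is_trig_mxP => i j ij; move/is_trig_mxP: tq => tq.
  by rewrite [LHS]mxE tq // add0r mxE -val_eqE /= ltn_eqF.
by rewrite [LHS]mxE dq dp mxE eqxx mulr1n !hornerE.
Qed.

End Spectral.

Section ConjugatePart.
Context {n : nat}.
Implicit Types (x y : 'M[C]_n.+1) (v : 'rV[C]_n.+1) (r : seq C).

(** Induction on j + k from the identity v y (x - (a - mu)) = v (x - a) y - v ([x, y] - mu y), each
    term of which lowers one of the two exponents. *)
Lemma gen_eigen_mul x (y : 'M[C]_n.+1) a mu j k v :
    v *m (x - a%:M) ^+ j = 0 ->
    mxvec y *m (lin_mx (bracket x) - mu%:M : 'M[C]_((n + n * n.+1).+1)) ^+ k = 0 ->
  (v *m y) *m (x - (a - mu)%:M) ^+ (j + k) = 0.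
Proof.
move: {2}(j + k)%N (erefl (j + k)%N) => m.
elim: m j k v y => [|m IH] [|j] [|k] v y //=; rewrite ?expr0 ?mulmx1.
- by move=> _ -> _; rewrite mul0mx.
- by move=> _ -> _; rewrite !mul0mx.
- move=> _ _ y0; have -> : y = 0 by rewrite -[y]mxvecK y0 linear0.
  by rewrite mulmx0 mul0mx.
move=> [jk]; rewrite addSn !exprS !mulmxA => vx yx.
pose y' := bracket x y - mu *: y.
have yx' : mxvec y' *m (lin_mx (bracket x) - mu%:M : 'M[C]_((n + n * n.+1).+1)) ^+ k = 0.
  suff -> : mxvec y' = mxvec y *m (lin_mx (bracket x) - mu%:M) by [].
  by rewrite mulmxBr mul_vec_lin mul_mx_scalar linearB linearZ.
have -> : v *m y *m (x - (a - mu)%:M) = v *m (x - a%:M) *m y - v *m y'.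
  rewrite /y' bracketE raddfB /= !mulmxBr !mulmxBl !mulmxA !mul_mx_scalar.
  rewrite -scalemxAr -scalemxAl !opprB.
  rewrite scalerBl opprB !addrA [RHS](ACl ((4*3*2)*(1*5))) /=.
  by rewrite subrr addr0.
rewrite mulmxBl (IH j k.+1) // ?exprS ?mulmxA // sub0r.
have -> : (j + k.+1 = j.+1 + k)%N by rewrite addnS.
by rewrite (IH j.+1 k) ?oppr0 // ?exprS ?mulmxA // addSnnS.
Qed.

(* For s the image of x under an interpolation of complex conjugation on the
   spectrum, tr (x s) is the sum of the |a|^2 over the eigenvalues a of x. *)
Lemma conj_part x : exists q, let s := horner_mx x q in
  [/\ \tr (x *m s) = 0 -> x ^+ n.+1 = 0 &
   forall W : {vspace 'M[C]_n.+1}, (forall w, w \in W -> bracket x w \in W) ->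
   forall w, w \in W -> bracket s w \in W].
Proof.
have [r] := closed_field_poly_normal (char_poly x).
rewrite (monicP (char_poly_monic x)) scale1r => rE.
(* This size is convertible to [n.+1 * n.+1], and has the successor form that [horner_mx]
   expects. *)
pose L : 'M[C]_((n + n * n.+1).+1) := lin_mx (bracket x).
have [r2] := closed_field_poly_normal (char_poly L).
rewrite (monicP (char_poly_monic L)) scale1r => r2E.
(* The bound is the exponent that [gen_eigen_mul] gives for the product of a generalized eigenvector
   of x and one of ad x. *)
have [q [qr qP]] := gen_eigen_interpolate (size r + size r2) Num.conj rE.
have [Q [_ QP]] := gen_eigen_interpolate (size r2) Num.conj r2E.
exists q => s; split.
  have [//|P uP tP] := @Schur C n.+1 x.
  have {}uP : P \in unitmx by exact: unitarymx_unit.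
  pose T := P *m x *m invmx P.
  have tT : is_trig_mx T by move: tP; rewrite /similar_to /= conjumx.
  have Tr i : T i i \in r.
    have : root (char_poly T) (T i i).
      by rewrite char_poly_trig // (bigD1 i) //= rootM root_XsubC eqxx.
    rewrite -eigenvalue_root_char => /eigenvalueP [v vT v0].
    have : eigenvalue x (T i i).
      apply/eigenvalueP; exists (v *m P).
        by rewrite scalemxAl -vT /T !mulmxA mulmxKV.
      apply: contraNneq v0 => /(congr1 (mulmx^~ (invmx P))).
      by rewrite mulmxK // mul0mx => ->.
    by rewrite eigenvalue_root_char rE root_prod_XsubC.
  have -> : \tr (x *m s) = \sum_i T i i * (T i i)^*.
    have -> : x *m s = invmx P *m horner_mx T ('X * q) *m P.
      rewrite horner_mx_uconj // rmorphM /= horner_mx_X -/s.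
      by rewrite !mulmxA mulVmx // mul1mx mulmxKV.
    rewrite mxtrace_mulC mulmxA mulmxV // mul1mx /mxtrace.
    apply: eq_bigr => i _; have [_ ->] := trig_horner_mx ('X * q) tT.
    by rewrite !hornerE qr.
  move=> /eqP; rewrite psumr_eq0 => [/allP T0|i _]; last exact: mul_conjC_ge0.
  have {}T0 i : T i i = 0.
    by have /implyP := T0 i (mem_index_enum _); rewrite mul_conjC_eq0 => /(_ isT)/eqP.
  have Tn : T ^+ n.+1 = 0.
    have := Cayley_Hamilton T; rewrite char_poly_trig //.
    rewrite (eq_bigr (fun=> 'X)) => [|i _]; last by rewrite T0 subr0.
    by rewrite prodr_const card_ord rmorphXn /= horner_mx_X.
  have -> : x = invmx P *m T *m P by rewrite /T !mulmxA mulVmx // mul1mx mulmxKV.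
  have -> k : (invmx P *m T *m P) ^+ k = invmx P *m T ^+ k *m P.
    elim: k => [|k IH]; first by rewrite !expr0 mulmx1 mulVmx.
    by rewrite !exprS IH -[LHS]/(_ *m _) -[T * _]/(_ *m _) !mulmxA mulmxK.
  by rewrite Tn mulmx0 mul0mx.
(* That is, ad s = Q(ad x). If y has weight mu under ad x and u has eigenvalue a, then u y has
   eigenvalue a - mu, so u [s, y] is u y times the conjugate of a minus that of a - mu, which is the
   conjugate of mu. *)
have key w : mxvec (bracket s w) = mxvec w *m horner_mx L Q.
  suff H (v : 'rV_(n.+1 * n.+1)) : mxvec (bracket s (vec_mx v)) = v *m horner_mx L Q.
    by rewrite -H mxvecK.
  have addE (u u' : 'rV[C]_(n.+1 * n.+1)) : mxvec (bracket s (vec_mx (u + u')))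
      = mxvec (bracket s (vec_mx u)) + mxvec (bracket s (vec_mx u')).
    by rewrite (raddfD vec_mx) (raddfD (bracket s)) (raddfD mxvec).
  pose P (v : 'rV_((n + n * n.+1).+1)) :=
    mxvec (bracket s (vec_mx (v : 'rV_(n.+1 * n.+1)))) = v *m horner_mx L Q.
  apply: (@gen_eigen_ind _ L r2 (size r2) P) => //; rewrite /P.
  - move=> u u' Hu Hu'; rewrite mulmxDl -Hu -Hu'; exact: addE.
  - by rewrite mul0mx (raddf0 vec_mx) (raddf0 (bracket s)) (raddf0 mxvec).
  move=> {}v mu _ vmu; rewrite (QP v mu (size r2)) //.
  pose y : 'M[C]_n.+1 := vec_mx (v : 'rV_(n.+1 * n.+1)).
  have yv : mxvec y = v by exact: vec_mxK.
  suff H : bracket s y = mu^* *: y by rewrite -/y H linearZ /= yv.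
  apply/row_matrixP => i; rewrite !rowE.
  apply: (@gen_eigen_ind _ x r (size r)
      (fun u => u *m bracket s y = u *m (mu^* *: y))) => //.
  - by move=> u u' Hu Hu'; rewrite !mulmxDl Hu Hu'.
  - by rewrite !mul0mx.
  move=> u a _ ua.
  have uya : u *m y *m (x - (a - mu)%:M) ^+ (size r + size r2) = 0.
    by apply: gen_eigen_mul => //; rewrite yv.
  rewrite bracketE mulmxBr !mulmxA (qP u a (size r)) ?leq_addr //.
  rewrite (qP _ _ _ (leqnn _) uya) -scalemxAl -scalerBl -scalemxAr.
  by rewrite rmorphB opprB addrC subrK.
move=> W WP w wW.
(* [D p] is p(ad x) applied to w; by Horner's scheme it stays in every subspace stable under ad
   x. *)
pose D p : 'M[C]_n.+1 := vec_mx ((mxvec w *m horner_mx L p) : 'rV_(n.+1 * n.+1)).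
have F c (u : 'rV[C]_(n.+1 * n.+1)) :
    vec_mx (u *m lin_mx (bracket x) + c *: mxvec w) = bracket x (vec_mx u) + c *: w.
  by rewrite [LHS]linearD linearZ /= mul_rV_lin !mxvecK.
have DE p c : D (p * 'X + c%:P) = bracket x (D p) + c *: w.
  have E : mxvec w *m horner_mx L (p * 'X + c%:P) =
      mxvec w *m horner_mx L p *m L + c *: mxvec w.
    rewrite rmorphD rmorphM /= horner_mx_X horner_mx_C mulmxDr mulmxA.
    by rewrite mul_mx_scalar.
  rewrite /D E; exact: F.
have -> : bracket s w = D Q by rewrite /D -key mxvecK.
elim/poly_ind: Q {QP key} => [|Q c IH].
  by rewrite /D rmorph0 mulmx0 (raddf0 vec_mx) mem0v.
by rewrite DE memvD ?memvZ ?WP.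
Qed.

End ConjugatePart.
End Matrices.

(** * The Jacobson-Morozov lemma *)

Section Engel.
Context {C : numClosedFieldType} {n : nat}.
Implicit Types (x y : 'M[C]_n.+1) (U W : {vspace 'M[C]_n.+1}).

Lemma expv_eq0 W k l : (W ^+ k)%VS = 0%VS -> (k <= l)%N -> (W ^+ l)%VS = 0%VS.
Proof. by move=> Wk /subnK <-; rewrite addnC expvD Wk prod0v. Qed.

(** If no such y existed, one could bracket an element outside W with elements of W again and again
    without ever entering W. After k + k brackets every term has at least k factors from W on one
    side, so the result is 0, which does lie in W. *)
Lemma nilpotent_normalizer U W k :
    (forall x y, x \in U -> y \in U -> bracket x y \in U) ->
    (W <= U)%VS -> (W ^+ k)%VS = 0%VS -> W != U ->
  exists y, [/\ y \in U, y \notin W & forall w, w \in W -> bracket w y \in W].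
Proof.
move=> brU WU Wk WnU; apply: contrapT => noy.
have step y : y \in U -> y \notin W -> exists2 w, w \in W & bracket w y \notin W.
  move=> yU yW; apply: contrapT => now; apply: noy; exists y; split=> // w wW.
  by apply: contrapT => /negP wy; apply: now; exists w.
have main j : exists y, [/\ y \in U, y \notin W & forall a b u v,
    (k + k <= a + b + j)%N -> u \in (W ^+ a)%VS -> v \in (W ^+ b)%VS -> u * y * v = 0].
  elim: j => [|j [y [yU yW yP]]].
    have /subvPn [y yU yW] : ~~ (U <= W)%VS.
      by apply: contraNN WnU => UW; apply/eqP/subv_anti; rewrite WU UW.
    exists y; split=> // a b u v; rewrite addn0 => kab ua vb.
    have [ka|ak] := leqP k a.
      by move: ua; rewrite (expv_eq0 Wk ka) memv0 => /eqP ->; rewrite !mul0r.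
    have kb : (k <= b)%N by rewrite -(leq_add2l k) (leq_trans kab) // leq_add2r ltnW.
    by move: vb; rewrite (expv_eq0 Wk kb) memv0 => /eqP ->; rewrite mulr0.
  have [w wW wy] := step y yU yW; exists (bracket w y); split=> //.
    by apply: brU => //; apply: (subvP WU).
  move=> a b u v kab ua vb.
  have -> : u * bracket w y * v = (u * w) * y * v - u * y * (w * v).
    by rewrite !bracketE mulrBr mulrBl !mulrA.
  rewrite (yP a.+1 b) ?(yP a b.+1) ?subrr //.
  - by rewrite addnS addSn -addnS.
  - by rewrite expvSl memv_mul.
  - by rewrite !addSn -addnS.
  - by rewrite expvSr memv_mul.
have [y [_ yW yP]] := main (k + k)%N.
have y0 : y = 0.
  by have := yP 0 0 1 1; rewrite !expv0 mul1r mulr1; apply; rewrite ?memv_line.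
by rewrite y0 mem0v in yW.
Qed.

(** The left ideals [V i] generated by the powers of W are stable under right multiplication by y,
    since W y is contained in y W + W. A product of p factors from W and y either has a factor in W,
    and moves [V i] into [V i.+1], or is y ^+ p = 0. *)
Lemma nilpotent_extend W y k p :
    (W ^+ k)%VS = 0%VS -> y ^+ p = 0 -> (forall w, w \in W -> bracket w y \in W) ->
  ((W + <[y]>) ^+ (p * k))%VS = 0%VS.
Proof.
move=> Wk yp Wy; pose V i := (fullv * W ^+ i)%VS.
have VW i : (V i * W)%VS = V i.+1 by rewrite /V -prodvA -expvSr.
have VS i : (V i.+1 <= V i)%VS.
  by rewrite /V expvSl prodvA prodvSl // subvf.
have Vy i : (V i * <[y]> <= V i)%VS.
  suff H : (W ^+ i * <[y]> <= V i)%VS.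
    rewrite /V -prodvA (subv_trans (prodvSr _ H)) // /V prodvA.
    by rewrite prodvSl // subvf.
  elim: i => [|i IH]; first by rewrite /V expv0 prod1v prodv1 subvf.
  rewrite expvSr -prodvA.
  have Hw : (W * <[y]> <= <[y]> * W + W)%VS.
    apply/prodvP => w z wW /vlineP [c ->].
    have -> : w * (c *: y) = (c *: y) * w + c *: bracket w y.
      by rewrite !bracketE scalerBr -scalerAr -scalerAl addrC subrK.
    by rewrite memv_add ?memv_mul ?memvZ ?memv_line ?Wy.
  rewrite (subv_trans (prodvSr _ Hw)) // prodvDr subv_add; apply/andP; split.
    by rewrite prodvA -VW prodvSl.
  by rewrite -expvSr /V -[X in (X <= _)%VS]prod1v prodvSl // subvf.
have Vp i : (V i * (W + <[y]>) ^+ p <= V i.+1)%VS.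
  suff H q : (V i * (W + <[y]>) ^+ q <= V i.+1 + V i * <[y]> ^+ q)%VS.
    rewrite (subv_trans (H p)) // expv_line yp subv_add subvv /=.
    have -> : (<[0 : 'M[C]_n.+1]> = 0)%VS by apply/eqP; rewrite -subv0 -memvE memv0.
    by rewrite prodv0 sub0v.
  elim: q => [|q IH]; first by rewrite !expv0 addvSr.
  rewrite expvSr prodvA (subv_trans (prodvSl _ IH)) // prodvDl !prodvDr !subv_add.
  rewrite VW (subv_trans (VS _)) ?addvSl // (subv_trans (Vy _)) ?addvSl //=.
  have Vyq : (V i * <[y]> ^+ q <= V i)%VS.
    elim: q {IH} => [|q IH]; first by rewrite expv0 prodv1.
    by rewrite expvSr prodvA (subv_trans (prodvSl _ IH)).
  by rewrite (subv_trans (prodvSl _ Vyq)) ?VW ?addvSl //= expvSr prodvA addvSr.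
have Vk j : (V 0%N * (W + <[y]>) ^+ (p * j) <= V j)%VS.
  elim: j => [|j IH]; first by rewrite muln0 expv0 prodv1.
  by rewrite mulnSr expvD prodvA (subv_trans (prodvSl _ IH)).
apply/eqP; rewrite -subv0.
have := Vk k; rewrite {2}/V Wk prodv0; apply: subv_trans.
by rewrite /V expv0 prodv1 -[X in (X <= _)%VS]prod1v prodvSl // subvf.
Qed.

(** Engel's theorem in associative form: products, and not only iterated brackets, vanish, which is
    what [filt] needs later. A nilpotent subalgebra W different from U is enlarged by an element
    normalizing it, so its dimension reaches any prescribed bound d unless W = U. *)
Lemma engel U :
    (forall x y, x \in U -> y \in U -> bracket x y \in U) ->
    (forall x, x \in U -> exists k, x ^+ k = 0) ->
  exists k, (U ^+ k)%VS = 0%VS.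
Proof.
move=> brU nilU.
suff [W [k [WU _ Wk [->|dW]]]] : exists W k, [/\ (W <= U)%VS,
    forall x y, x \in W -> y \in W -> bracket x y \in W,
    (W ^+ k)%VS = 0%VS & U = W \/ (\dim U <= \dim W)%N].
- by exists k.
- by exists k; have /eqP <- : W == U by rewrite eqEdim WU.
move: {1}(\dim U) => d; elim: d => [|d [W [k [WU brW Wk dW]]]].
  exists 0%VS, 1%N; split; rewrite ?sub0v ?expv1 //; last by right.
  by move=> x y; rewrite !memv0 => /eqP -> _; rewrite bracketC linear0 oppr0.
have [WeU|WnU] := eqVneq W U.
  by exists W, k; split=> //; left.
case: dW => [/esym/eqP|dW]; first by rewrite (negbTE WnU).
have [y [yU yW yP]] := nilpotent_normalizer brU WU Wk WnU.
have [p yp] := nilU y yU.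
exists (W + <[y]>)%VS, (p * k)%N; split.
- by rewrite subv_add WU -memvE.
- move=> u v /memv_addP [w wW [_ /vlineP [c ->] ->]].
  move=> /memv_addP [w' w'W [_ /vlineP [c' ->] ->]].
  rewrite bracketDl bracketZl !bracketDr !bracketZr bracketxx !scaler0 addr0.
  rewrite (subvP (addvSl _ _)) // (bracketC y); apply: memvD; first apply: memvD.
  + exact: brW.
  + by rewrite memvZ ?yP.
  + by rewrite memvZ // memvN yP.
- exact: nilpotent_extend.
- right; rewrite (leq_ltn_trans dW) // ltnNge; apply: contraNN yW => dWy.
  have /eqP -> : W == (W + <[y]>)%VS by rewrite eqEdim addvSl.
  by rewrite memvE addvSr.
Qed.

End Engel.

Lemma prodv_linear (K : fieldType) (A : falgType K) (V : vectType K)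
    (f : {linear A -> V}) (U1 U2 : {vspace A}) (W : {vspace V}) :
  {in U1 & U2, forall u v, f (u * v) \in W} ->
  forall x, x \in (U1 * U2)%VS -> f x \in W.
Proof.
move=> fW x xU; rewrite -(lfunE f) memv_preim; apply: (subvP _ _ xU).
by apply/prodvP => u v uU vU; rewrite -memv_preim lfunE fW.
Qed.

Section NilpotentMatrices.
Context {C : numClosedFieldType} {n : nat}.
Implicit Types (x y z : 'M[C]_n.+1).

Lemma nilpotent_char_poly x k : x ^+ k = 0 -> char_poly x = 'X^(n.+1).
Proof.
move=> xk; have [r] := closed_field_poly_normal (char_poly x).
rewrite (monicP (char_poly_monic x)) scale1r => rE.
have r0 a : a \in r -> a = 0.
  rewrite -root_prod_XsubC -rE -eigenvalue_root_char => /eigenvalueP [v vx v0].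
  have vxk j : v *m x ^+ j = a ^+ j *: v.
    elim: j => [|j IH]; first by rewrite !expr0 mulmx1 scale1r.
    by rewrite !exprS mulmxA vx -scalemxAl IH scalerA.
  have := vxk k; rewrite xk mulmx0 => /esym/eqP.
  by rewrite scaler_eq0 (negPf v0) orbF expf_eq0 => /andP [_ /eqP].
have sr : size r = n.+1.
  by have := size_char_poly x; rewrite rE size_prod_XsubC => -[].
rewrite rE big_seq (eq_bigr (fun=> 'X)) => [|a /r0 ->]; last by rewrite subr0.
by rewrite -big_seq big_const_seq count_predT sr iter_mulr_1.
Qed.

Lemma nilpotent_index x k : x ^+ k = 0 -> x ^+ n.+1 = 0.
Proof.
move/nilpotent_char_poly => cx; have := Cayley_Hamilton x.
by rewrite cx rmorphXn /= horner_mx_X.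
Qed.

Lemma nilpotent_trace x k : x ^+ k = 0 -> \tr x = 0.
Proof.
move/nilpotent_char_poly => cx; apply: oppr_inj.
by rewrite oppr0 -char_poly_trace // cx coefXn eqn_leq ltnn andbF.
Qed.

Lemma trace_bracketl x y z : \tr (bracket x y *m z) = - \tr (y *m bracket x z).
Proof.
rewrite !bracketE mulmxBl mulmxBr !raddfB /= opprK !mulmxA [LHS]addrC.
by congr (_ + _); rewrite -[x *m y *m z]mulmxA mxtrace_mulC.
Qed.

(** Each term of the expansion has the form x ^+ a * y * x ^+ b with a + b = k + k, so one of the
    two powers vanishes. *)
Lemma iter_bracket_nilpotent x y k : x ^+ k = 0 -> iter (k + k) (bracket x) y = 0.
Proof.
move=> xk.
suff H j a b : (k + k <= a + b + j)%N -> x ^+ a * iter j (bracket x) y * x ^+ b = 0.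
  by have := H (k + k)%N 0 0; rewrite !expr0 mul1r mulr1; apply.
elim: j a b => [|j IH] a b kab /=.
  have xl l : (k <= l)%N -> x ^+ l = 0.
    by move=> /subnK <-; rewrite exprD xk mulr0.
  have [ka|ak] := leqP k a; first by rewrite xl // !mul0r.
  rewrite (xl b) ?mulr0 // -(leq_add2l k) (leq_trans kab) //.
  by rewrite addn0 leq_add2r ltnW.
set v := iter j _ y.
have -> : x ^+ a * bracket x v * x ^+ b = x ^+ a.+1 * v * x ^+ b - x ^+ a * v * x ^+ b.+1.
  by rewrite !bracketE mulrBr mulrBl exprSr exprS !mulrA.
by rewrite (IH a.+1 b) ?(IH a b.+1) ?subrr // ?addnS ?addSn -?addnS.
Qed.

End NilpotentMatrices.

Section SL2.
Context {C : numClosedFieldType} {n : nat}.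
Implicit Types (x y h z a : 'M[C]_n.+1).

(** The identity e^(k+1) f = f e^(k+1) + (k+1) (h - k) e^k of the enveloping algebra of sl2, in the
    adjoint action. *)
Lemma sl2_iter x y h a k : bracket x y = h -> bracket h x = x *+ 2 ->
  iter k.+1 (bracket x) (bracket y a) = bracket y (iter k.+1 (bracket x) a)
    + k.+1%:R *: (bracket h (iter k (bracket x) a) - k%:R *: iter k (bracket x) a).
Proof.
move=> xy hx; elim: k => [|k IH].
  by rewrite /= scale0r subr0 scale1r jacobi xy addrC.
rewrite [LHS]iterS IH !iterS; move: (iter k _ a) => b {IH}.
rewrite bracketDr bracketZr bracketBr jacobi xy bracketZr; set c := bracket x b.
have -> : bracket x (bracket h b) = bracket h c - c *+ 2.
  rewrite jacobi [bracket x h]bracketC hx bracketNl mulr2n bracketDl -/c.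
  by rewrite addrC mulr2n.
rewrite -/c [X in X + _]addrC -addrA; congr (_ + _).
rewrite -scaler_nat !scalerBr !scalerA -[X in X + _]scale1r addrA addrA.
rewrite (ACl ((1*2)*(3*4))) /= -scalerDl -opprD -scalerDl.
by congr (_ *: _ - _ *: _); rewrite -!natr1; ring.
Qed.

(** A vector killed by ad x cannot have negative weight. If z = (ad x)^i a, then (ad x)^(i+1) [y, a]
    = - (i+1) (i+2) z, so z lies in the image of every power of the nilpotent ad x. *)
Lemma sl2_lowest x y h z k : bracket x y = h -> bracket h x = x *+ 2 -> x ^+ k = 0 ->
  bracket x z = 0 -> bracket h z = - (z *+ 2) -> z = 0.
Proof.
move=> xy hx xk xz hz.
have main i : exists a, z = iter i (bracket x) a.
  elim: i => [|i [a za]]; first by exists z.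
  have E0 : iter i.+1 (bracket x) a = 0 by rewrite iterS -za.
  have := sl2_iter a i xy hx; rewrite E0 bracket0r add0r -za hz.
  rewrite -scaler_nat -opprD -scalerDl scalerN scalerA => E.
  pose c : C := - (i.+1%:R * (2%:R + i%:R)).
  have c0 : c != 0 by rewrite oppr_eq0 mulf_neq0 // -?natrD pnatr_eq0.
  exists (c^-1 *: bracket y a).
  have -> : iter i.+1 (bracket x) (c^-1 *: bracket y a) =
      c^-1 *: iter i.+1 (bracket x) (bracket y a).
    by elim: i.+1 => //= j ->; rewrite linearZ.
  by rewrite E -scaleNr scalerA mulVf // scale1r.
by have [a ->] := main (k + k)%N; rewrite iter_bracket_nilpotent.
Qed.

End SL2.

(** * Duality for bilinear pairings *)

Section Duality.
Context {K : fieldType} {V1 V2 : vectType K}.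
Variable b : V1 -> V2 -> K.
Hypothesis bl : forall z, linear (fun u => b u z : K^o).
Hypothesis br : forall u, linear (fun z => b u z : K^o).

(** In bases, the hypothesis says that the row of values of x is annihilated by the cokernel of the
    matrix of the pairing, hence that it belongs to its row space. *)
Lemma bilinear_duality (I : {vspace V1}) (W : {vspace V2}) x :
    (forall z, z \in W -> (forall i, i \in I -> b i z = 0) -> b x z = 0) ->
  exists2 i, i \in I & forall z, z \in W -> b (x - i) z = 0.
Proof.
move=> xI.
have bl0 (m : nat) (c : 'I_m -> K) (u : 'I_m -> V1) z :
    b (\sum_k c k *: u k) z = \sum_k c k * b (u k) z.
  elim: m c u => [|m IH] c u.
    rewrite !big_ord0; have := bl z 0 0 0; rewrite scale0r add0r [0 *: _]mul0r add0r.
    by have := bl z 1 0 0; rewrite !scale1r addr0 => /(canLR (addrK _)); rewrite subrr => <-.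
  by rewrite !big_ord_recr /= addrC bl IH addrC.
have br0 (m : nat) (c : 'I_m -> K) (z : 'I_m -> V2) u :
    b u (\sum_k c k *: z k) = \sum_k c k * b u (z k).
  elim: m c z => [|m IH] c z.
    rewrite !big_ord0.
    by have := br u 1 0 0; rewrite !scale1r addr0 => /(canLR (addrK _)); rewrite subrr => <-.
  by rewrite !big_ord_recr /= addrC br IH addrC.
pose vI := vbasis I; pose vW := vbasis W.
pose A := \matrix_(k < \dim I, l < \dim W) b vI`_k vW`_l.
pose r := \row_(l < \dim W) b x vW`_l.
have : (r <= A)%MS.
  rewrite submxE; apply/eqP/rowP => l; rewrite !mxE.
  pose z := \sum_k (cokermx A) k l *: vW`_k.
  have zW : z \in W.
    by apply: memv_suml => k _; rewrite memvZ // vbasis_mem // mem_nth ?size_tuple.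
  rewrite (_ : \sum_j _ = b x z); last first.
    by rewrite br0; apply: eq_bigr => k _; rewrite mxE mulrC.
  apply: xI => // i iI; rewrite (coord_vbasis iI) bl0 big1 // => k _.
  have /matrixP/(_ k l) := mulmx_coker A; rewrite !mxE br0 => h.
  rewrite (_ : \sum_k0 _ = 0) ?mulr0 // -[RHS]h.
  by apply: eq_bigr => k' _; rewrite [A k k']mxE mulrC.
case/submxP => D rD; pose i := \sum_k D 0 k *: vI`_k.
exists i => [|z zW].
  by apply: memv_suml => k _; rewrite memvZ // vbasis_mem // mem_nth ?size_tuple.
rewrite (coord_vbasis zW) br0 big1 // => l _.
suff -> : b (x - i) vW`_l = 0 by rewrite mulr0.
have -> : x - i = (-1) *: i + x by rewrite scaleN1r addrC.
rewrite bl bl0 [_ *: _]mulN1r addrC; apply/eqP; rewrite subr_eq0; apply/eqP.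
have /rowP/(_ l) := rD; rewrite !mxE => ->.
by apply: eq_bigr => k _; rewrite mxE.
Qed.

End Duality.

Section JacobsonMorozov.
Context {C : numClosedFieldType} {n : nat}.
Implicit Types (x y h z t : 'M[C]_n.+1).

(** The element d = [x, z] commutes with x, so tr (d s) = - tr (z [x, s]) = 0 for every polynomial s
    in d, and d is nilpotent by [conj_part]. It also commutes with t, so t d is nilpotent, and 0 =
    tr (t d) = tr ([t, x] z) = c tr (x z). *)
Lemma trace_centralized_bracket x z t c k : x ^+ k = 0 -> c != 0 ->
    bracket t x = c *: x -> bracket t (bracket x z) = 0 ->
  bracket x (bracket x z) = 0 -> \tr (x *m z) = 0.
Proof.
move=> xk c0 tx td xd; set d := bracket x z in td xd.
have [q [dnil _]] := conj_part d.
have {}dnil : d ^+ n.+1 = 0.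
  apply: dnil; rewrite /d trace_bracketl.
  suff -> : bracket x (horner_mx d q) = 0 by rewrite mulmx0 raddf0 oppr0.
  apply/eqP; rewrite bracket_eq0; apply/eqP/comm_mx_horner.
  by apply/eqP; rewrite -bracket_eq0 xd.
have cd : GRing.comm t d by apply/eqP; rewrite -[_ == _]bracket_eq0 td.
have : \tr (t *m d) = 0.
  by apply: (@nilpotent_trace _ _ _ n.+1); rewrite [LHS]exprMn_comm // dnil mulr0.
have -> : \tr (t *m d) = \tr (bracket t x *m z).
  rewrite trace_bracketl /d !bracketE !mulmxBr !raddfB /= opprK !mulmxA.
  rewrite [RHS]addrC; congr (_ - _); first by rewrite -mulmxA mxtrace_mulC.
  by rewrite mxtrace_mulC mulmxA.
by rewrite tx -scalemxAl linearZ /= => /eqP; rewrite mulf_eq0 (negPf c0) => /eqP.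
Qed.

(** [Up], [Um] and [U0] stand for the spaces of weights alpha, - alpha and 0. Prescribing them
    forces the third vector of the triple to be a weight vector, which the ungraded lemma would not
    give. *)
Lemma jacobson_morozov (Up Um U0 : {vspace 'M[C]_n.+1}) x t c k :
    x \in Up -> x ^+ k = 0 -> c != 0 -> bracket t x = c *: x ->
    (forall h, h \in U0 -> bracket t h = 0) ->
    (forall y, y \in Um -> bracket x y \in U0) ->
    (forall h, h \in U0 -> bracket x h \in Up) ->
    (forall h y, h \in U0 -> y \in Um -> bracket h y \in Um) ->
    (forall z, z \in Up -> (forall y, y \in Um -> \tr (z *m y) = 0) -> z = 0) ->
  exists2 y, y \in Um & let h := bracket x y in
    bracket h x = x *+ 2 /\ bracket h y = - (y *+ 2).
Proof.
move=> xUp xk c0 tx tU0 xUm xU0 U0Um nondeg.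
pose phi := linfun (bracket x \o bracket x).
have phiE y : phi y = bracket x (bracket x y) by rewrite lfunE.
have phiUp y : y \in Um -> phi y \in Up by move=> yU; rewrite phiE xU0 ?xUm.
have phiT y z : \tr (phi y *m z) = \tr (y *m phi z).
  by rewrite !phiE !trace_bracketl opprK.
pose b (u v : 'M[C]_n.+1) := \tr (u *m v).
have bl z : linear (fun u => b u z : C^o).
  by move=> a u v; rewrite /b mulmxDl -scalemxAl linearD linearZ.
have br u : linear (fun z => b u z : C^o).
  by move=> a z v; rewrite /b mulmxDr -scalemxAr linearD linearZ.
(* As phi is self-adjoint for the trace form, an element z of [Um] orthogonal to the image of phi
   satisfies phi z = 0, and then tr (x z) = 0 by [trace_centralized_bracket]. By duality x lies in
   the image of phi. *)
have [|i /memv_imgP [y0 y0U ->] xy0] :=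
  bilinear_duality (b := b) bl br (I := (phi @: Um)%VS) (W := Um) (x := x).
  move=> z zU phiz; apply: (@trace_centralized_bracket _ _ t c k) => //.
    by rewrite tU0 ?xUm.
  rewrite -phiE; apply: nondeg; first exact: phiUp.
  by move=> y yU; rewrite mxtrace_mulC -phiT; apply: phiz; apply: memv_img.
have {xy0} xE : x = phi y0.
  apply/eqP; rewrite -subr_eq0; apply/eqP/nondeg; first by rewrite memvB ?phiUp.
  exact: xy0.
(* The factor - 2 turns [x, [x, y0]] = x into [[x, y1], x] = 2 x. *)
pose y1 := - (y0 *+ 2); have y1U : y1 \in Um by rewrite memvN rpredMn.
pose h := bracket x y1.
have hx : bracket h x = x *+ 2.
  by rewrite bracketC /h /y1 !bracketNr !bracketMnr -phiE -xE opprK.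
have hU : h \in U0 by exact: xUm.
(* The defect [h, y1] + 2 y1 lies in K. On K the map ad h + 2 is injective by [sl2_lowest], hence
   surjective; subtracting a preimage of the defect from y1 leaves h unchanged and repairs the last
   relation. *)
pose K := (Um :&: lker (linfun (bracket x)))%VS.
have KP z : z \in K -> z \in Um /\ bracket x z = 0.
  by rewrite memv_cap memv_ker lfunE => /andP [? /eqP].
have KI z : z \in Um -> bracket x z = 0 -> z \in K.
  by rewrite memv_cap memv_ker lfunE /= => -> ->; rewrite eqxx.
have xh : bracket x h = - (x *+ 2) by rewrite bracketC hx.
have xpsi z : bracket x (bracket h z + z *+ 2) = bracket h (bracket x z).
  rewrite bracketDr bracketMnr jacobi xh bracketNl !mulr2n bracketDl.
  by rewrite addrAC addNr add0r.
pose psi := linfun (bracket h \+ *:%R 2%:R).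
have psiE z : psi z = bracket h z + z *+ 2 by rewrite lfunE /= scaler_nat.
have psiK : (psi @: K <= K)%VS.
  apply/subvP => _ /memv_imgP [z /KP [zU xz] ->]; rewrite psiE; apply: KI.
    by rewrite memvD ?rpredMn ?U0Um.
  by rewrite xpsi xz linear0.
have psi_inj : (K :&: lker psi)%VS = 0%VS.
  apply/eqP; rewrite -subv0; apply/subvP => z; rewrite memv_cap memv_ker psiE.
  case/andP => /KP [zU xz]; rewrite addr_eq0 => /eqP hz; rewrite memv0.
  by apply/eqP; apply: (@sl2_lowest _ _ x y1 h z k).
have psi_surj : (psi @: K)%VS = K.
  by apply/eqP; rewrite eqEdim psiK (limg_dim_eq psi_inj) leqnn.
have : bracket h y1 + y1 *+ 2 \in K.
  by apply: KI; rewrite ?memvD ?rpredMn ?U0Um // xpsi bracketxx.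
rewrite -psi_surj => /memv_imgP [z /KP [zU xz]]; rewrite psiE => zE.
exists (y1 - z); first exact: memvB.
have -> : bracket x (y1 - z) = h by rewrite bracketBr xz subr0.
split=> //; rewrite bracketBr mulrnBl opprB; apply/eqP.
by rewrite subr_eq addrAC eq_sym subr_eq zE addrC.
Qed.

End JacobsonMorozov.

(** * Exponentials of nilpotent matrices *)

Section NilpotentExponential.
Context {C : numClosedFieldType} {n : nat}.
Local Notation M := 'M[C]_n.+1.
Implicit Types (x y h g : M) (z s : C).

(** Nilpotent matrices of this size have vanishing [n.+1]-st power, so no term is lost, and the
    exponential is polynomial in the entries. *)
Definition nexp x : M := \sum_(k < n.+1) (k`!%:R^-1 : C) *: x ^+ k.

(** The curve s |-> exp(s x) as a polynomial with matrix coefficients. Identities are proved on its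
    coefficients or by formal differentiation, and then evaluated at scalar matrices, where
    evaluation is multiplicative because they are central. *)
Definition nexp_poly x : {poly M} := \poly_(k < n.+1) ((k`!%:R^-1 : C) *: x ^+ k).

Lemma coef_nexp_poly x k : x ^+ n.+1 = 0 -> (nexp_poly x)`_k = (k`!%:R^-1 : C) *: x ^+ k.
Proof.
move=> xn; rewrite coef_poly; case: ltnP => // nk.
by rewrite -(subnK nk) exprD xn mulr0 scaler0.
Qed.

Lemma horner_scalarM (p q : {poly M}) z : (p * q).[z%:M] = p.[z%:M] * q.[z%:M].
Proof.
by apply: hornerM_comm; rewrite /comm_poly -[RHS]/(_ *m _) scalar_mxC.
Qed.

Lemma horner_scalarE (p : {poly M}) z : p.[z%:M] = \sum_(i < size p) z ^+ i *: p`_i.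
Proof.
rewrite horner_coef; apply: eq_bigr => i _.
by rewrite -rmorphXn /= -[LHS]/(_ *m _) mul_mx_scalar.
Qed.

Lemma horner_nexp_poly x z : (nexp_poly x).[z%:M] = nexp (z *: x).
Proof.
rewrite horner_poly; apply: eq_bigr => i _.
by rewrite -rmorphXn /= -[LHS]/(_ *m _) mul_mx_scalar exprZn !scalerA mulrC.
Qed.

Lemma deriv_nexp_poly x : x ^+ n.+1 = 0 -> (nexp_poly x)^`() = x%:P * nexp_poly x.
Proof.
move=> xn; apply/polyP => k; rewrite coef_deriv coefCM !coef_nexp_poly //.
rewrite factS -scaler_nat scalerA -scalerAr -exprS; congr (_ *: _).
by rewrite natrM invfM mulrA mulfV ?mul1r // pnatr_eq0.
Qed.

Lemma nexp_comm x y : GRing.comm x y -> GRing.comm (nexp x) y.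
Proof.
move=> xy; apply: commr_sym; apply: commr_sum => k _.
by rewrite /GRing.comm -scalerAr -scalerAl; congr (_ *: _); apply: commrX; apply: commr_sym.
Qed.

Lemma nexp_poly_comm x : GRing.comm (nexp_poly x) x%:P.
Proof.
apply/polyP => k; rewrite coefCM coefMC coef_poly; case: ifP => _; last by rewrite mulr0 mul0r.
by rewrite -scalerAl -scalerAr -exprS -exprSr.
Qed.

Lemma nexp0 : nexp 0 = 1.
Proof.
rewrite /nexp big_ord_recl fact0 invr1 scale1r big1 ?addr0 // => i _.
by rewrite expr0n scaler0.
Qed.

Lemma poly_deriv0 (p : {poly M}) z : p^`() = 0 -> p.[z%:M] = p.[0].
Proof.
move=> dp; suff -> : p = (p`_0)%:P by rewrite !hornerC.
apply/polyP => -[|k]; rewrite coefC //=.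
have /polyP/(_ k) := dp; rewrite coef_deriv coef0 => /eqP.
by rewrite -scaler_nat scaler_eq0 pnatr_eq0 => /eqP.
Qed.

Lemma nexpN x : x ^+ n.+1 = 0 -> nexp x * nexp (- x) = 1.
Proof.
move=> xn; have xn' : (- x) ^+ n.+1 = 0 by rewrite exprNn xn mulr0.
have := @poly_deriv0 (nexp_poly x * nexp_poly (- x)) 1.
rewrite derivM !deriv_nexp_poly // [nexp_poly x * (_ * _)]mulrA polyCN mulrN nexp_poly_comm.
rewrite mulNr subrr => /(_ erefl).
rewrite -[in RHS](raddf0 (@scalar_mx C n.+1)) !horner_scalarM !horner_nexp_poly.
by rewrite !scale1r !scale0r nexp0 mulr1.
Qed.

Lemma nexp_unit x : x ^+ n.+1 = 0 -> nexp x \in unitmx.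
Proof. by move=> /nexpN/mulmx1_unit []. Qed.

Lemma nexpZ_unit x z : x ^+ n.+1 = 0 -> nexp (z *: x) \in unitmx.
Proof. by move=> xn; apply: nexp_unit; rewrite exprZn xn scaler0. Qed.

Lemma invmx_nexp x : x ^+ n.+1 = 0 -> invmx (nexp x) = nexp (- x).
Proof.
move=> xn; rewrite -[RHS](mulKmx (nexp_unit xn)).
by rewrite [nexp x *m _](nexpN xn) mulmx1.
Qed.

Definition nexp_entry x i j : {poly C} :=
  \poly_(k < n.+1) ((k`!%:R^-1 : C) *: x ^+ k) i j.

Lemma horner_nexp_entry x i j s : (nexp_entry x i j).[s] = nexp (s *: x) i j.
Proof.
rewrite horner_poly summxE; apply: eq_bigr => k _.
by rewrite exprZn [_ *: (_ *: _)]scalerA [_^-1 * _]mulrC -scalerA [in RHS]mxE mulrC.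
Qed.

Lemma deriv_nexp_entry x i j s : x ^+ n.+1 = 0 ->
  (nexp_entry x i j)^`().[s] = (nexp (s *: x) *m x) i j.
Proof.
move=> xn; rewrite (horner_coef_wide s (n := n.+1)); last first.
  by apply: leq_trans (size_poly _ _) _; rewrite (leq_trans (leq_pred _)) ?size_poly.
rewrite mulmx_suml summxE; apply: eq_bigr => k _.
rewrite coef_deriv coef_poly exprZn -!scalemxAl -[x ^+ k *m x]exprSr scalerA mulrC -scalerA.
rewrite [in RHS]mxE mulrC; case: ltnP => [kn|nk].
  rewrite -[_ *+ k.+1]mulr_natr [in LHS]mxE [in RHS]mxE factS natrM invfM.
  set c := k`!%:R^-1; set y := (x ^+ _) i j.
  have -> : k.+1%:R^-1 * c * y * k.+1%:R * s ^+ k = k.+1%:R^-1 * k.+1%:R * (c * (s ^+ k * y)).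
    by ring.
  by rewrite mulVf ?mul1r // pnatr_eq0.
have -> : k.+1 = n.+1 by apply/eqP; rewrite eqn_leq nk ltn_ord.
by rewrite xn mul0rn scaler0 mxE !mulr0 // mul0r.
Qed.

(** The determinant is a polynomial in z without zeros, hence constant. *)
Lemma det_nexp x z : x ^+ n.+1 = 0 -> \det (nexp (z *: x)) = 1.
Proof.
move=> xn; pose q := \det (\matrix_(i, j) nexp_entry x i j).
have qE s : \det (nexp (s *: x)) = q.[s].
  rewrite -horner_evalE -det_map_mx; congr (\det _).
  apply/matrixP => i j; rewrite [RHS]mxE.
  have -> : (\matrix_(i, j) nexp_entry x i j) i j = nexp_entry x i j by rewrite mxE.
  exact: esym (horner_nexp_entry x i j s).
have : size q == 1.
  apply: contraT => /closed_rootP [s0 /rootP]; rewrite -qE => /eqP.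
  by have := nexpZ_unit s0 xn; rewrite unitmxE unitfE => /negPf ->.
move/eqP/eq_leq/size1_polyC => qc.
have qz s : q.[s] = q`_0 by rewrite {1}qc hornerC.
by rewrite qE qz -(qz 0) -qE scale0r nexp0 det1.
Qed.

Lemma conj_nexp g x : g \in unitmx -> g *m nexp x *m invmx g = nexp (g *m x *m invmx g).
Proof.
move=> ug; rewrite mulmx_sumr mulmx_suml; apply: eq_bigr => k _.
rewrite -scalemxAr -scalemxAl; congr (_ *: _).
elim: (k : nat) => [|j IH]; first by rewrite !expr0 mulmx1 mulmxV.
by rewrite !exprS -IH -[LHS]/(g *m (x *m _) *m _) -[RHS]/(_ *m _) !mulmxA mulmxKV.
Qed.

Section Triple.
Variables (x y h : M).
Hypothesis xn : x ^+ n.+1 = 0.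
Hypothesis xy : bracket x y = h.
Hypothesis hx : bracket h x = x *+ 2.

Let xyE : x * y = y * x + h.
Proof. by rewrite -xy bracketE addrC subrK. Qed.

Let xhE : x * h = h * x - x *+ 2.
Proof. by rewrite -hx bracketE opprB addrC subrK. Qed.

Lemma sl2_expr_mul k :
  x ^+ k.+1 * y = y * x ^+ k.+1 + k.+1%:R *: (h * x ^+ k - k%:R *: x ^+ k).
Proof.
elim: k => [|k IH]; first by rewrite expr1 expr0 scale0r subr0 scale1r mulr1.
rewrite exprS -mulrA IH mulrDr mulrA xyE mulrDl -mulrA -exprS -addrA; congr (_ + _).
rewrite -scalerAr mulrBr -scalerAr mulrA xhE mulrBl -mulrA -exprS.
rewrite mulrnAl -exprS -scaler_nat !scalerBr !scalerA -[X in X + _]scale1r addrA addrA.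
rewrite (ACl ((1*2)*(3*4))) /= -scalerDl -opprD -scalerDl.
by congr (_ *: _ - _ *: _); rewrite -!natr1; ring.
Qed.

Lemma sl2_expr_mulh k : x ^+ k * h = h * x ^+ k - (k%:R * 2%:R) *: x ^+ k.
Proof.
elim: k => [|k IH]; first by rewrite !expr0 mul0r scale0r subr0 mulr1 mul1r.
rewrite exprS -mulrA IH mulrBr -scalerAr [x * (h * _)]mulrA xhE mulrBl -mulrA -!exprS.
rewrite [x *+ 2 * _]mulrnAl -exprS -scaler_nat -addrA -opprD -scalerDl.
by congr (_ - _ *: _); rewrite -natr1; ring.
Qed.

Local Notation E := (nexp_poly x).

(** The adjoint action Ad(exp(s x)) y = y + s h - s^2 x, with the inverse exponential moved to the
    other side. *)
Lemma nexp_poly_mul : E * y%:P = y%:P * E + h%:P * E * 'X - x%:P * E * 'X^2.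
Proof.
apply/polyP => k; rewrite coefMC coefB coefD coefCM coefMX coefMXn !coefCM !coef_nexp_poly //.
case: k => [|k]; first by rewrite /= !subr0 addr0 expr0 -scalerAl -scalerAr mulr1 mul1r.
rewrite -scalerAl sl2_expr_mul scalerDr -scalerAr -addrA; congr (_ + _) => /=.
rewrite scalerA factS natrM invfM mulrAC mulVf ?pnatr_eq0 // mul1r.
rewrite scalerBr -scalerAr; congr (_ - _).
case: k => [|k] /=; first by rewrite scale0r scaler0.
rewrite (_ : k.+2 - 2 = k)%N ?subn2 // -scalerAr -exprS scalerA.
by rewrite factS natrM invfM mulrAC mulVf ?pnatr_eq0 // mul1r.
Qed.

Lemma nexp_poly_mulh : E * h%:P = h%:P * E - x%:P * E * 'X *+ 2.
Proof.
apply/polyP => k; rewrite coefMC coefB coefMn coefCM coefMX coefCM !coef_nexp_poly //.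
case: k => [|k]; first by rewrite mul0rn subr0 expr0 -scalerAl -scalerAr mulr1 mul1r.
rewrite -scalerAl sl2_expr_mulh scalerBr -!scalerAr; congr (_ - _) => /=.
rewrite -exprS -scaler_nat !scalerA; congr (_ *: _).
by rewrite factS natrM invfM mulrACA mulVf ?pnatr_eq0 // mul1r mulrC.
Qed.

Lemma nexp_mul : nexp x * y = (y + h - x) * nexp x.
Proof.
have := congr1 (fun p => p.[1%:M]) nexp_poly_mul.
rewrite expr2 mulrA hornerD hornerN hornerD !horner_scalarM !hornerC hornerX horner_nexp_poly.
by rewrite scale1r -[1%:M]/(1 : M) !mulr1 !mulrDl mulNr.
Qed.

Lemma nexp_mulh : nexp x * h = (h - x *+ 2) * nexp x.
Proof.
have := congr1 (fun p => p.[1%:M]) nexp_poly_mulh.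
rewrite hornerD hornerN hornerMn !horner_scalarM !hornerC hornerX horner_nexp_poly.
by rewrite scale1r -[1%:M]/(1 : M) mulr1 mulrBl mulrnAl.
Qed.

End Triple.

Section Torus.
Variables (x y h : M).
Hypothesis xn : x ^+ n.+1 = 0.
Hypothesis yn : y ^+ n.+1 = 0.
Hypothesis xy : bracket x y = h.
Hypothesis hx : bracket h x = x *+ 2.
Hypothesis hy : bracket h y = - (y *+ 2).

Variable N : nat.
Hypothesis nN : (n <= N)%N.

(* This is w(z) = x(z) y(-1/z) x(z), for which w(z) w(1)^-1 is the value at z of the
   coroot. *)
Definition sl2_weyl z : M := nexp (z *: x) * nexp (- (z^-1 *: y)) * nexp (z *: x).

Local Notation E := (nexp_poly x).
Let Ny : (- y) ^+ n.+1 = 0. Proof. by rewrite exprNn yn mulr0. Qed.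
(** Since n <= N, reversing the coefficients makes F the polynomial z^N exp(- y / z), and W is then
    z^N w(z). *)
Let f k : M := (nexp_poly (- y))`_k.
Let F : {poly M} := \poly_(j < N.+1) f (N - j).
Let W := E * F * E.

Let f0 k : (N < k)%N -> f k = 0.
Proof. by move=> nk; rewrite /f coef_poly ltnNge (leq_ltn_trans nN nk). Qed.

Let fS k : k.+1%:R *: f k.+1 = - y * f k.
Proof.
rewrite /f !coef_nexp_poly // -scalerAr -exprS scalerA; congr (_ *: _).
by rewrite factS natrM invfM mulrA mulfV ?mul1r // pnatr_eq0.
Qed.

Let fx k : f k.+2 * x = x * f k.+2 + h * f k.+1 - y * f k.
Proof.
have yx : bracket (- y) (- x) = - h by rewrite bracketNl bracketNr opprK bracketC xy.
have hy' : bracket (- h) (- y) = (- y) *+ 2.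
  by rewrite bracketNl bracketNr opprK hy mulNrn.
have /polyP/(_ k.+2) := nexp_poly_mul Ny yx hy'.
rewrite coefMC coefB coefD coefCM coefMX coefMXn !coefCM /= (_ : k.+2 - 2 = k)%N ?subn2 //.
rewrite -!/(f _) mulrN !mulNr opprK => /(congr1 -%R); rewrite opprK => ->.
by rewrite !opprD !opprK.
Qed.

Let fx1 : f 1 * x = x * f 1 + h * f 0.
Proof.
have yx : bracket (- y) (- x) = - h by rewrite bracketNl bracketNr opprK bracketC xy.
have hy' : bracket (- h) (- y) = (- y) *+ 2.
  by rewrite bracketNl bracketNr opprK hy mulNrn.
have /polyP/(_ 1%N) := nexp_poly_mul Ny yx hy'.
rewrite coefMC coefB coefD coefCM coefMX coefMXn !coefCM /= subr0.
rewrite -!/(f _) mulrN !mulNr => /(congr1 -%R); rewrite opprK => ->.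
by rewrite !opprD !opprK.
Qed.

Let coefF j : F`_j = if (j <= N)%N then f (N - j) else 0.
Proof. by rewrite coef_poly ltnS. Qed.

Let dF : F^`() * 'X^2 = F * 'X *+ N + y%:P * F.
Proof.
apply/polyP => -[|k]; rewrite coefMXn coefD coefMn coefMX coefCM /=.
  by rewrite mul0rn add0r coefF subn0 -[y]opprK mulNr -fS f0 // scaler0 oppr0.
rewrite !coefF coef_deriv; case: k => [|k] /=.
  rewrite subn0; case: ifP => [N0|/negbT]; last first.
    by rewrite -leqNgt leqn0 => /eqP N0; rewrite N0 mulr0 addr0 mulr0n.
  have -> : f N = f (N - 1).+1 by rewrite subn1 prednK.
  by rewrite -[y]opprK mulNr -fS -scaler_nat subn1 prednK // subrr.
rewrite (_ : k.+2 - 2 = k)%N ?subn2 // coefF; have [kn|nk] := ltnP k N; last first.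
  by rewrite ltnNge (leq_trans nk (leqnSn _)) mulr0 addr0 !mul0rn.
have [kn1|] := ltnP k.+1 N; last first.
  move=> nk; have -> : N = k.+1 by apply/eqP; rewrite eqn_leq nk kn.
  by rewrite mulr0 addr0.
have -> : f (N - k.+1) = f (N - k.+2).+1 by rewrite subnSK.
rewrite -[y]opprK mulNr -fS -!scaler_nat -scalerBl; congr (_ *: _).
by rewrite subnSK // natrB ?(ltnW kn1) // opprB addrC subrK.
Qed.

(** The adjoint action of exp(- y / z) on x, multiplied by z^2 to clear denominators. *)
Let Fx : F * x%:P * 'X^2 = x%:P * F * 'X^2 + h%:P * F * 'X - y%:P * F.
Proof.
apply/polyP => -[|[|k]]; rewrite coefB coefD !coefMXn coefMX !coefCM ?coefMC /=.
- rewrite add0r coefF subn0 -[y]opprK mulNr -fS f0 // scaler0.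
  by rewrite !(oppr0, addr0).
- rewrite add0r !coefF subn0; case: ltnP => [N0|].
    have -> : f N = f (N - 1).+1 by rewrite subn1 prednK.
    have := fx (N - 1); rewrite subn1 prednK // !(@f0 N.+1) // mul0r mulr0 add0r => <- //.
  rewrite leqn0 => /eqP N0; rewrite N0 mulr0 subr0.
  by have := fx1; rewrite f0 ?N0 // mul0r mulr0 add0r => <-.
rewrite (_ : k.+2 - 2 = k)%N ?subn2 // !coefF.
have [kn|] := ltnP k.+1 N.
  rewrite (ltnW (ltnW kn)) (ltnW kn).
  have e1 : (N - k = (N - k.+2).+2)%N by lia.
  have e2 : (N - k.+1 = (N - k.+2).+1)%N by rewrite subnSK.
  by rewrite e1 e2 fx.
rewrite mulr0 subr0 leq_eqVlt => /orP [/eqP nk|].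
  by rewrite nk leqnSn leqnn subnn subSnn fx1.
rewrite ltnS => nk; rewrite ltnNge nk /= mulr0 addr0.
move: nk; rewrite leq_eqVlt => /orP [/eqP ->|nk]; last by rewrite leqNgt nk /= mul0r mulr0.
rewrite leqnn subnn /f coef_nexp_poly // fact0 invr1 scale1r expr0.
by rewrite mul1r mulr1.
Qed.

Let Ey : E * y%:P = y%:P * E + h%:P * E * 'X - x%:P * E * 'X^2.
Proof. exact: nexp_poly_mul. Qed.

Let Eh : E * h%:P = h%:P * E - x%:P * E * 'X *+ 2.
Proof. exact: nexp_poly_mulh. Qed.

(** This is the differential equation z W' = (N + h) W, multiplied by z. Its coefficients say that
    left multiplication by h acts on the k-th one by k - N. *)
Let dW : W^`() * 'X^2 = (W *+ N + h%:P * W) * 'X.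
Proof.
have [X2 X2E] : exists X2 : {poly M}, X2 = 'X^2 by exists 'X^2.
have X2C (p q : {poly M}) : p * X2 * q = p * q * X2.
  by rewrite X2E -mulrA -[RHS]mulrA; congr (p * _); exact: (esym (commr_polyXn q 2)).
have X1C (p q : {poly M}) : p * 'X * q = p * q * 'X.
  by rewrite -mulrA -[RHS]mulrA; congr (p * _); exact: (esym (commr_polyX q)).
have XX (p : {poly M}) : p * 'X * 'X = p * X2 by rewrite X2E expr2 mulrA.
move: dF Fx Ey; rewrite -X2E => dF' Fx' Ey'.
have T1 : E * F^`() * E * X2 =
    W * 'X *+ N + (y%:P * W + h%:P * W * 'X - x%:P * W * X2).
  rewrite -X2C -[E * _ * _]mulrA dF' mulrDr mulrDl mulrnAr mulrnAl !mulrA.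
  congr (_ + _); first by rewrite X1C.
  by rewrite Ey' !(mulrDl, mulrBl, mulNr) !X2C !X1C.
have T2 : E * F * (x%:P * E) * X2 = - (y%:P * W).
  have -> : E * F * (x%:P * E) * X2 = E * (F * x%:P * X2) * E.
    by rewrite !mulrA !X2C.
  rewrite Fx' !(mulrDr, mulrDl, mulrN, mulNr) !mulrA !X1C !X2C Ey' Eh nexp_poly_comm.
  rewrite -[x%:P * E * 'X *+ 2]mulr_natr !(mulrDl, mulrBl, mulNr).
  have C2 (p q : {poly M}) : p * 2%:R * q = p * q * 2%:R.
    by rewrite !mulr_natr mulrnAl.
  rewrite !C2 !X2C !X1C !C2 XX.
  have -> : x%:P * E * F * E = x%:P * W by rewrite /W !mulrA.
  have -> : y%:P * E * F * E = y%:P * W by rewrite /W !mulrA.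
  have -> : h%:P * E * F * E = h%:P * W by rewrite /W !mulrA.
  move: (x%:P * W * X2) (h%:P * W * 'X) (y%:P * W) => a b c.
  rewrite mulr_natr mulr2n !opprD !opprK !addrA.
  by rewrite (ACl ((1*3)*(2*6)*(7*4)*5)) /= !subrr !add0r.
rewrite /W derivM derivM !deriv_nexp_poly // -/W !mulrDl T1 T2 mulrnAl.
have -> : x%:P * E * F * E = x%:P * W by rewrite /W !mulrA.
by rewrite !addrA (ACl ((2*4)*(1*5)*(3*6))) /= !subrr !addr0.
Qed.

Let hW k : h * W`_k = (k%:R - N%:R) *: W`_k.
Proof.
have /polyP/(_ k.+1) := dW.
rewrite coefMXn coefMX coefD coefMn coefCM /= => E.
rewrite scalerBl !scaler_nat; apply/eqP; rewrite eq_sym subr_eq addrC -E; apply/eqP.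
by case: k {E} => [|k]; rewrite ?mulr0n //= subSS subn1 coef_deriv.
Qed.

Let evalW z : z != 0 -> W.[z%:M] = z ^+ N *: sl2_weyl z.
Proof.
move=> z0; rewrite /W !horner_scalarM !horner_nexp_poly /sl2_weyl.
suff -> : F.[z%:M] = z ^+ N *: nexp (- (z^-1 *: y)) by rewrite -scalerAr -scalerAl.
have -> : F.[z%:M] = \sum_(j < N.+1) z ^+ j *: f (N - j).
  rewrite horner_poly; apply: eq_bigr => j _.
  by rewrite -rmorphXn /= -[LHS]/(_ *m _) mul_mx_scalar.
rewrite (reindex_inj rev_ord_inj) /=.
have -> : - (z^-1 *: y) = z^-1 *: (- y) by rewrite scalerN.
rewrite -horner_nexp_poly (horner_coef_wide (n := N.+1)); last first.
  by rewrite (leq_trans (size_poly _ _)).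
rewrite scaler_sumr; apply: eq_bigr => j _; rewrite -/(f j).
rewrite -rmorphXn /= -[f j * _]/(_ *m _) mul_mx_scalar scalerA exprVn.
have jN : (j <= N)%N by rewrite -ltnS.
rewrite subSS subKn //; congr (_ *: _).
by have := exprD z (N - j) j; rewrite subnK // => ->; rewrite mulfK // expf_neq0.
Qed.

Lemma sl2_weyl_unit z : sl2_weyl z \in unitmx.
Proof.
have u1 : nexp (z *: x) \in unitmx by rewrite nexp_unit // exprZn xn scaler0.
have u2 : nexp (- (z^-1 *: y)) \in unitmx.
  by rewrite nexp_unit // -scalerN exprZn Ny scaler0.
by rewrite /sl2_weyl -[_ * _]/(_ *m _ *m _) !unitmx_mul u1 u2.
Qed.

(** The e k are the coefficients of W times w(1)^-1; this factor normalizes the value at z = 1 and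
    does not disturb left eigenvectors of h. *)
Lemma sl2_torus : exists (K : nat) (e : nat -> M), [/\ \sum_(k < K) e k = 1,
  forall k, h * e k = (k%:R - N%:R) *: e k &
  forall z, z != 0 ->
    \sum_(k < K) (z ^+ k / z ^+ N) *: e k = sl2_weyl z * invmx (sl2_weyl 1)].
Proof.
have E z : z != 0 -> \sum_(k < size W) (z ^+ k / z ^+ N) *: (W`_k * invmx (sl2_weyl 1))
    = sl2_weyl z * invmx (sl2_weyl 1).
  move=> z0; have zN : z ^+ N != 0 by rewrite expf_neq0.
  rewrite -[sl2_weyl z](scalerK zN) -evalW // horner_scalarE.
  rewrite scaler_sumr mulr_suml; apply: eq_bigr => k _.
  by rewrite scalerA scalerAl [_^-1 * _]mulrC.
exists (size W), (fun k => W`_k * invmx (sl2_weyl 1)); split => //.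
- rewrite -[RHS](mulmxV (sl2_weyl_unit 1)) -[RHS](E 1 (oner_neq0 _)).
  by apply: eq_bigr => k _; rewrite !expr1n divr1 scale1r.
- by move=> k; rewrite mulrA hW scalerAl.
Qed.

End Torus.
End NilpotentExponential.

(** * Gradings *)

Lemma poly_eq0_of_infinite (F : numFieldType) (p : {poly F}) (Z : seq F) :
  (forall z, z \notin Z -> p.[z] = 0) -> p = 0.
Proof.
move=> pz; apply/eqP; apply: contraT => p0.
pose s := [seq x <- [seq (i%:R : F) | i <- iota 0 (size p + size Z)] | x \notin Z].
have us : uniq s.
  by rewrite filter_uniq // map_inj_uniq ?iota_uniq // => i j /eqP; rewrite eqr_nat => /eqP.
have rs : all (root p) s.
  by apply/allP => x; rewrite mem_filter => /andP [/pz px _]; apply/rootP.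
have := max_poly_roots p0 rs us; rewrite ltnNge => /negP; case.
have /= := count_predC (mem Z) [seq (i%:R : F) | i <- iota 0 (size p + size Z)].
rewrite size_map size_iota -!size_filter -/s => E.
rewrite -(leq_add2r (size Z)) -E addnC leq_add2l.
apply: uniq_leq_size; last by move=> x; rewrite mem_filter => /andP [].
by rewrite filter_uniq // map_inj_uniq ?iota_uniq // => i j /eqP; rewrite eqr_nat => /eqP.
Qed.

Lemma idempotent_trace (F : numFieldType) m (A : 'M[F]_m) : A *m A = A ->
  \tr A = (\rank A)%:R.
Proof.
move=> AA; have E := mulmx_base A.
have QP : row_base A *m col_base A = 1%:M.
  apply: (row_free_inj (row_base_free A)); apply: (row_full_inj (col_base_full A)) => /=.
  by rewrite mul1mx -[in LHS]mulmxA mulmxA !E.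
by rewrite -[in LHS]E mxtrace_mulC QP mxtrace1.
Qed.

Section Gradings.
Context {C : numClosedFieldType} {n : nat}.
Local Notation M := 'M[C]_n.+1.
Implicit Types (x y : M) (z : C).

Section Eigen.
Variables (K : nat) (h : M) (a : nat -> C).
Hypothesis a_inj : injective a.

Lemma eigen_indep (v : nat -> M) : (forall k, (k < K)%N -> h * v k = a k *: v k) ->
  \sum_(k < K) v k = 0 -> forall k, (k < K)%N -> v k = 0.
Proof.
move=> hv sv k kK.
pose p := \prod_(j < K | j != k :> nat) ('X - (a j)%:P).
have hp (q : {poly C}) j : (j < K)%N -> horner_mx h q * v j = q.[a j] *: v j.
  move=> jK; elim/poly_ind: q => [|q c IH].
    by rewrite rmorph0 mul0r horner0 scale0r.
  rewrite rmorphD rmorphM /= horner_mx_X horner_mx_C mulrDl -mulrA hv // -scalerAr IH.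
  rewrite scalerA -[c%:M * _]/(_ *m _) mul_scalar_mx -scalerDl.
  by rewrite !hornerE mulrC.
have := congr1 (fun u => horner_mx h p * u) sv; rewrite /= mulr0 mulr_sumr.
rewrite (bigD1 (Ordinal kK)) //= big1 ?addr0 => [|j jk]; last first.
  rewrite hp // /p (bigD1 j) //= hornerM hornerXsubC subrr mul0r scale0r //.
rewrite hp // => /eqP; rewrite scaler_eq0 => /orP [|/eqP //].
rewrite horner_prod prodf_seq_eq0 => /hasP [j _ /andP [jk]].
by rewrite hornerXsubC subr_eq0 => /eqP/a_inj/eqP; rewrite eq_sym (negPf jk).
Qed.

End Eigen.

(* A decomposition 1 = sum of e_k (k < K) into orthogonal idempotents; the
   exponents of the cocharacter attached to it are shifted by N. *)
Definition orth_idem K (e : nat -> M) :=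
  \sum_(k < K) e k = 1 /\
  forall i j, (i < K)%N -> (j < K)%N -> e i * e j = if i == j then e i else 0.

Definition cochar_mx K N (e : nat -> M) z : M := \sum_(k < K) (z ^+ k / z ^+ N) *: e k.

(** The derivative of [cochar_mx] at z = 1. *)
Definition cochar_tangent K N (e : nat -> M) : M := \sum_(k < K) (k%:R - N%:R) *: e k.

(** Multiplying 1 = sum of e k on the right by e j writes the eigenvector e j as a sum of
    eigenvectors e k * e j for distinct eigenvalues; only the term k = j can survive. *)
Lemma eigen_orth_idem K N (h : M) (e : nat -> M) : \sum_(k < K) e k = 1 ->
  (forall k, h * e k = (k%:R - N%:R) *: e k) ->
  orth_idem K e /\ cochar_tangent K N e = h.
Proof.
move=> se he; split; last first.
  rewrite -[RHS]mulr1 -se mulr_sumr; apply: eq_bigr => k _; exact: esym.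
split=> // i j iK jK.
have ainj : injective (fun k : nat => k%:R - N%:R : C).
  by move=> k l /addIr/eqP; rewrite eqr_nat => /eqP.
pose v k := e k * e j - (if k == j then e j else 0).
suff : v i = 0 by rewrite /v => /eqP; rewrite subr_eq0 => /eqP ->; case: eqP => // ->.
apply: (eigen_indep ainj (K := K) (h := h)) => // [k kK|].
  rewrite /v mulrBr mulrA he -scalerAl scalerBr; congr (_ - _).
  by case: eqP => [->|_]; rewrite ?he // mulr0 scaler0.
rewrite sumrB -mulr_suml se mul1r (bigD1 (Ordinal jK)) //= eqxx big1 ?addr0 ?subrr // => k.
by rewrite -val_eqE /= => /negPf ->.
Qed.

Section Theory.
Variables (K N : nat) (e : nat -> M).
Hypothesis ee : orth_idem K e.
Local Notation S := (cochar_mx K N e).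
Local Notation T := (cochar_tangent K N e).

Lemma cochar_mxl z k : (k < K)%N -> S z * e k = (z ^+ k / z ^+ N) *: e k.
Proof.
case: ee => _ eM kK; rewrite mulr_suml (bigD1 (Ordinal kK)) //= big1 ?addr0 => [|j jk].
  by rewrite -scalerAl eM // eqxx.
by rewrite -scalerAl eM // -[_ == _]/(val j == k) -[k]/(val (Ordinal kK)) val_eqE (negPf jk) scaler0.
Qed.

Lemma cochar_mxr z k : (k < K)%N -> e k * S z = (z ^+ k / z ^+ N) *: e k.
Proof.
case: ee => _ eM kK; rewrite mulr_sumr (bigD1 (Ordinal kK)) //= big1 ?addr0 => [|j jk].
  by rewrite -scalerAr eM // eqxx.
rewrite -scalerAr eM // eq_sym.
by rewrite -[_ == _]/(val j == k) -[k]/(val (Ordinal kK)) val_eqE (negPf jk) scaler0.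
Qed.

Lemma cochar_tangentl k : (k < K)%N -> T * e k = (k%:R - N%:R) *: e k.
Proof.
case: ee => _ eM kK; rewrite mulr_suml (bigD1 (Ordinal kK)) //= big1 ?addr0 => [|j jk].
  by rewrite -scalerAl eM // eqxx.
by rewrite -scalerAl eM // -[_ == _]/(val j == k) -[k]/(val (Ordinal kK)) val_eqE (negPf jk) scaler0.
Qed.

Lemma cochar_tangentr k : (k < K)%N -> e k * T = (k%:R - N%:R) *: e k.
Proof.
case: ee => _ eM kK; rewrite mulr_sumr (bigD1 (Ordinal kK)) //= big1 ?addr0 => [|j jk].
  by rewrite -scalerAr eM // eqxx.
rewrite -scalerAr eM // eq_sym.
by rewrite -[_ == _]/(val j == k) -[k]/(val (Ordinal kK)) val_eqE (negPf jk) scaler0.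
Qed.

Lemma cochar_mx1 : S 1 = 1.
Proof.
case: ee => <- _; apply: eq_bigr => k _.
by rewrite !expr1n divr1 scale1r.
Qed.

Lemma cochar_mxM z w : z != 0 -> w != 0 -> S (z * w) = S z * S w.
Proof.
move=> z0 w0; rewrite [in RHS]/cochar_mx mulr_sumr; apply: eq_bigr => k _.
by rewrite -scalerAr cochar_mxl // scalerA !exprMn invfM mulrACA mulrC.
Qed.

Lemma cochar_mxV z : z != 0 -> S z * S z^-1 = 1.
Proof. by move=> z0; rewrite -cochar_mxM ?invr_eq0 // mulfV // cochar_mx1. Qed.

Lemma orth_idem_decomp x : x = \sum_(i < K) \sum_(j < K) e i * x * e j.
Proof.
case: ee => e1 _; rewrite -{1}[x]mul1r -e1 mulr_suml; apply: eq_bigr => i _.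
by rewrite -{1}[e i * x]mulr1 -e1 mulr_sumr.
Qed.

Lemma block_eq x y : (forall i j, (i < K)%N -> (j < K)%N -> e i * x * e j = e i * y * e j) ->
  x = y.
Proof.
move=> xy; rewrite [x]orth_idem_decomp [y]orth_idem_decomp.
by apply: eq_bigr => i _; apply: eq_bigr => j _; exact: xy.
Qed.

(* x has weight a - b. *)
Lemma weight_block x a b :
    (forall z, z != 0 -> S z * x = (z ^+ a / z ^+ b) *: (x * S z)) ->
  forall i j, (i < K)%N -> (j < K)%N -> (i + b != j + a)%N -> e i * x * e j = 0.
Proof.
move=> Sx i j iK jK ij.
pose p : {poly C} := 'X^(i + b) - 'X^(j + a).
have p0 : p != 0.
  apply/eqP => /polyP/(_ (i + b)%N)/eqP.
  by rewrite coefB !coefXn eqxx coef0 (negPf ij) subr0 oner_eq0.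
have pz z : z != 0 -> p.[z] *: (e i * x * e j) = 0.
  move=> z0; have := congr1 (fun u => e i * u * e j) (Sx z z0); rewrite /=.
  rewrite mulrA cochar_mxr // -!scalerAl -scalerAr -scalerAl mulrA -[_ * S z * _]mulrA.
  rewrite cochar_mxl // -scalerAr scalerA => /eqP.
  rewrite -subr_eq0 -scalerBl scaler_eq0 => /orP [|/eqP ->]; last by rewrite scaler0.
  have zk k : z ^+ k != 0 by rewrite expf_neq0.
  rewrite mulrA -mulrBl mulf_eq0 invr_eq0 (negPf (zk N)) orbF subr_eq0 => /eqP E.
  rewrite /p hornerD hornerN !hornerXn !exprD E.
  by rewrite mulrAC divfK // mulrC subrr scale0r.
apply/eqP; apply: contraT => b0; case/negP: p0; apply/eqP.
apply: (@poly_eq0_of_infinite _ _ [:: 0]) => z; rewrite inE => z0.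
by have /eqP := pz z z0; rewrite scaler_eq0 (negPf b0) orbF => /eqP.
Qed.

Lemma weight_tangent x a b :
    (forall z, z != 0 -> S z * x = (z ^+ a / z ^+ b) *: (x * S z)) ->
  bracket T x = (a%:R - b%:R) *: x.
Proof.
move=> Sx; apply: block_eq => i j iK jK.
rewrite bracketE -!/(GRing.mul _ _) mulrBr mulrBl !mulrA cochar_tangentr //.
rewrite -[_ * T * _]mulrA cochar_tangentl // -!scalerAl -scalerAr -scalerBl.
rewrite -scalerAr -scalerAl; have [ij|ij] := eqVneq (i + b)%N (j + a)%N; last first.
  by rewrite (weight_block Sx) // !scaler0.
congr (_ *: _); have /(congr1 (fun k : nat => k%:R : C)) := ij; rewrite !natrD => E.
by rewrite opprB addrA subrK -[i%:R](addrK b%:R) E; ring.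
Qed.

(** On the block e i * x * e j the tangent acts by the integer i - j and the group by z^(i - j), so
    in characteristic 0 the infinitesimal equation selects the same blocks as the group equation. *)
Lemma tangent_weight x a b : bracket T x = (a%:R - b%:R) *: x ->
  forall z, z != 0 -> S z * x = (z ^+ a / z ^+ b) *: (x * S z).
Proof.
move=> Tx z z0; apply: block_eq => i j iK jK.
have zk k : z ^+ k != 0 by rewrite expf_neq0.
rewrite mulrA cochar_mxr // -!scalerAl -scalerAr -scalerAl mulrA -[_ * S z * _]mulrA.
rewrite cochar_mxl // -scalerAr scalerA.
have [ij|ij] := eqVneq (i + b)%N (j + a)%N.
  congr (_ *: _); apply/eqP; rewrite -(inj_eq (mulIf (zk N))) mulrA !divfK //.
  by rewrite -(inj_eq (mulIf (zk b))) mulrAC divfK // -!exprD ij addnC.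
have := congr1 (fun u => e i * u * e j) Tx; rewrite /=.
rewrite bracketE -!/(GRing.mul _ _) mulrBr mulrBl !mulrA cochar_tangentr //.
rewrite -[_ * T * _]mulrA cochar_tangentl // -!scalerAl -scalerAr -scalerBl.
rewrite -scalerAr -scalerAl => /eqP; rewrite -subr_eq0 -scalerBl scaler_eq0.
case/orP => [|/eqP ->]; last by rewrite !scaler0.
rewrite subr_eq0 => /eqP E; case/negP: ij; rewrite -(eqr_nat C) !natrD; apply/eqP.
have -> : i%:R = (i%:R - N%:R - (j%:R - N%:R)) + j%:R :> C by ring.
by rewrite E; ring.
Qed.

End Theory.
End Gradings.

Lemma matrix_coef_eq0 (F : numFieldType) m p K (a : nat -> 'M[F]_(m, p)) (Z : seq F) :
    (forall s, s \notin Z -> \sum_(k < K) s ^+ k *: a k = 0) ->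
  forall k, (k < K)%N -> a k = 0.
Proof.
move=> sZ k kK; apply/matrixP => i j; rewrite mxE.
pose q : {poly F} := \poly_(l < K) a l i j.
suff q0 : q = 0 by have := coef_poly K (fun l => a l i j) k; rewrite -/q q0 coef0 kK => <-.
apply: (@poly_eq0_of_infinite _ _ Z) => s sZ'; rewrite horner_poly.
have := congr1 (fun A : 'M[F]_(m, p) => A i j) (sZ s sZ'); rewrite summxE mxE => E.
by rewrite -[RHS]E; apply: eq_bigr => l _; rewrite mxE mulrC.
Qed.

Section Cocharacters.
Context {C : numClosedFieldType} {n : nat}.
Local Notation M := 'M[C]_n.+1.

(** Comparison of the coefficients of z^i w^j in S(z w) = S(z) S(w), first in z and then in w. *)
Lemma hom_orth_idem K N (e : nat -> M) :
    (forall z w, z != 0 -> w != 0 ->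
      cochar_mx K N e (z * w) = cochar_mx K N e z * cochar_mx K N e w) ->
    cochar_mx K N e 1 = 1 ->
  orth_idem K e.
Proof.
move=> SM S1; split.
  by rewrite -S1; apply: eq_bigr => k _; rewrite !expr1n divr1 scale1r.
have zN (z : C) k : z != 0 -> z ^+ k != 0 by move=> z0; rewrite expf_neq0.
pose S0 z : M := \sum_(k < K) z ^+ k *: e k.
have SE z : z != 0 -> cochar_mx K N e z = (z ^+ N)^-1 *: S0 z.
  by move=> z0; rewrite scaler_sumr; apply: eq_bigr => k _; rewrite scalerA mulrC.
have S0M z w : z != 0 -> w != 0 -> S0 (z * w) = S0 z * S0 w.
  move=> z0 w0; have := SM z w z0 w0; rewrite !SE ?mulf_neq0 // -scalerAl -scalerAr scalerA.
  by rewrite -invfM -exprMn; apply: scalerI; rewrite invr_eq0 zN // mulf_neq0.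
move=> i j iK jK.
have H w : w != 0 -> forall k, (k < K)%N -> e k * S0 w - w ^+ k *: e k = 0.
  move=> w0; apply: (@matrix_coef_eq0 _ _ _ _ _ [:: 0]) => z; rewrite inE => z0.
  under eq_bigr do rewrite scalerBr.
  rewrite sumrB; apply/eqP; rewrite subr_eq0; apply/eqP.
  have -> : \sum_(k < K) z ^+ k *: (w ^+ k *: e k) = S0 (z * w).
    by apply: eq_bigr => k _; rewrite scalerA exprMn.
  by rewrite S0M // mulr_suml; apply: eq_bigr => k _; rewrite scalerAl.
have := (@matrix_coef_eq0 _ _ _ K (fun l => e i * e l - (if i == l then e i else 0)) [:: 0]).
move=> /(_ _ j jK)/eqP; rewrite subr_eq0 => /(_ _)/eqP; apply => w; rewrite inE => w0.
rewrite -[RHS](H w w0 i iK).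
under eq_bigr do rewrite scalerBr.
rewrite sumrB mulr_sumr; congr (_ - _); first by apply: eq_bigr => k _; rewrite scalerAr.
rewrite (bigD1 (Ordinal iK)) //= eqxx big1 ?addr0 // => k ki.
by rewrite eq_sym -[_ == _]/(val k == val (Ordinal iK)) val_eqE (negPf ki) scaler0.
Qed.

(** The trace equals the sum of (k - N)^2 rank(e k). This positivity of the trace form on
    cocharacters yields the uniqueness of coroots. *)
Lemma tangent_square_trace K N (e : nat -> M) : orth_idem K e ->
  0 <= \tr (cochar_tangent K N e * cochar_tangent K N e) ?= iff
    [forall k : 'I_K, (k == N :> nat) || (e k == 0)].
Proof.
move=> ee.
have -> : \tr (cochar_tangent K N e * cochar_tangent K N e) =
    \sum_(k < K) (k%:R - N%:R) ^+ 2 * (\rank (e k))%:R.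
  rewrite [X in X * _]/cochar_tangent mulr_suml raddf_sum; apply: eq_bigr => k _ /=.
  rewrite -scalerAl cochar_tangentr // scalerA mxtraceZ expr2; congr (_ * _).
  by apply: idempotent_trace; case: ee => _ /(_ k k (ltn_ord k) (ltn_ord k)); rewrite eqxx.
have ge0 k : 0 <= ((k%:R - N%:R) ^+ 2 * (\rank (e k))%:R : C).
  apply: mulr_ge0; last exact: ler0n.
  by rewrite real_exprn_even_ge0 // rpredB ?realn.
split; first by apply: sumr_ge0 => k _; exact: ge0.
rewrite eq_sym psumr_eq0 => [|k _]; last exact: ge0.
apply/allP/forallP => h k.
  have := h k (mem_index_enum _); rewrite mulf_eq0 expf_eq0 /= subr_eq0 eqr_nat pnatr_eq0.
  by rewrite mxrank_eq0.
move=> _; rewrite mulf_eq0 expf_eq0 /= subr_eq0 eqr_nat pnatr_eq0 mxrank_eq0; exact: h.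
Qed.

Lemma cochar_mx_trivial K N (e : nat -> M) : orth_idem K e ->
    (forall k : 'I_K, k = N :> nat \/ e k = 0) ->
  forall z, z != 0 -> cochar_mx K N e z = 1.
Proof.
move=> [e1 _] eN z z0; rewrite -e1; apply: eq_bigr => k _.
by case: (eN k) => ->; rewrite ?scaler0 // divff ?scale1r // expf_neq0.
Qed.

End Cocharacters.

(** * Simultaneous diagonalization of cocharacters *)

Section Codiagonal.
Context {C : numClosedFieldType} {n : nat}.
Local Notation M := 'M[C]_n.+1.

Lemma idempotent_diagonalizable (A : M) : A * A = A -> diagonalizable A.
Proof.
move=> AA; apply/diagonalizableP; exists [:: 0; 1].
  by rewrite /= inE eq_sym oner_eq0.
apply: mxminpoly_min; rewrite !big_cons big_nil mulr1 rmorphM !rmorphB /= horner_mx_X !horner_mx_C.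
by rewrite raddf0 subr0 mulrBr AA mulr1 subrr.
Qed.

Lemma cochar_comm K N (e : nat -> M) (x : M) : orth_idem K e ->
    (forall z, z != 0 -> cochar_mx K N e z * x = x * cochar_mx K N e z) ->
  forall k, (k < K)%N -> e k * x = x * e k.
Proof.
move=> ee ex.
have E i j : (i < K)%N -> (j < K)%N -> i != j -> e i * x * e j = 0.
  move=> iK jK ij; apply: (weight_block ee (N := N) (a := 0) (b := 0)) => //.
    by move=> z z0; rewrite ex // !expr0 divr1 scale1r.
  by rewrite !addn0.
case: (ee) => e1 _ k kK.
have -> : e k * x = e k * x * e k.
  rewrite -{1}[e k * x]mulr1 -{1}e1 mulr_sumr (bigD1 (Ordinal kK)) //= big1 ?addr0 // => j jk.
  by rewrite E // eq_sym.
rewrite -[RHS]mul1r -[in RHS]e1 mulr_suml (bigD1 (Ordinal kK)) //= big1 ?addr0 ?mulrA // => j jk.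
by rewrite mulrA E.
Qed.

(** Commuting cocharacters have commuting idempotents, by comparison of coefficients; these are
    simultaneously diagonalizable. *)
Lemma cochar_codiag r (K N : 'I_r -> nat) (e : 'I_r -> nat -> M) :
    (forall k, orth_idem (K k) (e k)) ->
    (forall k l z w, z != 0 -> w != 0 ->
       cochar_mx (K k) (N k) (e k) z * cochar_mx (K l) (N l) (e l) w =
       cochar_mx (K l) (N l) (e l) w * cochar_mx (K k) (N k) (e k) z) ->
  exists2 P : M, P \in unitmx & exists a : 'M[int]_(r, n.+1),
    forall k z, z != 0 -> cochar_mx (K k) (N k) (e k) z =
      invmx P *m diag_mx (\row_j z ^ a k j) *m P.
Proof.
move=> ee ec; pose As := [seq e k i | k <- enum 'I_r, i <- iota 0 (K k)].
have AsP A : A \in As -> exists k i, (i < K k)%N /\ A = e k i.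
  by move/allpairsPdep => [k [i [_]]]; rewrite mem_iota => /andP [_ iK] ->; exists k, i.
have [P Pu /allP PA] : codiagonalizable As.
  apply/codiagonalizableP; split=> [A B /AsP [k [i [iK ->]]] /AsP [l [j [jK ->]]]|A].
    apply: (cochar_comm (ee k) (N := N k)) iK => z z0.
    apply/esym; apply: (cochar_comm (ee l) (N := N l)) jK => w w0.
    exact: ec.
  move=> /AsP [k [i [iK ->]]]; apply: idempotent_diagonalizable.
  by case: (ee k) => _ ->; rewrite ?eqxx.
have dP k i : (i < K k)%N -> exists d : 'rV[C]_n.+1, e k i = invmx P *m diag_mx d *m P.
  move=> iK; have /PA /= : e k i \in As.
    by apply/allpairsPdep; exists k, i; rewrite mem_enum mem_iota.
  move=> /(diagonalizable_forLR Pu) [d ->]; exists d.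
  exact: mxpoly.conjVmx.
pose d k i : 'rV[C]_n.+1 := if pselect ((i < K k)%N) is left h then projT1 (cid (dP k i h)) else 0.
have dE k i : (i < K k)%N -> e k i = invmx P *m diag_mx (d k i) *m P.
  by move=> iK; rewrite /d; case: pselect => // h; case: cid.
have dmx k i : (i < K k)%N -> diag_mx (d k i) = P *m e k i *m invmx P.
  by move=> /dE ->; rewrite !mulmxA mulmxV // mul1mx mulmxK.
(* The j-th diagonal entries of the idempotents are orthogonal scalar idempotents of sum 1, so
   exactly one of them is 1; its index gives the exponent of z at j. *)
have aP k j : exists i, (i < K k)%N /\ forall l, (l < K k)%N -> d k l ord0 j = (l == i)%:R.
  have dd i l : (i < K k)%N -> (l < K k)%N -> d k i ord0 j * d k l ord0 j = if i == l then d k i ord0 j else 0.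
    move=> iK lK; have [_ eM] := ee k; have := eM i l iK lK.
    move=> /(congr1 (fun A => (P *m A *m invmx P) j j)).
    have -> : P *m (e k i * e k l) *m invmx P = diag_mx (d k i) *m diag_mx (d k l).
      by rewrite !dmx // !mulmxA mulmxKV.
    rewrite mulmx_diag mxE eqxx mulr1n mxE => ->.
    case: eqP => _; last by rewrite mulmx0 mul0mx mxE.
    by rewrite -dmx // mxE eqxx mulr1n.
  have d1 : \sum_(i < K k) d k i ord0 j = 1.
    have [e1 _] := ee k.
    have : P *m (\sum_(i < K k) e k i) *m invmx P = 1%:M by rewrite e1 -[P *m 1]/(P * 1) mulr1 mulmxV.
    move=> /(congr1 (fun A : M => A j j)); rewrite [X in _ = X -> _]mxE eqxx mulr1n => <-.
    rewrite mulmx_sumr mulmx_suml summxE; apply: eq_bigr => i _.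
    by rewrite -dmx // mxE eqxx mulr1n.
  have [i0 di0] : exists i : 'I_(K k), d k i ord0 j != 0.
    apply/existsP; apply: contraT; rewrite negb_exists => /forallP h.
    by move: d1; rewrite big1 => [/eqP|i _]; [rewrite eq_sym oner_eq0|apply/eqP; have := h i; rewrite negbK].
  exists i0; split=> // l lK; apply: (mulfI di0); rewrite dd // eq_sym.
  by case: eqP => _; rewrite ?mulr1 ?mulr0.
pose a : 'M[int]_(r, n.+1) := \matrix_(k, j) ((projT1 (cid (aP k j)))%:Z - (N k)%:Z).
exists P => //; exists a => k z z0.
suff E : P *m cochar_mx (K k) (N k) (e k) z *m invmx P = diag_mx (\row_j z ^ a k j).
  by rewrite -E !mulmxA mulVmx // mul1mx mulmxKV.
have -> : P *m cochar_mx (K k) (N k) (e k) z *m invmx P =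
    \sum_(i < K k) (z ^+ i / z ^+ N k) *: diag_mx (d k i).
  rewrite mulmx_sumr mulmx_suml; apply: eq_bigr => i _.
  by rewrite dmx // -scalemxAr -scalemxAl.
apply/matrixP => j l; rewrite summxE [RHS]mxE.
have [<-|jl] := eqVneq j l; last first.
  by rewrite mulr0n big1 // => i _; rewrite 2!mxE (negPf jl) mulr0n mulr0.
rewrite mulr1n !mxE; case: cid => i [iK h] /=.
rewrite (bigD1 (Ordinal iK)) //= big1 ?addr0 => [|l' l'i].
  by rewrite 2!mxE eqxx mulr1n h // eqxx mulr1 expfzDr // -exprnN.
by rewrite 2!mxE eqxx mulr1n h // -[_ == i]/(val l' == val (Ordinal iK)) val_eqE (negPf l'i) mulr0.
Qed.

End Codiagonal.

(** * Monomial maps of split tori *)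

Section Monomial.
Context {C : numClosedFieldType}.

(** The homomorphism of split tori with matrix of exponents a. Points are rows, so the product a *m
    b corresponds to a followed by b. *)
Definition mono m n (a : 'M[int]_(m, n)) (u : 'rV[C]_m) : 'rV[C]_n :=
  \row_j \prod_k u ord0 k ^ a k j.

Definition nonzero m (u : 'rV[C]_m) := forall k, u ord0 k != 0.

Lemma mono_nonzero m n (a : 'M[int]_(m, n)) u : nonzero u -> nonzero (mono a u).
Proof. by move=> u0 j; rewrite mxE; apply/prodf_neq0 => k _; rewrite expfz_neq0. Qed.

Lemma monoM m n p (a : 'M[int]_(m, n)) (b : 'M[int]_(n, p)) u : nonzero u ->
  mono (a *m b) u = mono b (mono a u).
Proof.
move=> u0; apply/rowP => j; rewrite !mxE.
under [RHS]eq_bigr do rewrite mxE.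
have -> : \prod_k u ord0 k ^ (a *m b) k j = \prod_k \prod_l u ord0 k ^ (a k l * b l j).
  apply: eq_bigr => k _; rewrite mxE.
  by elim/big_rec2: _ => [|l x y _ <-]; rewrite ?expr0z // expfzDr.
rewrite exchange_big; apply: eq_bigr => l _.
have bm : {morph (fun x : C => x ^ b l j) : x y / x * y} by move=> x y; exact: expfzMl.
rewrite (big_morph _ bm (exp1rz C _)).
by apply: eq_bigr => k _; rewrite exprz_exp.
Qed.

Lemma mono1 m u : nonzero u -> mono (1%:M : 'M[int]_m) u = u.
Proof.
move=> u0; apply/rowP => j; rewrite mxE (bigD1 j) //= mxE eqxx expr1z big1 ?mulr1 // => k kj.
by rewrite mxE (negPf kj) expr0z.
Qed.

Definition rowM m (u v : 'rV[C]_m) : 'rV[C]_m := \row_j (u ord0 j * v ord0 j).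

Lemma mono_rowM m n (a : 'M[int]_(m, n)) u v : mono a (rowM u v) = rowM (mono a u) (mono a v).
Proof.
apply/rowP => j; rewrite !mxE -big_split; apply: eq_bigr => k _.
by rewrite mxE expfzMl.
Qed.

Lemma mono_one m n (a : 'M[int]_(m, n)) : mono a (const_mx 1) = const_mx 1.
Proof. by apply/rowP => j; rewrite !mxE big1 // => k _; rewrite mxE exp1rz. Qed.

Lemma expz_surj (d : int) (w : C) : d != 0 -> w != 0 -> exists2 z, z != 0 & z ^ d = w.
Proof.
have H k (x : C) : x != 0 -> exists2 z, z != 0 & z ^+ k.+1 = x.
  move=> x0; exists (k.+1.-root x); last by rewrite rootCK.
  by rewrite rootC_eq0.
case: d => [[|k]|k] // _ w0; first by have [z z0 E] := H k w w0; exists z.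
have [z z0 E] := H k _ (invr_neq0 w0); exists z => //.
by rewrite NegzE -invr_expz -[LHS]/((z ^+ k.+1)^-1) E invrK.
Qed.

(* V gives coordinates, adapted to the image, by the Smith normal form of a. *)
Lemma mono_image m n (a : 'M[int]_(m, n)) : exists U V : 'M[int]_n, exists J : {set 'I_n},
  [/\ U *m V = 1%:M, V *m U = 1%:M &
    forall v : 'rV[C]_n, (exists2 u, nonzero u & v = mono a u) <->
      nonzero v /\ forall j, j \notin J -> mono V v ord0 j = 1].
Proof.
have [L uL [U uU [d _ aE]]] := int_Smith_normal_form a.
pose D : 'M[int]_(m, n) := \matrix_(i, j) (d`_i *+ (i == j :> nat)).
(* The coordinates with nonzero invariant factor: there the map is a nonzero power, hence surjective
   on nonzero numbers, while it is constantly 1 on the other coordinates. *)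
pose J := [set j : 'I_n | (j < m)%N && (d`_j != 0)].
have UV : U *m invmx U = 1%:M by rewrite mulmxV.
have VU : invmx U *m U = 1%:M by rewrite mulVmx.
exists U, (invmx U), J; split=> // v; split.
  move=> [u u0 ->]; split; first exact: mono_nonzero.
  move=> j jJ; rewrite -monoM // aE -mulmxA UV mulmx1 monoM // mxE big1 // => k _.
  rewrite [X in _ ^ X]mxE; have [kj|kj] := eqVneq (k : nat) (j : nat); last by rewrite mulr0n expr0z.
  move: jJ; rewrite inE -kj ltn_ord /= negbK => /eqP ->.
  by rewrite mulr1n expr0z.
move=> [v0 vJ]; set w := mono (invmx U) v in vJ.
have w0 : nonzero w by exact: mono_nonzero.
have E (k : 'I_m) : exists z, z != 0 /\ forall j : 'I_n, k = j :> nat -> z ^ d`_k = w ord0 j.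
  have [kn|nk] := ltnP k n; last first.
    by exists 1; split=> [|j kj]; rewrite ?oner_eq0 //; have := ltn_ord j; rewrite -kj ltnNge nk.
  have [dk|dk] := eqVneq d`_k 0.
    exists 1; split=> [|j kj]; rewrite ?oner_eq0 // exp1rz vJ // inE -kj dk eqxx andbF //.
  have [z z0 zE] := expz_surj dk (w0 (Ordinal kn)).
  exists z; split=> // j kj; rewrite zE; congr (w ord0 _); exact: val_inj.
pose y : 'rV[C]_m := \row_k projT1 (cid (E k)).
have y0 : nonzero y by move=> k; rewrite mxE; have [] := projT2 (cid (E k)).
have yw : mono D y = w.
  apply/rowP => j; rewrite mxE.
  have [jm|mj] := ltnP j m.
    rewrite (bigD1 (Ordinal jm)) //= big1 ?mulr1 => [|k kj].
      rewrite [y _ _]mxE [D _ _]mxE eqxx mulr1n.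
      by have [_ h] := projT2 (cid (E (Ordinal jm))); exact: h.
    rewrite [D _ _]mxE -[_ == _]/(val k == val (Ordinal jm)) val_eqE (negPf kj) mulr0n.
    exact: expr0z.
  rewrite big1 => [|k _].
    by rewrite vJ // inE ltnNge mj.
  rewrite [D _ _]mxE ltn_eqF ?mulr0n ?expr0z //.
  by apply: leq_trans mj; exact: ltn_ord.
exists (mono (invmx L) y); first exact: mono_nonzero.
rewrite -monoM // aE !mulmxA mulVmx // mul1mx monoM // yw -monoM //.
by rewrite VU mono1.
Qed.

End Monomial.

(** * Weyl elements of sl2-triples *)

Section SL2.
Context {C : numClosedFieldType} {n : nat}.
Implicit Types (x y h z a u : 'M[C]_n.+1).

(** As in [sl2_lowest], a vector of weight 0 killed by ad x that lies in the image of ad x lies in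
    the image of every power of ad x; the scalar is now - (i+2) (i+1). *)
Lemma sl2_weight0 x y h z k : bracket x y = h -> bracket h x = x *+ 2 -> x ^+ k = 0 ->
  bracket h (bracket x z) = 0 -> bracket x (bracket x z) = 0 -> bracket x z = 0.
Proof.
move=> xy hx xk hu xu; set u := bracket x z in hu xu *.
have main i : exists a, u = iter i.+1 (bracket x) a.
  elim: i => [|i [a ua]]; first by exists z.
  have E0 : iter i.+2 (bracket x) a = 0 by rewrite iterS -ua.
  have := sl2_iter a i.+1 xy hx; rewrite E0 bracket0r add0r -ua hu sub0r scalerN scalerA => E.
  pose c : C := - (i.+2%:R * i.+1%:R).
  have c0 : c != 0 by rewrite oppr_eq0 mulf_neq0 // pnatr_eq0.
  exists (c^-1 *: bracket y a).
  have -> : iter i.+2 (bracket x) (c^-1 *: bracket y a) =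
      c^-1 *: iter i.+2 (bracket x) (bracket y a).
    by elim: i.+2 => //= j ->; rewrite bracketZr.
  by rewrite E -scaleNr scalerA mulVf // scale1r.
by have [a ->] := main (k + k)%N; rewrite iterS iter_bracket_nilpotent // bracket0r.
Qed.

Definition weyl_mx x y := nexp x * nexp (- y) * nexp x.

Lemma weyl_mxE x y : weyl_mx x y = nexp x *m nexp (- y) *m nexp x.
Proof. by []. Qed.

(** Moved through the three exponentials, h becomes h - 2 x, then - h - 2 x, then - h. *)
Lemma weyl_antifixed x y h : x ^+ n.+1 = 0 -> y ^+ n.+1 = 0 -> bracket x y = h ->
    bracket h x = x *+ 2 -> bracket h y = - (y *+ 2) ->
  h * weyl_mx x y = - (weyl_mx x y * h).
Proof.
move=> xn yn xy hx hy; rewrite /weyl_mx.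
have yn' : (- y) ^+ n.+1 = 0 by rewrite exprNn yn mulr0.
have yx : bracket (- y) (- x) = - h by rewrite bracketNl bracketNr opprK bracketC xy.
have hy' : bracket (- h) (- y) = (- y) *+ 2 by rewrite bracketNl bracketNr opprK hy mulNrn.
set E := nexp x; set F := nexp (- y).
have Eh : E * h = (h - x *+ 2) * E by exact: nexp_mulh.
have Ex : E * x = x * E by exact: nexp_comm.
(* Linear identities between matrices are checked entrywise, where [ring] applies. *)
have mx : forall a b : 'M[C]_n.+1, (forall i j, a i j = b i j) -> a = b by move=> a b; move/matrixP.
have Fh : F * h = (h - y *+ 2) * F.
  rewrite -[LHS]opprK -mulrN (nexp_mulh yn' hy') -mulNr; congr (_ * _).
  by apply: mx => i j; rewrite !mxE; ring.
have Fx : F * x = (x + h - y) * F.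
  rewrite -[LHS]opprK -mulrN (nexp_mul yn' yx hy') -mulNr; congr (_ * _).
  by apply: mx => i j; rewrite !mxE; ring.
have E1 : F * (h - x *+ 2) = (- h - x *+ 2) * F.
  rewrite mulrBr mulrnAr Fh Fx -mulrnAl -mulrBl; congr (_ * _).
  by apply: mx => i j; rewrite !mxE; ring.
have E2 : E * (- h - x *+ 2) = - h * E.
  rewrite mulrBr mulrN mulrnAr Eh Ex !mulrBl mulrnAl opprB mulNr.
  by rewrite addrAC subrr add0r.
have -> : E * F * E * h = E * (F * (h - x *+ 2)) * E by rewrite -!mulrA Eh.
by rewrite E1 !mulrA E2 !mulNr opprK.
Qed.

Lemma weyl_commute x y t : x * t = t * x -> y * t = t * y ->
  weyl_mx x y * t = t * weyl_mx x y.
Proof.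
move=> xt yt; have Et : GRing.comm t (nexp x) by apply/commr_sym/nexp_comm.
have Ft : GRing.comm t (nexp (- y)).
  by apply/commr_sym/nexp_comm; rewrite /GRing.comm mulNr mulrN yt.
by apply/esym; do 2?apply: commrM.
Qed.

Lemma weyl_unitmx x y : x ^+ n.+1 = 0 -> y ^+ n.+1 = 0 ->
  weyl_mx x y \in unitmx.
Proof.
move=> xn yn; have := sl2_weyl_unit xn yn 1.
by rewrite /weyl_mx /sl2_weyl invr1 !scale1r.
Qed.

(** Anticommutation with the tangent confines x to the blocks with i + j = N + N, where z^(i - N)
    equals z^-1 to the power j - N. *)
Lemma weyl_cochar K N (e : nat -> 'M[C]_n.+1) x : orth_idem K e ->
    cochar_tangent K N e * x = - (x * cochar_tangent K N e) ->
  forall z : C, z != 0 -> cochar_mx K N e z * x = x * cochar_mx K N e z^-1.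
Proof.
move=> ee tx z z0; apply: (block_eq ee) => i j iK jK.
rewrite !mulrA (cochar_mxr N ee) // -!mulrA (cochar_mxl N ee) // !mulrA -!scalerAr -!scalerAl.
have [ij|ij] := eqVneq (i + j)%N (N + N)%N.
  congr (_ *: _); rewrite !exprVn invrK.
  have zN : z ^+ N != 0 by rewrite expf_neq0.
  have zj : z ^+ j != 0 by rewrite expf_neq0.
  apply: (mulIf zN); rewrite divfK //; apply: (mulIf zj).
  by rewrite -exprD ij exprD -!mulrA [RHS]mulrC -!mulrA mulfV ?mulr1.
suff -> : e i * x * e j = 0 by rewrite !scaler0.
have := congr1 (fun w => e i * w * e j) tx.
rewrite mulrN mulNr !mulrA (cochar_tangentr N ee) // -!mulrA (cochar_tangentl N ee) // !mulrA.
rewrite -!scalerAr -!scalerAl => /eqP; rewrite -addr_eq0 -scalerDl scaler_eq0 => /orP [|/eqP //].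
rewrite addrACA -opprD -!natrD subr_eq0 eqr_nat (negPf ij) //.
Qed.

(* The determinant of (y, z) |-> tr ((ad (a x1 + b x2))^2 y . z) is homogeneous of
   positive degree in (a, b), so it vanishes somewhere. *)
Lemma singular_pencil (Up Um : {vspace 'M[C]_n.+1}) x1 x2 :
    (forall (a b : C) y, y \in Um -> let x := a *: x1 + b *: x2 in bracket x (bracket x y) \in Up) ->
    (forall z, z \in Up -> (forall y, y \in Um -> \tr (z *m y) = 0) -> z = 0) ->
    (forall (a b : C) y, y \in Um -> let x := a *: x1 + b *: x2 in
       x != 0 -> bracket x (bracket x y) = 0 -> y = 0) ->
    Um != 0%VS ->
  exists a b : C, (a, b) != (0, 0) /\ a *: x1 + b *: x2 = 0.
Proof.
move=> UmUp nd inj Um0; apply: contrapT => no.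
pose X (a b : C) := a *: x1 + b *: x2.
have X0 (a b : C) : (a, b) != (0, 0) -> X a b != 0.
  by move=> ab0; apply/eqP => Xab; apply: no; exists a, b.
pose d := \dim Um; have d0 : (0 < d)%N by rewrite lt0n dimv_eq0.
pose v (i : 'I_d) := (vbasis Um)`_i.
have vU i : v i \in Um by apply: vbasis_mem; rewrite mem_nth // size_tuple.
pose B (a b : C) : 'M[C]_d := \matrix_(i, j) \tr (bracket (X a b) (bracket (X a b) (v i)) *m v j).
have B0 (a b : C) : (a, b) != (0, 0) -> \det (B a b) != 0.
  move=> ab0; apply/negP => /det0P [c c0 cB].
  pose y := \sum_i c ord0 i *: v i.
  have yU : y \in Um by rewrite memv_suml // => i _; rewrite memvZ.
  have br : bracket (X a b) (bracket (X a b) y) =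
      \sum_i c ord0 i *: bracket (X a b) (bracket (X a b) (v i)).
    have bs (w : 'I_d -> 'M[C]_n.+1) : bracket (X a b) (\sum_i c ord0 i *: w i) =
        \sum_i c ord0 i *: bracket (X a b) (w i).
      rewrite (big_morph (bracket (X a b)) (bracketDr _) (bracket0r _)).
      by apply: eq_bigr => i _; rewrite bracketZr.
    by rewrite /y !bs.
  have xy0 : bracket (X a b) (bracket (X a b) y) = 0.
    apply: nd; first exact: UmUp.
    move=> y' /coord_vbasis ->; rewrite mulmx_sumr raddf_sum big1 // => j _ /=.
    rewrite -scalemxAr mxtraceZ br mulmx_suml raddf_sum /=.
    have := congr1 (fun A : 'rV[C]_d => A ord0 j) cB; rewrite /= !mxE => E.
    rewrite [X in _ * X](_ : _ = 0) ?mulr0 // -[RHS]E; apply: eq_bigr => i _.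
    by rewrite -scalemxAl mxtraceZ mxE.
  have y0 : y = 0 by apply: inj yU _ xy0; exact: X0.
  have /freeP fr := basis_free (vbasisP Um).
  case/eqP: c0; apply/rowP => i; rewrite [RHS]mxE; exact: fr y0 i.
(* The entries of B on the two affine charts (1, s) and (s, 1) of the projective line. *)
pose P (i j : 'I_d) : {poly C} * {poly C} :=
  let t u w := \tr (bracket u (bracket w (v i)) *m v j) in
  ((t x1 x1)%:P + (t x1 x2 + t x2 x1) *: 'X + (t x2 x2) *: 'X^2,
   (t x2 x2)%:P + (t x1 x2 + t x2 x1) *: 'X + (t x1 x1) *: 'X^2).
have BE (a b : C) i j : let t u w := \tr (bracket u (bracket w (v i)) *m v j) in
    B a b i j = a * a * t x1 x1 + a * b * (t x1 x2 + t x2 x1) + b * b * t x2 x2.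
  rewrite /= mxE /X !(bracketDl, bracketDr, bracketZl, bracketZr) !mulmxDl -!scalemxAl !raddfD /=.
  by rewrite !mxtraceZ !mulmxDl -!scalemxAl !raddfD /= !mxtraceZ; ring.
pose p1 := \det (\matrix_(i, j) (P i j).1); pose p2 := \det (\matrix_(i, j) (P i j).2).
have p1E (s : C) : p1.[s] = \det (B 1 s).
  rewrite -[LHS]/(horner_eval s p1) -det_map_mx; congr (\det _); apply/matrixP => i j.
  rewrite [LHS]mxE BE (_ : (\matrix_(i, j) (P i j).1) i j = (P i j).1); last by rewrite mxE.
  by rewrite -[LHS]/((P i j).1.[s]) /P /= !hornerD !hornerZ !hornerC hornerX hornerXn; ring.
have p2E (s : C) : p2.[s] = \det (B s 1).
  rewrite -[LHS]/(horner_eval s p2) -det_map_mx; congr (\det _); apply/matrixP => i j.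
  rewrite [LHS]mxE BE (_ : (\matrix_(i, j) (P i j).2) i j = (P i j).2); last by rewrite mxE.
  by rewrite -[LHS]/((P i j).2.[s]) /P /= !hornerD !hornerZ !hornerC hornerX hornerXn; ring.
have /size_poly1P [c c0 p1c] : size p1 == 1%N.
  apply: contraT => /closed_rootP [s /rootP]; rewrite p1E => /eqP.
  by rewrite (negPf (B0 _ _ _)) // xpair_eqE oner_eq0.
(* On the first chart the determinant has no zero and is a constant c. By homogeneity it is c s^(2d)
   on the second one, and it vanishes at s = 0 because d > 0. *)
have p2c : p2 - c *: 'X^(d + d) = 0.
  apply: (@poly_eq0_of_infinite _ _ [:: 0]) => s; rewrite inE => s0.
  rewrite hornerD hornerN hornerZ hornerXn p2E.
  have -> : B s 1 = (s * s) *: B 1 s^-1.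
    by apply/matrixP => i j; rewrite [RHS]mxE !BE; field.
  by rewrite detZ -p1E p1c hornerC exprMn -exprD mulrC subrr.
have := p2E 0; have /eqP := p2c; rewrite subr_eq0 => /eqP ->.
rewrite hornerZ hornerXn expr0n addn_eq0 (gtn_eqF d0) mulr0 => /esym/eqP.
by rewrite (negPf (B0 _ _ _)) // xpair_eqE oner_eq0 andbF.
Qed.

Lemma trace_sub_square x y : \tr ((x - y) *m (x - y)) =
  \tr (x *m x) - \tr (x *m y) - (\tr (y *m x) - \tr (y *m y)).
Proof.
have trB (u v : 'M[C]_n.+1) : \tr (u - v) = \tr u - \tr v by exact: raddfB.
by rewrite mulmxBl !mulmxBr !trB.
Qed.

(** Each entry of exp(s x) exp((a + b - s) x) is a polynomial in s with zero derivative; its values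
    at s = a and s = 0 are compared. *)
Lemma nexp_scaleD x (a b : C) : x ^+ n.+1 = 0 ->
  nexp ((a + b) *: x) = nexp (a *: x) *m nexp (b *: x).
Proof.
move=> xn; apply/matrixP => i j; set c := a + b.
pose P k l := nexp_entry x k l.
pose Q := \sum_k P i k * (P k j \Po (c%:P - 'X)).
have QE s : Q.[s] = (nexp (s *: x) *m nexp ((c - s) *: x)) i j.
  rewrite horner_sum mxE; apply: eq_bigr => k _.
  by rewrite hornerM horner_comp !hornerE !horner_nexp_entry.
have dQ : Q^`() = 0.
  apply: (@poly_eq0_of_infinite _ _ [::]) => s _.
  rewrite raddf_sum horner_sum /=.
  have -> : \sum_k (P i k * (P k j \Po (c%:P - 'X)))^`().[s] =
      \sum_k ((nexp (s *: x) *m x) i k * nexp ((c - s) *: x) k j -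
              nexp (s *: x) i k * (nexp ((c - s) *: x) *m x) k j).
    apply: eq_bigr => k _; rewrite derivM deriv_comp derivB derivC derivX sub0r hornerD !hornerM.
    have h1 : (-1 : {poly C}).[s] = -1 by rewrite hornerN hornerC.
    have h2 : (c%:P - 'X).[s] = c - s by rewrite hornerD hornerN hornerC hornerX.
    by rewrite !horner_comp h1 h2 !horner_nexp_entry !deriv_nexp_entry // mulrN1 mulrN.
  rewrite sumrB; apply/eqP; rewrite subr_eq0; apply/eqP.
  transitivity ((nexp (s *: x) *m x *m nexp ((c - s) *: x)) i j); first by rewrite [RHS]mxE.
  transitivity ((nexp (s *: x) *m (nexp ((c - s) *: x) *m x)) i j); last by rewrite [LHS]mxE.
  rewrite -mulmxA; congr ((_ *m _) i j); apply/esym.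
  by apply: nexp_comm; rewrite /GRing.comm -scalerAl -scalerAr.
have Qc s : Q.[s] = Q`_0.
  have -> : Q = (Q`_0)%:P.
    apply/polyP => -[|k]; rewrite coefC //=; have /polyP/(_ k)/eqP := dQ.
    by rewrite coef_deriv coef0 mulrn_eq0 /= => /eqP.
  by rewrite !hornerE coefC.
have cb : c - a = b by rewrite /c addrC addKr.
have Ea := QE a; rewrite cb Qc in Ea.
have E0 := QE 0; rewrite subr0 scale0r nexp0 -[1 *m _]/(1 * _) mul1r Qc in E0.
by rewrite -Ea E0.
Qed.

(** Here g is the value of the coroot at 2. It scales x by c = 4 and y by c = 1/4, so the commutator
    with exp(s' v) is exp((c - 1) s' v), and c - 1 is invertible. *)
Lemma sl2_commutator x y : x ^+ n.+1 = 0 -> y ^+ n.+1 = 0 ->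
    bracket (bracket x y) x = x *+ 2 -> bracket (bracket x y) y = - (y *+ 2) ->
  let g := sl2_weyl x y 2%:R *m invmx (sl2_weyl x y 1) in
  forall v, v = x \/ v = y -> forall s, exists s' : C,
    g *m nexp (s' *: v) *m invmx g *m invmx (nexp (s' *: v)) = nexp (s *: v).
Proof.
move=> xn yn hx hy g.
have [K [e [e1 he Se]]] := sl2_torus xn yn erefl hx hy (leqnn n).
have [ee te] := eigen_orth_idem e1 he.
have t0 : (2%:R : C) != 0 by rewrite pnatr_eq0.
have gE : g = cochar_mx K n e 2%:R by rewrite [RHS]Se.
have gu : g \in unitmx by rewrite gE; have [] := mulmx1_unit (cochar_mxV n ee t0).
have main (v : 'M[C]_n.+1) (a b : nat) : v ^+ n.+1 = 0 -> bracket (bracket x y) v = (a%:R - b%:R) *: v ->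
    (2%:R : C) ^+ a / 2%:R ^+ b != 1 -> forall s, exists s' : C,
    g *m nexp (s' *: v) *m invmx g *m invmx (nexp (s' *: v)) = nexp (s *: v).
  move=> vn hv; set c := _ / _ => c1 s; have c1' : c - 1 != 0 by rewrite subr_eq0.
  exists (s / (c - 1)); set s' := s / (c - 1).
  have E : g *m v *m invmx g = c *: v.
    have := tangent_weight ee (N := n) (x := v) (a := a) (b := b).
    rewrite te => /(_ hv _ t0); rewrite -gE => E.
    by rewrite -[g *m v]/(g * v) E -[v * g]/(v *m g) -scalemxAl mulmxK.
  have vn' : (s' *: v) ^+ n.+1 = 0 by rewrite exprZn vn scaler0.
  rewrite (conj_nexp _ gu) -scalemxAr -scalemxAl E scalerA invmx_nexp // -scaleNr.
  rewrite -nexp_scaleD //; congr (nexp (_ *: _)).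
  by rewrite mulrC -{2}[s']mul1r -mulrBl mulrC /s' divfK.
move=> v [->|->].
  apply: (main x 2%N 0%N) => //; first by rewrite hx subr0 scaler_nat.
  by rewrite expr0 divr1 -natrX pnatr_eq1.
apply: (main y 0%N 2%N) => //; first by rewrite hy sub0r scaleNr scaler_nat.
by rewrite expr0 mul1r invr_eq1 -natrX pnatr_eq1.
Qed.

Lemma sl2_weylE x y (z : C) : sl2_weyl x y z = nexp (z *: x) *m nexp ((- z^-1) *: y) *m nexp (z *: x).
Proof. by rewrite /sl2_weyl scaleNr. Qed.

End SL2.

(** * Point derivations *)

Local Open Scope classical_set_scope.
Local Open Scope ring_scope.

(** A subspace inside P that does not exhaust P can be enlarged by a line, which can happen only
    finitely often. *)
Lemma vspace_of_pred (K : fieldType) (V : vectType K) (P : V -> Prop) :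
  P 0 -> (forall a u v, P u -> P v -> P (a *: u + v)) ->
  exists U : {vspace V}, forall v, (v \in U) <-> P v.
Proof.
move=> P0 PD.
suff H (d : nat) : exists U : {vspace V}, (forall v, v \in U -> P v) /\
    ((d <= \dim U)%N \/ forall v, P v -> v \in U).
  have [U [UP [dU|PU]]] := H (\dim {:V}).+1.
    by have := dimvS (subvf U); rewrite leqNgt dU.
  by exists U => v; split=> [/UP|/PU].
elim: d => [|d [U [UP [dU|PU]]]].
- by exists 0%VS; split=> [v|]; [rewrite memv0 => /eqP -> | left].
- have [PU|] := pselect (forall v, P v -> v \in U); first by exists U; split=> //; right.
  move/existsNP => [v /not_implyP [Pv /negP vU]].
  exists (U + <[v]>)%VS; split=> [_ /memv_addP [u uU [_ /vlineP [c ->] ->]]|].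
    by rewrite addrC; apply: PD => //; apply: UP.
  left; rewrite (leq_ltn_trans dU) // ltnNge; apply: contraNN vU => dUv.
  have /eqP -> : U == (U + <[v]>)%VS by rewrite eqEdim addvSl.
  by rewrite memvE addvSr.
- by exists U; split=> //; right.
Qed.

Lemma coef_in_vspace (F : numFieldType) m (U : {vspace 'M[F]_m}) K (a : nat -> 'M[F]_m) (Z : seq F) :
    (forall s, s \notin Z -> \sum_(k < K) s ^+ k *: a k \in U) ->
  forall k, (k < K)%N -> a k \in U.
Proof.
move=> sU k kK; pose f := linfun ((@idfun 'M[F]_m) \- projv U).
have fE v : f v = v - projv U v by rewrite lfunE.
have fU v : v \in U -> f v = 0 by move=> vU; rewrite fE projv_id ?subrr.
suff : f (a k) = 0.
  by rewrite fE => /eqP; rewrite subr_eq0 => /eqP ->; exact: memv_proj.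
apply/matrixP => i j; rewrite mxE.
pose p : {poly F} := \poly_(l < K) f (a l) i j.
suff p0 : p = 0 by have := coef_poly K (fun l => f (a l) i j) k; rewrite -/p p0 coef0 kK => <-.
apply: (@poly_eq0_of_infinite _ _ Z) => s sZ; rewrite horner_poly.
have /matrixP/(_ i j) := fU _ (sU s sZ); rewrite linear_sum summxE mxE => E.
by rewrite -[RHS]E; apply: eq_bigr => l _; rewrite linearZ /= mxE mulrC.
Qed.

Section PolynomialFunctions.
Context {R : realType} {n : nat}.
Local Notation C := R[i].
Implicit Types (S : set 'M[C]_n) (g x : 'M[C]_n).

Inductive polyfun : ('M[C]_n -> C) -> Prop :=
| PolyCst c : polyfun (fun=> c)
| PolyCoord i j : polyfun (fun g => g i j)
| PolyAdd f h : polyfun f -> polyfun h -> polyfun (fun g => f g + h g)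
| PolyMul f h : polyfun f -> polyfun h -> polyfun (fun g => f g * h g).

Lemma polyfun_sum (I : Type) (r : seq I) (P : pred I) (F : I -> 'M[C]_n -> C) :
  (forall i, polyfun (F i)) -> polyfun (fun g => \sum_(i <- r | P i) F i g).
Proof.
move=> pF; elim: r => [|i r IH].
  by under eq_fun do rewrite big_nil; exact: PolyCst.
case Pi : (P i); last by under eq_fun do rewrite big_cons Pi.
by under eq_fun do rewrite big_cons Pi; exact: PolyAdd.
Qed.

Lemma polyfun_prod (I : Type) (r : seq I) (P : pred I) (F : I -> 'M[C]_n -> C) :
  (forall i, polyfun (F i)) -> polyfun (fun g => \prod_(i <- r | P i) F i g).
Proof.
move=> pF; elim: r => [|i r IH].
  by under eq_fun do rewrite big_nil; exact: PolyCst.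
case Pi : (P i); last by under eq_fun do rewrite big_cons Pi.
by under eq_fun do rewrite big_cons Pi; exact: PolyMul.
Qed.

Lemma polyfun_exp f k : polyfun f -> polyfun (fun g => f g ^+ k).
Proof.
move=> pf; elim: k => [|k IH]; first by under eq_fun do rewrite expr0; exact: PolyCst.
by under eq_fun do rewrite exprS; exact: PolyMul.
Qed.

Lemma polyfun_det : polyfun (fun g => \det g).
Proof.
apply: polyfun_sum => s; apply: PolyMul; first exact: PolyCst.
by apply: polyfun_prod => i; exact: PolyCoord.
Qed.

(** Clearing the powers of the determinant reduces questions on invertible matrices to polynomials
    in the entries, which restrict to polynomials on polynomial curves. *)
Lemma regular_polyfun f : regular f -> exists N p,
  polyfun p /\ forall g, g \in unitmx -> f g * (\det g) ^+ N = p g.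
Proof.
elim=> [c|i j||f1 f2 _ [N1 [p1 [P1 E1]]] _ [N2 [p2 [P2 E2]]]
       |f1 f2 _ [N1 [p1 [P1 E1]]] _ [N2 [p2 [P2 E2]]]].
- by exists 0%N, (fun=> c); split=> [|g _]; [exact: PolyCst | rewrite expr0 mulr1].
- by exists 0%N, (fun g => g i j); split=> [|g _]; [exact: PolyCoord | rewrite expr0 mulr1].
- exists 1%N, (fun=> 1); split=> [|g]; first exact: PolyCst.
  by rewrite unitmxE unitfE => g0; rewrite expr1 mulVf.
- exists (N1 + N2)%N, (fun g => p1 g * \det g ^+ N2 + p2 g * \det g ^+ N1); split.
    by apply: PolyAdd; apply: PolyMul => //; apply: polyfun_exp; exact: polyfun_det.
  by move=> g ug; rewrite -E1 // -E2 // exprD; ring.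
- exists (N1 + N2)%N, (fun g => p1 g * p2 g); split; first exact: PolyMul.
  by move=> g ug; rewrite -E1 // -E2 // exprD; ring.
Qed.

Lemma zclosed_polyfun S g : zclosed S -> g \in unitmx ->
    (forall p, polyfun p -> (forall x, S x -> p x = 0) -> p g = 0) ->
  S g.
Proof.
move=> [F Freg ES] ug pg; rewrite ES; split=> // f Ff.
have [N [p [Pp pE]]] := regular_polyfun (Freg f Ff).
have : p g = 0.
  apply: pg => // x; rewrite {1}ES => -[ux /(_ f Ff) fx].
  by rewrite -pE // fx mul0r.
rewrite -pE // => /eqP; rewrite mulf_eq0 expf_eq0 => /orP [/eqP //|/andP [_]].
by move: ug; rewrite unitmxE unitfE => /negPf ->.
Qed.

Lemma polyfun_curve p (gamma : C -> 'M[C]_n) :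
    (forall i j, exists q : {poly C}, forall s, gamma s i j = q.[s]) ->
  polyfun p -> exists q : {poly C}, forall s, p (gamma s) = q.[s].
Proof.
move=> cg; elim=> [c|i j|f1 f2 _ [q1 E1] _ [q2 E2]|f1 f2 _ [q1 E1] _ [q2 E2]].
- by exists c%:P => s; rewrite hornerC.
- exact: cg.
- by exists (q1 + q2) => s; rewrite hornerD E1 E2.
- by exists (q1 * q2) => s; rewrite hornerM E1 E2.
Qed.

End PolynomialFunctions.

Lemma addr_idem_eq0 (V : zmodType) (v : V) : v = v + v -> v = 0.
Proof. by move=> /(congr1 (fun w => w - v)); rewrite subrr addrK. Qed.

Section PointDerivations.
Context {R : realType} {n : nat} (G : agroup R n).
Local Notation C := R[i].

Section Rules.
Context (D : (pts G -> C) -> C).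
Hypothesis DP : point_derivation D.

Lemma derivation_lin c f h : regular_on f -> regular_on h ->
  D (fun x => c * f x + h x) = c * D f + D h.
Proof. by case: DP => + _; apply. Qed.

Lemma derivation_mul f h : regular_on f -> regular_on h ->
  D (fun x => f x * h x) = f (pt1 G) * D h + D f * h (pt1 G).
Proof. by case: DP => _; apply. Qed.

Lemma derivation_add f h : regular_on f -> regular_on h ->
  D (fun x => f x + h x) = D f + D h.
Proof.
move=> rf rh; rewrite -[D f]mul1r -derivation_lin //.
by congr D; apply/funext => x; rewrite mul1r.
Qed.

Lemma derivation0 : D (fun=> 0) = 0.
Proof.
have := derivation_add (regular_on_cst G 0) (regular_on_cst G 0).
rewrite (_ : (fun=> 0 + 0) = (fun=> 0)); last by apply/funext => x; rewrite addr0.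
exact: addr_idem_eq0.
Qed.

Lemma derivation_scale c f : regular_on f -> D (fun x => c * f x) = c * D f.
Proof.
move=> rf; rewrite -[RHS]addr0 -derivation0 -derivation_lin //; last exact: regular_on_cst.
by congr D; apply/funext => x; rewrite addr0.
Qed.

Lemma derivation_cst c : D (fun=> c) = 0.
Proof.
have D1 : D (fun=> 1) = 0.
  have E := derivation_mul (regular_on_cst G 1) (regular_on_cst G 1).
  rewrite (_ : (fun=> 1 * 1) = (fun=> 1)) in E; last by apply/funext => x; rewrite mulr1.
  by rewrite mul1r mulr1 in E; exact: addr_idem_eq0.
have := derivation_scale c (regular_on_cst G 1); rewrite D1 mulr0 => <-.
by congr D; apply/funext => x; rewrite mulr1.
Qed.

Lemma regular_on_sum (I : Type) (r : seq I) (f : I -> pts G -> C) :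
  (forall i, regular_on (f i)) -> regular_on (fun x => \sum_(i <- r) f i x).
Proof.
move=> rf; elim: r => [|i r IH].
  by apply: (regular_on_ext _ (regular_on_cst G 0)) => x; rewrite big_nil.
by apply: (regular_on_ext _ (regular_on_add (rf i) IH)) => x; rewrite big_cons.
Qed.

Lemma derivation_sum (I : Type) (r : seq I) (f : I -> pts G -> C) :
  (forall i, regular_on (f i)) ->
  D (fun x => \sum_(i <- r) f i x) = \sum_(i <- r) D (f i).
Proof.
move=> rf; elim: r => [|i r IH].
  by rewrite big_nil -[RHS]derivation0; congr D; apply/funext => x; rewrite big_nil.
rewrite big_cons -IH -derivation_add //; last exact: regular_on_sum.
by congr D; apply/funext => x; rewrite big_cons.
Qed.

End Rules.

Lemma regular_on_coord i j : regular_on (fun x : pts G => x i j).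
Proof. by exists (fun g => g i j) => //; exact: RegCoord. Qed.

Lemma lie_add X Y c : lie G X -> lie G Y -> lie G (c *: X + Y).
Proof.
move=> [D DP DX] [D' DP' DY]; exists (fun f => c * D f + D' f).
  split=> [a f h rf rh|f h rf rh].
    by rewrite (derivation_lin DP) // (derivation_lin DP') //; ring.
  by rewrite (derivation_mul DP) // (derivation_mul DP') //; ring.
by move=> i j; rewrite DX DY !mxE.
Qed.

Lemma lie0 : lie G 0.
Proof.
exists (fun=> 0) => [|i j]; last by rewrite mxE.
by split=> *; rewrite ?mulr0 ?mul0r addr0.
Qed.

Lemma lie_conj (g : pts G) X : lie G X -> lie G (intm g X).
Proof.
move=> [D DP DX]; pose c x := ptM (ptM g x) (ptV g).
have rc f : regular_on f -> regular_on (fun x => f (c x)).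
  move=> [F rF fF]; apply: (@regular_on_ext _ _ _ (fun x => F (pval (c x)))) => [x|].
    by rewrite fF.
  have rg i j : regular_on (fun x : pts G => pval g i j) by exact: regular_on_cst.
  have rgV i j : regular_on (fun x : pts G => invmx (pval g) i j) by exact: regular_on_cst.
  apply: (regular_comp_gen (D := fun x => pval g *m invmx (pval x) *m invmx (pval g))) rF.
  - apply: (@regular_on_mulmx _ _ _ _ (fun x => pval g *m pval x)) => // i j.
    by apply: regular_on_mulmx => // i' j'; exact: regular_on_coord.
  - apply: (@regular_on_mulmx _ _ _ _ (fun x => pval g *m invmx (pval x))) => // i j.
    by apply: regular_on_mulmx => // i' j'; exact: regular_on_invmx.
  - by move=> x; rewrite /= !mulmxA mulmxKV ?pt_unit // -[_ *m pval x *m _]mulmxA mulmxV ?pt_unit // mulmx1 mulmxV ?pt_unit.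
have c1 : c (pt1 G) = pt1 G.
  by apply: pval_inj; rewrite /= mulmx1 mulmxV ?pt_unit.
exists (fun f => D (fun x => f (c x))).
  split=> [a f h rf rh|f h rf rh].
    by rewrite (derivation_lin DP a (rc _ rf) (rc _ rh)).
  by rewrite (derivation_mul DP (rc _ rf) (rc _ rh)) c1.
move=> i j.
have E x : c x i j = \sum_l (\sum_k g i k * x k l) * invmx g l j.
  by rewrite /c /= mxE; apply: eq_bigr => l _; rewrite mxE.
have Ex l x : (\sum_k g i k * x k l) * invmx g l j = invmx g l j * \sum_k g i k * x k l.
  by rewrite mulrC.
under [X in D X]eq_fun do (rewrite E; under eq_bigr do rewrite Ex).
have rs l : regular_on (fun x : pts G => \sum_k g i k * x k l).
  apply: regular_on_sum => k; apply: regular_on_mul; first exact: regular_on_cst.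
  exact: regular_on_coord.
rewrite (derivation_sum DP); last first.
  by move=> l; apply: regular_on_mul => //; exact: regular_on_cst.
rewrite /intm mxE; apply: eq_bigr => l _; rewrite (derivation_scale DP) // mulrC; congr (_ * _).
rewrite (derivation_sum DP); last first.
  by move=> k; apply: regular_on_mul; [exact: regular_on_cst | exact: regular_on_coord].
rewrite mxE; apply: eq_bigr => k _; rewrite (derivation_scale DP) ?DX //.
exact: regular_on_coord.
Qed.

(* The denominator (1 + s)^N covers both additive and multiplicative
   one-parameter subgroups. *)
Lemma curve_derivation (gamma : C -> pts G) :
    (forall f, regular_on f -> exists N (q : {poly C}), forall s, 1 + s != 0 ->
      f (gamma s) * (1 + s) ^+ N = q.[s]) ->
    gamma 0 = pt1 G ->
  exists2 D, @point_derivation _ _ G D &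
    forall f N (q : {poly C}), (forall s, 1 + s != 0 -> f (gamma s) * (1 + s) ^+ N = q.[s]) ->
      D f = q^`().[0] - q.[0] * N%:R.
Proof.
move=> gq g0.
pose L : {poly C} := 1 + 'X.
have L0 k : (L ^+ k).[0] = 1 by rewrite /L !hornerE expr1n.
have dL k : (L ^+ k)^`().[0] = k%:R.
  by rewrite deriv_exp /L derivD derivC derivX add0r mul1r hornerMn L0.
pose rep (f : pts G -> C) (Nq : nat * {poly C}) :=
  forall s, 1 + s != 0 -> f (gamma s) * (1 + s) ^+ Nq.1 = Nq.2.[s].
(* The derivative at s = 0 of q(s) / (1 + s)^N. *)
pose val (Nq : nat * {poly C}) := Nq.2^`().[0] - Nq.2.[0] * Nq.1%:R.
have uniq f Nq Mp : rep f Nq -> rep f Mp -> val Nq = val Mp.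
  case: Nq Mp => [N q] [M p]; rewrite /rep /= => fq fp.
  have E : q * L ^+ M = p * L ^+ N.
    apply/eqP; rewrite -subr_eq0; apply/eqP.
    apply: (@poly_eq0_of_infinite _ _ [:: -1]) => s; rewrite inE => s1.
    have s0 : 1 + s != 0 by apply: contraNneq s1 => /eqP; rewrite addrC addr_eq0.
    rewrite /L !hornerE -fq // -fp //; ring.
  have := congr1 (fun p : {poly C} => p^`().[0]) E; rewrite /= !derivM !hornerD !hornerM !dL !L0.
  have := congr1 (fun p : {poly C} => p.[0]) E; rewrite /= !hornerM !L0 !mulr1 => E0.
  rewrite E0 /val /= E0 => H.
  by apply/eqP; rewrite subr_eq addrAC eq_sym subr_eq H.
(* By [uniq] the value does not depend on the chosen fraction; functions without one, which are not
   regular, get 0. *)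
pose D f := if pselect (exists Nq, rep f Nq) is left h then val (projT1 (cid h)) else 0.
have DE f Nq : rep f Nq -> D f = val Nq.
  move=> fq; rewrite /D; case: pselect => [h|]; last by case; exists Nq.
  by apply: uniq fq; case: cid.
have ex f : regular_on f -> exists Nq, rep f Nq.
  by move=> /gq [N [q E]]; exists (N, q).
have r0 f N q : rep f (N, q) -> f (pt1 G) = q.[0].
  by move=> /(_ 0); rewrite addr0 oner_neq0 g0 expr1n mulr1 => ->.
exists D => [|f N q fq]; last exact: (DE f (N, q)).
split=> [c f h /ex [[N q] fq] /ex [[M p] hp]|f h /ex [[N q] fq] /ex [[M p] hp]].
  have fh : rep (fun x => c * f x + h x) ((N + M)%N, c *: q * L ^+ M + p * L ^+ N).
    move=> s s0; rewrite /= /L !hornerE -(fq s s0) -(hp s s0) /= exprD; ring.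
  rewrite (DE _ _ fq) (DE _ _ hp) (DE _ _ fh) /val /= derivD !derivM derivZ.
  by rewrite !hornerD !hornerM !hornerZ !L0 !dL natrD; ring.
have fh : rep (fun x => f x * h x) ((N + M)%N, q * p).
  by move=> s s0; rewrite /= !hornerE -(fq s s0) -(hp s s0) /= exprD; ring.
rewrite (DE _ _ fq) (DE _ _ hp) (DE _ _ fh) (r0 _ _ _ fq) (r0 _ _ _ hp) /val /=.
by rewrite derivM !hornerE natrD; ring.
Qed.

End PointDerivations.

(** * Unipotent one-parameter subgroups *)

Section UnipotentSubgroups.
Context {R : realType} {n : nat}.
Local Notation C := R[i].
Implicit Types (X : 'M[C]_n.+1).

Lemma nexp_entry_poly X i j : exists q : {poly C}, forall s, nexp (s *: X) i j = q.[s].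
Proof.
by exists (nexp_entry X i j) => s; rewrite horner_nexp_entry.
Qed.

Lemma regular_nexp X F : X ^+ n.+1 = 0 -> regular F ->
  exists q : {poly C}, forall s, F (nexp (s *: X)) = q.[s].
Proof.
move=> Xn /regular_polyfun [N [p [Pp pE]]].
have [q qE] := polyfun_curve (@nexp_entry_poly X) Pp.
exists q => s; rewrite -qE -pE; last exact: nexpZ_unit.
by rewrite (det_nexp s Xn) expr1n mulr1.
Qed.

Lemma nexp_tangent (G : agroup R n.+1) X : X ^+ n.+1 = 0 ->
  (forall s, gset G (nexp (s *: X))) -> lie G X.
Proof.
move=> Xn GX; pose gamma s : pts G := Pt (GX s).
have [||D DP DE] := @curve_derivation _ _ G gamma.
- move=> f [F rF fF]; have [q qE] := regular_nexp Xn rF.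
  by exists 0%N, q => s _; rewrite expr0 mulr1 fF -qE.
- by apply: pval_inj; rewrite /= scale0r nexp0.
exists D => // i j.
rewrite (DE _ 0%N (nexp_entry X i j)) => [|s _]; last by rewrite expr0 mulr1 horner_nexp_entry.
by rewrite mulr0 subr0 deriv_nexp_entry // scale0r nexp0 mul1mx.
Qed.

Section Integration.
Variables (G : agroup R n.+1) (X : 'M[C]_n.+1).
Hypothesis Xn : X ^+ n.+1 = 0.
Variable D : (pts G -> C) -> C.
Hypothesis DP : point_derivation D.
Hypothesis DX : forall i j, D (fun x => x i j) = X i j.

Lemma regular_on_lmul (g : 'M[C]_n.+1) p : polyfun p ->
  regular_on (fun x : pts G => p (g *m pval x)).
Proof.
elim=> [c|i j|f1 f2 _ r1 _ r2|f1 f2 _ r1 _ r2].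
- exact: regular_on_cst.
- apply: (@regular_on_ext _ _ _ (fun x : pts G => \sum_k g i k * x k j)) => [x|].
    by rewrite mxE.
  apply: regular_on_sum => k; apply: regular_on_mul; first exact: regular_on_cst.
  exact: regular_on_coord.
- exact: regular_on_add.
- exact: regular_on_mul.
Qed.

(* The left-invariant vector field attached to X acts on polynomial functions,
   and restricts to d/ds along s |-> exp(sX). *)
Lemma invariant_derivative p : polyfun p -> exists p' (q : {poly C}), [/\ polyfun p',
  forall g : 'M[C]_n.+1, D (fun x => p (g *m pval x)) = p' g,
  forall s, p (nexp (s *: X)) = q.[s] &
  forall s, p' (nexp (s *: X)) = q^`().[s]].
Proof.
elim=> [c|i j|f1 f2 P1 [d1 [q1 [D1 E1 F1 G1]]] P2 [d2 [q2 [D2 E2 F2 G2]]]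
       |f1 f2 P1 [d1 [q1 [D1 E1 F1 G1]]] P2 [d2 [q2 [D2 E2 F2 G2]]]].
- exists (fun=> 0), c%:P; split=> [|g|s|s]; rewrite ?hornerC ?derivC ?horner0 //.
    exact: PolyCst.
  exact: derivation_cst.
- exists (fun g => (g *m X) i j), (nexp_entry X i j); split.
  + have -> : (fun g : 'M[C]_n.+1 => (g *m X) i j) = fun g => \sum_k g i k * X k j.
      by apply/funext => g; rewrite mxE.
    by apply: polyfun_sum => k; apply: PolyMul; [exact: PolyCoord | exact: PolyCst].
  + move=> g; under [X in D X]eq_fun do rewrite mxE.
    rewrite (derivation_sum DP) => [|k]; last first.
      by apply: regular_on_mul; [exact: regular_on_cst | exact: regular_on_coord].
    rewrite mxE; apply: eq_bigr => k _.
    by rewrite (derivation_scale DP) ?DX //; exact: regular_on_coord.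
  + by move=> s; rewrite horner_nexp_entry.
  + by move=> s; rewrite deriv_nexp_entry.
- exists (fun g => d1 g + d2 g), (q1 + q2); split=> [|g|s|s].
  + exact: PolyAdd.
  + by rewrite (derivation_add DP) ?E1 ?E2 //; exact: regular_on_lmul.
  + by rewrite hornerD F1 F2.
  + by rewrite derivD hornerD G1 G2.
- exists (fun g => f1 g * d2 g + d1 g * f2 g), (q1 * q2); split=> [|g|s|s].
  + by apply: PolyAdd; apply: PolyMul.
  + by rewrite (derivation_mul DP) ?E1 ?E2 /= ?mulmx1 //; exact: regular_on_lmul.
  + by rewrite hornerM F1 F2.
  + by rewrite derivM !hornerE G1 G2 F1 F2 addrC.
Qed.

End Integration.

(** The invariant vector field of X preserves the polynomials that vanish on G. Hence, for such a p,
    all derivatives of the polynomial s |-> p(exp(s X)) vanish at 0, and the polynomial is 0. *)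
Lemma nexp_in_group (G : agroup R n.+1) X s : lie G X -> X ^+ n.+1 = 0 ->
  gset G (nexp (s *: X)).
Proof.
move=> [D DP DX] Xn; apply: (zclosed_polyfun (gset_closed G)).
  exact: nexpZ_unit.
move=> p Pp pG.
have main k f (q : {poly C}) : polyfun f -> (forall x, gset G x -> f x = 0) ->
    (forall s, f (nexp (s *: X)) = q.[s]) -> q^`(k).[0] = 0.
  elim: k f q => [|k IH] f q Pf fG fq.
    rewrite derivn0 -fq scale0r nexp0 fG //; by have [_ + _ _] := gset_group G.
  have [f' [q' [Pf' f'E fq' f'q']]] := invariant_derivative Xn DP DX Pf.
  have qq' : q = q'.
    apply/eqP; rewrite -subr_eq0; apply/eqP; apply: (@poly_eq0_of_infinite _ _ [::]) => t _.
    by rewrite hornerD hornerN -fq fq' subrr.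
  rewrite derivSn qq'; apply: IH f'q' => // x Gx.
  rewrite -f'E -[RHS](derivation0 DP); congr D; apply/funext => y.
  by rewrite fG //; have [_ _ + _] := gset_group G; apply => //; exact: pvalP.
have [q qE] := polyfun_curve (@nexp_entry_poly X) Pp.
suff q0 : q = 0 by rewrite qE q0 horner0.
apply/polyP => k; rewrite coef0; have := main k p q Pp pG qE.
rewrite horner_coef0 coef_derivn addn0 => /eqP; rewrite -[_ *+ _]mulr_natr mulf_eq0 pnatr_eq0.
by rewrite ffactnn eqn0Ngt fact_gt0 orbF => /eqP.
Qed.

End UnipotentSubgroups.

(** * Cocharacters of algebraic groups *)

Section Gm.
Context {R : realType}.
Local Notation C := R[i].

Lemma pval_gm (z : C) : z != 0 -> pval (gm z) = z%:M.
Proof. by rewrite /gm; case: pselect. Qed.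

Lemma pt_gm (x : pts (Gm R)) : (x : 'M[C]_1) ord0 ord0 != 0 /\ x = gm ((x : 'M[C]_1) ord0 ord0).
Proof.
have E : pval x = ((x : 'M[C]_1) ord0 ord0)%:M by rewrite -mx11_scalar.
have x0 : (x : 'M[C]_1) ord0 ord0 != 0.
  by have := pt_unit x; rewrite unitmxE {1}E det_scalar1 unitfE.
by split=> //; apply: pval_inj; rewrite pval_gm.
Qed.

Lemma gmM (z w : C) : z != 0 -> w != 0 -> gm (z * w) = ptM (gm z) (gm w).
Proof.
move=> z0 w0; apply: pval_inj; rewrite /= !pval_gm ?mulf_neq0 //.
by rewrite mul_scalar_mx scale_scalar_mx.
Qed.

Lemma gm1 : gm (1 : C) = pt1 (Gm R).
Proof. by apply: pval_inj; rewrite pval_gm ?oner_neq0. Qed.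

Lemma regular_gm (f : pts (Gm R) -> C) : regular_on f ->
  exists N (q : {poly C}), forall z, z != 0 -> f (gm z) * z ^+ N = q.[z].
Proof.
move=> [F rF fF]; have [N [p [Pp pE]]] := regular_polyfun rF.
have cg (i j : 'I_1) : exists q : {poly C}, forall s, (s%:M : 'M[C]_1) i j = q.[s].
  by exists 'X => s; rewrite hornerX !ord1 mxE eqxx mulr1n.
have [q qE] := polyfun_curve cg Pp.
exists N, q => z z0; rewrite -qE -pE ?fF ?pval_gm // ?det_scalar1 //.
by rewrite unitmxE det_scalar1 unitfE.
Qed.

Lemma pt_derivation_gm : exists2 D, @point_derivation R 1 (Gm R) D &
  forall f N (q : {poly C}), (forall z, z != 0 -> f (gm z) * z ^+ N = q.[z]) ->
    D f = q^`().[1] - q.[1] * N%:R.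
Proof.
have [||D DP DE] := @curve_derivation R 1 (Gm R) (fun s => gm (1 + s)).
- move=> f /regular_gm [N [q qE]]; exists N, (q \Po (1 + 'X)) => s s0.
  by rewrite qE // horner_comp !hornerE.
- by rewrite addr0 gm1.
exists D => // f N q fq; rewrite (DE f N (q \Po (1 + 'X))) => [|s s0].
  rewrite deriv_comp hornerM !horner_comp derivD derivC derivX add0r hornerC mulr1.
  by rewrite !hornerE.
by rewrite fq // horner_comp !hornerE.
Qed.

(** Regular functions on the multiplicative group are Laurent polynomials in the coordinate, so a
    derivation is determined by its value on the coordinate. This makes differentials of
    cocharacters unique. *)
Lemma derivation_gm_uniq (D : (pts (Gm R) -> C) -> C) f N (q : {poly C}) :
    point_derivation D -> D (fun x => x ord0 ord0) = 1 ->
    (forall z, z != 0 -> f (gm z) * z ^+ N = q.[z]) ->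
  D f = q^`().[1] - q.[1] * N%:R.
Proof.
move=> DP D1 fq.
pose c (x : pts (Gm R)) : C := x ord0 ord0.
have rc : regular_on c by exact: regular_on_coord.
have rV : regular_on (fun x => (c x)^-1).
  exists (fun g => (\det g)^-1) => [|x]; first exact: RegInvDet.
  by rewrite /c {2}(mx11_scalar (pval x)) det_scalar1.
have cX k (h : pts (Gm R) -> C) : regular_on h -> regular_on (fun x => h x ^+ k).
  move=> rh; elim: k => [|k IH].
    by apply: regular_on_ext (regular_on_cst _ 1) => x; rewrite expr0.
  by apply: regular_on_ext (regular_on_mul rh IH) => x; rewrite exprS.
have c1 : c (pt1 (Gm R)) = 1 by rewrite /c /= mxE.
have DX (h : pts (Gm R) -> C) k : regular_on h -> h (pt1 (Gm R)) = 1 ->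
    D (fun x => h x ^+ k) = k%:R * D h.
  move=> rh h1; elim: k => [|k IH].
    by under [X in D X]eq_fun do rewrite expr0; rewrite derivation_cst ?mul0r.
  under [X in D X]eq_fun do rewrite exprS.
  by rewrite (derivation_mul DP) ?IH ?h1 ?expr1n ?mul1r ?mulr1 -?natr1 ?mulrDl ?mul1r //; exact: cX.
have DV : D (fun x => (c x)^-1) = -1.
  have := derivation_mul DP rc rV; rewrite c1 invr1 mul1r mulr1 D1.
  rewrite (_ : (fun x => c x * (c x)^-1) = (fun=> 1)).
    by rewrite derivation_cst // => /esym/eqP; rewrite addr_eq0 => /eqP.
  by apply/funext => x; rewrite mulfV //; have [] := pt_gm x.
have fE : f = (fun x => (\sum_(k < size q) q`_k * c x ^+ k) * (c x)^-1 ^+ N).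
  apply/funext => x; have [x0 {1}->] := pt_gm x.
  have := fq _ x0; rewrite -/(c x) => /(canRL (mulfK _)); rewrite expf_neq0 // => ->//.
  by rewrite horner_coef exprVn.
have rq k : regular_on (fun x => q`_k * c x ^+ k).
  by apply: regular_on_mul; [exact: regular_on_cst | exact: cX].
rewrite fE (derivation_mul DP); [|exact: regular_on_sum|exact: cX].
rewrite (derivation_sum DP) // DX ?c1 ?invr1 // DV expr1n mulr1 mulrN1 addrC; congr (_ + _).
  rewrite -[in RHS](coefK q) poly_def raddf_sum horner_sum; apply: eq_bigr => k _ /=.
  rewrite (derivation_scale DP); last exact: cX.
  by rewrite DX // D1 mulr1 derivZ derivXn hornerZ hornerMn hornerXn expr1n.
by rewrite mulrN horner_coef; congr (- (_ * _)); apply: eq_bigr => k _; rewrite c1.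
Qed.

End Gm.

Section Cocharacters.
Context {R : realType} {n : nat}.
Local Notation C := R[i].

(** The entries of l(z) are Laurent polynomials. Sums over all entries give a crude common
    denominator z^N and a crude bound K on the degrees, and multiplicativity makes the coefficient
    matrices orthogonal idempotents. *)
Lemma cochar_decomp (G : agroup R n.+1) (l : ahom (tgrp (rtor (Gm R))) G) : exists K N (e : nat -> 'M[C]_n.+1),
  orth_idem K e /\ forall z, z != 0 -> pval (l (gm z)) = cochar_mx K N e z.
Proof.
have rl i j : exists Nq : nat * {poly C}, forall z, z != 0 -> l (gm z) i j * z ^+ Nq.1 = Nq.2.[z].
  by have [N [q E]] := regular_gm (ahom_regular l i j); exists (N, q).
pose Nq i j := projT1 (cid (rl i j)).
have NqE i j z : z != 0 -> l (gm z) i j * z ^+ (Nq i j).1 = (Nq i j).2.[z].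
  by rewrite /Nq; case: cid => /= p; apply.
pose N := (\sum_i \sum_j (Nq i j).1)%N.
have Nij i j : ((Nq i j).1 <= N)%N.
  by rewrite /N (bigD1 i) //= (bigD1 j) //= -addnA leq_addr.
pose q i j : {poly C} := (Nq i j).2 * 'X^(N - (Nq i j).1).
pose K := (\sum_i \sum_j size (q i j))%N.
have Kij i j : (size (q i j) <= K)%N.
  by rewrite /K (bigD1 i) //= (bigD1 j) //= -addnA leq_addr.
pose e k := \matrix_(i, j) (q i j)`_k.
have lE z : z != 0 -> pval (l (gm z)) = cochar_mx K N e z.
  move=> z0; apply/matrixP => i j; rewrite summxE.
  have zN : z ^+ N != 0 by rewrite expf_neq0.
  apply: (mulIf zN); rewrite mulr_suml.
  have -> : l (gm z) i j * z ^+ N = l (gm z) i j * z ^+ (Nq i j).1 * z ^+ (N - (Nq i j).1).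
    by rewrite -mulrA -exprD subnKC // Nij.
  rewrite NqE //.
  have -> : (Nq i j).2.[z] * z ^+ (N - (Nq i j).1) = (q i j).[z].
    by rewrite /q hornerM hornerXn.
  rewrite (horner_coef_wide _ (Kij i j)); apply: eq_bigr => k _.
  by rewrite 2!mxE mulrAC divfK // mulrC.
exists K, N, e; split=> //; apply: (@hom_orth_idem _ _ K N) => [z w z0 w0|].
  by rewrite -!lE ?mulf_neq0 // gmM // ahomM.
by rewrite -lE ?oner_neq0 // gm1 ahom1.
Qed.

Lemma cochar_differential (G : agroup R n.+1) (l : ahom (tgrp (rtor (Gm R))) G) K N (e : nat -> 'M[C]_n.+1) :
    (forall z, z != 0 -> pval (l (gm z)) = cochar_mx K N e z) ->
  is_differential l 1%:M (cochar_tangent K N e) /\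
  forall Y, is_differential l 1%:M Y -> Y = cochar_tangent K N e.
Proof.
move=> lE.
pose q i j : {poly C} := \poly_(k < K) e k i j.
have qE i j z : z != 0 -> l (gm z) i j * z ^+ N = (q i j).[z].
  move=> z0; rewrite lE // summxE horner_poly mulr_suml; apply: eq_bigr => k _.
  by rewrite mxE mulrAC divfK ?expf_neq0 // mulrC.
have dq i j : (q i j)^`().[1] - (q i j).[1] * N%:R = cochar_tangent K N e i j.
  rewrite /q poly_def raddf_sum /= !horner_sum mulr_suml -sumrB summxE.
  apply: eq_bigr => k _; rewrite derivZ derivXn !hornerZ hornerMn !hornerXn !expr1n mulr1 mxE.
  by rewrite -mulrBr mulrC.
have X1 z : z != 0 -> (gm z : 'M[C]_1) ord0 ord0 * z ^+ 0 = ('X : {poly C}).[z].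
  by move=> z0; rewrite pval_gm // mxE eqxx mulr1n expr0 mulr1 hornerX.
split.
  have [D DP DE] := @pt_derivation_gm R; exists D; split=> // i j.
    rewrite !ord1 mxE eqxx; rewrite (DE (fun x => x ord0 ord0) 0%N 'X X1).
    by rewrite derivX hornerC mulr0 subr0.
  by rewrite (DE _ _ _ (qE i j)) dq.
move=> Y [D [DP D1 DY]]; apply/matrixP => i j; rewrite -DY -dq.
apply: derivation_gm_uniq => //; last exact: qE.
by have := D1 ord0 ord0; rewrite mxE eqxx.
Qed.

Lemma regular_on_comp m (G : agroup R m) k (H : agroup R k) (l : ahom G H) (f : pts H -> C) :
  regular_on f -> regular_on (fun x => f (l x)).
Proof.
move=> [F rF fF]; apply: (@regular_on_ext _ _ _ (fun x => F (pval (l x)))) => [x|].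
  by rewrite fF.
apply: (regular_comp_gen (D := fun x => pval (l (ptV x)))) rF => [a b|a b|x].
- exact: ahom_regular.
- have [F' rF' eF'] := ahom_regular l a b.
  apply: (@regular_on_ext _ _ _ (fun x => F' (invmx (pval x)))) => [x|]; first by rewrite eF'.
  apply: (regular_comp_gen (D := @pval _ _ G)) rF' => [i' j'|i' j'|x].
  + exact: regular_on_invmx.
  + exact: regular_on_coord.
  + by rewrite mulVmx ?pt_unit.
- by rewrite ahomV /= mulmxV ?pt_unit.
Qed.

Lemma differential_lie m (G : agroup R m) k (H : agroup R k) (l : ahom G H) X Y :
  is_differential l X Y -> lie H Y.
Proof.
move=> [D [DP DX DY]]; exists (fun f => D (fun x => f (l x))) => //; split.
  move=> c f h rf rh.
  by rewrite (derivation_lin DP) //; exact: regular_on_comp.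
move=> f h rf rh; rewrite (derivation_mul DP) ?ahom1 //; exact: regular_on_comp.
Qed.

End Cocharacters.

Section Pairing.
Context {R : realType}.
Local Notation C := R[i].

(** Among orthogonal idempotents of size 1 with sum 1, exactly one is nonzero, and its index is the
    exponent. *)
Lemma gm_hom_exp (l : ahom (tgrp (rtor (Gm R))) (tgrp (rtor (Gm R)))) :
  exists m : int, forall z, z != 0 -> (l (gm z) : 'M[C]_1) ord0 ord0 = z ^ m.
Proof.
have [K [N [e [[e1 eM] lE]]]] := cochar_decomp l.
have [k0 ek0] : exists k : 'I_K, e k != 0.
  apply/existsP; apply: contraT; rewrite negb_exists => /forallP e0.
  move/eqP: e1; rewrite big1 => [|k _]; last by apply/eqP; have := e0 k; rewrite negbK.
  by rewrite eq_sym oner_eq0.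
pose c k := e k ord0 ord0.
have ec k : e k = (c k)%:M by rewrite /c -mx11_scalar.
have cM i j : (i < K)%N -> (j < K)%N -> c i * c j = if i == j then c i else 0.
  move=> iK jK; have := congr1 (fun A : 'M[C]_1 => A ord0 ord0) (eM i j iK jK).
  rewrite /= mxE big_ord1 => ->; by case: eqP; rewrite ?mxE.
have ck0 : c k0 != 0 by apply: contraNneq ek0 => E; rewrite ec E raddf0.
exists (k0%:Z - N%:Z) => z z0; rewrite lE // summxE (bigD1 k0) //= big1 ?addr0.
  rewrite mxE; have -> : e k0 ord0 ord0 = 1.
    by apply: (mulfI ck0); rewrite mulr1 cM // eqxx.
  by rewrite mulr1 expfzDr // -exprnN.
move=> k kk0; rewrite mxE; have -> : e k ord0 ord0 = 0; last by rewrite mulr0.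
apply: (mulfI ck0); rewrite mulr0 cM //.
by rewrite -[_ == _]/(val k0 == val k) val_eqE eq_sym (negPf kk0).
Qed.

Context {n : nat} {T : torus R n}.
Implicit Types (chi : X^*(T)) (l : X_*(T)).

Lemma expz2_inj (m k : int) : (2%:R : C) ^ m = 2%:R ^ k -> m = k.
Proof.
move=> E; have t0 : (2%:R : C) != 0 by rewrite pnatr_eq0.
have : (2%:R : C) ^ (m - k) == 1 by rewrite expfzDr // E -expfzDr // subrr expr0z.
rewrite pexprz_eq1 ?ler0n // pnatr_eq1 orbF subr_eq0 => /eqP //.
Qed.

Lemma cochar_gmM l z w : z != 0 -> w != 0 -> l (gm (z * w)) = l (gm z) + l (gm w) :> pts T.
Proof. by move=> z0 w0; rewrite gmM // ahomM. Qed.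

Lemma cochar_gm1 l : l (gm 1) = 0 :> pts T.
Proof. by rewrite gm1 ahom1. Qed.

Lemma cochar_gmV l z : z != 0 -> l (gm z^-1) = - l (gm z) :> pts T.
Proof.
move=> z0; apply: (addrI (l (gm z) : pts T)).
by rewrite -cochar_gmM ?invr_eq0 // mulfV // cochar_gm1 subrr.
Qed.

Lemma pairing_eq chi l m :
  (forall z, z != 0 -> chv chi (l (gm z)) = z ^ m) -> pairing chi l = m.
Proof.
move=> h; rewrite /pairing; case: xgetP => [k _ kE|]; last by move/(_ m); case.
by apply: expz2_inj; rewrite -kE ?h // pnatr_eq0.
Qed.

Lemma pairingP chi l z : z != 0 -> chv chi (l (gm z)) = z ^ pairing chi l.
Proof.
have [m mE] := gm_hom_exp (acomp chi l).
by move=> z0; rewrite (@pairing_eq chi l m) // -mE.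
Qed.

Lemma chvD chi chi' t : chv (chi + chi') t = chv chi t * chv chi' t.
Proof. by rewrite /chv /= mxE big_ord1. Qed.

Lemma chv_neq0 chi t : chv chi t != 0.
Proof. by have [] := pt_gm (chi t). Qed.

Lemma chvM chi t t' : chv chi (t + t') = chv chi t * chv chi t'.
Proof. by rewrite /chv [chi _](ahomM chi) /= mxE big_ord1. Qed.

Lemma chv1 chi : chv chi 0 = 1.
Proof. by rewrite /chv [chi _](ahom1 chi) /= mxE. Qed.

Lemma chv0 t : chv (0 : X^*(T)) t = 1.
Proof. by rewrite /chv /= mxE. Qed.

Lemma chvN chi t : chv (- chi) t = (chv chi t)^-1.
Proof. by apply: (mulfI (chv_neq0 chi t)); rewrite -chvD subrr chv0 mulfV // chv_neq0. Qed.

Lemma chvNr chi t : chv chi (- t) = (chv chi t)^-1.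
Proof. by apply: (mulfI (chv_neq0 chi t)); rewrite -chvM subrr chv1 mulfV // chv_neq0. Qed.

Lemma pairingNl chi l : pairing (- chi) l = - pairing chi l.
Proof. by apply: pairing_eq => z z0; rewrite chvN !pairingP // -invr_expz. Qed.

Lemma pairingDr chi l l' : pairing chi (l + l') = pairing chi l + pairing chi l'.
Proof. by apply: pairing_eq => z z0; rewrite [X in chv _ X]/(l _ + l' _) chvM !pairingP // expfzDr. Qed.

Lemma pairingNr chi l : pairing chi (- l) = - pairing chi l.
Proof. by apply: pairing_eq => z z0; rewrite [X in chv _ X]/(- (l _)) chvNr !pairingP // -invr_expz. Qed.

Lemma pairing0r chi : pairing chi 0 = 0.
Proof. by apply: pairing_eq => z z0; rewrite [X in chv _ X]/(0 : pts T) chv1 expr0z. Qed.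

Lemma pairingMz chi l (m : int) : pairing chi (l *~ m) = pairing chi l * m.
Proof.
have Mn k : pairing chi (l *+ k) = pairing chi l *+ k.
  by elim: k => [|k IH]; rewrite ?mulr0n ?pairing0r // !mulrS pairingDr IH.
have E k : pairing chi l *+ k = pairing chi l * k%:Z by rewrite -mulr_natr natz.
case: m => k; first by rewrite -[l *~ _]/(l *+ k) Mn E.
by rewrite NegzE mulrNz pairingNr -[l *~ _]/(l *+ k.+1) Mn mulrN E.
Qed.

End Pairing.

(** * Subtori *)

Section TorusOps.
Context {R : realType}.
Local Notation C := R[i].

Lemma regular_on_expz m (G : agroup R m) (f : pts G -> C) (k : int) :
    regular_on f -> regular_on (fun x => (f x)^-1) -> regular_on (fun x => f x ^ k).
Proof.
have H (h : pts G -> C) l : regular_on h -> regular_on (fun x => h x ^+ l).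
  move=> rh; elim: l => [|l IH].
    by apply: regular_on_ext (regular_on_cst _ 1) => x; rewrite expr0.
  by apply: regular_on_ext (regular_on_mul rh IH) => x; rewrite exprS.
move=> rf rV; case: k => k; first exact: H.
by apply: regular_on_ext (H _ k.+1 rV) => x; rewrite NegzE -invr_expz exprVn.
Qed.

Lemma regular_on_prod m (G : agroup R m) (I : Type) (r : seq I) (f : I -> pts G -> C) :
  (forall i, regular_on (f i)) -> regular_on (fun x => \prod_(i <- r) f i x).
Proof.
move=> rf; elim: r => [|i r IH].
  by apply: regular_on_ext (regular_on_cst _ 1) => x; rewrite big_nil.
by apply: regular_on_ext (regular_on_mul (rf i) IH) => x; rewrite big_cons.
Qed.

(** Moving the negative exponents to the other side turns the monomial equation into a polynomial
    one, as closedness requires. *)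
Lemma mono_exp_split (m n : nat) (a : 'M[int]_(m, n)) (u : 'rV[C]_m) j : nonzero u ->
  (mono a u ord0 j == 1) =
  (\prod_k u ord0 k ^+ (if 0 <= a k j then `|a k j|%N else 0%N) -
   \prod_k u ord0 k ^+ (if 0 <= a k j then 0%N else `|a k j|%N) == 0).
Proof.
move=> u0; rewrite mxE subr_eq0.
set x := (X in _ = (X == _)); set y := (X in _ = (_ == X)).
have y0 : y != 0 by apply/prodf_neq0 => k _; rewrite expf_neq0.
have -> : \prod_k u ord0 k ^ a k j = x / y.
  rewrite /x /y -prodf_div; apply: eq_bigr => k _.
  case: (a k j) => l /=; first by rewrite expr0 divr1.
  by rewrite expr0 mul1r NegzE -invr_expz.
by rewrite -{1}(divff y0) (inj_eq (mulIf (invr_neq0 y0))).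
Qed.

Section Monomial.
Context {n : nat} (P : 'M[C]_n).
Hypothesis Pu : P \in unitmx.

Definition diag_conj (v : 'rV[C]_n) := invmx P *m diag_mx v *m P.

Lemma diag_conjM v w : diag_conj v *m diag_conj w = diag_conj (rowM v w).
Proof. by rewrite /diag_conj -!mulmxA mulKVmx // [_ *m (_ *m P)]mulmxA mulmx_diag. Qed.

Lemma diag_conj1 : diag_conj (const_mx 1) = 1%:M.
Proof. by rewrite /diag_conj diag_const_mx mulmx1 mulVmx. Qed.

Lemma diag_conj_unit v : nonzero v -> diag_conj v \in unitmx.
Proof.
move=> v0; rewrite !unitmx_mul unitmx_inv Pu andbT /= unitmxE det_diag unitfE.
by apply/prodf_neq0 => k _.
Qed.

Definition row_inv m (u : 'rV[C]_m) : 'rV[C]_m := \row_j (u ord0 j)^-1.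

Lemma row_inv_nonzero m (u : 'rV[C]_m) : nonzero u -> nonzero (row_inv u).
Proof. by move=> u0 j; rewrite mxE invr_eq0. Qed.

Lemma rowMV m (u : 'rV[C]_m) : nonzero u -> rowM u (row_inv u) = const_mx 1.
Proof. by move=> u0; apply/rowP => j; rewrite !mxE mulfV. Qed.

Definition diag_of (g : 'M[C]_n) : 'rV[C]_n := \row_k (P *m g *m invmx P) k k.

Lemma diag_ofK v : diag_of (diag_conj v) = v.
Proof.
apply/rowP => k; rewrite mxE /diag_conj !mulmxA mulmxV // mul1mx mulmxK //.
by rewrite mxE eqxx mulr1n.
Qed.

Lemma diag_conjK g : is_diag_mx (P *m g *m invmx P) -> diag_conj (diag_of g) = g.
Proof.
move=> /diag_mxP [d dE]; rewrite /diag_conj /diag_of dE.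
have -> : (\row_k diag_mx d k k) = d by apply/rowP => k; rewrite !mxE eqxx mulr1n.
by rewrite -dE !mulmxA mulVmx // mul1mx mulmxKV.
Qed.

Context {r : nat} (a : 'M[int]_(r, n)).

Definition mono_set : set 'M[C]_n :=
  [set g | exists2 u : 'rV[C]_r, nonzero u & g = diag_conj (mono a u)].

Fact mono_subgroup : is_subgroup mono_set.
Proof.
split.
- by move=> _ [u u0 ->]; apply: diag_conj_unit; exact: mono_nonzero.
- exists (const_mx 1); last by rewrite mono_one diag_conj1.
  by move=> k; rewrite mxE oner_eq0.
- move=> _ _ [u u0 ->] [v v0 ->]; exists (rowM u v); last by rewrite diag_conjM mono_rowM.
  by move=> k; rewrite mxE mulf_neq0.
- move=> _ [u u0 ->]; exists (row_inv u); first exact: row_inv_nonzero.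
  have E : diag_conj (mono a u) *m diag_conj (mono a (row_inv u)) = 1%:M.
    by rewrite diag_conjM -mono_rowM rowMV // mono_one diag_conj1.
  have U := diag_conj_unit (mono_nonzero a u0).
  by rewrite -[LHS]mulmx1 -E mulKmx.
Qed.

Context (U V : 'M[int]_n) (J : {set 'I_n}).
Hypothesis UV : U *m V = 1%:M.
Hypothesis VU : V *m U = 1%:M.
Hypothesis aJ : forall v : 'rV[C]_n, (exists2 u, nonzero u & v = mono a u) <->
      nonzero v /\ forall j, j \notin J -> mono V v ord0 j = 1.

Lemma mono_setP g : mono_set g <-> exists v, [/\ nonzero v,
  forall j, j \notin J -> mono V v ord0 j = 1 & g = diag_conj v].
Proof.
split=> [[u u0 ->]|[v [v0 vJ ->]]].
  have [+ _] := aJ (mono a u); case; first by exists u.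
  by move=> v0 vJ; exists (mono a u).
by have [_ [|u u0 ->]] := aJ v; [split|exists u].
Qed.

Let polyexp (j : 'I_n) (g : 'M[C]_n) : C :=
  \prod_k diag_of g ord0 k ^+ (if 0 <= V k j then `|V k j|%N else 0%N) -
  \prod_k diag_of g ord0 k ^+ (if 0 <= V k j then 0%N else `|V k j|%N).

(** The equations say that P g P^-1 is diagonal and that its Smith coordinates outside J are 1. *)
Fact mono_closed : zclosed mono_set.
Proof.
have rP (i j : 'I_n) : regular (fun g : 'M[C]_n => (P *m g *m invmx P) i j).
  apply: (@regular_ext _ _ (fun g => \sum_l (\sum_k P i k * g k l) * invmx P l j)).
    by move=> g; rewrite mxE; apply: eq_bigr => l _; rewrite mxE.
  apply: regular_sum => l; apply: RegMul; last exact: RegCst.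
  by apply: regular_sum => k; apply: RegMul; [exact: RegCst | exact: RegCoord].
have rX (f : 'M[C]_n -> C) l : regular f -> regular (fun g => f g ^+ l).
  move=> rf; elim: l => [|l IH].
    by apply: regular_ext (RegCst _ 1) => x; rewrite expr0.
  by apply: regular_ext (RegMul rf IH) => x; rewrite exprS.
have rD k l : regular (fun g => diag_of g ord0 k ^+ l).
  apply: (rX (fun g => diag_of g ord0 k)).
  by apply: regular_ext (rP k k) => g; rewrite [RHS]mxE.
exists [set f | (exists i j, i != j /\ f = fun g => (P *m g *m invmx P) i j) \/
                exists2 j, j \notin J & f = polyexp j].
  move=> f [[i [j [_ ->]]]|[j _ ->]]; first exact: rP.
  apply: (@regular_ext _ _ (fun g =>
    \prod_k diag_of g ord0 k ^+ (if 0 <= V k j then `|V k j|%N else 0%N) +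
    -1 * \prod_k diag_of g ord0 k ^+ (if 0 <= V k j then 0%N else `|V k j|%N))).
    by move=> g; rewrite mulN1r.
  apply: RegAdd; first by apply: regular_prod => k; exact: rD.
  by apply: RegMul; [exact: RegCst | apply: regular_prod => k; exact: rD].
apply/seteqP; split=> g.
  move=> /mono_setP [v [v0 vJ ->]]; split; first exact: diag_conj_unit.
  move=> f [[i [j [ij ->]]]|[j jJ ->]].
    rewrite /diag_conj !mulmxA mulmxV // mul1mx mulmxK // mxE (negPf ij) //.
  by apply/eqP; rewrite /polyexp diag_ofK -mono_exp_split // vJ.
move=> [gu gF]; apply/mono_setP.
have dg : is_diag_mx (P *m g *m invmx P).
  by apply/is_diag_mxP => i j ij; apply: (gF (fun g => (P *m g *m invmx P) i j)); left; exists i, j.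
have v0 : nonzero (diag_of g).
  move=> k; have : P *m g *m invmx P \in unitmx by rewrite !unitmx_mul unitmx_inv Pu gu.
  have /diag_mxP [d dE] := dg; rewrite mxE dE unitmxE det_diag unitfE => /prodf_neq0 h.
  by rewrite mxE eqxx mulr1n h.
exists (diag_of g); split=> //; last by rewrite diag_conjK.
move=> j jJ; apply/eqP; rewrite mono_exp_split //; apply/eqP.
by apply: (gF (polyexp j)); right; exists j.
Qed.

Definition mono_group : agroup R n := AGroup mono_closed mono_subgroup.

(** As a monomial map, E extends coordinates indexed by J by 1, and its transpose restricts to J. So
    E U and V E^T parametrize the subgroup and invert the parametrization. *)
Let E : 'M[int]_(#|J|, n) := \matrix_(k, j) (enum_val k == j)%:R.

Lemma enum_val_mx : E *m E^T = 1%:M.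
Proof.
apply/matrixP => k l; rewrite !mxE (bigD1 (enum_val k)) //= big1 => [|j jk].
  by rewrite !mxE eqxx mul1r addr0 (inj_eq enum_val_inj) eq_sym.
by rewrite !mxE eq_sym (negPf jk) mul0r.
Qed.

Lemma enum_val_mxT (w : 'rV[C]_n) : nonzero w -> (forall j, j \notin J -> w ord0 j = 1) ->
  mono (E^T *m E) w = w.
Proof.
move=> w0 wJ; have EE i j : (E^T *m E) i j = ((i == j) && (i \in J))%:R.
  rewrite mxE; have [iJ|iJ] := boolP (i \in J).
    rewrite (bigD1 (enum_rank_in iJ i)) //= big1 => [|k ki].
      by rewrite !mxE enum_rankK_in // eqxx mul1r addr0 andbT.
    rewrite !mxE; case: eqP => kE; last by rewrite mul0r.
    by case/eqP: ki; apply: enum_val_inj; rewrite kE enum_rankK_in.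
  rewrite andbF big1 // => k _; rewrite !mxE; case: eqP => kE; rewrite ?mul0r //.
  by move: iJ; rewrite -kE enum_valP.
apply/rowP => j; rewrite mxE (bigD1 j) //= big1 => [|k kj].
  rewrite EE eqxx mulr1 /=; case: (boolP (j \in J)) => [_|/wJ ->]; first exact: expr1z.
  by rewrite expr0z.
by rewrite EE (negPf kj) expr0z.
Qed.

Lemma diag_group_nonzero s (x : pts (@diag_group R s)) :
  nonzero (\row_k (x : 'M[C]_s) k k) /\ pval x = diag_mx (\row_k (x : 'M[C]_s) k k).
Proof.
case: x => x [xu /diag_mxP [d xE]] /=; subst x.
have -> : (\row_k diag_mx d k k) = d by apply/rowP => k; rewrite !mxE eqxx mulr1n.
split=> // k; move: xu; rewrite unitmxE det_diag unitfE => /prodf_neq0; exact.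
Qed.

Lemma regular_on_mono m (G : agroup R m) p q (b : 'M[int]_(p, q)) (f h : pts G -> 'M[C]_p) :
    (forall i j, regular_on (fun x => f x i j)) ->
    (forall i j, regular_on (fun x => h x i j)) ->
    (forall x i, h x i i = (f x i i)^-1) ->
  forall j, regular_on (fun x => mono b (\row_k f x k k) ord0 j).
Proof.
move=> rf rh fh j; apply: (@regular_on_ext _ _ _ (fun x => \prod_k f x k k ^ b k j)) => [x|].
  by rewrite mxE; apply: eq_bigr => k _; rewrite mxE.
apply: regular_on_prod => k; apply: regular_on_expz => //.
by apply: (@regular_on_ext _ _ _ (fun x => h x k k)) => [x|//]; rewrite fh.
Qed.

Let fmx (x : pts (@diag_group R #|J|)) : 'M[C]_n :=
  diag_conj (mono (E *m U) (\row_k (x : 'M[C]_#|J|) k k)).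

Fact mono_to_subproof x : mono_set (fmx x).
Proof.
have [x0 _] := diag_group_nonzero x.
apply/mono_setP; exists (mono (E *m U) (\row_k (x : 'M[C]_#|J|) k k)); split=> //.
  exact: mono_nonzero.
move=> j jJ; rewrite -monoM // -mulmxA UV mulmx1 mxE big1 // => k _.
rewrite [E _ _]mxE; case: (eqVneq (enum_val k) j) => [kj|_]; last exact: expr0z.
by move: jJ; rewrite -kj enum_valP.
Qed.

Definition mono_to_fun x : pts mono_group := @Pt R n mono_group (fmx x) (mono_to_subproof x).

Lemma diag_mx_rowM s (x y : pts (@diag_group R s)) :
  \row_k (x *m y) k k = rowM (\row_k (x : 'M[C]_s) k k) (\row_k (y : 'M[C]_s) k k).
Proof.
have [_ {1}->] := diag_group_nonzero x; have [_ {1}->] := diag_group_nonzero y.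
by rewrite mulmx_diag; apply/rowP => k; rewrite !mxE eqxx mulr1n.
Qed.

Fact mono_to_hom x y : mono_to_fun (ptM x y) = ptM (mono_to_fun x) (mono_to_fun y).
Proof. by apply: pval_inj; rewrite /= diag_conjM -mono_rowM /fmx /= diag_mx_rowM. Qed.

Lemma regular_on_conj m (G : agroup R m) (v : pts G -> 'rV[C]_n) (Q Q' : 'M[C]_n) :
    (forall j, regular_on (fun x => v x ord0 j)) ->
  forall i j, regular_on (fun x => (Q *m diag_mx (v x) *m Q') i j).
Proof.
move=> rv i j; apply: (@regular_on_mulmx _ _ _ _ (fun x => Q *m diag_mx (v x))).
  apply: (@regular_on_mulmx _ _ _ _ (fun=> Q)) => k l; first exact: regular_on_cst.
  apply: (@regular_on_ext _ _ _ (fun x => v x ord0 l *+ (k == l))) => [x|]; first by rewrite mxE; case: eqP => // ->.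
  by case: eqP => _; [exact: rv | exact: regular_on_cst].
by move=> k l; exact: regular_on_cst.
Qed.

Fact mono_to_regular i j : regular_on (fun x => mono_to_fun x i j).
Proof.
apply: regular_on_conj => k; apply: (@regular_on_mono _ _ _ _ _ (@pval _ _ _) (fun x => invmx (pval x))).
- exact: regular_on_coord.
- exact: regular_on_invmx.
move=> x l; have [x0 E'] := diag_group_nonzero x.
have xu := pt_unit x.
have e : invmx (pval x) = diag_mx (row_inv (\row_k (x : 'M[C]_#|J|) k k)).
  suff E1 : pval x *m diag_mx (row_inv (\row_k (x : 'M[C]_#|J|) k k)) = 1%:M.
    by rewrite -[RHS](mulKmx xu) E1 mulmx1.
  by rewrite {1}E' mulmx_diag -diag_const_mx -(rowMV x0).
by rewrite e !mxE eqxx mulr1n.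
Qed.

Definition mono_to := AHom mono_to_hom mono_to_regular.

Let hmx (x : pts mono_group) : 'M[C]_#|J| := diag_mx (mono (V *m E^T) (diag_of x)).

Lemma mono_group_nonzero (x : pts mono_group) : nonzero (diag_of x) /\
  diag_conj (diag_of x) = x /\ forall j, j \notin J -> mono V (diag_of x) ord0 j = 1.
Proof. by case: x => x /= /mono_setP [v [v0 vJ ->]]; rewrite diag_ofK. Qed.

Fact mono_of_subproof x : diag_set (hmx x).
Proof.
have [x0 _] := mono_group_nonzero x; split; last exact: diag_mx_is_diag.
rewrite unitmxE det_diag unitfE; apply/prodf_neq0 => k _; exact: mono_nonzero.
Qed.

Definition mono_of_fun x : pts (@diag_group R #|J|) := @Pt R _ (@diag_group R #|J|) (hmx x) (mono_of_subproof x).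

Fact mono_of_hom x y : mono_of_fun (ptM x y) = ptM (mono_of_fun x) (mono_of_fun y).
Proof.
apply: pval_inj; rewrite /= /hmx mulmx_diag /=.
have [_ [xE _]] := mono_group_nonzero x; have [_ [yE _]] := mono_group_nonzero y.
have -> : diag_of (x *m y) = rowM (diag_of x) (diag_of y).
  by rewrite -{1}xE -{1}yE diag_conjM diag_ofK.
by rewrite mono_rowM.
Qed.

Fact mono_of_regular i j : regular_on (fun x => mono_of_fun x i j).
Proof.
apply: (@regular_on_ext _ _ _ (fun x => mono (V *m E^T) (diag_of (pval x)) ord0 j *+ (i == j))) => [x|].
  by rewrite [RHS]mxE; case: (eqVneq i j) => [->|_]; rewrite ?mulr0n.
case: eqP => _; last exact: regular_on_cst.
apply: (@regular_on_mono _ mono_group _ _ _ (fun x => P *m pval x *m invmx P) (fun x => P *m invmx (pval x) *m invmx P)).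
- move=> k l; apply: (@regular_on_mulmx _ _ _ _ (fun x => P *m pval x)); last by move=> *; exact: regular_on_cst.
  apply: (@regular_on_mulmx _ _ _ _ (fun=> P)); first by move=> *; exact: regular_on_cst.
  exact: regular_on_coord.
- move=> k l; apply: (@regular_on_mulmx _ _ _ _ (fun x => P *m invmx (pval x))); last by move=> *; exact: regular_on_cst.
  apply: (@regular_on_mulmx _ _ _ _ (fun=> P)); first by move=> *; exact: regular_on_cst.
  exact: regular_on_invmx.
move=> x k; have [x0 [xE _]] := mono_group_nonzero x.
have xV : invmx (pval x) = diag_conj (row_inv (diag_of x)).
  suff E1 : pval x *m diag_conj (row_inv (diag_of x)) = 1%:M.
    by rewrite -[RHS](mulKmx (pt_unit x)) E1 mulmx1.
  by rewrite -{1}xE diag_conjM rowMV // diag_conj1.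
rewrite xV -{2}xE /diag_conj !mulmxA mulmxV // !mul1mx !mulmxK // !mxE eqxx !mulr1n //.
Qed.

Definition mono_of := AHom mono_of_hom mono_of_regular.

Lemma mono_aiso : is_aiso mono_to.
Proof.
exists mono_of; split=> x; apply: pval_inj => /=.
  have [x0 ->] := diag_group_nonzero x; rewrite /hmx /= /fmx diag_ofK.
  rewrite -monoM // !mulmxA -(mulmxA E) UV mulmx1 enum_val_mx mono1 //.
have [x0 [xE xJ]] := mono_group_nonzero x; rewrite /fmx /= /hmx.
have -> : (\row_k diag_mx (mono (V *m E^T) (diag_of x)) k k) = mono (V *m E^T) (diag_of x).
  by apply/rowP => k; rewrite !mxE eqxx mulr1n.
rewrite -{2}xE; congr diag_conj; rewrite -monoM // mulmxA -(mulmxA V) monoM // monoM //.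
by rewrite enum_val_mxT // -?monoM ?VU ?mono1 //; exact: mono_nonzero.
Qed.

End Monomial.

(** The image of a diagonal group under a monomial map is a torus; this is how a maximal torus is
    compared with a larger commutative group in [maximal_torus_cochar]. *)
Lemma monomial_torus n (P : 'M[C]_n) r (a : 'M[int]_(r, n)) : P \in unitmx ->
  exists T : torus R n, gset T = mono_set P a.
Proof.
move=> Pu; have [U [V [J [UV VU aJ]]]] := @mono_image (R[i] : numClosedFieldType) _ _ a.
have iso := mono_aiso Pu UV VU aJ.
by exists (@Torus R n (mono_group Pu aJ) (ex_intro _ _ (ex_intro _ _ iso))).
Qed.

Lemma regular_on_gm_inv : regular_on (fun x : pts (Gm R) => ((x : 'M[C]_1) ord0 ord0)^-1).
Proof.
exists (fun g => (\det g)^-1) => [|x]; first exact: RegInvDet.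
by rewrite {2}(mx11_scalar (pval x)) det_scalar1.
Qed.

Section Coordinates.
Context {s : nat} (k : 'I_s).

Let dmx (x : pts (Gm R)) : 'M[C]_s :=
  diag_mx (\row_j if j == k then (x : 'M[C]_1) ord0 ord0 else 1).

Fact diag_cochar_subproof x : diag_set (dmx x).
Proof.
split; last exact: diag_mx_is_diag.
rewrite unitmxE det_diag unitfE; apply/prodf_neq0 => j _; rewrite mxE.
by case: (j == k); [have [] := pt_gm x | exact: oner_neq0].
Qed.

Let dfun x : pts (@diag_group R s) := @Pt R s (@diag_group R s) (dmx x) (diag_cochar_subproof x).

Fact diag_cochar_hom x y : dfun (ptM x y) = ptM (dfun x) (dfun y).
Proof.
apply: pval_inj; rewrite /= /dmx mulmx_diag; congr diag_mx; apply/rowP => j; rewrite !mxE.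
by case: eqP => _; rewrite ?mulr1 // big_ord1.
Qed.

Fact diag_cochar_regular i j : regular_on (fun x => dfun x i j).
Proof.
apply: (@regular_on_ext _ _ _ (fun x =>
  (if j == k then (x : 'M[C]_1) ord0 ord0 else 1) *+ (i == j))) => [x|].
  by rewrite [RHS]mxE mxE; case: (eqVneq i j) => [->|_].
by case: eqP => _; case: eqP => _; rewrite ?mulr0n; first exact: regular_on_coord; exact: regular_on_cst.
Qed.

Definition diag_cochar : ahom (Gm R) (@diag_group R s) := AHom diag_cochar_hom diag_cochar_regular.

End Coordinates.

Lemma diag_iso_coord n (T : torus R n) r (f : ahom (@diag_group R r) T) (h : ahom T (@diag_group R r)) :
  cancel h f -> forall t, t = \sum_k f (diag_cochar k (gm ((h t : 'M[C]_r) k k))).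
Proof.
move=> hf t; have [u0 uE] := diag_group_nonzero (h t).
have uk k : (\row_k (h t : 'M[C]_r) k k) ord0 k = (h t : 'M[C]_r) k k by rewrite mxE.
transitivity (\sum_k f (diag_cochar k (gm ((\row_k (h t : 'M[C]_r) k k) ord0 k)))); last first.
  by apply: eq_bigr => k _; rewrite uk.
move: {uk} u0 uE; move: (\row_k _) => u u0 uE.
pose xm (s : seq 'I_r) : 'M[C]_r := diag_mx (\row_j if j \in s then u ord0 j else 1).
have xP s : diag_set (xm s).
  split; last exact: diag_mx_is_diag.
  rewrite unitmxE det_diag unitfE; apply/prodf_neq0 => j _; rewrite mxE.
  by case: (j \in s); rewrite ?oner_neq0.
pose x s : pts (@diag_group R r) := @Pt R r (@diag_group R r) (xm s) (xP s).
have H s : uniq s -> f (x s) = \sum_(k <- s) f (diag_cochar k (gm (u ord0 k))).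
  elim: s => [|k s IH] /=.
    rewrite big_nil => _; rewrite (_ : x [::] = pt1 _) ?ahom1 //; apply: pval_inj.
    rewrite /= /xm -diag_const_mx; congr diag_mx; apply/rowP => j; rewrite !mxE //.
  move=> /andP [ks us]; rewrite big_cons -IH // -[RHS]ahomM; congr (f _).
  apply: pval_inj; rewrite /= /xm mulmx_diag; congr diag_mx; apply/rowP => j.
  rewrite !mxE inE pval_gm // mxE eqxx mulr1n; case: (eqVneq j k) => [->|jk] /=.
    by rewrite (negPf ks) mulr1.
  by rewrite mul1r.
have -> : t = f (x (index_enum _)).
  rewrite -(hf t); congr (f _); apply: pval_inj; rewrite uE /= /xm; congr diag_mx.
  by apply/rowP => j; rewrite [RHS]mxE mem_index_enum.
by rewrite H ?index_enum_uniq.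
Qed.

Lemma torus_coord n (T : torus R n) : exists r (c : 'I_r -> X_*(T)),
  forall t : pts T, exists2 u : 'rV[C]_r, nonzero u & t = \sum_k c k (gm (u ord0 k)).
Proof.
have [r [f [h [_ hf]]]] := torusP T; exists r, (fun k => acomp f (diag_cochar k)) => t.
have [u0 _] := diag_group_nonzero (h t); exists (\row_k (h t : 'M[C]_r) k k) => //.
by rewrite {1}(diag_iso_coord hf t); apply: eq_bigr => k _; rewrite mxE.
Qed.

Lemma pval_sum n (T : torus R n.+1) (I : Type) (s : seq I) (F : I -> pts T) :
  pval (\sum_(i <- s) F i) = \prod_(i <- s) (F i : 'M[C]_n.+1).
Proof.
elim: s => [|i s IH]; first by rewrite !big_nil.
by rewrite !big_cons -IH.
Qed.

Lemma cochar_ahom n (H : agroup R n.+1) K N (e : nat -> 'M[C]_n.+1) : orth_idem K e ->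
    (forall z, z != 0 -> gset H (cochar_mx K N e z)) ->
  exists l : ahom (tgrp (rtor (Gm R))) H, forall z, z != 0 -> pval (l (gm z)) = cochar_mx K N e z.
Proof.
move=> ee ST'.
have xP (x : pts (Gm R)) := ST' _ (pt_gm x).1.
pose lf x : pts H := Pt (xP x).
have lM x y : lf (ptM x y) = ptM (lf x) (lf y).
  apply: pval_inj => /=; have [x0 _] := pt_gm x; have [y0 _] := pt_gm y.
  rewrite -[RHS](cochar_mxM _ ee x0 y0); congr (cochar_mx _ _ _ _).
  by rewrite mxE big_ord1.
have lr i j : regular_on (fun x => lf x i j).
  apply: (@regular_on_ext _ _ _ (fun x => \sum_(k < K)
    ((x : 'M[C]_1) ord0 ord0 ^ k * (((x : 'M[C]_1) ord0 ord0)^-1) ^ N * e k i j))) => [x|].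
    by rewrite summxE; apply: eq_bigr => k _; rewrite mxE -exprnP -exprnP exprVn.
  have rc := @regular_on_coord R 1 (Gm R) ord0 ord0.
  apply: regular_on_sum => k; apply: regular_on_mul; last exact: regular_on_cst.
  apply: regular_on_mul; apply: regular_on_expz => //; try exact: regular_on_gm_inv.
  by apply: regular_on_ext rc => x; rewrite invrK.
exists (@AHom R 1 n.+1 (Gm R) H lf lM lr) => z z0 /=.
by rewrite pval_gm // mxE eqxx mulr1n.
Qed.

(** The given one-parameter group and coordinate cocharacters of T commute, hence are simultaneously
    diagonal and generate a torus of G containing T. By maximality this torus is T. *)
Lemma maximal_torus_cochar n (G : agroup R n.+1) (T : torus R n.+1) K N (e : nat -> 'M[C]_n.+1) :
    maximal_torus G T -> orth_idem K e ->
    (forall z, z != 0 -> gset G (cochar_mx K N e z)) ->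
    (forall z (t : pts T), z != 0 -> cochar_mx K N e z * pval t = pval t * cochar_mx K N e z) ->
  exists l : X_*(T), forall z, z != 0 -> pval (l (gm z)) = cochar_mx K N e z.
Proof.
move=> [TG Tmax] ee SG ST.
have [r [c cP]] := torus_coord T.
have dec k : exists Ke : nat * nat * (nat -> 'M[C]_n.+1), orth_idem Ke.1.1 Ke.2 /\
    forall z, z != 0 -> pval (c k (gm z)) = cochar_mx Ke.1.1 Ke.1.2 Ke.2 z.
  by have [K' [N' [e' H]]] := cochar_decomp (c k); exists (K', N', e').
(* Index [ord0] is the new one-parameter group, the others are the coordinates of T. *)
pose d k := if unlift ord0 k is Some k' then projT1 (cid (dec k')) else (K, N, e).
have dl k : d (lift ord0 k) = projT1 (cid (dec k)) by rewrite /d liftK.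
have d0 : d ord0 = (K, N, e) by rewrite /d unlift_none.
have dP k : orth_idem (d k).1.1 (d k).2.
  have [k' ->|->] := unliftP ord0 k; last by rewrite d0.
  by rewrite dl; case: cid => x [].
have cE k z : z != 0 -> pval (c k (gm z)) =
    cochar_mx (d (lift ord0 k)).1.1 (d (lift ord0 k)).1.2 (d (lift ord0 k)).2 z.
  by move=> z0; rewrite dl; case: cid => x [_ /=]; apply.
have SE z : cochar_mx (d ord0).1.1 (d ord0).1.2 (d ord0).2 z = cochar_mx K N e z by rewrite d0.
have [|P Pu [a aE]] := @cochar_codiag _ n r.+1 _ (fun k => (d k).1.2) _ dP.
  move=> k l z w z0 w0.
  have [k' ->|->] := unliftP ord0 k; have [l' ->|->] := unliftP ord0 l.
  - rewrite -!cE // -[LHS]/(pval (c k' (gm z) + c l' (gm w))) addrC //.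
  - by rewrite -cE // SE ST.
  - by rewrite -cE // SE ST.
  - by rewrite !SE -!cochar_mxM // [z * w]mulrC.
have dcE (s : seq 'I_r.+1) (u : 'rV[C]_r.+1) : nonzero u ->
    diag_conj P (\row_j \prod_(k <- s) u ord0 k ^ a k j) =
    \prod_(k <- s) cochar_mx (d k).1.1 (d k).1.2 (d k).2 (u ord0 k).
  move=> u0; elim: s => [|k s IH].
    rewrite big_nil -[RHS](diag_conj1 Pu); congr diag_conj.
    by apply/rowP => j; rewrite !mxE big_nil.
  rewrite big_cons -IH aE // -[X in X * _]/(diag_conj P _) -[RHS]/(_ *m _) diag_conjM //.
  by congr diag_conj; apply/rowP => j; rewrite !mxE big_cons.
have [T' T'E] := @monomial_torus n.+1 P _ a Pu.
(* A point of T is reached with parameter 1 at [ord0]; the new group is reached below with 1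
   everywhere else. *)
have T'T : gset T' = gset T.
  apply: Tmax => g; rewrite T'E.
    move=> [u u0 ->]; rewrite /mono dcE // big_ord_recl SE.
    have [_ _ GM _] := gset_group G; apply: GM; first exact: SG.
    under eq_bigr do rewrite -cE //.
    by rewrite -pval_sum; apply: TG; exact: pvalP.
  move=> Tg; pose t : pts T := Pt Tg.
  have [u u0 tE] := cP t.
  pose u' : 'rV[C]_r.+1 := \row_k if unlift ord0 k is Some k' then u ord0 k' else 1.
  have u'0 : nonzero u' by move=> k; rewrite mxE; case: unlift => [k'|]; rewrite ?oner_neq0.
  exists u' => //; rewrite /mono dcE // big_ord_recl SE [u' _ _]mxE unlift_none cochar_mx1 // mul1r.
  under eq_bigr => k _ do rewrite -cE // mxE liftK.
  by rewrite -pval_sum -tE.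
have ST' z : z != 0 -> gset T (cochar_mx K N e z).
  move=> z0; rewrite -T'T T'E.
  pose u' : 'rV[C]_r.+1 := \row_k if unlift ord0 k is Some k' then 1 else z.
  have u'0 : nonzero u' by move=> k; rewrite mxE; case: unlift => [k'|]; rewrite ?oner_neq0.
  exists u' => //; rewrite /mono dcE // big_ord_recl SE [u' _ _]mxE unlift_none big1 ?mulr1 // => k _.
  by rewrite -cE // mxE liftK gm1 ahom1.
exact: cochar_ahom.
Qed.

End TorusOps.

(** * Normal subgroups generated by nilpotent ideals *)

Lemma span_of_pred (K : fieldType) (V : vectType K) (P : V -> Prop) :
  exists U : {vspace V}, (forall v, P v -> v \in U) /\
    forall W : {vspace V}, (forall v, P v -> v \in W) -> (U <= W)%VS.
Proof.
have [||U UE] := @vspace_of_pred K V (fun v => forall W : {vspace V}, (forall v, P v -> v \in W) -> v \in W).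
- by move=> W _; exact: mem0v.
- by move=> a u v hu hv W PW; rewrite memvD ?memvZ ?hu ?hv.
exists U; split=> [v Pv|W PW]; first by apply/UE => W; exact.
by apply/subvP => v /UE; apply.
Qed.

Section Components.
Context {C : numClosedFieldType} {n : nat}.
Local Notation M := 'M[C]_n.+1.
Context (K N : nat) (e : nat -> M).
Hypothesis ee : orth_idem K e.
Local Notation S := (cochar_mx K N e).

(* The part of y on which S z acts by z ^ (a - b). *)
Definition component a b (y : M) := \sum_(i < K) \sum_(j < K | (i + b == j + a)%N) e i * y * e j.

(** The block (i, j) is scaled by z^(i - j); the shift by K makes all exponents nonnegative, so that
    the components become coefficients of a polynomial curve. *)
Lemma conj_cochar_mx z y : z != 0 ->
  z ^+ K *: (S z * y * S z^-1) = \sum_(l < K + K) z ^+ l *: component l K y.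
Proof.
move=> z0; have zN : z ^+ N != 0 by rewrite expf_neq0.
transitivity (\sum_(i < K) \sum_(j < K) z ^+ (K + i - j) *: (e i * y * e j)).
  rewrite {1}/cochar_mx !mulr_suml scaler_sumr; apply: eq_bigr => i _.
  rewrite /cochar_mx mulr_sumr scaler_sumr; apply: eq_bigr => j _.
  rewrite -!scalerAl -scalerAr !scalerA; congr (_ *: _).
  have zj : z ^+ j != 0 by rewrite expf_neq0.
  apply: (mulIf zj); rewrite -exprD subnK; last first.
    by rewrite (leq_trans (ltnW (ltn_ord j))) // leq_addr.
  rewrite !exprVn invrK exprD; move: (z ^+ N) (z ^+ j) zN zj (z ^+ K) (z ^+ i) => p q p0 q0 r s.
  by field; rewrite p0 q0.
transitivity (\sum_(l < K + K) \sum_(i < K) \sum_(j < K | (i + K == j + l)%N) z ^+ l *: (e i * y * e j)).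
  rewrite [RHS]exchange_big; apply: eq_bigr => i _ /=.
  rewrite (exchange_big_dep predT) //=; apply: eq_bigr => j _.
  have lK : (K + i - j < K + K)%N by have := ltn_ord i; have := ltn_ord j; lia.
  rewrite (bigD1 (Ordinal lK)) /=; last by have := ltn_ord j; lia.
  rewrite big1 ?addr0 // => l /andP [/eqP il /eqP ln]; case: ln; apply: val_inj => /=.
  by have := ltn_ord j; lia.
apply: eq_bigr => l _; rewrite scaler_sumr; apply: eq_bigr => i _.
by rewrite scaler_sumr; apply: eq_bigr => j _.
Qed.

(** A polynomial curve with values in a subspace has its coefficients there, and the component is
    such a coefficient, or 0 if no block has the required difference. *)
Lemma component_in (W : {vspace M}) y a b : (forall z, z != 0 -> S z * y * S z^-1 \in W) ->
  component a b y \in W.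
Proof.
move=> SW; have H l : (l < K + K)%N -> component l K y \in W.
  move: l; apply: (@coef_in_vspace _ _ _ _ _ [:: 0]) => z; rewrite inE => z0.
  by rewrite -conj_cochar_mx // memvZ // SW.
have [E|E] := boolP [exists i : 'I_K, exists j : 'I_K, (i + b == j + a)%N]; last first.
  rewrite /component big1 ?mem0v // => i _; rewrite big1 // => j ij.
  by case/negP: E; apply/existsP; exists i; apply/existsP; exists j.
have [i /existsP [j ij]] := existsP E.
have -> : component a b y = component (K + a - b) K y.
  apply: eq_bigr => i' _; apply: eq_bigl => j'.
  by have := ltn_ord i; have := ltn_ord j; move: ij; lia.
by apply: H; have := ltn_ord i; have := ltn_ord j; move: ij; lia.
Qed.

Lemma component_weight y a b z : z != 0 ->
  S z * component a b y = (z ^+ a / z ^+ b) *: (component a b y * S z).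
Proof.
move=> z0; rewrite mulr_sumr mulr_suml scaler_sumr; apply: eq_bigr => i _.
rewrite mulr_sumr mulr_suml scaler_sumr; apply: eq_bigr => j /eqP ij.
rewrite !mulrA cochar_mxl // -!mulrA cochar_mxr // -scalerAl -!scalerAr scalerA; congr (_ *: _).
have zb : z ^+ b != 0 by rewrite expf_neq0.
apply: (mulIf zb); rewrite mulrAC -exprD ij exprD.
by rewrite [RHS]mulrAC divfK // mulrA [z ^+ j * _]mulrC.
Qed.

(** The trace pairs a weight only with its opposite, so the other components of y do not
    contribute. *)
Lemma component_trace x y a b :
    (forall z, z != 0 -> S z * x = (z ^+ b / z ^+ a) *: (x * S z)) ->
  \tr (x *m component a b y) = \tr (x *m y).
Proof.
move=> wx; rewrite {2}(orth_idem_decomp ee y) !mulmx_sumr !raddf_sum; apply: eq_bigr => i _ /=.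
rewrite !mulmx_sumr !raddf_sum [RHS](bigID (fun j : 'I_K => (i + b == j + a)%N)) /=.
rewrite [X in _ + X]big1 ?addr0 // => j ij.
have E : e j * x * e i = 0 by apply: (weight_block ee wx); rewrite // eq_sym.
have -> : x *m (e i * y * e j) = (x * e i * y) *m e j by rewrite -[RHS]/(x * e i * y * e j) -!mulrA.
by rewrite mxtrace_mulC -[e j *m _]/(e j * _) !mulrA E mul0r raddf0.
Qed.

Lemma component_comm u y a b : (forall z, z != 0 -> S z * u = u * S z) ->
  component a b (u * y) = u * component a b y /\ component a b (y * u) = component a b y * u.
Proof.
move=> Su; have eu k : (k < K)%N -> e k * u = u * e k by apply: (cochar_comm ee Su).
split; rewrite ?mulr_sumr ?mulr_suml; apply: eq_bigr => i _; rewrite ?mulr_sumr ?mulr_suml;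
  apply: eq_bigr => j _.
  by rewrite !mulrA eu.
by rewrite -!mulrA eu // !mulrA.
Qed.

Lemma componentZ c y a b : component a b (c *: y) = c *: component a b y.
Proof.
rewrite scaler_sumr; apply: eq_bigr => i _; rewrite scaler_sumr; apply: eq_bigr => j _.
by rewrite -scalerAr -scalerAl.
Qed.

Lemma tangent_component y :
  bracket (cochar_tangent K N e) y = \sum_(l < K + K) (l%:R - K%:R) *: component l K y.
Proof.
apply: (block_eq ee) => i j iK jK.
have tl' : e i * cochar_tangent K N e = (i%:R - N%:R) *: e i := cochar_tangentr N ee iK.
have tr : cochar_tangent K N e * e j = (j%:R - N%:R) *: e j := cochar_tangentl N ee jK.
have -> : e i * bracket (cochar_tangent K N e) y * e j = (i%:R - j%:R) *: (e i * y * e j).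
  rewrite bracketE mulrBr mulrBl !mulrA tl' -!mulrA tr.
  by rewrite -scalerAl -!scalerAr -scalerBl; congr (_ *: _); ring.
have ce l : e i * component l K y * e j = if (i + K == j + l)%N then e i * y * e j else 0.
  have [_ eM] := ee.
  rewrite /component mulr_sumr mulr_suml (bigD1 (Ordinal iK)) //= [X in _ + X]big1 ?addr0 => [|i' i'i]; last first.
    rewrite mulr_sumr mulr_suml big1 // => j' _; rewrite !mulrA eM //.
    by rewrite -[i == _]/(val (Ordinal iK) == val i') val_eqE eq_sym (negPf i'i) !mul0r.
  rewrite big_mkcond mulr_sumr mulr_suml (bigD1 (Ordinal jK)) //= big1 ?addr0 => [|j' j'j]; last first.
    case: ifP => _; rewrite ?mulr0 ?mul0r // -!mulrA eM //.
    by rewrite -[_ == j]/(val j' == val (Ordinal jK)) val_eqE (negPf j'j) !mulr0.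
  case: ifP => _; rewrite ?mulr0 ?mul0r // !mulrA eM // eqxx -!mulrA eM // eqxx //.
have lK : (K + i - j < K + K)%N by lia.
rewrite mulr_sumr mulr_suml (bigD1 (Ordinal lK)) //= big1 ?addr0 => [|l lE].
  rewrite -scalerAr -scalerAl ce ifT; last by lia.
  by congr (_ *: _); rewrite natrB ?natrD; [ring | lia].
rewrite -scalerAr -scalerAl ce ifF ?scaler0 //; apply/negP => /eqP E; case/eqP: lE; apply: val_inj => /=; lia.
Qed.

Lemma tangent_bracket_in (W : {vspace M}) y : (forall z, z != 0 -> S z * y * S z^-1 \in W) ->
  bracket (cochar_tangent K N e) y \in W.
Proof.
by move=> SW; rewrite tangent_component memv_suml // => l _; rewrite memvZ // component_in.
Qed.

End Components.

Section Filtration.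
Context {C : numClosedFieldType} {n : nat}.
Local Notation M := 'M[C]_n.+1.

(** The bracket is the linear coefficient of the polynomial exp(s x) y exp(- s x) in s. *)
Lemma nexp_bracket_in (W : {vspace M}) x y : x ^+ n.+1 = 0 ->
  (forall s, nexp (s *: x) * y * nexp (- (s *: x)) \in W) -> bracket x y \in W.
Proof.
move=> xn xW; have xn' : (- x) ^+ n.+1 = 0 by rewrite exprNn xn mulr0.
pose p := nexp_poly x * y%:P * nexp_poly (- x).
have p1 : p`_1 = bracket x y.
  rewrite coefM !big_ord_recl big_ord0 /= /bump /= !coefMC !(coef_nexp_poly _ xn) !(coef_nexp_poly _ xn').
  rewrite !fact0 factS fact0 muln1 !invr1 !scale1r !expr0 !expr1 mul1r mulr1 addr0 bracketE.
  by rewrite mulrN addrC.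
have pW s : \sum_(k < size p) s ^+ k *: p`_k \in W.
  rewrite -horner_scalarE !horner_scalarM !horner_nexp_poly hornerC scalerN.
  exact: xW.
rewrite -p1; have [p0|p0] := ltnP 1 (size p); last by rewrite nth_default ?mem0v.
by apply: (@coef_in_vspace _ _ _ _ _ [::] _ _ p0) => s _.
Qed.

Lemma nexp_eq1 (x : M) : x ^+ n.+1 = 0 -> (forall s, nexp (s *: x) = 1) -> x = 0.
Proof.
move=> xk xN.
pose a (l : nat) : M := if l == 0%N then 0 else (l`!%:R^-1) *: x ^+ l.
have a0 : forall l, (l < n.+1)%N -> a l = 0.
  apply: (@matrix_coef_eq0 _ _ _ _ _ [::]) => s _.
  have := xN s; rewrite /nexp big_ord_recl expr0 fact0 invr1 scale1r => /eqP.
  rewrite -subr_eq0 addrAC subrr add0r => /eqP E.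
  rewrite big_ord_recl scaler0 add0r -[RHS]E; apply: eq_bigr => i _.
  by rewrite /a /= exprZn !scalerA mulrC.
have [n1|n1] := ltnP 1 n.+1; first by have := a0 1%N n1; rewrite /a /= expr1 factS fact0 muln1 invr1 scale1r.
have e1 : n.+1 = 1%N by apply/eqP; rewrite eqn_leq n1.
by rewrite -[x]expr1 -[X in x ^+ X]e1.
Qed.

Context (U : {vspace M}) (k : nat).
Hypothesis Uk : (U ^+ k)%VS = 0%VS.

(** The span of all products of at least j elements of U, for positive j the j-th power of the
    nonunital algebra generated by U; k summands suffice because U ^+ k = 0. *)
Definition filt j := (\sum_(i < k) U ^+ (j + i))%VS.

Lemma filt_expv i j : (j <= i)%N -> (U ^+ i <= filt j)%VS.
Proof.
move=> ji; have [ik|ki] := ltnP i k; last by rewrite (expv_eq0 Uk ki) sub0v.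
have ijk : (i - j < k)%N by rewrite (leq_ltn_trans (leq_subr _ _)).
by have := @sumv_sup _ _ _ (Ordinal ijk) predT (U ^+ i)%VS (fun l : 'I_k => (U ^+ (j + l))%VS); rewrite /= subnKC //; apply.
Qed.

Lemma filt_mono i j : (j <= i)%N -> (filt i <= filt j)%VS.
Proof.
by move=> ji; apply/subv_sumP => l _; apply: filt_expv; rewrite (leq_trans ji) // leq_addr.
Qed.

Lemma filt_mul i j x y : x \in filt i -> y \in filt j -> x * y \in filt (i + j).
Proof.
move=> /memv_sumP [f fU ->] /memv_sumP [g gU ->].
rewrite mulr_suml memv_suml // => a _; rewrite mulr_sumr memv_suml // => b _.
have : f a * g b \in (U ^+ ((i + a) + (j + b)))%VS.
  by rewrite expvD memv_mul ?fU ?gU.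
by apply/subvP; apply: filt_expv; rewrite addnACA leq_addr.
Qed.

Lemma filt_mulW i j l x y : (l <= i + j)%N -> x \in filt i -> y \in filt j -> x * y \in filt l.
Proof. by move=> lij xi yj; apply: (subvP (filt_mono lij)); exact: filt_mul. Qed.

Lemma bracket_sub1 (x y : M) : (x - 1) * (y - 1) - (y - 1) * (x - 1) = x * y - y * x.
Proof.
rewrite !mulrBr !mulrBl !mulr1 !mul1r; move: (x * y) (y * x) => p q.
by apply/matrixP => i j; rewrite !mxE; ring.
Qed.

Lemma mul_sub1 (x y : M) : x * y - 1 = (x - 1) * (y - 1) + (x - 1) + (y - 1).
Proof. by rewrite mulrBr mulr1 mulrBl mul1r subrK addrA subrK. Qed.

Lemma filt_eq0 j : (k <= j)%N -> filt j = 0%VS.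
Proof.
move=> kj; apply/eqP; rewrite -subv0; apply/subv_sumP => l _.
by rewrite (expv_eq0 Uk) // (leq_trans kj) // leq_addr.
Qed.

Lemma filt_exp x i : x \in filt 1 -> x ^+ i.+1 \in filt i.+1.
Proof.
move=> x1; elim: i => [|i IH]; first by rewrite expr1.
by rewrite exprS -[i.+2]add1n filt_mul.
Qed.

Lemma filt_nilp x : x \in filt 1 -> x ^+ k = 0.
Proof.
move=> x1; have [k0|k0] := posnP k.
  have := memv_line (1 : M); rewrite -[<[_]>%VS]/(U ^+ 0)%VS -k0 Uk memv0 oner_eq0 //.
by move: (filt_exp k.-1 x1); rewrite prednK // filt_eq0 // memv0 => /eqP.
Qed.

Lemma filt_exp_mem x i : (0 < i)%N -> x \in filt 1 -> x ^+ i \in filt 1.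
Proof.
case: i => // i _ x1; apply: (subvP (filt_mono (isT : (1 <= i.+1)%N))); exact: filt_exp.
Qed.

Lemma filt_inv x : x \in filt 1 -> exists2 s, (1 + x) * s = 1 & s - 1 \in filt 1.
Proof.
move=> x1; have xk := filt_nilp x1; have nx1 : - x \in filt 1 by rewrite rpredN.
exists (\sum_(i < k) (- x) ^+ i).
  rewrite [1 + x]addrC.
  by have := subrX1 (- x) k; rewrite exprNn xk mulr0 sub0r -opprD mulNr => /oppr_inj <-.
have k1 : (0 < k)%N by rewrite lt0n; apply: contra_eq_neq xk => ->; rewrite expr0 oner_neq0.
have -> : \sum_(i < k) (- x) ^+ i = 1 + \sum_(i < k.-1) (- x) ^+ i.+1.
  by case: (k) k1 => // k' _; rewrite big_ord_recl expr0.
rewrite addrC addKr memv_suml // => i _; exact: filt_exp_mem.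
Qed.

End Filtration.

Section Powers.
Context {C : numClosedFieldType} {n : nat}.
Local Notation M := 'M[C]_n.+1.

Definition binomial_poly i : {poly C} := (i`!%:R^-1) *: \prod_(l < i) ('X - (l%:R)%:P).

Lemma horner_binomial_poly i m : (binomial_poly i).[m%:R] = 'C(m, i)%:R.
Proof.
have fi : (i`!%:R : C) != 0 by rewrite pnatr_eq0 -lt0n fact_gt0.
apply: (mulfI fi); rewrite hornerZ mulVKf // -natrM mulnC bin_ffact horner_prod.
elim: i {fi} => [|i IH]; first by rewrite big_ord0.
rewrite big_ord_recr /= IH hornerXsubC ffactnSr natrM.
have [im|mi] := leqP i m; first by rewrite natrB.
by rewrite ffact_small // !mul0r.
Qed.

(** The binomial series of (1 + x)^t for nilpotent x: a polynomial curve through the powers of a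
    unipotent matrix. *)
Definition power_curve k (x : M) (t : C) : M := \sum_(i < k) (binomial_poly i).[t] *: x ^+ i.

Lemma power_curve_nat k x m : x ^+ k = 0 -> power_curve k x m%:R = (1 + x) ^+ m.
Proof.
move=> xk; have H l : (k <= l)%N -> power_curve k x m%:R = power_curve l x m%:R.
  move=> kl; rewrite /power_curve (big_ord_widen _ (fun i => (binomial_poly i).[m%:R] *: x ^+ i) kl).
  rewrite big_mkcond; apply: eq_bigr => i _; case: ltnP => // ki.
  by rewrite -(subnK ki) exprD xk mulr0 scaler0.
rewrite (H (k + m.+1)%N) ?leq_addr // exprDn_comm; last exact: commr_sym (commr1 _).
rewrite (big_ord_widen _ (fun i => 1 ^+ (m - i) * x ^+ i *+ 'C(m, i)) (leq_addl k m.+1)).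
rewrite big_mkcond; apply: eq_bigr => i _; rewrite horner_binomial_poly scaler_nat expr1n mul1r.
by case: ltnP => // mi; rewrite bin_small.
Qed.

Lemma power_curve0 k x : (0 < k)%N -> power_curve k x 0 = 1.
Proof.
case: k => // k _; rewrite /power_curve big_ord_recl /= expr0.
have H i : (binomial_poly i).[0] = 'C(0, i)%:R by rewrite -horner_binomial_poly.
rewrite H bin0 scale1r big1 ?addr0 // => i _.
by rewrite H /= scale0r.
Qed.

End Powers.

(** * Connectedness through polynomial curves *)

Section ZariskiConnected.
Context {R : realType}.
Local Notation C := R[i].

(** If disjoint closed sets separated g from 1, an equation of one not holding at g and an equation
    of the other not holding at 1 would have product zero along the curve. One of the two
    polynomials would vanish identically, against its value at an end point. *)
Lemma zconnected_curves n (S : set 'M[C]_n) : S `<=` [set g | g \in unitmx] -> S 1%:M ->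
    (forall g, S g -> exists gamma : C -> 'M[C]_n, [/\ forall t, S (gamma t),
      forall i j, exists q : {poly C}, forall t, gamma t i j = q.[t],
      gamma 0 = 1%:M & gamma 1 = g]) ->
  zconnected S.
Proof.
move=> Su S1 Sc.
suff H Z1 Z2 : zclosed Z1 -> zclosed Z2 -> S `<=` Z1 `|` Z2 -> S `&` Z1 `&` Z2 = set0 ->
    Z1 1%:M -> S `<=` Z1.
  move=> Z1 Z2 c1 c2 S12 S0; have [h|h] := S12 _ S1; [left|right].
    exact: (H Z1 Z2).
  apply: (H Z2 Z1) => //; first by rewrite setUC.
  by rewrite -setIA [Z2 `&` Z1]setIC setIA.
move=> [F1 rF1 Z1E] [F2 rF2 Z2E] S12 S0 Z11 g Sg.
have [gamma [Sgamma pg g0 g1]] := Sc g Sg.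
have pol f : regular f -> exists N (q : {poly C}), forall t, f (gamma t) * (\det (gamma t)) ^+ N = q.[t].
  move=> /regular_polyfun [N [p [Pp pE]]]; have [q qE] := polyfun_curve pg Pp.
  by exists N, q => t; rewrite pE ?qE //; exact: Su.
have du t N : (\det (gamma t)) ^+ N != 0.
  by rewrite expf_neq0 // -unitfE -unitmxE; exact: Su.
have [//|nZ1] := pselect (Z1 g).
have [f1 F1f f1g] : exists2 f, F1 f & f g <> 0.
  apply: contrapT => H; apply: nZ1; rewrite Z1E; split; first exact: Su.
  by move=> f Ff; apply: contrapT => fg; apply: H; exists f.
have nZ2 : ~ Z2 1%:M by move=> h; suff : (set0 : set 'M[C]_n) 1%:M by []; rewrite -S0.
have [f2 F2f f21] : exists2 f, F2 f & f 1%:M <> 0.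
  apply: contrapT => H; apply: nZ2; rewrite Z2E; split; first exact: unitmx1.
  by move=> f Ff; apply: contrapT => fg; apply: H; exists f.
have [N1 [q1 q1E]] := pol f1 (rF1 _ F1f).
have [N2 [q2 q2E]] := pol f2 (rF2 _ F2f).
have : q1 * q2 = 0.
  apply: (@poly_eq0_of_infinite _ _ [::]) => t _.
  rewrite hornerM -q1E -q2E; have [] := S12 _ (Sgamma t).
    by rewrite Z1E => -[_ /(_ f1 F1f) ->]; rewrite !mul0r.
  by rewrite Z2E => -[_ /(_ f2 F2f) ->]; rewrite mul0r mulr0.
move/eqP; rewrite mulf_eq0 => /orP [] /eqP q0.
  have /eqP := q1E 1; rewrite q0 horner0 mulf_eq0 (negPf (du _ _)) orbF g1 => /eqP; exact.
have /eqP := q2E 0; rewrite q0 horner0 mulf_eq0 (negPf (du _ _)) orbF g0 => /eqP; exact.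
Qed.

End ZariskiConnected.

Section NilpotentIdeal.
Context {R : realType} {n : nat} (G : agroup R n.+1).
Local Notation C := R[i].
Local Notation M := 'M[C]_n.+1.
Context (U : {vspace M}) (k : nat).
Hypothesis Uk : (U ^+ k)%VS = 0%VS.
Hypothesis GU : forall g x, gset G g -> x \in U -> intm g x \in U.

Local Notation F := (filt U k).

Definition unipotent_part j : set M := [set g | gset G g /\ g - 1 \in F j].

Lemma filt_intm g x j : gset G g -> x \in F j -> intm g x \in F j.
Proof.
move=> Gg; have gu : g \in unitmx by have [+ _ _ _] := gset_group G; apply.
pose c x := intm g x.
have cl : linear c by move=> a u v; rewrite /c /intm mulmxDr mulmxDl -scalemxAr -scalemxAl.
pose L := GRing.isLinear.Build _ _ _ _ c cl.
pose f : {linear M -> M} := HB.pack c L.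
have fM u v : f (u * v) = f u * f v.
  change (g *m (u *m v) *m invmx g = (g *m u *m invmx g) *m (g *m v *m invmx g)).
  by rewrite !mulmxA mulmxKV.
have fU l : forall x, x \in (U ^+ l)%VS -> f x \in (U ^+ l)%VS.
  elim: l => [|l IH] y.
    rewrite expv0 => /vlineP [a ->]; rewrite linearZ memvZ //= /c /intm mulmx1 mulmxV //.
    exact: memv_line.
  rewrite expvSr; apply: prodv_linear => u v /IH uU vU.
  by rewrite fM memv_mul //; exact: GU.
move=> /memv_sumP [h hU ->]; rewrite -[intm _ _]/(f _) linear_sum memv_suml // => i _.
by rewrite (subvP (filt_expv _ (leq_addr i j))) // fU // hU.
Qed.

Lemma unipotent_part_mono i j : (i <= j)%N -> unipotent_part j `<=` unipotent_part i.
Proof. by move=> ij g [Gg gF]; split=> //; apply: (subvP (filt_mono Uk ij)). Qed.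

Lemma unipotent_part_inv g : unipotent_part 1 g -> invmx g - 1 \in F 1.
Proof.
move=> [Gg gF]; have gu : g \in unitmx by have [+ _ _ _] := gset_group G; apply.
have [s] := filt_inv Uk gF; rewrite addrC subrK => gs sF.
by rewrite -(mulKmx gu s) -[g *m s]/(g * s) gs mulmx1 in sF.
Qed.

Fact unipotent_part_group : is_subgroup (unipotent_part 1).
Proof.
have [Gu G1 GM GV] := gset_group G.
split.
- by move=> g [/Gu].
- by split=> //; rewrite subrr mem0v.
- move=> g h [Gg gF] [Gh hF]; split; first exact: GM.
  rewrite -[g *m h]/(g * h) mul_sub1; apply: memvD (hF); apply: memvD (gF).
  exact: (filt_mulW Uk _ gF hF).
- by move=> g ug; split; [apply: GV; case: ug | exact: unipotent_part_inv].
Qed.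

Fact unipotent_part_closed : zclosed (unipotent_part 1).
Proof.
have [FG rFG GE] := gset_closed G.
(* The deviation from the projection expresses membership in a subspace by equations that are affine
   in the entries of g. *)
pose p (g : M) := (g - 1) - projv (F 1) (g - 1).
have pP g : (g - 1 \in F 1) <-> p g = 0.
  split; first by move=> gF; rewrite /p projv_id // subrr.
  by rewrite /p => /eqP; rewrite subr_eq0 => /eqP ->; exact: memv_proj.
have rp i j : regular (fun g => p g i j).
  pose q (g : M) := g - projv (F 1) g.
  have qS g : q g = \sum_a \sum_b g a b *: q (delta_mx a b).
    rewrite /q {1 2}[g]matrix_sum_delta linear_sum /= -sumrB; apply: eq_bigr => a _.
    by rewrite linear_sum -sumrB; apply: eq_bigr => b _; rewrite linearZ /= -scalerBr.
  apply: (@regular_ext _ _ (fun g => \sum_a \sum_b g a b * q (delta_mx a b) i j + (- q 1 i j))).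
    move=> g; have -> : p g = q g - q 1.
      by rewrite /p /q linearB /= !opprB addrACA [RHS]addrACA; congr (_ + _); rewrite addrC.
    have sub (A B : M) : (A - B) i j = A i j - B i j by rewrite !mxE.
    rewrite sub (qS g) summxE; congr (_ - _); apply: eq_bigr => a _.
    by rewrite summxE; apply: eq_bigr => b _; rewrite [RHS]mxE.
  apply: RegAdd; last exact: RegCst.
  apply: regular_sum => a; apply: regular_sum => b; apply: RegMul; last exact: RegCst.
  exact: RegCoord.
exists [set f | FG f \/ exists i j, f = fun g => p g i j].
  by move=> f [|[i [j ->]]]; [exact: rFG | exact: rp].
apply/seteqP; split=> g.
  move=> [+ /pP pg]; rewrite GE => -[gu gF]; split=> // f [/gF //|[i [j ->]]].
  by rewrite pg mxE.
move=> [gu gF]; split; first by rewrite GE; split=> // f Ff; apply: gF; left.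
apply/pP/matrixP => i j; rewrite [RHS]mxE; apply: (gF (fun g => p g i j)).
by right; exists i, j.
Qed.

Definition unipotent_group : agroup R n.+1 := AGroup unipotent_part_closed unipotent_part_group.

Lemma unipotent_group_normal : normal_in unipotent_group G.
Proof.
have [Gu G1 GM GV] := gset_group G.
split=> [g []//|g x Gg [Gx xF]].
split; first exact: GM (GM _ _ Gg Gx) (GV _ Gg).
have -> : intm g x - 1 = intm g (x - 1).
  by rewrite /intm mulmxBr mulmxBl mulmx1 mulmxV //; exact: Gu.
exact: filt_intm.
Qed.

(** The commutator of a and b is 1 + [a - 1, b - 1] a^-1 b^-1, and the bracket lies in step j + j of
    the filtration, which is at least j + 1. *)
Lemma unipotent_derived j : (0 < j)%N ->
  derived_subgroup (unipotent_part j) `<=` unipotent_part j.+1.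
Proof.
have [Gu G1 GM GV] := gset_group G.
move=> j0 g; apply.
  split.
  - by move=> h [/Gu].
  - by split=> //; rewrite subrr mem0v.
  - move=> x h [Gx xF] [Gh hF]; split; first exact: GM.
    rewrite -[x *m h]/(x * h) mul_sub1; apply: memvD (hF); apply: memvD (xF).
    exact: (filt_mulW Uk (leq_addr _ _) xF hF).
  - move=> x xU; split; first by apply: GV; case: xU.
    have [Gx xF] := xU; have x1 : invmx x - 1 \in F 1.
      by apply: unipotent_part_inv; apply: (unipotent_part_mono (isT : (1 <= j.+1)%N)).
    have -> : invmx x - 1 = - ((invmx x - 1) * (x - 1) + (x - 1)).
      rewrite mulrBr mulr1 mulrBl mul1r -[invmx x * x]/(invmx x *m x) mulVmx; last exact: Gu.
      by rewrite -[1%:M]/(1 : M) addrAC addrA subrK subrr sub0r opprK.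
    rewrite rpredN; apply: memvD (xF); exact: (filt_mulW Uk (leq_addl _ _) x1 xF).
move=> a b aU bU; have [Ga aF] := aU; have [Gb bF] := bU.
have ua := Gu _ Ga; have ub := Gu _ Gb.
split; first exact: GM (GM _ _ (GM _ _ Ga Gb) (GV _ Ga)) (GV _ Gb).
have a1 : invmx a - 1 \in F 1 by apply: unipotent_part_inv; exact: (unipotent_part_mono j0).
have b1 : invmx b - 1 \in F 1 by apply: unipotent_part_inv; exact: (unipotent_part_mono j0).
pose c := (a - 1) * (b - 1) - (b - 1) * (a - 1).
have cF : c \in F j.+1.
  have jj : (j.+1 <= j + j)%N by rewrite -addn1 leq_add2l.
  by rewrite memvB //; [exact: (filt_mulW Uk jj aF bF) | exact: (filt_mulW Uk jj bF aF)].
have cFm x : x - 1 \in F 1 -> forall y, y \in F j.+1 -> y * x \in F j.+1.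
  move=> xF y yF; have -> : y * x = y * (x - 1) + y by rewrite mulrBr mulr1 subrK.
  apply: memvD (yF); exact: (filt_mulW Uk (leq_addr _ _) yF xF).
have -> : a *m b *m invmx a *m invmx b - 1 = c * invmx a * invmx b.
  rewrite /c bracket_sub1.
  rewrite !mulrBl; congr (_ - _); rewrite -[b * a * _]/(b *m a *m invmx a) mulmxK //.
  by rewrite -[_ * _]/(b *m invmx b) mulmxV.
exact: cFm b1 _ (cFm _ a1 _ cF).
Qed.

Lemma unipotent_group_solvable : solvable_set (gset unipotent_group).
Proof.
exists k; have H j : iter j (@derived_subgroup R n.+1) (unipotent_part 1) `<=` unipotent_part j.+1.
  elim: j => [|j IH] //= g dg; apply: (@unipotent_derived j.+1) => // K Kg KS.
  by apply: dg => // a b /IH aU /IH bU; exact: KS.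
move=> g /H [_]; rewrite (filt_eq0 Uk) ?leqnSn // memv0 subr_eq0 => /eqP -> //.
Qed.

(** The curve t |-> g^t joins 1 to g. It stays in the closed group because polynomial equations that
    hold at all natural t hold at all t. *)
Lemma unipotent_group_connected : zconnected (gset unipotent_group).
Proof.
have [Nu N1 NM NV] := unipotent_part_group.
apply: zconnected_curves => // g [Gg gF].
have xk := filt_nilp Uk gF.
have k0 : (0 < k)%N.
  by case: k xk => // /eqP; rewrite expr0 oner_eq0.
pose gamma t := power_curve k (g - 1) t.
have gp i j : exists q : {poly C}, forall t, gamma t i j = q.[t].
  exists (\sum_(l < k) ((g - 1) ^+ l) i j *: binomial_poly l) => t.
  rewrite horner_sum summxE; apply: eq_bigr => l _; by rewrite [LHS]mxE [RHS]hornerZ [LHS]mulrC.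
have gm m : gamma m%:R = g ^+ m by rewrite /gamma power_curve_nat // addrC subrK.
have Gm m : unipotent_part 1 (g ^+ m).
  elim: m => [|m IH]; first by rewrite expr0.
  by rewrite exprS; apply: NM.
have g1F t : gamma t - 1 \in F 1.
  have -> : gamma t - 1 = \sum_(l < k) (if l == 0%N :> nat then 0 else (binomial_poly l).[t] *: (g - 1) ^+ l).
    rewrite /gamma /power_curve; case: k k0 => // k' _; rewrite !big_ord_recl /= add0r.
    have -> : binomial_poly 0 = 1 :> {poly C}.
      by rewrite /binomial_poly big_ord0 fact0 invr1 scale1r.
    by rewrite hornerC expr0 scale1r addrC addKr.
  rewrite memv_suml // => l _; case: eqP => [_|/eqP l0]; first exact: mem0v.
  by rewrite memvZ // (filt_exp_mem Uk) // lt0n.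
have gu t : gamma t \in unitmx.
  have [s] := filt_inv Uk (g1F t); rewrite addrC subrK => gs _.
  by have [] := mulmx1_unit gs.
exists gamma; split=> //.
- move=> t; apply: (zclosed_polyfun unipotent_part_closed) => // p Pp pN.
  have [q qE] := polyfun_curve gp Pp; rewrite qE.
  have -> : q = 0; last by rewrite horner0.
  apply/eqP; apply: contraT => q0.
  pose s := [seq (i%:R : C) | i <- iota 0 (size q)].
  have us : uniq s by rewrite map_inj_uniq ?iota_uniq // => a b /eqP; rewrite eqr_nat => /eqP.
  have rs : all (root q) s.
    by apply/allP => _ /mapP [m _ ->]; apply/rootP; rewrite -qE gm pN.
  by have := max_poly_roots q0 rs us; rewrite size_map size_iota ltnn.
- by rewrite /gamma power_curve0.
- by rewrite -[1]/(1%:R) gm expr1.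
Qed.

(** Semisimplicity makes the solvable connected normal subgroup of G inside 1 + [F 1] trivial, and
    it contains exp(s x) for all s. *)
Lemma nilpotent_ideal_trivial x : semisimple G -> x \in U -> lie G x -> x = 0.
Proof.
move=> [_ ss] xU Gx.
have F1 : U = (U ^+ 1)%VS by rewrite expv1.
have xF : x \in F 1 by apply: (subvP (filt_expv Uk (leqnn 1))); rewrite -F1.
have xk := nilpotent_index (filt_nilp Uk xF).
have N1 := ss _ unipotent_group_normal unipotent_group_connected unipotent_group_solvable.
have xN s : nexp (s *: x) = 1.
  have : unipotent_part 1 (nexp (s *: x)).
    split; first exact: nexp_in_group.
    rewrite /nexp big_ord_recl expr0 fact0 invr1 scale1r addrC addKr memv_suml // => i _.
    by rewrite memvZ // (filt_exp_mem Uk) // memvZ.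
  by rewrite -[unipotent_part 1]/(gset unipotent_group) N1.
exact: (nexp_eq1 xk xN).
Qed.

End NilpotentIdeal.

(** * The trace form of a semisimple group *)

Section InnerAutomorphisms.
Context {R : realType} {n : nat}.
Implicit Types (g h x : 'M[R[i]]_n).

Lemma invmx_mulmx g h : g \in unitmx -> h \in unitmx -> invmx (g *m h) = invmx h *m invmx g.
Proof.
move=> gu hu; have ghu : g *m h \in unitmx by rewrite unitmx_mul gu.
have e : (g *m h) *m (invmx h *m invmx g) = 1%:M by rewrite mulmxA mulmxK // mulmxV.
by rewrite -[LHS]mulmx1 -e mulKmx.
Qed.

Lemma intm_comp g h x : g \in unitmx -> h \in unitmx -> intm (g *m h) x = intm g (intm h x).
Proof. by move=> gu hu; rewrite /intm invmx_mulmx // !mulmxA. Qed.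

Lemma intmK g x : g \in unitmx -> intm (invmx g) (intm g x) = x.
Proof. by move=> gu; rewrite /intm invmxK !mulmxA mulVmx // mul1mx mulmxKV. Qed.

End InnerAutomorphisms.

Section Nondegenerate.
Context {R : realType} {n : nat} (G : agroup R n.+1).
Local Notation C := R[i].
Local Notation M := 'M[C]_n.+1.

(** Conjugation by the group permutes its additive and its multiplicative one-parameter subgroups,
    and hence their tangent vectors. *)
Definition integrable (x : M) :=
  (x ^+ n.+1 = 0 /\ forall s, gset G (nexp (s *: x))) \/
  exists K N e, [/\ orth_idem K e, forall z, z != 0 -> gset G (cochar_mx K N e z) &
    x = cochar_tangent K N e].

Let intspan := cid (span_of_pred integrable).

(* The span of the Lie algebras of one-parameter subgroups; unlike for [lie G],
   its stability under brackets is immediate. *)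
Definition intlie : {vspace M} := projT1 intspan.

Lemma integrable_intlie x : integrable x -> x \in intlie.
Proof. by rewrite /intlie; case: intspan => U [h _] /=; exact: h. Qed.

Lemma intlie_sub (W : {vspace M}) : (forall x, integrable x -> x \in W) -> (intlie <= W)%VS.
Proof. by rewrite /intlie; case: intspan => U [_ h] /=; exact: h. Qed.

Lemma nilpotent_intlie x : lie G x -> x ^+ n.+1 = 0 -> x \in intlie.
Proof.
move=> Gx xn; apply: integrable_intlie; left; split=> // s; exact: nexp_in_group.
Qed.

Lemma gset_unit g : gset G g -> g \in unitmx.
Proof. by have [+ _ _ _] := gset_group G; apply. Qed.

Lemma intm_lin (g : M) a x y : intm g (a *: x + y) = a *: intm g x + intm g y.
Proof. by rewrite /intm mulmxDr mulmxDl -scalemxAr -scalemxAl. Qed.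

Lemma intm_mul (g x y : M) : g \in unitmx -> intm g (x *m y) = intm g x *m intm g y.
Proof. by move=> gu; rewrite /intm !mulmxA mulmxKV. Qed.

Lemma intm_bracket (g x y : M) : g \in unitmx -> intm g (bracket x y) = bracket (intm g x) (intm g y).
Proof. by move=> gu; rewrite !bracketE -!intm_mul // /intm mulmxBr mulmxBl. Qed.

Lemma intm_exp (g x : M) l : g \in unitmx -> intm g (x ^+ l) = (intm g x) ^+ l.
Proof.
move=> gu; elim: l => [|l IH]; first by rewrite !expr0 /intm mulmx1 mulmxV.
by rewrite !exprS -[x * _]/(x *m _) intm_mul // IH.
Qed.

Lemma vspace_lin_pred (P : M -> Prop) : P 0 -> (forall a u v, P u -> P v -> P (a *: u + v)) ->
  exists U : {vspace M}, forall v, (v \in U) <-> P v.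
Proof. exact: vspace_of_pred. Qed.

Lemma intlie_ind (P : M -> Prop) : P 0 -> (forall a u v, P u -> P v -> P (a *: u + v)) ->
  (forall x, integrable x -> P x) -> forall x, x \in intlie -> P x.
Proof.
move=> P0 PD Pi x xU; have [U UE] := vspace_lin_pred P0 PD.
by apply/UE; apply: (subvP (intlie_sub _) _ xU) => y /Pi /UE.
Qed.

Lemma intlie_intm g x : gset G g -> x \in intlie -> intm g x \in intlie.
Proof.
move=> Gg; have gu := gset_unit Gg; move: x; apply: intlie_ind => [|a u v hu hv|x ix].
- by rewrite /intm mulmx0 mul0mx mem0v.
- by rewrite intm_lin memvD ?memvZ.
have [_ G1 GM GV] := gset_group G.
have Gi h : gset G h -> gset G (intm g h) by move=> Gh; exact: GM (GM _ _ Gg Gh) (GV _ Gg).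
apply: integrable_intlie; case: ix => [[xn Gx]|[K [N [e [ee Ge ->]]]]].
  left; split=> [|s]; first by rewrite -intm_exp // xn /intm mulmx0 mul0mx.
  have -> : s *: intm g x = intm g (s *: x) by rewrite /intm -scalemxAr -scalemxAl.
  by rewrite -[intm g _]/(_ *m _ *m _) -conj_nexp //; exact: Gi.
have isum (I : finType) (c : I -> C) (y : I -> M) : intm g (\sum_i c i *: y i) = \sum_i c i *: intm g (y i).
  rewrite /intm mulmx_sumr mulmx_suml; apply: eq_bigr => i _.
  by rewrite -scalemxAr -scalemxAl.
right; exists K, N, (fun k => intm g (e k)); split.
- have [e1 eM] := ee; split.
    by rewrite -mulmx_suml -mulmx_sumr e1 mulmx1 mulmxV.
  move=> i j iK jK; rewrite -[_ * _]/(_ *m _) -intm_mul // -[_ *m _]/(_ * _) eM //.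
  by case: eqP => // _; rewrite /intm mulmx0 mul0mx.
- by move=> z z0; rewrite -[cochar_mx _ _ _ _]isum; apply: Gi; exact: Ge.
- exact: isum.
Qed.

Lemma intlie_bracket x y : x \in intlie -> y \in intlie -> bracket x y \in intlie.
Proof.
move=> xU yU; move: x xU; apply: intlie_ind => [|a u v hu hv|x ix].
- by rewrite bracket0l mem0v.
- by rewrite bracketDl bracketZl memvD ?memvZ.
case: ix => [[xn Gx]|[K [N [e [ee Ge ->]]]]].
  apply: nexp_bracket_in => // s; rewrite -(invmx_nexp (x := s *: x)); last by rewrite exprZn xn scaler0.
  exact: intlie_intm.
apply: (tangent_bracket_in ee) => z z0.
have -> : cochar_mx K N e z^-1 = invmx (cochar_mx K N e z).
  rewrite -[LHS](mulKmx (gset_unit (Ge _ z0))) -[RHS]mulmx1.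
  congr (_ *m _); exact: (cochar_mxV N ee z0).
exact: intlie_intm (Ge _ z0) yU.
Qed.

Fact radical_exists : exists U : {vspace M},
  forall x, x \in U <-> x \in intlie /\ forall y, y \in intlie -> \tr (x *m y) = 0.
Proof.
apply: vspace_lin_pred => [|a u v [uU hu] [vU hv]]; first by split=> [|y _]; rewrite ?mem0v // mul0mx raddf0.
split=> [|y yU]; first by rewrite memvD ?memvZ.
by rewrite mulmxDl raddfD -scalemxAl /= mxtraceZ hu // hv // mulr0 addr0.
Qed.

Definition radical : {vspace M} := projT1 (cid radical_exists).

Lemma radicalP x : x \in radical <-> x \in intlie /\ forall y, y \in intlie -> \tr (x *m y) = 0.
Proof. by rewrite /radical; case: cid. Qed.

Lemma intm_trace (g x y : M) : g \in unitmx -> \tr (intm g x *m intm g y) = \tr (x *m y).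
Proof. by move=> gu; rewrite -intm_mul // /intm mxtrace_mulC mulKmx. Qed.

Lemma radical_intm g x : gset G g -> x \in radical -> intm g x \in radical.
Proof.
move=> Gg /radicalP [xU xr]; have gu := gset_unit Gg; apply/radicalP; split; first exact: intlie_intm.
have [_ _ _ GV] := gset_group G.
move=> y yU; have -> : y = intm g (intm (invmx g) y) by rewrite -{1}(invmxK g) intmK ?unitmx_inv.
by rewrite intm_trace // xr //; exact: intlie_intm (GV _ Gg) yU.
Qed.

Lemma radical_bracket y r : y \in intlie -> r \in radical -> bracket y r \in radical.
Proof.
move=> yU /radicalP [rU rr]; apply/radicalP; split; first exact: intlie_bracket.
by move=> z zU; rewrite trace_bracketl rr ?oppr0 //; exact: intlie_bracket.
Qed.

Let bspan := cid (@span_of_pred _ _ (fun x => exists y r, [/\ y \in intlie, r \in radical & x = bracket y r])).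

Definition bracket_radical : {vspace M} := projT1 bspan.

Lemma bracket_radical_mem y r : y \in intlie -> r \in radical -> bracket y r \in bracket_radical.
Proof. by rewrite /bracket_radical; case: bspan => U [h _] yU rr /=; apply: h; exists y, r. Qed.

Lemma bracket_radical_ind (P : M -> Prop) : P 0 -> (forall a u v, P u -> P v -> P (a *: u + v)) ->
  (forall y r, y \in intlie -> r \in radical -> P (bracket y r)) ->
  forall x, x \in bracket_radical -> P x.
Proof.
move=> P0 PD Pb x; have [W WE] := vspace_lin_pred P0 PD.
rewrite /bracket_radical; case: bspan => U [_ h] /= xU; apply/WE.
by apply: (subvP (h W _) _ xU) => _ [y [r [yU rr ->]]]; apply/WE; exact: Pb.
Qed.

Lemma bracket_radical_sub x : x \in bracket_radical -> x \in radical.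
Proof.
move: x; apply: bracket_radical_ind => [|a u v hu hv|y r]; first exact: mem0v.
  by rewrite memvD ?memvZ.
exact: radical_bracket.
Qed.

(** Cartan's criterion: for s as in [conj_part], tr ([y, r] s) = tr (r [s, y]) = 0, because ad s
    preserves the Lie algebra and r is in the radical. *)
Lemma bracket_radical_nilpotent x : x \in bracket_radical -> x ^+ n.+1 = 0.
Proof.
move=> xB; have [xU _] := (radicalP x).1 (bracket_radical_sub xB).
have [q [nil st]] := conj_part x; apply: nil; set s := horner_mx x q in st *.
have sU : forall y, y \in intlie -> bracket s y \in intlie.
  by apply: st => y yU; exact: intlie_bracket.
suff H z : z \in bracket_radical -> \tr (z *m s) = 0 by exact: H.
move: z; apply: bracket_radical_ind => [|a u v hu hv|y r yU /radicalP [_ rr]].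
- by rewrite mul0mx raddf0.
- by rewrite mulmxDl raddfD -scalemxAl /= mxtraceZ hu hv mulr0 addr0.
by rewrite trace_bracketl bracketC mulmxN raddfN /= rr ?opprK ?oppr0 //; exact: sU.
Qed.

Lemma bracket_radical_intm g x : gset G g -> x \in bracket_radical -> intm g x \in bracket_radical.
Proof.
move=> Gg; have gu := gset_unit Gg; move: x; apply: bracket_radical_ind => [|a u v hu hv|y r yU rr].
- by rewrite /intm mulmx0 mul0mx mem0v.
- by rewrite intm_lin memvD ?memvZ.
rewrite intm_bracket //.
by apply: bracket_radical_mem; [exact: intlie_intm | exact: radical_intm].
Qed.

(** For every polynomial s in x, m tr (x s) = tr ([h, x] s) = tr (h [x, s]) = 0; [conj_part]
    supplies the s to use. *)
Lemma eigen_nilpotent (h x : M) (m : C) : m != 0 -> bracket h x = m *: x -> x ^+ n.+1 = 0.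
Proof.
move=> m0 hx; have [q [nil _]] := conj_part x; apply: nil; set s := horner_mx x q.
have xs : bracket x s = 0.
  apply/eqP; rewrite bracket_eq0; apply/eqP/comm_mx_horner; exact: comm_mx_refl.
apply: (mulfI m0); rewrite mulr0 -mxtraceZ scalemxAl -hx bracketC.
rewrite mulNmx raddfN /= trace_bracketl xs mulmx0 raddf0 !oppr0 //.
Qed.

(** The nonzero eigenvalue is what moves x from the radical into the nilpotent ideal of brackets: x
    = m^-1 [h, x]. *)
Lemma semisimple_nondegenerate h x (m : C) : semisimple G -> lie G x -> x != 0 ->
    h \in intlie -> m != 0 -> bracket h x = m *: x ->
  exists2 y, y \in intlie & \tr (x *m y) != 0.
Proof.
move=> ss Gx x0 hU m0 hx; apply: contrapT => noy.
have xn := eigen_nilpotent m0 hx.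
have xU : x \in intlie by exact: nilpotent_intlie.
have xr : x \in radical.
  apply/radicalP; split=> // y yU; apply/eqP; apply: contraT => h0.
  by case: noy; exists y.
have xB : x \in bracket_radical.
  by rewrite -[x](scalerK m0) -hx memvZ //; exact: bracket_radical_mem.
have brB u v : u \in bracket_radical -> v \in bracket_radical -> bracket u v \in bracket_radical.
  move=> uB vB; apply: bracket_radical_mem; last exact: bracket_radical_sub.
  by have [] := (radicalP u).1 (bracket_radical_sub uB).
have nilB u : u \in bracket_radical -> exists k, u ^+ k = 0.
  by move=> /bracket_radical_nilpotent; exists n.+1.
have [k Uk] := engel brB nilB.
case/eqP: x0; exact: (nilpotent_ideal_trivial Uk bracket_radical_intm ss xB Gx).
Qed.

Lemma integrable_lie x : integrable x -> lie G x.
Proof.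
case=> [[xn Gx]|[K [N [e [ee Ge ->]]]]]; first exact: nexp_tangent.
have [l lE] := cochar_ahom ee Ge.
by have [/differential_lie ? _] := cochar_differential lE.
Qed.

Lemma intlie_lie x : x \in intlie -> lie G x.
Proof.
move: x; apply: intlie_ind; [exact: lie0 | by move=> a u v; exact: lie_add | exact: integrable_lie].
Qed.

End Nondegenerate.

(** * Roots *)

Section Tangent.
Context {R : realType} {n : nat}.
Local Notation C := R[i].
Local Notation M := 'M[C]_n.+1.

Definition gm_derivation : (pts (Gm R) -> C) -> C := projT1 (cid2 (@pt_derivation_gm R)).

Lemma gm_derivationP : point_derivation gm_derivation.
Proof. by rewrite /gm_derivation; case: cid2. Qed.

Lemma gm_derivationE f N (q : {poly C}) : (forall z, z != 0 -> f (gm z) * z ^+ N = q.[z]) ->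
  gm_derivation f = q^`().[1] - q.[1] * N%:R.
Proof. by rewrite /gm_derivation; case: cid2 => D DP DE /=; exact: DE. Qed.

Lemma gm_derivation_coord (i j : 'I_1) : gm_derivation (fun x => x i j) = (1%:M : 'M[C]_1) i j.
Proof.
rewrite !ord1 [RHS]mxE eqxx mulr1n (@gm_derivationE _ 0%N 'X) => [|z z0].
  by rewrite derivX hornerC mulr0 subr0.
by rewrite pval_gm // mxE eqxx mulr1n expr0 mulr1 hornerX.
Qed.

Section Group.
Context (G : agroup R n.+1).

Definition tangent (l : ahom (tgrp (rtor (Gm R))) G) : M :=
  \matrix_(i, j) gm_derivation (fun x => l x i j).

Lemma tangentP l : is_differential l 1%:M (tangent l).
Proof.
exists gm_derivation; split=> [|i j|i j]; first exact: gm_derivationP.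
  exact: gm_derivation_coord.
by rewrite [RHS]mxE.
Qed.

Lemma tangent_cochar (l : ahom (tgrp (rtor (Gm R))) G) K N (e : nat -> M) :
  (forall z, z != 0 -> pval (l (gm z)) = cochar_mx K N e z) ->
  tangent l = cochar_tangent K N e.
Proof. by move=> lE; have [_] := cochar_differential lE; apply; exact: tangentP. Qed.

Lemma tangent_uniq l Y : is_differential l 1%:M Y -> Y = tangent l.
Proof.
move=> lY; have [K [N [e [_ lE]]]] := cochar_decomp l.
have [_ h] := cochar_differential lE.
by rewrite (h _ lY) (h _ (tangentP l)).
Qed.

End Group.

Lemma tangentD (T : torus R n.+1) (l l' : X_*(T)) : tangent (l + l') = tangent l + tangent l'.
Proof.
apply/matrixP => i j; rewrite [LHS]mxE [RHS]mxE [X in _ = X + _]mxE [X in _ = _ + X]mxE.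
have DP := gm_derivationP.
have rl (k : X_*(T)) a b : regular_on (fun x => k x a b) by exact: ahom_regular.
have -> : (fun x => (l + l') x i j) = (fun x => \sum_k l x i k * l' x k j).
  by apply/funext => x; rewrite -[pval _]/(l x *m l' x) mxE.
rewrite (derivation_sum DP) => [|k]; last exact: regular_on_mul.
transitivity (\sum_k ((i == k)%:R * gm_derivation (fun x => l' x k j) +
                      gm_derivation (fun x => l x i k) * (k == j)%:R)).
  apply: eq_bigr => k _; rewrite (derivation_mul DP) // !ahom1.
  by rewrite -[pval (pt1 T)]/(1%:M) !mxE.
rewrite big_split addrC /=; congr (_ + _).
  rewrite (bigD1 i) //= eqxx mul1r big1 ?addr0 // => k; rewrite eq_sym => /negPf ->; exact: mul0r.
rewrite (bigD1 j) //= eqxx mulr1 big1 ?addr0 // => k /negPf ->; exact: mulr0.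
Qed.

Lemma tangentN (T : torus R n.+1) (l : X_*(T)) : tangent (- l) = - tangent l.
Proof.
have t0 : tangent (0 : X_*(T)) = 0 by apply: addr_idem_eq0; rewrite -tangentD addr0.
by apply: (addrI (tangent l)); rewrite -tangentD !subrr.
Qed.

(** The tangent of a cocharacter has integer eigenvalues, so the trace of its square is a sum of
    nonnegative terms. *)
Lemma tangent_eq0 (T : torus R n.+1) (l : X_*(T)) : \tr (tangent l *m tangent l) = 0 -> l = 0.
Proof.
move=> tl; have [K [N [e [ee lE]]]] := cochar_decomp l.
have := tangent_square_trace N ee; rewrite -(tangent_cochar lE) => /leifP.
case: ifP => [/forallP h _|_]; last by rewrite -[tangent l * _]/(_ *m _) tl ltxx.
apply: ahom_eq => x; have [x0 ->] := pt_gm x; apply: pval_inj; rewrite lE //.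
rewrite (@cochar_mx_trivial _ _ K N e ee) // => k; have /orP [/eqP|/eqP] := h k; by [left|right].
Qed.

Lemma int_split (m : int) : exists a b : nat, m = a%:Z - b%:Z.
Proof.
by case: m => k; [exists k, 0%N; rewrite subr0 | exists 0%N, k.+1; rewrite NegzE sub0r].
Qed.

Lemma intm_eqP (g Y : M) (c : C) : g \in unitmx ->
  (intm g Y = c *: Y) <-> (g *m Y = c *: (Y *m g)).
Proof.
move=> gu; split=> [E|E].
  by rewrite scalemxAl -E /intm mulmxKV.
by rewrite /intm E -scalemxAl mulmxK.
Qed.

End Tangent.

Section Weights.
Context {R : realType} {n : nat} {T : torus R n.+1}.
Local Notation C := R[i].
Local Notation M := 'M[C]_n.+1.
Implicit Types (chi : X^*(T)) (l : X_*(T)) (x y : M).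

Definition has_weight chi x := forall t : pts T, intm t x = chv chi t *: x.

Lemma has_weight_comm chi x (t : pts T) : has_weight chi x -> t *m x = chv chi t *: (x *m t).
Proof. by move=> hx; apply/intm_eqP; [exact: pt_unit | exact: hx]. Qed.

Lemma has_weight_bracket chi psi x y : has_weight chi x -> has_weight psi y ->
  has_weight (chi + psi) (bracket x y).
Proof.
move=> hx hy t; rewrite intm_bracket ?pt_unit // hx hy bracketZl bracketZr scalerA.
by rewrite chvD.
Qed.

Lemma has_weight0 x : has_weight 0 x <-> forall t : pts T, t *m x = x *m t.
Proof.
split=> [hx t|hx t]; first by rewrite (has_weight_comm t hx) chv0 scale1r.
by apply/intm_eqP; [exact: pt_unit | rewrite chv0 scale1r hx].
Qed.

Lemma has_weight_lin chi a x y : has_weight chi x -> has_weight chi y ->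
  has_weight chi (a *: x + y).
Proof. by move=> hx hy t; rewrite intm_lin hx hy scalerDr !scalerA mulrC. Qed.

Lemma has_weight_zero chi : has_weight chi 0.
Proof. by move=> t; rewrite /intm mulmx0 mul0mx scaler0. Qed.

Lemma chv_cochar chi l a b z : pairing chi l = a%:Z - b%:Z -> z != 0 ->
  chv chi (l (gm z)) = z ^+ a / z ^+ b.
Proof. by move=> E z0; rewrite pairingP // E expfzDr // -exprnN. Qed.

Lemma has_weight_tangent chi x l : has_weight chi x ->
  bracket (tangent l) x = (pairing chi l)%:~R *: x.
Proof.
move=> hx; have [K [N [e [ee lE]]]] := cochar_decomp l.
have [a [b ab]] := int_split (pairing chi l).
rewrite (tangent_cochar lE) (@weight_tangent _ _ _ _ _ ee _ a b) => [|z z0].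
  by rewrite ab rmorphB.
by rewrite -lE // -(chv_cochar ab) //; exact: has_weight_comm.
Qed.

Lemma chv_prod r (c : 'I_r -> X_*(T)) chi (u : 'rV[C]_r) :
  chv chi (\sum_k c k (gm (u ord0 k))) = \prod_k chv chi (c k (gm (u ord0 k))).
Proof. by apply: (big_morph (chv chi)) => [t t'|]; [exact: chvM | exact: chv1]. Qed.

Lemma has_weight_coord r (c : 'I_r -> X_*(T)) chi x :
    (forall t : pts T, exists2 u : 'rV[C]_r, nonzero u & t = \sum_k c k (gm (u ord0 k))) ->
    (forall k z, z != 0 -> intm (c k (gm z)) x = chv chi (c k (gm z)) *: x) ->
  has_weight chi x.
Proof.
move=> cP cx t; have [u u0 ->] := cP t.
elim/big_rec: _ => [|k s _ IH].
  by rewrite chv1 scale1r /intm -[pval 0]/(1%:M) mul1mx invmx1 mulmx1.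
rewrite -[pval _]/(c k (gm (u ord0 k)) *m s) intm_comp ?pt_unit //.
by rewrite IH chvM mulrC -scalerA -cx // /intm -scalemxAr -scalemxAl.
Qed.

Lemma pairing_neq0 chi : chi <> 0 -> exists l, pairing chi l != 0.
Proof.
move=> chi0; apply: contrapT => no; apply: chi0; apply: ahom_eq => t.
have [r [c cP]] := torus_coord T; have [u u0 tE] := cP t.
apply: pval_inj; rewrite [LHS]mx11_scalar -/(chv chi t) tE chv_prod big1 // => k _.
rewrite pairingP //; suff -> : pairing chi (c k) = 0 by rewrite expr0z.
by apply/eqP; apply: contraT => h; case: no; exists (c k).
Qed.

End Weights.

Lemma pairing0l (R : realType) n (T : torus R n) (l : X_*(T)) : pairing (0 : X^*(T)) l = 0.
Proof. by apply: pairing_eq => z z0; rewrite chv0 expr0z. Qed.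

Lemma sl2_weyl_in_group (R : realType) n (G : agroup R n.+1) (x y : 'M[R[i]]_n.+1) :
  x ^+ n.+1 = 0 -> y ^+ n.+1 = 0 -> lie G x -> lie G y -> forall z, gset G (sl2_weyl x y z).
Proof.
move=> xn yn Gx Gy z; have [_ _ GM _] := gset_group G; rewrite /sl2_weyl -scaleNr.
exact: GM (GM _ _ (nexp_in_group z Gx xn) (nexp_in_group _ Gy yn)) (nexp_in_group z Gx xn).
Qed.

Section Roots.
Context {R : realType} {n : nat} (G : agroup R n.+1) (T : torus R n.+1).
Local Notation C := R[i].
Local Notation M := 'M[C]_n.+1.
Hypothesis ss : semisimple G.
Hypothesis Tmax : maximal_torus G T.
Implicit Types (chi alpha beta : X^*(T)) (l : X_*(T)) (x y : M).

Lemma torus_sub (t : pts T) : gset G t.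
Proof. by case: Tmax => TG _; apply: TG; exact: pvalP. Qed.

Lemma tangent_intlie l : tangent l \in intlie G.
Proof.
have [K [N [e [ee lE]]]] := cochar_decomp l.
apply: integrable_intlie; right; exists K, N, e; split=> //; last exact: tangent_cochar.
by move=> z z0; rewrite -lE //; exact: torus_sub.
Qed.

Lemma weight_space chi : exists U : {vspace M}, forall x,
  x \in U <-> x \in intlie G /\ has_weight chi x.
Proof.
apply: vspace_lin_pred => [|a u v [uU hu] [vU hv]].
  by split; [exact: mem0v | exact: has_weight_zero].
by split; [rewrite memvD ?memvZ | exact: has_weight_lin].
Qed.

(** The vector y is projected to weight - chi for one coordinate cocharacter after another. Each
    projection keeps the trace against x, stays in [intlie G], and preserves the weights already
    fixed because the torus is commutative. *)
Lemma weight_projection chi x y : has_weight chi x -> y \in intlie G -> \tr (x *m y) != 0 ->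
  exists y', [/\ y' \in intlie G, has_weight (- chi) y' & \tr (x *m y') != 0].
Proof.
move=> hx yU xy; have [r [c cP]] := torus_coord T.
suff H (s : seq 'I_r) : exists y', [/\ y' \in intlie G, \tr (x *m y') != 0 &
    forall k, k \in s -> forall z, z != 0 ->
      intm (c k (gm z)) y' = chv (- chi) (c k (gm z)) *: y'].
  have [y' [y'U xy' cy']] := H (enum 'I_r); exists y'; split=> //.
  by apply: (has_weight_coord cP) => k; apply: cy'; rewrite mem_enum.
elim: s => [|k s [w [wU xw cw]]]; first by exists y.
have [K [N [e [ee lE]]]] := cochar_decomp (c k).
have [b [a ba]] := int_split (pairing chi (c k)).
have ab : pairing (- chi) (c k) = a%:Z - b%:Z by rewrite pairingNl ba opprB.
pose w' := component K e a b w; exists w'; split.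
- rewrite /w'; apply: (@component_in _ _ K N e) => z z0.
  have Gz : gset G (cochar_mx K N e z) by rewrite -lE //; exact: torus_sub.
  have -> : cochar_mx K N e z^-1 = invmx (cochar_mx K N e z).
    rewrite -[LHS](mulKmx (gset_unit Gz)) -[RHS]mulmx1; congr (_ *m _).
    exact: (cochar_mxV N ee z0).
  exact: intlie_intm.
- rewrite (component_trace ee w (N := N)) // => z z0.
  rewrite -lE // -(chv_cochar ba) //; exact: has_weight_comm.
move=> l; rewrite inE => /orP [/eqP ->|ls] z z0.
  apply/intm_eqP; first exact: pt_unit.
  by rewrite (chv_cochar ab) // lE //; exact: component_weight.
apply/intm_eqP; first exact: pt_unit.
have lw : pval (c l (gm z)) *m w = chv (- chi) (c l (gm z)) *: (w *m c l (gm z)).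
  by apply/intm_eqP; [exact: pt_unit | exact: cw].
have [|c1 c2] := component_comm ee (N := N) (u := pval (c l (gm z))) w a b.
  move=> v v0; rewrite -lE // -[LHS]/(pval (c k (gm v) + c l (gm z))) addrC //.
rewrite -[LHS]c1 -[w' *m _]c2 -componentZ; congr (component _ _ _ _ _); exact: lw.
Qed.

(** The Jacobson-Morozov lemma is applied to weight spaces inside [intlie G]. The one-parameter
    group of the resulting triple commutes with T, so it is a cocharacter of the maximal torus T. *)
Lemma sl2_root alpha x : alpha <> 0 -> root_space G alpha x -> x <> 0 ->
  exists y av, [/\ root_space G (- alpha) y, tangent av = bracket x y,
    bracket (tangent av) x = x *+ 2, bracket (tangent av) y = - (y *+ 2) &
    pairing alpha av = 2].
Proof.
move=> a0 [Gx wx] /eqP x0; have [l l0] := pairing_neq0 a0.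
pose m : C := (pairing alpha l)%:~R; have m0 : m != 0 by rewrite intr_eq0.
have tw z : has_weight alpha z -> bracket (tangent l) z = m *: z by exact: has_weight_tangent.
have xn := eigen_nilpotent m0 (tw _ wx).
have nondeg z : z \in intlie G -> has_weight alpha z -> z != 0 ->
    exists y, [/\ y \in intlie G, has_weight (- alpha) y & \tr (z *m y) != 0].
  move=> zU wz z0; have [y yU zy] := semisimple_nondegenerate ss (intlie_lie zU) z0 (tangent_intlie l) m0 (tw _ wz).
  exact: weight_projection wz yU zy.
have [Up UpE] := weight_space alpha; have [Um UmE] := weight_space (- alpha).
have [U0 U0E] := weight_space 0.
have xUp : x \in Up by apply/UpE; split=> //; exact: nilpotent_intlie.
have xU : x \in intlie G by have [] := (UpE x).1 xUp.
have tU0 h : h \in U0 -> bracket (tangent l) h = 0.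
  by move=> /U0E [_ wh]; rewrite (has_weight_tangent l wh) pairing0l scale0r.
have xUm y : y \in Um -> bracket x y \in U0.
  move=> /UmE [yU wy]; apply/U0E; split; first exact: intlie_bracket.
  by rewrite -(subrr alpha); exact: has_weight_bracket.
have xU0 h : h \in U0 -> bracket x h \in Up.
  move=> /U0E [hU wh]; apply/UpE; split; first exact: intlie_bracket.
  by rewrite -[alpha]addr0; exact: has_weight_bracket.
have U0Um h y : h \in U0 -> y \in Um -> bracket h y \in Um.
  move=> /U0E [hU wh] /UmE [yU wy]; apply/UmE; split; first exact: intlie_bracket.
  by rewrite -[- alpha]add0r; exact: has_weight_bracket.
have nd z : z \in Up -> (forall y, y \in Um -> \tr (z *m y) = 0) -> z = 0.
  move=> /UpE [zU wz] zUm; apply/eqP; apply: contraT => z0.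
  have [y [yU wy zy]] := nondeg z zU wz z0.
  by case/eqP: zy; apply: zUm; apply/UmE.
have [y yUm /= [hx hy]] := jacobson_morozov xUp xn m0 (tw _ wx) tU0 xUm xU0 U0Um nd.
have [yU wy] := (UmE y).1 yUm.
have yn : y ^+ n.+1 = 0.
  have my0 : - m != 0 by rewrite oppr_eq0.
  apply: (eigen_nilpotent my0 (h := tangent l)).
  by rewrite (has_weight_tangent l wy) pairingNl rmorphN.
have [K [e [e1 he Se]]] := sl2_torus xn yn erefl hx hy (leqnn n).
have [ee te] := eigen_orth_idem e1 he.
have SG z : z != 0 -> gset G (cochar_mx K n e z).
  move=> z0; rewrite [cochar_mx _ _ _ _]Se //.
  have [_ _ GM GV] := gset_group G.
  have Gw v : gset G (sl2_weyl x y v) by exact: sl2_weyl_in_group xn yn Gx (intlie_lie yU) v.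
  exact: GM (Gw z) (GV _ (Gw 1)).
have [_ wh] := (U0E _).1 (xUm y yUm).
(* The point t commutes with [x, y], which has weight 0; [tangent_weight] with a = b = 0 then gives
   commutation with the whole one-parameter group. *)
have ST z (t : pts T) : z != 0 -> cochar_mx K n e z * pval t = pval t * cochar_mx K n e z.
  move=> z0; have := @tangent_weight _ _ K n e ee (pval t) 0 0 _ z z0.
  rewrite !expr0 divr1 scale1r; apply.
  rewrite te subrr scale0r bracketE (_ : _ *m _ = pval t *m bracket x y) ?subrr //.
  exact: esym ((has_weight0 _).1 wh t).
have [av avE] := maximal_torus_cochar Tmax ee SG ST.
have tav : tangent av = bracket x y by rewrite (tangent_cochar avE).
exists y, av; rewrite tav; split=> //.
  by split; [exact: intlie_lie | exact: wy].
have := has_weight_tangent av wx; rewrite tav hx -scaler_nat => /eqP.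
rewrite -subr_eq0 -scalerBl scaler_eq0 (negPf x0) orbF subr_eq0 => /eqP E.
by apply/eqP; rewrite -(eqr_int C) -E.
Qed.

(* tr (d mu . d av) = <alpha, mu> tr (x y) when d av = [x, y]; applied to two
   candidates, this gives tr ((d av - d av')^2) = 0. *)
Lemma coroot_candidate_uniq alpha av av' x y x' y' :
    has_weight alpha x -> has_weight alpha x' ->
    tangent av = bracket x y -> tangent av' = bracket x' y' ->
    pairing alpha av = 2 -> pairing alpha av' = 2 ->
  av = av'.
Proof.
move=> wx wx' ta ta' pa pa'.
have T1 l u v (b : X_*(T)) : has_weight alpha u -> tangent b = bracket u v ->
    \tr (tangent l *m tangent b) = (pairing alpha l)%:~R * \tr (u *m v).
  move=> wu tb; rewrite -mxtraceZ scalemxAl -(has_weight_tangent l wu) tb.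
  by rewrite [bracket (tangent l) u]bracketC mulNmx raddfN /= trace_bracketl opprK.
apply/eqP; rewrite -subr_eq0; apply/eqP/tangent_eq0.
have E1 := T1 av _ _ _ wx ta; have E2 := T1 av' _ _ _ wx ta.
have E3 := T1 av _ _ _ wx' ta'; have E4 := T1 av' _ _ _ wx' ta'.
rewrite pa in E1 E3; rewrite pa' in E2 E4.
rewrite tangentD tangentN trace_sub_square E1 E2 E3 E4; exact: subrr.
Qed.

(** The cocharacter of [sl2_root] satisfies the conditions that define [coroot], and uniqueness
    identifies it with the chosen one, whatever root vector x one starts from. *)
Lemma corootP alpha x : alpha <> 0 -> root_space G alpha x -> x <> 0 ->
  exists y, [/\ root_space G (- alpha) y, tangent (coroot G alpha) = bracket x y,
    bracket (bracket x y) x = x *+ 2, bracket (bracket x y) y = - (y *+ 2) &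
    pairing alpha (coroot G alpha) = 2].
Proof.
move=> a0 rx x0; have [y [av [ry tav hx hy pav]]] := sl2_root a0 rx x0.
suff -> : coroot G alpha = av by exists y; rewrite -tav; split.
rewrite /coroot; case: xgetP => [av' _ [pav' [x' [y' [[_ wx'] _ d']]]]|no].
  have d : tangent av' = bracket x' y' by rewrite bracketE (tangent_uniq d').
  exact: (coroot_candidate_uniq wx' rx.2 d tav pav' pav).
case: (no av); split=> //; exists x, y; split=> //.
by rewrite -bracketE -tav; exact: tangentP.
Qed.

Lemma oppositeP alpha x : alpha <> 0 -> root_space G alpha x -> x <> 0 ->
  [/\ root_space G (- alpha) (opposite G alpha x),
    tangent (coroot G alpha) = bracket x (opposite G alpha x),
    bracket (tangent (coroot G alpha)) x = x *+ 2,
    bracket (tangent (coroot G alpha)) (opposite G alpha x) = - (opposite G alpha x *+ 2) &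
    pairing alpha (coroot G alpha) = 2].
Proof.
move=> a0 rx x0; have [y [ry tav hx hy pav]] := corootP a0 rx x0.
rewrite /opposite; case: xgetP => [y' _ [ry' [h dh [h1 h2 h3]]]|no].
  by have hE := tangent_uniq dh; rewrite -hE !bracketE; split.
case: (no y); split=> //; exists (tangent (coroot G alpha)); first exact: tangentP.
by rewrite tav; split; rewrite -?[LHS]bracketE.
Qed.

Lemma chvMz chi (m : int) (t : pts T) : chv (chi *~ m) t = chv chi t ^ m.
Proof.
have Mn k : chv (chi *+ k) t = chv chi t ^+ k.
  by elim: k => [|k IH]; rewrite ?mulr0n ?chv0 // mulrS chvD IH exprS.
case: m => k; first exact: Mn.
by rewrite NegzE mulrNz chvN -[chi *~ _]/(chi *+ k.+1) Mn -invr_expz.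
Qed.

Section Reflection.
Context (alpha : X^*(T)) (x y : M).
Hypothesis a0 : alpha <> 0.
Hypothesis rx : root_space G alpha x.
Hypothesis ry : root_space G (- alpha) y.
Hypothesis xy : tangent (coroot G alpha) = bracket x y.
Hypothesis hx : bracket (tangent (coroot G alpha)) x = x *+ 2.
Hypothesis hy : bracket (tangent (coroot G alpha)) y = - (y *+ 2).
Hypothesis pa : pairing alpha (coroot G alpha) = 2.

Lemma root_nilpotent : x ^+ n.+1 = 0 /\ y ^+ n.+1 = 0.
Proof.
have t0 : (2%:R : C) != 0 by rewrite pnatr_eq0.
have t0' : - (2%:R : C) != 0 by rewrite oppr_eq0.
split; first by apply: (eigen_nilpotent t0 (h := tangent (coroot G alpha))); rewrite hx scaler_nat.
by apply: (eigen_nilpotent t0' (h := tangent (coroot G alpha))); rewrite hy scaleNr scaler_nat.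
Qed.

Local Notation w := (weyl_mx x y).

Lemma weyl_unit : w \in unitmx.
Proof.
have [xn yn] := root_nilpotent.
exact (weyl_unitmx xn yn).
Qed.

Lemma weyl_in_group : gset G w.
Proof.
have [xn yn] := root_nilpotent; rewrite weyl_mxE -[nexp x](congr1 nexp (scale1r x)) -(congr1 nexp (scale1r (- y))).
have [_ _ GM _] := gset_group G.
have yn' : (- y) ^+ n.+1 = 0 by rewrite exprNn yn mulr0.
have Gy : lie G (- y) by rewrite -scaleN1r -[_ *: _]addr0; apply: lie_add (lie0 G); exact: ry.1.
exact: GM (GM _ _ (nexp_in_group 1 rx.1 xn) (nexp_in_group 1 Gy yn')) (nexp_in_group 1 rx.1 xn).
Qed.

(** Since alpha takes the value z^2 on the coroot at z, a square root z of alpha(t) splits t into a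
    factor killed by alpha, which commutes with x, y and w, and a value of the coroot, which w
    inverts. *)
Lemma weyl_torus (t : pts T) : intm w t = pval (t - coroot G alpha (gm (chv alpha t))).
Proof.
have [xn yn] := root_nilpotent; set av := coroot G alpha.
pose z := sqrtC (chv alpha t); have zz : z * z = chv alpha t by rewrite -expr2 sqrtCK.
have z0 : z != 0 by have := chv_neq0 alpha t; rewrite -zz mulf_eq0 orbb.
pose t' := t - av (gm z) : pts T.
have tE : t = t' + av (gm z) by rewrite /t' subrK.
have at' : chv alpha t' = 1.
  rewrite /t' chvM chvNr (pairingP alpha av z0) pa -zz -[z ^ 2]/(z ^+ 2) expr2 mulfV //.
  by rewrite mulf_neq0.
have xt : x * pval t' = pval t' * x.
  by have := has_weight_comm t' rx.2; rewrite at' scale1r.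
have yt : y * pval t' = pval t' * y.
  by have := has_weight_comm t' ry.2; rewrite chvN at' invr1 scale1r.
have wt := weyl_commute xt yt.
have [K [N [e [ee lE]]]] := cochar_decomp av.
have te := tangent_cochar lE.
have anti := weyl_antifixed xn yn (esym xy) hx hy; rewrite te in anti.
have wav : w * pval (av (gm z)) = pval (av (gm z^-1)) * w.
  by have := weyl_cochar ee anti (invr_neq0 z0); rewrite invrK !lE ?invr_eq0.
have wu := weyl_unit.
have -> : t - av (gm (chv alpha t)) = t' + av (gm z^-1).
  by rewrite -zz cochar_gmM // cochar_gmV // opprD addrA.
have i1 : intm w t' = t'.
  have wt' : w *m pval t' = pval t' *m w := wt.
  by rewrite /intm wt' mulmxK.
have i2 : intm w (av (gm z)) = av (gm z^-1).
  have wav' : w *m pval (av (gm z)) = pval (av (gm z^-1)) *m w := wav.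
  by rewrite /intm wav' mulmxK.
transitivity (intm w (pval t' *m pval (av (gm z)))); first by rewrite {1}tE.
by rewrite intm_mul // i1 i2.
Qed.

Lemma weyl_root_space beta b : root_space G beta b ->
  root_space G (refl_char G alpha beta) (intm w b).
Proof.
move=> [Gb wb]; have wu := weyl_unit; split.
  by have := @lie_conj _ _ G (Pt weyl_in_group) b Gb.
(* The reflection of t: as reflections are involutions, conjugation by w sends it back to t. *)
move=> t; set av := coroot G alpha; pose t'' := t - av (gm (chv alpha t)) : pts T.
have at0 := chv_neq0 alpha t.
have at'' : chv alpha t'' = (chv alpha t)^-1.
  rewrite /t'' chvM chvNr (pairingP alpha av at0) pa -[_ ^ 2]/(_ ^+ 2) expr2 invfM mulrA.
  by rewrite mulfV // mul1r.
have wt : intm w t'' = pval t.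
  by rewrite weyl_torus at'' cochar_gmV // opprK /t'' subrK.
have tw : pval t *m w = w *m pval t'' by rewrite -wt /intm mulmxKV.
rewrite -intm_comp ?pt_unit // tw intm_comp ?pt_unit // wb.
have -> : chv beta t'' = chv (refl_char G alpha beta) t.
  by rewrite /t'' chvM chvNr (pairingP beta av at0) /refl_char chvD chvN chvMz.
by rewrite /intm -scalemxAr -scalemxAl.
Qed.

End Reflection.

End Roots.

Lemma lie_sub (R : realType) n (B G : agroup R n) : gset B `<=` gset G -> lie B `<=` lie G.
Proof.
move=> BG X [D DP DX].
pose c (x : pts B) : pts G := Pt (BG _ (pvalP x)).
have rc (f : pts G -> R[i]) : regular_on f -> regular_on (fun x => f (c x)).
  by move=> [F rF fF]; exists F => // x; rewrite fF.
have c1 : c (pt1 B) = pt1 G by apply: pval_inj.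
exists (fun f => D (fun x => f (c x))) => //; split.
  by move=> a f h rf rh; rewrite (derivation_lin DP) //; exact: rc.
by move=> f h rf rh; rewrite (derivation_mul DP) ?c1 //; exact: rc.
Qed.

Lemma derived_is_subgroup (R : realType) n (S : set 'M[R[i]]_n) :
  is_subgroup S -> is_subgroup (derived_subgroup S).
Proof.
move=> [Su S1 SM SV]; split.
- move=> g; apply; first split=> //.
  + exact: unitmx1.
  + by move=> a b ua ub; rewrite /= unitmx_mul ua ub.
  + by move=> a ua; rewrite /= unitmx_inv ua.
  move=> a b /Su ua /Su ub.
  by rewrite /= !unitmx_mul !unitmx_inv ua ub.
- by move=> K [].
- by move=> a b ha hb K Kg KS; have [_ _ KM _] := Kg; exact: KM (ha K Kg KS) (hb K Kg KS).
- by move=> a ha K Kg KS; have [_ _ _ KV] := Kg; exact: KV (ha K Kg KS).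
Qed.

(* Being normalized by the torus in the group they generate, both one-parameter
   subgroups survive in all derived subgroups. *)
Lemma sl2_not_solvable (R : realType) n (S : set 'M[R[i]]_n.+1) (x y : 'M[R[i]]_n.+1) :
    is_subgroup S -> solvable_set S -> x ^+ n.+1 = 0 -> y ^+ n.+1 = 0 ->
    bracket (bracket x y) x = x *+ 2 -> bracket (bracket x y) y = - (y *+ 2) ->
    (forall s, S (nexp (s *: x))) -> (forall s, S (nexp (s *: y))) -> x = 0.
Proof.
move=> Sg [k Sk] xn yn hx hy Sx Sy.
have cP0 := @sl2_commutator (R[i] : numClosedFieldType) n x y.
have cP := cP0 xn yn hx hy.
have H j : is_subgroup (iter j (@derived_subgroup R n.+1) S) /\ forall s,
    iter j (@derived_subgroup R n.+1) S (nexp (s *: x)) /\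
    iter j (@derived_subgroup R n.+1) S (nexp (s *: y)).
  elim: j => [|j [IHg IH]]; first by split=> // s; split; [exact: Sx | exact: Sy].
  split; first exact: derived_is_subgroup.
  have [Du D1 DM DV] := IHg.
  have Dw z : iter j (@derived_subgroup R n.+1) S (sl2_weyl x y z).
    by rewrite sl2_weylE; exact: DM _ _ (DM _ _ (IH z).1 (IH _).2) (IH z).1.
  have Dg := DM _ _ (Dw 2%:R) (DV _ (Dw 1)).
  move=> s; split=> K' K'g K'S.
    by have [s' <-] := cP x (or_introl erefl) s; exact: K'S Dg (IH s').1.
  by have [s' <-] := cP y (or_intror erefl) s; exact: K'S Dg (IH s').2.
have xN s : nexp (s *: x) = 1 by exact: Sk _ ((H k).2 s).1.
exact: (nexp_eq1 xn xN).
Qed.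

(** * Root spaces are lines *)

Section DimensionOne.
Context {R : realType} {n : nat} (G : agroup R n.+1) (T : torus R n.+1).
Local Notation C := R[i].
Local Notation M := 'M[C]_n.+1.
Hypothesis ss : semisimple G.
Hypothesis Tmax : maximal_torus G T.

Lemma root_intlie (alpha : X^*(T)) x : alpha <> 0 -> root_space G alpha x -> x \in intlie G.
Proof.
move=> a0 [Gx wx]; have [l l0] := pairing_neq0 a0.
have m0 : (pairing alpha l)%:~R != 0 :> C by rewrite intr_eq0.
apply: nilpotent_intlie => //; exact: (eigen_nilpotent m0 (has_weight_tangent l wx)).
Qed.

(* (ad x)^2 is injective from the root space of - alpha to that of alpha for every
   nonzero x in the latter, so two independent x would give a nonsingular pencil. *)
Lemma root_space_dim1 (alpha : X^*(T)) x1 x2 : alpha <> 0 ->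
  root_space G alpha x1 -> root_space G alpha x2 -> x2 <> 0 -> exists c, x1 = c *: x2.
Proof.
move=> a0 r1 r2 x20.
have [Up UpE] := weight_space G alpha; have [Um UmE] := weight_space G (- alpha).
have rX (a b : C) : root_space G alpha (a *: x1 + b *: x2).
  rewrite -[b *: x2]addr0; split; last first.
    by apply: has_weight_lin r1.2 _; apply: has_weight_lin r2.2 _; exact: has_weight_zero.
  by apply: lie_add r1.1 _; apply: lie_add r2.1 _; exact: lie0.
have UmUp (a b : C) y : y \in Um -> let x := a *: x1 + b *: x2 in bracket x (bracket x y) \in Up.
  move=> /UmE [yU wy] /=; set x := _ + _; apply/UpE; have xU := root_intlie a0 (rX a b).
  split; first exact: intlie_bracket xU (intlie_bracket xU yU).
  rewrite -[alpha]addr0 -[X in _ + X](subrr alpha).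
  exact: has_weight_bracket (rX a b).2 (has_weight_bracket (rX a b).2 wy).
have nd z : z \in Up -> (forall y, y \in Um -> \tr (z *m y) = 0) -> z = 0.
  move=> /UpE [zU wz] zUm; apply/eqP; apply: contraT => z0.
  have [l l0] := pairing_neq0 a0; have m0 : (pairing alpha l)%:~R != 0 :> C by rewrite intr_eq0.
  have [y yU zy] := semisimple_nondegenerate ss (intlie_lie zU) z0 (tangent_intlie Tmax l) m0 (has_weight_tangent l wz).
  have [y' [y'U wy' zy']] := weight_projection Tmax wz yU zy.
  by case/eqP: zy'; apply: zUm; apply/UmE.
have inj (a b : C) y : y \in Um -> let x := a *: x1 + b *: x2 in
    x != 0 -> bracket x (bracket x y) = 0 -> y = 0.
  move=> /UmE [yU wy] x /eqP x0 xxy.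
  have [y' [ry' txy hx hy pa]] := corootP ss Tmax a0 (rX a b) x0.
  have [l l0] := pairing_neq0 a0; have m0 : (pairing alpha l)%:~R != 0 :> C by rewrite intr_eq0.
  have xn := eigen_nilpotent m0 (has_weight_tangent l (rX a b).2).
  have hu : bracket (bracket x y') (bracket x y) = 0.
    rewrite -txy; have w0 : has_weight (0 : X^*(T)) (bracket x y).
      by rewrite -(subrr alpha); exact: has_weight_bracket (rX a b).2 wy.
    by rewrite (has_weight_tangent _ w0) pairing0l scale0r.
  (* The bracket [x, y] has weight 0 and is killed by ad x, so it vanishes; then y has weight - 2
     and is killed by ad x, so it vanishes too. *)
  have xy0 := sl2_weight0 erefl hx xn hu xxy.
  apply: (sl2_lowest erefl hx xn xy0).
  rewrite -txy (has_weight_tangent _ wy) pairingNl pa rmorphN scaleNr.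
  by rewrite -scaler_nat.
have Um0 : Um != 0%VS.
  have [y' [ry' txy hx hy pa]] := corootP ss Tmax a0 r2 x20.
  apply/eqP => U0; have a0' : - alpha <> 0 by move/eqP; rewrite oppr_eq0 => /eqP.
  have : y' \in Um by apply/UmE; split; [exact: root_intlie a0' ry' | exact: ry'.2].
  rewrite U0 memv0 => /eqP y0; apply: x20; move: hx; rewrite y0 bracket0r bracket0l => /esym/eqP.
  by rewrite -scaler_nat scaler_eq0 pnatr_eq0 /= => /eqP.
have [a [b [ab0 abx]]] := singular_pencil UmUp nd inj Um0.
have an0 : a != 0.
  apply: contraNneq ab0 => a00; move: abx; rewrite a00 scale0r add0r => /eqP.
  by rewrite scaler_eq0 => /orP [/eqP ->|/eqP //].
exists (- (b / a)); apply: (scalerI an0).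
by apply/eqP; rewrite scalerA mulrN mulrCA mulfV // mulr1 scaleNr -addr_eq0 abx.
Qed.

(** As root spaces are lines, y is proportional to the vector that completes x to an sl2-triple, so
    B contains both unipotent subgroups of the triple. *)
Lemma no_opposite_roots (B : agroup R n.+1) (alpha : X^*(T)) x y :
    gset B `<=` gset G -> solvable_set (gset B) -> alpha <> 0 ->
  root_space B alpha x -> x <> 0 -> root_space B (- alpha) y -> y <> 0 -> False.
Proof.
move=> BG Bs a0 [Bx wx] x0 [By wy] y0.
have rx : root_space G alpha x by split=> //; exact: lie_sub BG _ Bx.
have ry : root_space G (- alpha) y by split=> //; exact: lie_sub BG _ By.
have a0' : - alpha <> 0 by move/eqP; rewrite oppr_eq0 => /eqP.
have [y' [ry' txy hx hy pa]] := corootP ss Tmax a0 rx x0.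
have [c cE] := root_space_dim1 a0' ry' ry y0.
have [l l0] := pairing_neq0 a0; have m0 : (pairing alpha l)%:~R != 0 :> C by rewrite intr_eq0.
have m0' : (pairing (- alpha) l)%:~R != 0 :> C by rewrite pairingNl rmorphN oppr_eq0.
have xn := eigen_nilpotent m0 (has_weight_tangent l wx).
have yn := eigen_nilpotent m0' (has_weight_tangent l ry'.2).
have By' : lie B y' by rewrite cE -[_ *: _]addr0; exact: lie_add By (lie0 B).
apply: x0; apply: (sl2_not_solvable (gset_group B) Bs xn yn hx hy) => s.
  exact: nexp_in_group Bx xn.
exact: nexp_in_group By' yn.
Qed.

End DimensionOne.

(** * The matrix exponential *)

Section ComplexLimits.
Import numFieldNormedType.Exports.
Context {R : realType}.
Local Notation C := R[i].

(** Real and imaginary parts are kept apart because [mexp] takes its limits in this way. *)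
Definition ccvg (a : nat -> C) (l : C) :=
  (fun N => complex.Re (a N)) @ \oo --> complex.Re l /\
  (fun N => complex.Im (a N)) @ \oo --> complex.Im l.

Lemma ccvg_uniq a l l' : ccvg a l -> ccvg a l' -> l = l'.
Proof.
move=> [r i] [r' i']; apply/eqP; rewrite eq_complex.
by rewrite (cvg_unique _ r r') // (cvg_unique _ i i') // !eqxx.
Qed.

Lemma ccvg_cst (c : C) : ccvg (fun=> c) c.
Proof. by split; exact: cvg_cst. Qed.

Lemma ccvgD a b l m : ccvg a l -> ccvg b m -> ccvg (fun N => a N + b N) (l + m).
Proof.
move=> [r i] [r' i']; split.
  by under eq_fun do rewrite raddfD; rewrite raddfD; exact: cvgD.
by under eq_fun do rewrite raddfD; rewrite raddfD; exact: cvgD.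
Qed.

Lemma ccvgM c a l : ccvg a l -> ccvg (fun N => c * a N) (c * l).
Proof.
case: c => x y [r i].
have E (z : C) : ((x +i* y)%C * z) =
  ((x * complex.Re z - y * complex.Im z) +i* (x * complex.Im z + y * complex.Re z))%C.
  by case: z.
split; under eq_fun do rewrite E; rewrite E /=.
  by apply: cvgB; apply: cvgMr.
by apply: cvgD; apply: cvgMr.
Qed.

Lemma ccvg_sum (I : Type) (r : seq I) (a : I -> nat -> C) (l : I -> C) :
  (forall i, ccvg (a i) (l i)) -> ccvg (fun N => \sum_(i <- r) a i N) (\sum_(i <- r) l i).
Proof.
move=> h; elim: r => [|i r IH].
  by under eq_fun do rewrite big_nil; rewrite big_nil; exact: ccvg_cst.
by under eq_fun do rewrite big_cons; rewrite big_cons; exact: ccvgD.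
Qed.

Lemma ccvg_shift k a l : ccvg (fun N => a (N + k)%N) l -> ccvg a l.
Proof.
move=> [r i]; split.
  by rewrite -(cvg_shiftn k).
by rewrite -(cvg_shiftn k).
Qed.

End ComplexLimits.

Section MatrixExponential.
Import numFieldNormedType.Exports.
Context {R : realType} {n : nat}.
Local Notation C := R[i].
Local Notation M := 'M[C]_n.+1.
Implicit Types x y : M.

Definition norm1 (z : C) : R := `|complex.Re z| + `|complex.Im z|.

Lemma norm1_ge0 z : 0 <= norm1 z.
Proof. by rewrite addr_ge0. Qed.

Lemma norm1D z w : norm1 (z + w) <= norm1 z + norm1 w.
Proof. by rewrite /norm1 !raddfD addrACA lerD // ler_normD. Qed.

Lemma norm1M z w : norm1 (z * w) <= norm1 z * norm1 w.
Proof.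
case: z w => a b [c d]; rewrite /norm1 /=.
have h1 : `|a * c - b * d| <= `|a| * `|c| + `|b| * `|d|.
  by rewrite -!normrM; exact: ler_normB.
have h2 : `|a * d + b * c| <= `|a| * `|d| + `|b| * `|c|.
  by rewrite -!normrM; exact: ler_normD.
apply: le_trans (lerD h1 h2) _; rewrite le_eqVlt; apply/orP; left; apply/eqP; ring.
Qed.

Definition mxnorm1 x : R := \sum_i \sum_j norm1 (x i j).

Lemma mxnorm1_ge0 x : 0 <= mxnorm1 x.
Proof. by apply: sumr_ge0 => i _; apply: sumr_ge0 => j _; exact: norm1_ge0. Qed.

Lemma norm1_le x i j : norm1 (x i j) <= mxnorm1 x.
Proof.
rewrite /mxnorm1 (bigD1 i) //= (bigD1 j) //= -addrA lerDl addr_ge0 //.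
  by apply: sumr_ge0 => k _; exact: norm1_ge0.
by apply: sumr_ge0 => k _; apply: sumr_ge0 => l _; exact: norm1_ge0.
Qed.

Lemma norm1_sum (I : Type) (r : seq I) (F : I -> C) :
  norm1 (\sum_(i <- r) F i) <= \sum_(i <- r) norm1 (F i).
Proof.
elim: r => [|i r IH]; first by rewrite !big_nil /norm1 /= !normr0 addr0.
by rewrite !big_cons (le_trans (norm1D _ _)) // lerD2l.
Qed.

Lemma mxnorm1M x y : mxnorm1 (x *m y) <= mxnorm1 x * mxnorm1 y.
Proof.
have h i j : norm1 ((x *m y) i j) <= \sum_k norm1 (x i k) * norm1 (y k j).
  rewrite mxE (le_trans (norm1_sum _ _)) // ler_sum // => k _; exact: norm1M.
apply: (@le_trans _ _ (\sum_i \sum_j \sum_k norm1 (x i k) * norm1 (y k j))).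
  by apply: ler_sum => i _; apply: ler_sum => j _; exact: h.
rewrite /mxnorm1 mulr_suml ler_sum // => i _; rewrite exchange_big mulr_suml ler_sum // => k _.
rewrite -mulr_sumr ler_wpM2l ?norm1_ge0 //.
rewrite [leRHS](bigD1 k) //= lerDl; apply: sumr_ge0 => k' _; apply: sumr_ge0 => l _.
exact: norm1_ge0.
Qed.

(** The factor [mxnorm1 1] accounts for the power 0, as this norm of the identity is its size and
    not 1. *)
Lemma mxnorm1X x k : mxnorm1 (x ^+ k) <= mxnorm1 1 * mxnorm1 x ^+ k.
Proof.
elim: k => [|k IH]; first by rewrite !expr0 mulr1.
by rewrite exprS exprS mulrCA; apply: le_trans (mxnorm1M _ _) _; rewrite ler_wpM2l // mxnorm1_ge0.
Qed.

Lemma mexp_partialE x N i j :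
  mexp_partial x N i j = \sum_(k < N) ((k`!%:R : R)^-1)%:C%C * (x ^+ k) i j.
Proof.
rewrite summxE; apply: eq_bigr => k _; rewrite mxE; congr (_ * _).
by rewrite fmorphV rmorph_nat.
Qed.

Lemma cvg_exp_series (c d : R) (u : nat -> R) : 0 <= c -> 0 <= d ->
  (forall k, `|u k| <= d * c ^+ k) ->
  cvgn (fun N => \sum_(k < N) (k`!%:R)^-1 * u k).
Proof.
move=> c0 d0 uc.
pose v k : R := (k`!%:R)^-1 * u k.
have -> : (fun N => \sum_(k < N) (k`!%:R)^-1 * u k) = series v.
  by apply/funext => N; rewrite /series /= big_mkord.
apply: normed_cvg.
apply: (@series_le_cvg _ _ (fun k => d * exp_coeff c k)).
- by move=> k; exact: normr_ge0.
- by move=> k; rewrite mulr_ge0 // exp_coeff_ge0.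
- move=> k; rewrite -[X in X <= _]/(`|(k`!%:R)^-1 * u k|) normrM ger0_norm ?invr_ge0 ?ler0n // /exp_coeff /=.
  by rewrite mulrC mulrA ler_wpM2r ?invr_ge0 ?ler0n.
have -> : series (fun k => d * exp_coeff c k) = (fun N => d * series (exp_coeff c) N).
  by apply/funext => N; rewrite /series /= mulr_sumr.
by apply: is_cvgMr; exact: is_cvg_series_exp_coeff.
Qed.

Lemma mexp_ccvg x i j : ccvg (fun N => mexp_partial x N i j) (mexp x i j).
Proof.
have h k : norm1 ((x ^+ k) i j) <= mxnorm1 1 * mxnorm1 x ^+ k.
  exact: le_trans (norm1_le _ _ _) (mxnorm1X _ _).
have hr k : `|complex.Re ((x ^+ k) i j)| <= mxnorm1 1 * mxnorm1 x ^+ k.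
  by apply: le_trans (h k); rewrite /norm1 lerDl.
have hi k : `|complex.Im ((x ^+ k) i j)| <= mxnorm1 1 * mxnorm1 x ^+ k.
  by apply: le_trans (h k); rewrite /norm1 lerDr.
have rc (r : R) (z : C) : (r%:C%C * z) = ((r * complex.Re z) +i* (r * complex.Im z))%C.
  by case: z => a b; rewrite /=; apply/eqP; rewrite eq_complex /= !mul0r subr0 addr0 !eqxx.
rewrite /ccvg mxE /=; split.
  have -> : (fun N => complex.Re (mexp_partial x N i j)) =
      (fun N => \sum_(k < N) (k`!%:R)^-1 * complex.Re ((x ^+ k) i j)).
    apply/funext => N; rewrite mexp_partialE raddf_sum; apply: eq_bigr => k _.
    by rewrite rc.
  exact: cvg_exp_series (mxnorm1_ge0 _) (mxnorm1_ge0 _) hr.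
have -> : (fun N => complex.Im (mexp_partial x N i j)) =
    (fun N => \sum_(k < N) (k`!%:R)^-1 * complex.Im ((x ^+ k) i j)).
  apply/funext => N; rewrite mexp_partialE raddf_sum; apply: eq_bigr => k _.
  by rewrite rc.
exact: cvg_exp_series (mxnorm1_ge0 _) (mxnorm1_ge0 _) hi.
Qed.

(** Commutation passes to the limit of the partial sums; used for Cayley elements, whose exponents
    are not nilpotent. *)
Lemma mexp_comm x y : x *m y = y *m x -> mexp x *m y = y *m mexp x.
Proof.
move=> xy; apply/matrixP => i j.
have pc N : mexp_partial x N *m y = y *m mexp_partial x N.
  rewrite mulmx_suml mulmx_sumr; apply: eq_bigr => k _.
  rewrite -scalemxAl -scalemxAr; congr (_ *: _).
  elim: (k : nat) => [|l IH]; first by rewrite expr0 mul1mx mulmx1.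
  by rewrite exprS -[x * _]/(x *m _) -mulmxA IH !mulmxA xy.
apply: (@ccvg_uniq _ (fun N => (mexp_partial x N *m y) i j)).
  rewrite mxE; under eq_fun do rewrite mxE.
  apply: ccvg_sum => k; rewrite mulrC; under eq_fun do rewrite mulrC.
  exact: ccvgM (mexp_ccvg _ _ _).
under eq_fun do rewrite pc; rewrite mxE; under eq_fun do rewrite mxE.
by apply: ccvg_sum => k; exact: ccvgM (mexp_ccvg _ _ _).
Qed.

Lemma mexp_nilpotent x : x ^+ n.+1 = 0 -> mexp x = nexp x.
Proof.
move=> xn; apply/matrixP => i j; apply: (@ccvg_uniq _ (fun N => mexp_partial x N i j)).
  exact: mexp_ccvg.
apply: (@ccvg_shift _ n.+1).
suff -> : (fun N => mexp_partial x (N + n.+1) i j) = (fun=> nexp x i j) by exact: ccvg_cst.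
apply/funext => N; congr (fun_of_matrix _ i j); rewrite /mexp_partial addnC big_split_ord /=.
rewrite [X in _ + X]big1 ?addr0 // => k _.
by rewrite exprD xn mul0r scaler0.
Qed.

End MatrixExponential.

(** * Canonical isomorphisms *)

Section Separation.
Context {R : realType}.
Local Notation C := R[i].

Section DiagonalCharacter.
Context {s : nat} (k : 'I_s).

Let dmx (x : pts (@diag_group R s)) : 'M[C]_1 := ((x : 'M[C]_s) k k)%:M.

Fact diag_char_subproof x : diag_set (dmx x).
Proof.
split; last exact: mx11_is_diag.
by rewrite unitmxE det_scalar1 unitfE; have [/(_ k)] := diag_group_nonzero x; rewrite mxE.
Qed.

Let dfun x : pts (Gm R) := @Pt R 1 (Gm R) (dmx x) (diag_char_subproof x).

Fact diag_char_hom x y : dfun (ptM x y) = ptM (dfun x) (dfun y).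
Proof.
apply: pval_inj; rewrite /= /dmx mul_scalar_mx scale_scalar_mx; congr (_%:M).
have /rowP/(_ k) := diag_mx_rowM x y; rewrite [LHS]mxE => ->.
by rewrite 3!mxE.
Qed.

Fact diag_char_regular i j : regular_on (fun x => dfun x i j).
Proof.
apply: (@regular_on_ext _ _ _ (fun x : pts (@diag_group R s) => (x : 'M[C]_s) k k)) => [x|].
  by rewrite !ord1 /= mxE eqxx mulr1n.
exact: regular_on_coord.
Qed.

Definition diag_char : ahom (@diag_group R s) (Gm R) := AHom diag_char_hom diag_char_regular.

End DiagonalCharacter.

Lemma characters_separate n (T : torus R n) (t t' : pts T) :
  (forall chi : X^*(T), chv chi t = chv chi t') -> t = t'.
Proof.
move=> tt'; have [r [f [h [fh hf]]]] := torusP T.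
rewrite -(hf t) -(hf t'); congr (f _); apply: pval_inj.
have [_ ->] := diag_group_nonzero (h t); have [_ ->] := diag_group_nonzero (h t').
congr diag_mx; apply/rowP => k; rewrite !mxE.
by have := tt' (acomp (diag_char k) h); rewrite /chv /= !mxE eqxx !mulr1n.
Qed.

Lemma conj_gm (z : C) : z != 0 -> conj_pt (rtorP (Gm R)) (gm z) = gm (conjc z).
Proof.
move=> z0; apply: pval_inj; rewrite /= !pval_gm ?conjc_eq0 //.
by apply/matrixP => i j; rewrite !mxE !ord1 eqxx !mulr1n.
Qed.

Lemma conjc_exprz (z : C) (m : int) : conjc (z ^ m) = (conjc z) ^ m.
Proof.
have H k : conjc (z ^+ k) = conjc z ^+ k by exact: rmorphXn.
case: m => k; first exact: H.
by rewrite NegzE -!invr_expz conjc_inv; congr (_^-1); exact: H.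
Qed.

(** On a split torus every character commutes with conjugation, and the two conjugations acting on
    z^m cancel; characters separate points. *)
Lemma split_galc n (T : rtorus R n) (nu : X_*(T)) : split_torus T -> galc true nu = nu.
Proof.
move=> sT; apply: ahom_eq => x; have [x0 ->] := pt_gm x; set z := pval x _ _ in x0 *.
apply: characters_separate => chi.
have zc0 : conjc z != 0 by rewrite conjc_eq0.
rewrite -[galc true nu _]/(conj_pt (rtorP T) (nu (conj_pt (rtorP (Gm R)) (gm z)))) sT conj_gm //.
by rewrite !pairingP // conjc_exprz conjcK.
Qed.

End Separation.

Section CanonicalIsomorphisms.
Context {R : realType} {n : nat} {G : agroup R n.+1} (S : splitting G).
Local Notation C := R[i].
Local Notation M := 'M[C]_n.+1.
Local Notation T0 := (rtor (spT S)).
Local Notation B := (spB S).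
Hypothesis ss : semisimple G.
Implicit Types (alpha beta chi : X^*(T0)) (x y : M) (A : {fset X^*(T0)}).

Lemma sp_maximal : maximal_torus G T0.
Proof. by have [] := sp_pair S. Qed.
Let Tmax := sp_maximal.

Lemma sp_borel_sub : gset B `<=` gset G.
Proof. by have [[]] := sp_pair S. Qed.

Lemma sp_borel_solvable : solvable_set (gset B).
Proof. by have [[]] := sp_pair S. Qed.

Lemma simple_rootP beta : simple_root B beta ->
  [/\ beta <> 0, root_space G beta (spX S beta) & spX S beta <> 0].
Proof. by move=> sb; have [rX _ X0] := spX_root sb; split=> //; case: sb => -[]. Qed.

Lemma n_simple_weyl beta : simple_root B beta ->
  n_simple beta = weyl_mx (spX S beta) (opposite G beta (spX S beta)).
Proof.
move=> /simple_rootP [b0 rX X0]; rewrite weyl_mxE /n_simple.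
have [ry xy hx hy pa] := oppositeP ss Tmax b0 rX X0.
have [xn yn] := root_nilpotent hx hy.
have yn' : (- opposite G beta (spX S beta)) ^+ n.+1 = 0 by rewrite exprNn yn mulr0.
rewrite (mexp_nilpotent xn) (mexp_nilpotent yn'); reflexivity.
Qed.

Lemma n_word_root w chi x : (forall alpha, alpha \in w -> simple_root B alpha) ->
  root_space G chi x ->
  n_word w \in unitmx /\ root_space G (word_char w chi) (intm (n_word w) x).
Proof.
elim: w => [|alpha w IH] sw rx /=.
  by rewrite unitmx1 /intm mul1mx invmx1 mulmx1.
have [|wu rw] := IH _ rx; first by move=> beta bw; apply: sw; rewrite inE bw orbT.
have sa : simple_root B alpha by apply: sw; rewrite mem_head.
have [a0 rX X0] := simple_rootP sa.
have [ry xy hx hy pa] := oppositeP ss Tmax a0 rX X0.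
rewrite n_simple_weyl //.
have nu := weyl_unit hx hy.
split; first by rewrite unitmx_mul nu wu.
rewrite intm_comp //; exact: (weyl_root_space rX ry xy hx hy pa rw).
Qed.

Definition cayley_scalar : C := (pi / 4)*i%C.

(** Only this shape of a Cayley element matters from here on; the word and the simple root that
    produced it are forgotten. *)
Lemma is_cayleyP alpha g : alpha <> 0 -> is_cayley alpha g -> exists x y,
  [/\ root_space G alpha x, x <> 0, root_space G (- alpha) y &
      g = mexp (cayley_scalar *: (x + y))].
Proof.
move=> a0 [w [beta [[sw _] sb wE ->]]]; have [b0 rX X0] := simple_rootP sb.
have [wu rw] := n_word_root sw rX; rewrite wE in rw.
set x := intm (n_word w) (spX S beta) in rw.
have x0 : x <> 0.
  by move=> x0; apply: X0; rewrite -(intmK (spX S beta) wu) -/x x0 /intm mulmx0 mul0mx.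
have [ry _ _ _ _] := oppositeP ss Tmax a0 rw x0.
exists x, (opposite G alpha x); split; [exact: rw | exact: x0 | exact: ry |].
by rewrite /cayley wE; reflexivity.
Qed.

(** A nonzero bracket would be a root vector for alpha + beta; the sum has to be nonzero, since a
    bracket of weight 0 contradicts nothing. *)
Lemma root_bracket_eq0 alpha beta x y : alpha <> 0 -> beta <> 0 -> alpha + beta <> 0 ->
  ~ is_root G (alpha + beta) -> root_space G alpha x -> root_space G beta y ->
  bracket x y = 0.
Proof.
move=> a0 b0 ab0 nab rx ry; apply: contrapT => xy0; apply: nab; split=> //.
exists (bracket x y) => //; split; last exact: has_weight_bracket rx.2 ry.2.
by apply: intlie_lie; apply: intlie_bracket; [exact: root_intlie a0 rx | exact: root_intlie b0 ry].
Qed.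

Lemma is_rootN alpha : is_root G alpha -> is_root G (- alpha).
Proof.
move=> [a0 [x rx x0]]; have [y [ry txy hx hy pa]] := corootP ss Tmax a0 rx x0.
split; first by move/eqP; rewrite oppr_eq0 => /eqP.
exists y => // y0; apply: x0; move: hx; rewrite y0 bracket0r bracket0l => /esym/eqP.
by rewrite -scaler_nat scaler_eq0 pnatr_eq0 /= => /eqP.
Qed.

Lemma positive_add_neq0 alpha beta : is_root B alpha -> is_root B beta -> alpha + beta <> 0.
Proof.
move=> [a0 [x rx x0]] [b0 [y ry y0]] ab0.
have bE : beta = - alpha by apply/eqP; rewrite -addr_eq0 addrC ab0.
move: ry; rewrite bE => ry.
exact: (no_opposite_roots ss Tmax sp_borel_sub sp_borel_solvable a0 rx x0 ry y0).
Qed.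

Section Orthogonal.
Context (alpha beta : X^*(T0)).
Hypothesis Ba : is_root B alpha.
Hypothesis Bb : is_root B beta.
Hypothesis ab : alpha <> beta.
Hypothesis nD : ~ is_root G (alpha + beta).
Hypothesis nB : ~ is_root G (alpha - beta).

Lemma orthogonal_bracket x y : (root_space G alpha x \/ root_space G (- alpha) x) ->
  (root_space G beta y \/ root_space G (- beta) y) -> bracket x y = 0.
Proof.
have [a0 _] := Ba; have [b0 _] := Bb.
have na0 : - alpha <> 0 by move/eqP; rewrite oppr_eq0 => /eqP.
have nb0 : - beta <> 0 by move/eqP; rewrite oppr_eq0 => /eqP.
have abD := positive_add_neq0 Ba Bb.
have abB : alpha - beta <> 0 by move/eqP; rewrite subr_eq0 => /eqP.
have abD' : - alpha - beta <> 0 by rewrite -opprD => /eqP; rewrite oppr_eq0 => /eqP.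
have abB' : - alpha + beta <> 0 by rewrite addrC => /eqP; rewrite subr_eq0 => /eqP /esym.
have nD' : ~ is_root G (- alpha - beta).
  by rewrite -opprD => /is_rootN; rewrite opprK.
have nB' : ~ is_root G (- alpha + beta).
  by move=> /is_rootN; rewrite opprD opprK.
move=> [rx|rx] [ry|ry].
- exact: (root_bracket_eq0 a0 b0 abD nD rx ry).
- exact: (root_bracket_eq0 a0 nb0 abB nB rx ry).
- exact: (root_bracket_eq0 na0 b0 abB' nB' rx ry).
- exact: (root_bracket_eq0 na0 nb0 abD' nD' rx ry).
Qed.

(** For u of weight beta, the pairing times u equals [[x, y], u], which the Jacobi identity
    expresses through [x, u] = [y, u] = 0. *)
Lemma orthogonal_coroot : pairing beta (coroot G alpha) = 0.
Proof.
have [a0 [x rx x0]] := Ba; have [b0 [u ru u0]] := Bb.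
rewrite /is_root in rx ru.
have rx' : root_space G alpha x by split; [exact: lie_sub sp_borel_sub _ rx.1 | exact: rx.2].
have ru' : root_space G beta u by split; [exact: lie_sub sp_borel_sub _ ru.1 | exact: ru.2].
have [y [ry txy hx hy pa]] := corootP ss Tmax a0 rx' x0.
have xu : bracket x u = 0 by apply: orthogonal_bracket; left.
have yu : bracket y u = 0 by apply: orthogonal_bracket; [right|left].
have := has_weight_tangent (coroot G alpha) ru'.2.
rewrite txy; have := jacobi x y u; rewrite yu xu !bracket0r addr0.
move=> <- /esym/eqP; rewrite scaler_eq0 intr_eq0 => /orP [/eqP //|/eqP].
by move/u0.
Qed.

Lemma orthogonal_cayley g h : is_cayley alpha g -> is_cayley beta h -> g *m h = h *m g.
Proof.
have [a0 _] := Ba; have [b0 _] := Bb.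
move=> /(is_cayleyP a0) [x [y [rx _ ry ->]]] /(is_cayleyP b0) [u [v [ru _ rv ->]]].
have br : bracket (x + y) (u + v) = 0.
  rewrite bracketDl !bracketDr !orthogonal_bracket ?addr0 //; try by left.
  - by right.
  - by right.
  - by right.
  - by right.
have br' : (x + y) *m (u + v) = (u + v) *m (x + y).
  by apply/eqP; rewrite -bracket_eq0 br.
apply: mexp_comm; apply/esym; apply: mexp_comm.
by rewrite -!scalemxAl -!scalemxAr br' scalerA mulrC -scalerA.
Qed.

End Orthogonal.

Lemma cayley_comm_cochar beta g (nu : X_*(T0)) z : beta <> 0 -> is_cayley beta g ->
  pairing beta nu = 0 -> z != 0 -> g *m nu (gm z) = nu (gm z) *m g.
Proof.
move=> b0 /(is_cayleyP b0) [x [y [rx _ ry ->]]] bnu z0.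
have xc : x *m nu (gm z) = nu (gm z) *m x.
  by rewrite (has_weight_comm (nu (gm z)) rx.2) pairingP // bnu expr0z scale1r.
have yc : y *m nu (gm z) = nu (gm z) *m y.
  by rewrite (has_weight_comm (nu (gm z)) ry.2) pairingP // pairingNl bnu oppr0 expr0z scale1r.
by apply: mexp_comm; rewrite -scalemxAl -scalemxAr mulmxDl mulmxDr xc yc.
Qed.

Lemma big_mulmx_comm (I : eqType) (r : seq I) (f : I -> M) x :
  (forall i, i \in r -> f i *m x = x *m f i) ->
  \big[mulmx/1%:M]_(i <- r) f i *m x = x *m \big[mulmx/1%:M]_(i <- r) f i.
Proof.
elim: r => [|i r IH] h; first by rewrite big_nil mul1mx mulmx1.
rewrite big_cons -mulmxA IH => [|k kr]; last by apply: h; rewrite inE kr orbT.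
by rewrite !mulmxA h // mem_head.
Qed.

Section Fixed.
Context (A' A : {fset X^*(T0)}) (TA' TA : rtorus R n.+1).
Hypothesis A_SOS : SOS A.
Hypothesis A_positive : forall alpha, alpha \in A -> is_root B alpha.
Hypothesis A'A : (A' `<=` A)%fset.

Let orth alpha beta : alpha \in A' -> beta \in (A `\` A')%fset ->
  [/\ is_root B alpha, is_root B beta, alpha <> beta,
      ~ is_root G (alpha + beta) & ~ is_root G (alpha - beta)].
Proof.
move=> aA'; rewrite inE => /andP [bA' bA]; have aA := fsubsetP A'A _ aA'.
have ab : alpha != beta by apply: contraNneq bA' => <-.
have [nD nB] := A_SOS.2 _ _ aA bA ab.
by split=> //; [exact: A_positive | exact: A_positive | exact/eqP].
Qed.

Lemma pairing_S_ beta nu (D : {fset X^*(T0)}) :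
  (forall alpha, alpha \in D -> pairing beta (coroot G alpha) = 0) ->
  pairing beta (S_ D nu) = pairing beta nu.
Proof.
rewrite /S_ => h; have {h} : forall alpha, alpha \in enum_fset D -> pairing beta (coroot G alpha) = 0.
  by move=> alpha aD; apply: h.
elim: (enum_fset D) => [//|alpha s IH] h /=.
rewrite /refl_cochar pairingDr pairingNr pairingMz h ?mem_head // mul0r oppr0 addr0.
by apply: IH => gamma gs; apply: h; rewrite inE gs orbT.
Qed.

Lemma acomp_inj (R' : realType) m k l (K : agroup R' m) (H : agroup R' k) (T : torus R' l)
    (c : ahom H T) (f h : ahom K H) : is_aiso c -> acomp c f = acomp c h -> f = h.
Proof.
move=> [d [cK _]] E; apply: ahom_eq => x; apply: (can_inj cK).
by have := congr1 (fun e : ahom K T => e x) E.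
Qed.

Lemma acompN m k l (K : agroup R m) (T : torus R k) (T' : torus R l) (c : ahom T T')
    (f : ahom K T) : acomp c (- f) = - acomp c f.
Proof. by apply: ahom_eq => u; exact: ahomV. Qed.

Lemma aiso_unit m (H K : agroup R m) (c : ahom H K) (g : 'M[C]_m) :
  (forall u, pval (c u) = intm g u) -> g \in unitmx.
Proof.
move=> cE; have := cE (pt1 H); rewrite ahom1 /intm mulmx1 => /esym g1.
by have [] := mulmx1_unit g1.
Qed.

Lemma minus_one_cochar (c : ahom T0 (rtor TA')) (lambda : Xm1 TA') : canonical_from_T0 A' c ->
  exists nu, [/\ acomp c nu = val lambda, S_ A' nu = - nu &
    forall beta, beta \in (A `\` A')%fset -> pairing beta nu = 0].
Proof.
move=> [_ ciso ctw]; have [d [cK dK]] := ciso.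
pose nu := acomp d (val lambda).
have cnu : acomp c nu = val lambda by apply: ahom_eq => x /=; rewrite dK.
have Snu : S_ A' nu = - nu.
  (* As T_0 is split, the twisted reality of c says that the Galois action on c nu is c applied to
     S_A' nu. *)
  apply: (acomp_inj ciso); have := ctw nu; rewrite (split_galc nu (@sp_split _ _ _ S)) => <-.
  rewrite cnu; have /eqP -> : galc true (val lambda) == - val lambda by exact: xm1P lambda.
  by apply: ahom_eq => x /=; rewrite ahomV /= dK.
exists nu; split=> // beta bD.
have := @pairing_S_ beta nu A' _; rewrite Snu pairingNr => H.
have /eqP : - pairing beta nu = pairing beta nu.
  apply: H => alpha aA'; have [Ba Bb ab nD nB] := orth aA' bD.
  exact: orthogonal_coroot Ba Bb ab nD nB.
by lia.
Qed.

Lemma canonical_iso_fix (j : ahom TA' TA) (lambda : Xm1 TA') (x : pts (Gm R)) : canonical_iso A' A j ->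
  pval (j (val lambda x)) = pval (val lambda x).
Proof.
move=> [[g' [gf [gfP g'E]] jE] jiso [c cc _]].
have [nu [cnu Snu bnu]] := minus_one_cochar lambda cc.
have [[g0 [gf0 [gf0P g0E]] cE] _ _] := cc.
have gu' := aiso_unit jE; have gu0 := aiso_unit cE.
have [x0 xE] := pt_gm x; set z := pval x _ _ in x0 xE.
have lE : pval (val lambda x) = intm g0 (nu (gm z)) by rewrite -cnu /= cE -xE.
(* The value of lambda is the conjugate by g0 of a value of nu; g' commutes with g0 and with nu, so
   conjugation by g' fixes it. *)
have g'g0 : g' *m g0 = g0 *m g'.
  rewrite g'E g0E; apply: big_mulmx_comm => beta bD; apply/esym.
  apply: big_mulmx_comm => alpha aA'.
  have [Ba Bb ab nD nB] := orth aA' bD.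
  exact: (orthogonal_cayley Ba Bb ab nD nB (gf0P _ aA') (gfP _ bD)).
have g'nu : g' *m nu (gm z) = nu (gm z) *m g'.
  rewrite g'E; apply: big_mulmx_comm => beta bD.
  have [b0 _] : is_root B beta by apply: A_positive; move: bD; rewrite inE => /andP [].
  exact: (cayley_comm_cochar b0 (gfP _ bD) (bnu _ bD) x0).
have g'g0V : g' *m invmx g0 = invmx g0 *m g'.
  by rewrite -[RHS](mulmxK gu0) -[_ *m g' *m g0]mulmxA g'g0 mulKmx.
rewrite jE {1}/intm lE /intm !mulmxA g'g0 -[g0 *m g' *m _]mulmxA g'nu !mulmxA.
by rewrite -[_ *m g' *m invmx g0]mulmxA g'g0V !mulmxA mulmxK.
Qed.

(** The twist by the reflections of the roots in A outside A' does not move nu, as their pairings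
    with it are 0; so j intertwines the Galois actions on lambda. *)
Lemma canonical_iso_minus_one (j : ahom TA' TA) (lambda : Xm1 TA') : canonical_iso A' A j ->
  acomp j (val lambda) \in @minus_one R n.+1 TA.
Proof.
move=> [_ _ [c cc jtw]]; have [nu [cnu Snu bnu]] := minus_one_cochar lambda cc.
have [_ ciso _] := cc.
have lN : galc true (xm1val lambda) = - xm1val lambda by apply/eqP; exact: xm1P.
have cnu' : acomp c nu = xm1val lambda := cnu.
suff : galc true (acomp j (xm1val lambda)) = - acomp j (xm1val lambda) by move/eqP.
rewrite jtw lN.
have cN : acomp c (- nu) = - xm1val lambda by rewrite -cnu'; exact: acompN.
have -> : transport c (S_ (A `\` A')%fset) (- xm1val lambda) = - xm1val lambda.
  rewrite /transport; case: xgetP => [nu' _ nu'E|no]; last by case: (no (- nu)).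
  have -> : nu' = - nu by apply: (acomp_inj ciso); rewrite nu'E cN.
  suff -> : S_ (A `\` A')%fset (- nu) = - nu by [].
  rewrite /S_; have {}bnu : forall beta, beta \in enum_fset (A `\` A')%fset -> pairing beta nu = 0.
    by move=> beta bD; exact: bnu.
  elim: (enum_fset _) bnu => [//|beta s IH] h /=.
  rewrite IH => [|gamma gs]; last by apply: h; rewrite inE gs orbT.
  have p0 : pairing beta (- nu) = 0 by rewrite pairingNr h ?mem_head // oppr0.
  by rewrite /refl_cochar p0; exact: subr0.
exact: acompN.
Qed.

Lemma i_embE (j : ahom TA' TA) (lambda : Xm1 TA') (x : pts (Gm R)) : canonical_iso A' A j ->
  pval (val (i_emb A' A TA lambda) x) = pval (val lambda x).
Proof.
move=> jc; rewrite /i_emb; case: xgetP => [mu _ [j' jc' ->]|no].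
  exact: canonical_iso_fix.
case: (no (MkXm1 (canonical_iso_minus_one lambda jc))).
by exists j.
Qed.

End Fixed.

End CanonicalIsomorphisms.

(** * The Tate-Nakayama isomorphism *)

 
Section ComplexExponential.
Context {R : realType}.
Local Notation C := R[i].

Lemma cos_periodic_int (y : R) (m : int) : cos (y + pi *+ 2 *~ m) = cos y.
Proof.
case: m => k; first by rewrite -pmulrn; exact: (periodicn (@cosD2pi R)).
by rewrite NegzE mulrNz -pmulrn -(periodicn (@cosD2pi R) k.+1) subrK.
Qed.

Lemma cos_eq1 (y : R) : cos y = 1 -> exists m : int, y = pi *+ 2 *~ m.
Proof.
move=> cy; have p0 : 0 < pi *+ 2 :> R by rewrite mulrn_wgt0 // pi_gt0.
pose m := Num.floor (y / (pi *+ 2)); exists m.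
have [m1 m2] : m%:~R * (pi *+ 2) <= y /\ y < (m + 1)%:~R * (pi *+ 2).
  by rewrite -ler_pdivlMr // -ltr_pdivrMr // floor_le_tmp floorD1_gt.
pose w := y - pi *+ 2 *~ m.
have yE : y = w + pi *+ 2 *~ m by rewrite subrK.
have w0 : 0 <= w by rewrite subr_ge0 -mulrzl.
have w2 : w < pi *+ 2 by rewrite ltrBlDr -[X in X + _]mulr1z -mulrzDr -mulrzl addrC.
have cw : cos w = 1 by rewrite -cy [in RHS]yE cos_periodic_int.
have pi0 := @pi_ge0 R.
have cos1 (t : R) : 0 <= t <= pi -> cos t = 1 -> t = 0.
  move=> t0 ct; apply: (@cos_inj R); rewrite ?ct ?cos0 // in_itv //=.
  by rewrite lexx.
have [wp|wp] := leP w pi; first by rewrite yE (cos1 w) ?add0r // w0.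
have /cos1 E : 0 <= pi *+ 2 - w <= pi.
  by rewrite subr_ge0 (ltW w2) /= lerBlDr mulr2n lerD2l ltW.
have : pi *+ 2 - w = 0.
  apply: E; rewrite -cw -[RHS]cosN -[RHS](cosD2pi (- w)).
  by rewrite addrC.
by move/eqP; rewrite subr_eq0 => /eqP e; rewrite e ltxx in w2.
Qed.

Definition cexp (v : C) : C :=
  let: Complex x y := v in Complex (expR x * cos y) (expR x * sin y).

Lemma cexpD v w : cexp (v + w) = cexp v * cexp w.
Proof.
case: v w => [a b] [c d]; rewrite -[LHS]/(Complex (expR (a + c) * cos (b + d)) (expR (a + c) * sin (b + d))).
rewrite expRD cosD sinD; set ea := expR a; set ec := expR c; set sb := sin b; set cb := cos b; set sd := sin d; set cd := cos d.
rewrite -[RHS]/(Complex (ea * cb * (ec * cd) - ea * sb * (ec * sd)) (ea * cb * (ec * sd) + ea * sb * (ec * cd))).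
by congr Complex; ring.
Qed.

Lemma cexp_conj v : cexp (conjc v) = conjc (cexp v).
Proof. by case: v => [a b] /=; rewrite cosN sinN mulrN. Qed.

Lemma cexp0 : cexp 0 = 1.
Proof. by rewrite /= expR0 cos0 sin0 mulr1 mulr0. Qed.

Lemma cexp_neq0 v : cexp v != 0.
Proof.
apply/eqP => v0; have := cexpD v (- v); rewrite subrr cexp0 v0 mul0r => /eqP.
by rewrite oner_eq0.
Qed.

Lemma cexp_pi : cexp (Complex 0 pi) = -1.
Proof. by rewrite /= expR0 cospi sinpi !mul1r; congr Complex; rewrite oppr0. Qed.

Lemma cexp_eq1 v : cexp v = 1 -> exists m : int, v = Complex 0 (pi *+ 2) *~ m.
Proof.
case: v => x y /eqP; rewrite eq_complex /= => /andP [/eqP c1 /eqP s0].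
have ex := expR_gt0 x.
have sy : sin y = 0 by move/eqP: s0; rewrite mulf_eq0 gt_eqF //= => /eqP.
have cy : cos y = 1.
  have c0 : 0 < cos y by rewrite -(pmulr_rgt0 _ ex) c1 ltr01.
  by have /eqP := norm_cos_eq1 y; rewrite sy eqxx gtr0_norm //.
have x0 : x = 0.
  by apply: expR_inj; rewrite expR0 -c1 cy mulr1.
have [m ->] := cos_eq1 cy; exists m; rewrite x0.
have cz (a : R) (k : nat) : Complex 0 a *+ k = Complex 0 (a *+ k) :> C.
  elim: k => [|k IH]; first by rewrite !mulr0n.
  by rewrite !mulrS IH -[LHS]/(Complex (0 + 0) _) addr0.
case: m => k; first by rewrite -!pmulrn cz.
by rewrite NegzE !mulrNz -!pmulrn cz -[RHS]/(Complex (- 0) _) oppr0.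
Qed.

Lemma cexp_surj z : z != 0 -> exists v, cexp v = z.
Proof.
case: z => a b; rewrite eq_complex /= negb_and => ab.
have n0 : 0 < a ^+ 2 + b ^+ 2.
  by rewrite lt_def addr_ge0 ?sqr_ge0 // andbT paddr_eq0 ?sqr_ge0 // !sqrf_eq0 negb_and.
pose r := Num.sqrt (a ^+ 2 + b ^+ 2).
have r0 : 0 < r by rewrite sqrtr_gt0.
have r2 : r ^+ 2 = a ^+ 2 + b ^+ 2 by rewrite sqr_sqrtr // ltW.
have er : expR (ln r) = r by rewrite lnK // posrE.
have x1 : -1 <= a / r <= 1.
  rewrite -ler_norml normrM normfV [ `|r|]gtr0_norm // ler_pdivrMr // mul1r.
  by rewrite -(ler_pXn2r (n := 2)) ?nnegrE ?normr_ge0 ?(ltW r0) // real_normK ?num_real // r2 lerDl sqr_ge0.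
have sE : sin (acos (a / r)) = `|b| / r.
  rewrite sin_acos // -[RHS]ger0_norm ?divr_ge0 ?(ltW r0) // -sqrtr_sqr; congr Num.sqrt.
  rewrite !expr_div_n real_normK ?num_real // r2; field; exact: lt0r_neq0.
have cE : cos (acos (a / r)) = a / r by rewrite acosK // in_itv.
have rr (u : R) : r * (u / r) = u by rewrite mulrC divfK // lt0r_neq0.
have [b0|b0] := leP 0 b.
  by exists (Complex (ln r) (acos (a / r))); rewrite /= er cE sE !rr ger0_norm.
exists (Complex (ln r) (- acos (a / r))).
by rewrite /= er cosN sinN cE sE mulrN !rr ltr0_norm // opprK.
Qed.

End ComplexExponential.

(* [X_*(T) -> V -> T(C)] is the exponential sequence, with [p] standing for
   multiplication by [pi * i] and [p *+ 2] for the inclusion of the lattice of periods. *)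
Section ExponentialSequence.
Variables (L V P : zmodType) (p : {additive L -> V}) (e : {additive V -> P}).
Variables (sL : {additive L -> L}) (sV : {additive V -> V}) (sP : {additive P -> P}).
Hypothesis half : forall v : V, exists w, v = w *+ 2.
Hypothesis torsion_free : forall v : V, v *+ 2 = 0 -> v = 0.
Hypothesis p_inj : injective p.
Hypothesis sVp : forall l, sV (p l) = - p (sL l).
Hypothesis sVK : involutive sV.
Hypothesis sPe : forall v, sP (e v) = e (sV v).
Hypothesis e_surj : forall x, exists v, e v = x.
Hypothesis e_ker : forall v, e v = 0 -> exists l, v = p l *+ 2.

Let double_inj (v w : V) : v *+ 2 = w *+ 2 -> v = w.
Proof. by move=> E; apply/eqP; rewrite -subr_eq0; apply/eqP/torsion_free; rewrite mulrnBl E subrr. Qed.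

(** For a = e v the sum v + sV v is a period 2 p(l). The difference v - p(l) is antiinvariant, and
    writing it as 2 w with w antiinvariant makes it the coboundary of - w. *)
Lemma exp_cohomology_surj a : sP a = - a ->
  exists l b, sL l = - l /\ a = e (p l) + (sP b - b).
Proof.
have [v <-] := e_surj a; rewrite sPe => /eqP; rewrite -addr_eq0 -raddfD => /eqP /e_ker [l lE].
have sl : sL l = - l.
  apply: p_inj; rewrite raddfN; apply: oppr_inj; rewrite opprK; apply: double_inj.
  by rewrite -sVp -(raddfMn sV) -lE (raddfD sV) sVK addrC.
exists l; have [w wE] := half (v - p l).
have sw : sV w = - w.
  apply: double_inj; rewrite mulNrn -wE -raddfMn -wE raddfB /= sVp sl raddfN opprK opprB.
  have -> : sV v = p l *+ 2 - v by rewrite -lE addrK.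
  by rewrite mulr2n addrAC addrK.
exists (e (- w)); split=> //; rewrite sPe -raddfB -raddfD raddfN /= sw !opprK.
by rewrite -mulr2n -wE addrC subrK.
Qed.

(** With b = e v, the difference p(l) - (sV v - v) is a period 2 p(m). Applying - sV and adding
    eliminates v and leaves 2 p(l) = 2 p(m - sL m). *)
Lemma exp_cohomology_inj l b : sL l = - l -> e (p l) = sP b - b -> exists m, l = m - sL m.
Proof.
have [v <-] := e_surj b; rewrite sPe => sl /eqP.
rewrite -raddfB -subr_eq0 -raddfB => /eqP /e_ker [m mE]; exists m.
apply: p_inj; apply: double_inj.
have mE' : p l - (v - sV v) = p (- sL m) *+ 2.
  rewrite raddfN mulNrn; rewrite -[p (sL m)]opprK -sVp mulNrn opprK -raddfMn -mE.
  by rewrite (raddfB sV) (raddfB sV) sVK sVp sl raddfN opprK.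
rewrite raddfD mulrnDl -mE -mE'; rewrite opprB.
have -> : p l - (v - sV v) = p l + (sV v - v) by rewrite opprB.
by rewrite addrACA -opprB addNr addr0.
Qed.

End ExponentialSequence.

Lemma conjcMz (R : realType) (v : R[i]) (m : int) : conjc (v *~ m) = conjc v *~ m.
Proof. exact: (raddfMz (@conjc R)). Qed.

Section Coordinates.
Context {R : realType} {n : nat} (T : rtorus R n).
Local Notation C := R[i].

Lemma torus_dual_basis : exists r (c : 'I_r -> X_*(T)) (chi : 'I_r -> X^*(T)),
  (forall j k, pairing (chi j) (c k) = (j == k)%:R) /\
  forall t : pts T, t = \sum_k c k (gm (chv (chi k) t)).
Proof.
have [r [f [h [fh hf]]]] := torusP T.
pose c k : X_*(T) := acomp f (diag_cochar k); pose chi k : X^*(T) := acomp (diag_char k) h.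
have chic j k z : z != 0 -> chv (chi j) (c k (gm z)) = if j == k then z else 1.
  move=> z0; rewrite /chv /= fh /= !mxE !eqxx !mulr1n pval_gm // mxE eqxx mulr1n; case: (j == k); exact: erefl.
exists r, c, chi; split=> [j k|t].
  by apply: pairing_eq => z z0; rewrite chic //; case: (j == k).
rewrite {1}(diag_iso_coord hf t); apply: eq_bigr => k _; congr (f (diag_cochar k (gm _))).
by rewrite /chv /= mxE eqxx mulr1n.
Qed.

Definition cochar_exp (l : X_*(T)) (v : C) : pts T := l (gm (cexp v)).

Lemma cochar_expD l v w : cochar_exp l (v + w) = cochar_exp l v + cochar_exp l w.
Proof. by rewrite /cochar_exp cexpD cochar_gmM ?cexp_neq0. Qed.

Lemma cochar_exp0 l : cochar_exp l 0 = 0.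
Proof. by rewrite /cochar_exp cexp0 cochar_gm1. Qed.

Lemma cochar_expN l v : cochar_exp l (- v) = - cochar_exp l v.
Proof. by apply: (addrI (cochar_exp l v)); rewrite -cochar_expD !subrr cochar_exp0. Qed.

Lemma cochar_exp_sum l (I : Type) (s : seq I) (v : I -> C) :
  cochar_exp l (\sum_(i <- s) v i) = \sum_(i <- s) cochar_exp l (v i).
Proof. exact: (big_morph _ (cochar_expD l) (cochar_exp0 l)). Qed.

Lemma cochar_suml x (I : Type) (s : seq I) (l : I -> X_*(T)) :
  (\sum_(i <- s) l i) x = \sum_(i <- s) l i x.
Proof. exact: (big_morph (fun l : X_*(T) => l x : pts T) (fun _ _ => erefl) erefl). Qed.

Lemma cochar_expMz l v (m : int) : cochar_exp (l *~ m) v = cochar_exp l (v *~ m).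
Proof.
have Mn k : cochar_exp (l *+ k) v = cochar_exp l (v *+ k).
  elim: k => [|k IH]; first by rewrite !mulr0n cochar_exp0.
  by rewrite !mulrS cochar_expD -IH.
case: m => k; first exact: Mn.
by rewrite NegzE !mulrNz cochar_expN -!pmulrn -Mn.
Qed.

Lemma galp_cochar_exp l v : galp true (cochar_exp l v) = cochar_exp (galc true l) (conjc v).
Proof.
rewrite /cochar_exp -[RHS]/(galp true (l (conj_pt (rtorP (Gm R)) (gm (cexp (conjc v)))))).
by rewrite conj_gm ?cexp_neq0 // cexp_conj conjcK.
Qed.

Section Basis.
Context {r : nat} (c : 'I_r -> X_*(T)) (chi : 'I_r -> X^*(T)).
Hypothesis dual : forall j k, pairing (chi j) (c k) = (j == k)%:R.
Hypothesis coord : forall t : pts T, t = \sum_k c k (gm (chv (chi k) t)).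

Lemma cochar_basis l : l = \sum_k c k *~ pairing (chi k) l.
Proof.
apply: ahom_eq => x; have [x0 ->] := pt_gm x; move: x0; set z := pval x _ _ => z0.
rewrite cochar_suml {1}(coord (l (gm z))).
apply: eq_bigr => k _; rewrite pairingP //.
(* Writing z as an exponential turns integer powers of z into multiples of v, which pass through the
   cocharacter. *)
have [v <-] := cexp_surj z0.
rewrite -[RHS]/(cochar_exp (c k *~ _) v) cochar_expMz /cochar_exp; congr (c k (gm _)).
move: (pairing _ _) => m.
have X k' : cexp (v *+ k') = cexp v ^+ k'.
  by elim: k' => [|k' IH]; rewrite ?mulr0n ?cexp0 // mulrS cexpD IH exprS.
case: m => k'; first by rewrite -pmulrn X.
rewrite NegzE mulrNz -pmulrn -invr_expz; apply: (mulfI (cexp_neq0 (v *+ k'.+1))).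
by rewrite -cexpD subrr cexp0 X mulfV // expf_neq0 // cexp_neq0.
Qed.

Definition torus_exp (v : 'rV[C]_r) : pts T := \sum_k cochar_exp (c k) (v ord0 k).

Fact torus_exp_is_zmod : zmod_morphism torus_exp.
Proof.
move=> v w; rewrite /torus_exp -sumrB; apply: eq_bigr => k _.
by rewrite !mxE cochar_expD cochar_expN.
Qed.

HB.instance Definition _ := GRing.isZmodMorphism.Build 'rV[C]_r (pts T) torus_exp torus_exp_is_zmod.

Lemma chv_torus_exp j v : chv (chi j) (torus_exp v) = cexp (v ord0 j).
Proof.
rewrite /torus_exp (big_morph (chv (chi j)) (chvM (chi j)) (chv1 (chi j))).
rewrite (bigD1 j) //= big1 => [|k kj].
  by rewrite pairingP ?cexp_neq0 // dual eqxx mulr1 expr1z.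
by rewrite pairingP ?cexp_neq0 // dual eq_sym (negPf kj) expr0z.
Qed.

Lemma torus_exp_surj t : exists v, torus_exp v = t.
Proof.
have E k : exists v, cexp v = chv (chi k) t by apply: cexp_surj; exact: chv_neq0.
exists (\row_k sval (cid (E k))); transitivity (\sum_k c k (gm (chv (chi k) t))); last exact: esym (coord t); apply: eq_bigr => k _.
by rewrite mxE /cochar_exp; case: cid => /= v ->.
Qed.

Definition half_period (l : X_*(T)) : 'rV[C]_r := \row_k (Complex 0 pi *~ pairing (chi k) l).

Fact half_period_is_zmod : zmod_morphism half_period.
Proof.
by move=> l l'; apply/rowP => k; rewrite !mxE pairingDr pairingNr mulrzDr mulrNz.
Qed.

HB.instance Definition _ :=
  GRing.isZmodMorphism.Build X_*(T) 'rV[C]_r half_period half_period_is_zmod.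

Lemma torus_exp_half_period l : torus_exp (half_period l) = l (gm (-1)).
Proof.
rewrite -cexp_pi -[RHS]/(cochar_exp l _) {2}(cochar_basis l) /cochar_exp cochar_suml.
by apply: eq_bigr => k _; rewrite mxE -cochar_expMz.
Qed.

Lemma torus_exp_ker v : torus_exp v = 0 -> exists l, v = half_period l *+ 2.
Proof.
move=> v0; have E k : exists m : int, v ord0 k = Complex 0 (pi *+ 2) *~ m.
  by apply: cexp_eq1; rewrite -chv_torus_exp v0 chv1.
exists (\sum_k c k *~ sval (cid (E k))); apply/rowP => j; rewrite !mxE.
have -> : pairing (chi j) (\sum_k c k *~ sval (cid (E k))) = sval (cid (E j)).
  rewrite (big_morph (pairing (chi j)) (pairingDr (chi j)) (pairing0r (chi j))).
  rewrite (bigD1 j) //= big1 => [|k kj]; first by rewrite pairingMz dual eqxx mul1r addr0.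
  by rewrite pairingMz dual eq_sym (negPf kj) mul0r.
case: cid => /= m ->; rewrite mulr2n -mulrzDl; congr (_ *~ _).
by rewrite -[RHS]/(Complex (0 + 0) (pi + pi)) addr0.
Qed.

(** The tensor product of the Galois action on cocharacters with complex conjugation, in the
    coordinates of the basis c. *)
Definition exp_galois (v : 'rV[C]_r) : 'rV[C]_r :=
  \row_j \sum_k conjc (v ord0 k) *~ pairing (chi j) (galc true (c k)).

Fact exp_galois_is_zmod : zmod_morphism exp_galois.
Proof.
move=> v w; apply/rowP => j; rewrite !mxE -sumrB; apply: eq_bigr => k _.
by rewrite !mxE rmorphB mulrzBl.
Qed.

HB.instance Definition _ :=
  GRing.isZmodMorphism.Build 'rV[C]_r 'rV[C]_r exp_galois exp_galois_is_zmod.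

Lemma galp_torus_exp v : galp true (torus_exp v) = torus_exp (exp_galois v).
Proof.
rewrite /torus_exp (raddf_sum (galp true)).
apply: etrans (eq_bigr _ (fun k _ => galp_cochar_exp (c k) (v ord0 k))) _.
under [RHS]eq_bigr do rewrite mxE cochar_exp_sum.
rewrite exchange_big; apply: eq_bigr => k _.
rewrite {1}(cochar_basis (galc true (c k))) /cochar_exp cochar_suml; apply: eq_bigr => j _.
exact: (cochar_expMz (c j) (conjc (v ord0 k))).
Qed.

Lemma galc_coord l j :
  pairing (chi j) (galc true l) = \sum_k pairing (chi j) (galc true (c k)) * pairing (chi k) l.
Proof.
rewrite {1}(cochar_basis l) raddf_sum.
rewrite (big_morph (pairing (chi j)) (pairingDr (chi j)) (pairing0r (chi j))).
by apply: eq_bigr => k _; rewrite raddfMz pairingMz.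
Qed.

Lemma exp_galois_half_period l : exp_galois (half_period l) = - half_period (galc true l).
Proof.
have piN : conjc (Complex 0 pi : C) = - Complex 0 pi.
  by rewrite -[RHS]/(Complex (- 0) (- pi)) oppr0.
apply/rowP => j; rewrite !mxE galc_coord -mulNrz mulrz_sumr; apply: eq_bigr => k _.
by rewrite mxE conjcMz piN -mulrzA mulrC.
Qed.

Lemma galcK : involutive (@galc R n T true).
Proof. by move=> l; apply: ahom_eq => z; apply: pval_inj; rewrite /= conjmK /=; congr (pval (l _)); apply: pval_inj; exact: conjmK. Qed.

Lemma exp_galoisK : involutive exp_galois.
Proof.
move=> v; apply/rowP => l; rewrite mxE.
have E k : \sum_j pairing (chi j) (galc true (c k)) * pairing (chi l) (galc true (c j)) = (l == k)%:R.
  rewrite -(dual l k) -{2}(galcK (c k)) galc_coord.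
  by apply: eq_bigr => j _; rewrite mulrC.
transitivity (\sum_k v ord0 k *~ (l == k)%:R); last first.
  by rewrite (bigD1 l) //= big1 => [|k kl]; rewrite ?eqxx ?addr0 // eq_sym (negPf kl).
under [RHS]eq_bigr do rewrite -E mulrz_sumr.
rewrite exchange_big; apply: eq_bigr => j _; rewrite mxE.
rewrite (raddf_sum (@conjc R)) mulrz_suml; apply: eq_bigr => k _.
apply: (etrans (congr1 (fun x => x *~ _) (conjcMz _ _))).
by rewrite conjcK mulrzA.
Qed.

End Basis.

Lemma tate_nakayama_basis : exists r (p : {additive X_*(T) -> 'rV[C]_r}) (e : {additive 'rV[C]_r -> pts T})
    (s : {additive 'rV[C]_r -> 'rV[C]_r}),
  [/\ injective p, forall l, s (p l) = - p (galc true l), involutive s,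
    forall v, galp true (e v) = e (s v) & forall x, exists v, e v = x] /\
  (forall v, e v = 0 -> exists l, v = p l *+ 2) /\ forall l, e (p l) = l (gm (-1)).
Proof.
have [r [c [chi [dual coord]]]] := torus_dual_basis.
exists r, (half_period chi), (torus_exp c), (exp_galois c chi); split; [split|split].
- move=> l l' E; rewrite (cochar_basis coord l) (cochar_basis coord l').
  apply: eq_bigr => k _; congr (_ *~ _); have /rowP/(_ k) := E; rewrite !mxE.
  move=> /(congr1 (fun z => z - Complex 0 pi *~ pairing (chi k) l')); rewrite subrr -mulrzBr.
  move=> /eqP; rewrite mulrz_eq0 subr_eq0 => /orP [/eqP // |]; rewrite eq_complex /= => /andP [_].
  by rewrite gt_eqF // pi_gt0.
- exact: exp_galois_half_period.
- exact: exp_galoisK.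
- exact: galp_torus_exp.
- exact: torus_exp_surj.
- exact: torus_exp_ker.
- exact: torus_exp_half_period.
Qed.

Let row_half r (v : 'rV[C]_r) : exists w, v = w *+ 2.
Proof.
have two : (2%:R : C) != 0 by rewrite pnatr_eq0.
by exists (2%:R^-1 *: v); rewrite -scaler_nat scalerA mulfV // scale1r.
Qed.

Let row_torsion_free r (v : 'rV[C]_r) : v *+ 2 = 0 -> v = 0.
Proof.
have two : (2%:R : C) != 0 by rewrite pnatr_eq0.
by rewrite -scaler_nat => /eqP; rewrite scaler_eq0 (negPf two) => /eqP.
Qed.

Lemma tate_nakayama_surj (a : pts T) : galp true a = - a ->
  exists (l : X_*(T)) b, galc true l = - l /\ a = l (gm (-1)) + (galp true b - b).
Proof.
have [r [p [e [s [[pi_ sp sK se es] [ek ep]]]]]] := tate_nakayama_basis => aN.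
have [l [b [lN ab]]] := exp_cohomology_surj (@row_half r) (@row_torsion_free r) pi_ sp sK se es ek aN.
by exists l, b; rewrite -ep.
Qed.

Lemma tate_nakayama_inj (l : X_*(T)) (b : pts T) : galc true l = - l ->
  l (gm (-1)) = galp true b - b -> exists m : X_*(T), l = m - galc true m.
Proof.
have [r [p [e [s [[pi_ sp sK se es] [ek ep]]]]]] := tate_nakayama_basis => lN; rewrite -ep.
exact: (exp_cohomology_inj (@row_torsion_free r) pi_ sp sK se es ek lN).
Qed.

End Coordinates.

Local Open Scope quotient_scope.

(** * Characters of quotient groups *)

Section QuotientCharacter.
Context {R : realType} {V : zmodType}.
Local Notation C := R[i].

Lemma cxchar0 (phi : cxchar R V) : phi 0 = 1.
Proof.
by apply: (mulfI (cxfun_neq0 phi 0)); rewrite -cxfunD addr0 mulr1.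
Qed.

Lemma cxcharN (phi : cxchar R V) x : phi (- x) = (phi x)^-1.
Proof. by apply: (mulfI (cxfun_neq0 phi x)); rewrite -cxfunD subrr cxchar0 mulfV // cxfun_neq0. Qed.

Lemma cxcharB (phi : cxchar R V) x y : phi (x - y) = 1 -> phi x = phi y.
Proof. by rewrite -{2}(subrK y x) cxfunD => ->; rewrite mul1r. Qed.

Lemma cxchar_generated (phi : cxchar R V) (S : set V) x :
  (forall v, S v -> phi v = 1) -> x \in generated S -> phi x = 1.
Proof.
move=> S1; rewrite inE => xS; apply: (xS [set v | phi v = 1]) => [|v w /= v1 w1|v /S1 //].
  exact: cxchar0.
by rewrite cxfunD cxcharN v1 w1 invr1 mulr1.
Qed.

Lemma quotient_piP (S : set V) (x y : V) :
  \pi_(quotient_by S) x = \pi_(quotient_by S) y <-> x - y \in generated S.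
Proof. by rewrite Quotient.idealrBE; split=> /eqP. Qed.

Lemma quotient_char (phi : cxchar R V) (S : set V) : (forall v, S v -> phi v = 1) ->
  exists theta : cxchar R (quotient_by S), forall v, theta (\pi_(quotient_by S) v) = phi v.
Proof.
move=> S1; pose f (q : quotient_by S) : C := phi (repr q).
have fE v : f (\pi_(quotient_by S) v) = phi v.
  apply: cxcharB; apply: (cxchar_generated S1); apply/quotient_piP; exact: reprK.
have fD x y : f (x + y) = f x * f y.
  rewrite -(reprK x) -(reprK y) -[\pi _ + \pi _]raddfD !fE.
  by rewrite cxfunD.
have f0 x : f x != 0 by exact: cxfun_neq0.
by exists (CxChar fD f0).
Qed.

End QuotientCharacter.

Lemma sum_rearrange (V : zmodType) (x y z b b' c sb sb' sc : V) :
  x + y + (sb - b + (sb' - b')) = z + (sc - c) -> z - (x + y) = sb + sb' - sc - (b + b' - c).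
Proof.
move=> E.
have -> : z = x + y + (sb - b + (sb' - b')) - (sc - c) by rewrite E addrK.
rewrite addrAC [x + y + _]addrC addrK addrACA -opprD !opprB.
by rewrite addrACA [RHS]addrACA [- (b + b') - sc]addrC.
Qed.

Lemma difference_rearrange (V : zmodType) (x y d b d' b' : V) :
  x + (d' - b') = y + (d - b) -> x - y = d - d' - (b - b').
Proof.
move=> E; have -> : x = y + (d - b) - (d' - b') by rewrite -E addrK.
rewrite addrAC [y + _]addrC addrK !opprB addrACA [RHS]addrACA.
by rewrite [- b - d']addrC.
Qed.

Section TateNakayama.
Context {R : realType} {n : nat} (T : rtorus R n).
Local Notation C := R[i].

Fact minus_one_char_D (s : cxchar R X_*(T)) (x y : Xm1 T) : s (val (x + y)) = s (val x) * s (val y).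
Proof. by rewrite -cxfunD; congr (s _). Qed.

Definition minus_one_char (s : cxchar R X_*(T)) : cxchar R (Xm1 T) :=
  CxChar (minus_one_char_D s) (fun x => cxfun_neq0 s (val x)).

Lemma minus_one_char_IX (s : cxchar R X_*(T)) (l : Xm1 T) :
  (forall l : X_*(T), s (galc true l) = s l) -> IX l -> minus_one_char s l = 1.
Proof.
by move=> sg [m lE]; rewrite /= lE cxfunD cxcharN sg mulfV // cxfun_neq0.
Qed.

Lemma cup_true (l : X_*(T)) : cup l true = l (gm (-1)).
Proof.
rewrite ffunE big_bool /fundamental_cocycle /= gm1.
rewrite -[conj_pt _ (l _)]/(galc true l (pt1 (Gm R))) (ahom1 (galc true l)).
exact: (@addr0 (pts T)).
Qed.

Lemma cocycle_true (a : Z1 T) : galp true (val a true) = - val a true /\ val a false = 0.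
Proof.
have aP : forall r r', val a (r (+) r') = val a r + galp r (val a r').
  by have := z1P a; rewrite inE.
have a0 : val a false = 0 by apply: (addIr (val a false)); rewrite add0r; exact: esym (aP false false).
split=> //; apply/eqP; rewrite -addr_eq0 addrC -(aP true true) /=; exact/eqP.
Qed.

(** Surjectivity of Tate-Nakayama gives each cocycle a cocharacter at which s is evaluated;
    injectivity shows that the choice does not matter. *)
Lemma Tate_character (s : cxchar R X_*(T)) : (forall l : X_*(T), s (galc true l) = s l) ->
  exists chi : cxchar R (H1 T), tn_character s chi.
Proof.
move=> sg.
have P (a : Z1 T) : exists l : Xm1 T, exists b, val a true = xm1val l (gm (-1)) + (galp true b - b).
  have [aN _] := cocycle_true a; have [l [b [lN ab]]] := tate_nakayama_surj aN.
  have lP : l \in @minus_one R n T by apply/eqP.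
  by exists (MkXm1 lP), b.
have [g gE] := choice P.
(* If the values at - 1 differ by a coboundary, the cocharacters differ by m minus its conjugate, on
   which the invariant s is 1. *)
have sB (l l' : Xm1 T) b : xm1val l (gm (-1)) - xm1val l' (gm (-1)) = galp true b - b -> s (val l) = s (val l').
  move=> E; apply: cxcharB.
  have lN : galc true (xm1val l - xm1val l') = - (xm1val l - xm1val l').
    have /eqP e : galc true (xm1val l) == - xm1val l by exact: xm1P.
    have /eqP e' : galc true (xm1val l') == - xm1val l' by exact: xm1P.
    have -> : galc true (xm1val l - xm1val l') = galc true (xm1val l) - galc true (xm1val l').
      exact: raddfB.
    by rewrite e e' opprB opprK addrC.
  have [m mE] := tate_nakayama_inj lN E.
  by rewrite -[_ - _]/(xm1val l - xm1val l') mE cxfunD cxcharN sg mulfV // cxfun_neq0.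
pose phi0 (a : Z1 T) : C := s (val (g a)).
have phiD a a' : phi0 (a + a') = phi0 a * phi0 a'.
  rewrite -cxfunD -[val _ + val _]/(val (g a + g a')).
  have [b bE] := gE a; have [b' bE'] := gE a'; have [c cE] := gE (a + a').
  apply: (sB _ _ (b + b' - c)).
  rewrite -[xm1val (g a + g a') _]/(xm1val (g a) (gm (-1)) + xm1val (g a') (gm (-1))).
  have E : val (a + a') true = val a true + val a' true by rewrite -[LHS]/((val a + val a') true) ffunE.
  move: cE; rewrite E bE bE' addrACA.
  move: (xm1val (g a) _) (xm1val (g a') _) (xm1val (g (a + a')) _) => x y z cE.
  rewrite (galp_zmod true) galpD; exact: sum_rearrange cE.
pose phi := CxChar phiD (fun a => cxfun_neq0 s (val (g a))).
have phi1 (a : Z1 T) l b : val a true = xm1val l (gm (-1)) + (galp true b - b) -> phi a = s (val l).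
  have [b' bE'] := gE a; rewrite bE' => E; apply: (sB _ _ (b - b')).
  rewrite (galp_zmod true); exact: difference_rearrange E.
have [|chi chiE] := @quotient_char _ _ phi (@B1 R n T).
  move=> a [b ab]; rewrite (phi1 a 0 b) ?cxchar0 // ab ffunE.
  by rewrite [X in _ = X + _]/(0 : pts T) add0r.
exists chi => l; rewrite /tate_nakayama chiE.
rewrite (phi1 _ (repr (\pi_(Tate T) l)) 0); last first.
  have -> : galp true (0 : pts T) = 0 by exact: raddf0.
  by rewrite subr0 addr0; exact: cup_true.
(* [tate_nakayama] uses the chosen representative of the class, which differs from l by an element
   of the subgroup generated by [IX]. *)
rewrite -[s (val l)]/(minus_one_char s l) -[s (val _)]/(minus_one_char s _).
apply: cxcharB; apply: (cxchar_generated (fun v vI => minus_one_char_IX sg vI)).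
by apply/quotient_piP; exact: reprK.
Qed.

End TateNakayama.

(** * Galois invariance of s *)

Section Conjugation.
Context {R : realType} {m : nat}.
Local Notation C := R[i].
Implicit Types (T : torus R m) (g h x : 'M[C]_m).

Lemma int_ahom T T' g : g \in unitmx -> (forall t : pts T, gset T' (intm g t)) ->
  exists c : ahom T T', forall t, pval (c t) = intm g t.
Proof.
move=> gu gT; pose c t : pts T' := Pt (gT t).
have cM t u : c (ptM t u) = ptM (c t) (c u).
  by apply: pval_inj; rewrite /= /intm !mulmxA mulmxKV.
have cr i j : regular_on (fun t => c t i j).
  apply: (@regular_on_mulmx _ _ _ _ (fun t => g *m pval t)) => [k l|k l]; last exact: regular_on_cst.
  by apply: (@regular_on_mulmx _ _ _ _ (fun=> g)) => [a b|a b]; [exact: regular_on_cst|exact: regular_on_coord].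
by exists (@AHom R m m T T' c cM cr).
Qed.

Lemma conj_cocharP T T' g (l : X_*(T)) : g \in unitmx -> (forall t : pts T, gset T' (intm g t)) ->
  forall z, pval (conj_cochar g T' l z) = intm g (l z).
Proof.
move=> gu gT; rewrite /conj_cochar; case: xgetP => [l' _ //|no].
by have [c cE] := int_ahom gu gT; case: (no (acomp c l)) => z /=.
Qed.

Lemma cochar_pval_eq T (l l' : X_*(T)) : (forall z, pval (l z) = pval (l' z)) -> l = l'.
Proof. by move=> E; apply: ahom_eq => z; exact: pval_inj. Qed.

Lemma conj_charP T g (chi : X^*(T)) : g \in unitmx -> (forall t : pts T, gset T (intm (invmx g) t)) ->
  forall x y : pts T, pval y = intm g x -> conj_char g chi y = chi x.
Proof.
move=> gu gT; rewrite /conj_char; case: xgetP => [chi' _ //|no].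
have gu' : invmx g \in unitmx by rewrite unitmx_inv.
have [c cE] := int_ahom gu' gT; case: (no (acomp chi c)) => x y yE /=.
congr (chi _); apply: pval_inj; rewrite cE yE /intm invmxK !mulmxA mulVmx // mul1mx mulmxKV //.
Qed.

Lemma intm_image (S S' : set 'M[C]_m) g : g \in unitmx -> intm g @` S = S' ->
  forall x, S' x -> S (intm (invmx g) x).
Proof.
move=> gu E x; rewrite -E => -[y Sy <-].
by rewrite /intm invmxK !mulmxA mulVmx // mul1mx mulmxKV.
Qed.

Lemma conjm_intm g x : g \in unitmx -> conjm (intm g x) = intm (conjm g) (conjm x).
Proof.
move=> gu; rewrite /intm !conjmM; congr (_ *m _).
by rewrite /conjm map_invmx.
Qed.

Lemma conjm_unit g : g \in unitmx -> conjm g \in unitmx.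
Proof. by move=> gu; rewrite /conjm map_unitmx. Qed.

Lemma intm_Kinv g x : g \in unitmx -> intm g (intm (invmx g) x) = x.
Proof. by move=> gu; rewrite -{1}[g]invmxK intmK ?unitmx_inv. Qed.

End Conjugation.

Section GaloisInvariance.
Context {R : realType} {n : nat} {G : agroup R n} {dG : dual_group G}.
Context (E : endoscopic_triple dG).
Local Notation C := R[i].
Local Notation dH := (en_dual E).

(* h and its conjugate differ by an element of the normalizer of the reference
   torus of H; this Weyl element fixes the central element s. *)
Lemma dual_eval_galois (TH : rtorus R (en_dim E)) h (t : pts (dgThat dH)) (l : X_*(TH)) :
  borel_frame dH TH h -> pval t = pval (en_s E) ->
  dual_eval h t (galc true l) = dual_eval h t l.
Proof.
move=> [Hh [B [_ _ _ hT]]] ts.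
have [Hu H1 HM HV] := gset_group (en_H E).
have hu : h \in unitmx by exact: Hu.
have hcu := conjm_unit hu.
have hTH x : gset TH x -> gset (dgT dH) (intm (invmx h) x) by exact: intm_image.
have Th x : gset (dgT dH) x -> gset TH (intm h x) by move=> Tx; rewrite -hT; exists x.
have Tcj : conj_stable (gset (dgT dH)) by exact: rtorP.
have THcj : conj_stable (gset TH) by exact: rtorP.
pose k := invmx h *m conjm h.
have ku : k \in unitmx by rewrite unitmx_mul unitmx_inv hu.
have conjK (x : 'M[C]_(en_dim E)) : conjm (conjm x) = x by exact: conjmK.
have Thc x : gset (dgT dH) x -> gset TH (intm (conjm h) x).
  move=> Tx; rewrite -[x]conjK -conjm_intm //; apply: THcj; apply: Th; exact: Tcj.
have hcT x : gset TH x -> gset (dgT dH) (intm (invmx (conjm h)) x).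
  move=> Tx; have -> : invmx (conjm h) = conjm (invmx h) by rewrite /conjm map_invmx.
  rewrite -[x]conjK -conjm_intm ?unitmx_inv //; apply: Tcj; apply: hTH; exact: THcj.
have hV : invmx h \in unitmx by rewrite unitmx_inv.
have kE x : intm k x = intm (invmx h) (intm (conjm h) x) by rewrite intm_comp.
have kT (x : pts (dgT dH)) : gset (dgT dH) (intm k x).
  by rewrite kE; apply: hTH; apply: Thc; exact: pvalP.
have kN : normalizer (gset (en_H E)) (gset (dgT dH)) k.
  split; first exact: HM (HV _ Hh) (en_real Hh).
  apply/seteqP; split=> x; first by move=> [y Ty <-]; exact: (kT (Pt Ty)).
  move=> Tx; exists (intm (invmx (conjm h)) (intm h x)); first by apply: hcT; exact: Th.
  by rewrite kE intm_Kinv // intmK.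
have hTH' (x : pts TH) : gset (dgT dH) (intm (invmx h) x) by apply: hTH; exact: pvalP.
pose psi := conj_cochar (invmx h) (dgT dH) l.
have psiE z : pval (psi z) = intm (invmx h) (l z) by exact: conj_cocharP.
have lE z : pval (l z) = intm h (psi z) by rewrite psiE intm_Kinv.
have -> : dual_eval h t (galc true l) = chv (dg_delta dH (conj_cochar k (dgT dH) (galc true psi))) t.
  rewrite /dual_eval; congr (chv (dg_delta dH _) t); apply: cochar_pval_eq => z.
  rewrite conj_cocharP // conj_cocharP // kE; congr (intm _ _).
  by rewrite -[LHS]/(conjm (l _)) lE conjm_intm.
have [x xN ->] := dg_weyl kN.
have [Gx xT] := xN; have xu : x \in unitmx by have [+ _ _ _] := gset_group (dg_hat dH); apply.
have xTV (u : pts (dgThat dH)) : gset (dgThat dH) (intm (invmx x) u).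
  by apply: (intm_image xu xT); exact: pvalP.
(* The Weyl element x acts trivially on t because s is central in the dual group. *)
have xt : pval t = intm x t.
  by rewrite ts; have [_ cs] := en_central E; rewrite /intm -cs // mulmxK.
rewrite /chv (conj_charP _ xu xTV xt) dg_galois.
have st : pval (dg_sigmaT dH t) = pval t.
  by rewrite (dg_sigmaTE (t := t) (x := en_s E)) // en_s_galois ts.
by rewrite /dual_eval -/psi /chv /= (pval_inj st).
Qed.

Lemma image_of_s_galois (TH : rtorus R (en_dim E)) (T : rtorus R n) (phi : ahom TH T)
    (sT : dual_torus T) (l : X_*(T)) :
  admissible phi -> image_of_s phi sT -> sT (galc true l) = sT l.
Proof.
move=> [[d [pd dp]] phiR _] [h [t [hf ts sE]]].
pose l0 : X_*(TH) := acomp d l.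
have lE : l = acomp phi l0 by apply: ahom_eq => z /=; rewrite dp.
have -> : galc true l = acomp phi (galc true l0).
  rewrite lE; apply: ahom_eq => z; rewrite -[LHS]/(galp true (phi (l0 _))) -phiR //.
by rewrite sE dual_eval_galois // lE sE.
Qed.

End GaloisInvariance.

(** The preceding theory works in the ring of matrices of size [n.+1]; in size 0 all points
    coincide. *)
Lemma i_emb_acomp (R : realType) n (G : agroup R n) (S : splitting G)
    (A' A : {fset X^*(spT S)}) (TA' TA : rtorus R n) (j : ahom TA' TA) (lambda : Xm1 TA') :
    semisimple G -> SOS A -> (forall alpha, alpha \in A -> is_root (spB S) alpha) ->
    (A' `<=` A)%fset -> canonical_iso A' A j ->
  val (i_emb A' A TA lambda) = acomp j (val lambda).
Proof.
case: n G S A' A TA' TA j lambda => [|n] G S A' A TA' TA j lambda ss AS Ap A'A jc.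
  by apply: ahom_eq => x; apply: pval_inj; apply/matrixP => -[].
apply: ahom_eq => x; apply: pval_inj.
rewrite (i_embE ss AS Ap A'A lambda x jc).
exact: esym (canonical_iso_fix ss AS Ap A'A lambda x jc).
Qed.

Theorem lemma5p2 (R : realType) (n : nat) (G : agroup R n)
    (G_real : conj_stable (gset G)) (G_semisimple : semisimple G)
    (G_simply_connected : simply_connected G)
    (S : splitting G)
    (A' A : {fset X^*(spT S)})
    (A'_SOS : SOS A') (A_SOS : SOS A)
    (A'_positive : forall alpha, alpha \in A' -> is_root (spB S) alpha)
    (A_positive : forall alpha, alpha \in A -> is_root (spB S) alpha)
    (A'A : (A' `<=` A)%fset)
    (TA' TA : rtorus R n) (TA'P : is_T_ A' TA') (TAP : is_T_ A TA)
    (dG : dual_group G) (E : endoscopic_triple dG)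
    (T1 T2 : rtorus R (en_dim E))
    (T1_max : maximal_torus (en_H E) T1) (T2_max : maximal_torus (en_H E) T2)
    (phi1 : ahom T1 TA') (phi2 : ahom T2 TA)
    (phi1_admissible : admissible phi1) (phi2_admissible : admissible phi2)
    (sTA' : dual_torus TA') (sTA : dual_torus TA)
    (sTA'P : image_of_s phi1 sTA') (sTAP : image_of_s phi2 sTA)
    (j : ahom TA' TA) (j_canonical : canonical_iso A' A j)
    (j_s : forall lambda : X_*(TA'), sTA (acomp j lambda) = sTA' lambda) :
  exists (chi' : cxchar R (H1 TA')) (chi : cxchar R (H1 TA))
         (theta' : cxchar R (Q_sub A' A TA' TA)) (theta : cxchar R (Q_big A' A TA' TA)),
    [/\ tn_character sTA' chi',
        tn_character sTA chi,
        forall lambda : Xm1 TA',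
          chi' (tate_nakayama (\pi_(Tate TA') lambda)) = theta' (\pi_(Q_sub A' A TA' TA) lambda),
        forall lambda : Xm1 TA,
          chi (tate_nakayama (\pi_(Tate TA) lambda)) = theta (\pi_(Q_big A' A TA' TA) lambda) &
        forall q : Q_sub A' A TA' TA, theta (i_bar q) = theta' q].

Proof.
have sg' (l : X_*(TA')) : sTA' (galc true l) = sTA' l by exact: (image_of_s_galois l phi1_admissible sTA'P).
have sg (l : X_*(TA)) : sTA (galc true l) = sTA l by exact: (image_of_s_galois l phi2_admissible sTAP).
(* This compatibility makes [sTA'] trivial on the preimage of [IX] of T_A and [sTA] trivial on the
   image of [IX] of T_A'; it is also the final equality of characters. *)
have iE (lambda : Xm1 TA') : minus_one_char sTA (i_emb A' A TA lambda) = minus_one_char sTA' lambda.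
  by rewrite -[RHS]j_s -(i_emb_acomp lambda G_semisimple A_SOS A_positive A'A j_canonical).
have IX1' (lambda : Xm1 TA') : IX lambda -> minus_one_char sTA' lambda = 1.
  exact: (minus_one_char_IX (fun l => sg' l)).
have IX1 (lambda : Xm1 TA) : IX lambda -> minus_one_char sTA lambda = 1.
  exact: (minus_one_char_IX (fun l => sg l)).
have [chi' chi'E] := Tate_character (fun l => sg' l).
have [chi chiE] := Tate_character (fun l => sg l).
have [|theta' theta'E] := @quotient_char _ _ (minus_one_char sTA')
    (@IX R n TA' `|` i_emb A' A TA @^-1` @IX R n TA).
  by move=> v [/IX1' //|/IX1]; rewrite iE.
have [|theta thetaE] := @quotient_char _ _ (minus_one_char sTA)
    ((i_emb A' A TA @` @IX R n TA') `|` @IX R n TA).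
  by move=> _ [[v /IX1' v1 <-]|/IX1 //]; rewrite iE.
exists chi', chi, theta', theta; split=> //.
- by move=> lambda; rewrite chi'E theta'E.
- by move=> lambda; rewrite chiE thetaE.
- by move=> q; rewrite /i_bar thetaE iE -theta'E reprK.
Qed.
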